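(* Let $\ell$ be a good integer for $\mathfrak{sp}_4$ (that is, any odd integer greater than $1$) and $\varepsilon$ a primitive $\ell$-th root of unity. Any irreducible representation $V$ of $\mathcal{U}_\varepsilon(\mathfrak{sp}_4)$ has dimension divisible by $\ell^{\frac12\dim\mathcal{O}_V}$, where $\mathcal{O}_V$ is the conjugacy class of $Sp_4(\mathbb{C})$ associated to $V$.
   Context: Put $\mathfrak g=\mathfrak{sp}_4$ (type $C_2$) and $G=Sp_4(\mathbb{C})$, with $T$ a maximal torus, $B,B^-$ opposite Borel subgroups containing $T$, and $U,U^-$ their unipotent radicals. Quantum group. Let $(a_{ij})$ be the Cartan matrix, $\alpha_1,\alpha_2$ the simple roots, $P$ the weight lattice, $(\cdot,\cdot)$ the $W$-invariant form with $(\alpha_i,\alpha_j)=d_ia_{ij}$ where the $d_i$ are the relatively prime positive integers with $d_ia_{ij}=d_ja_{ji}$, and $\varepsilon_i=\varepsilon^{d_i}$. $\mathcal{U}_\varepsilon(\mathfrak g)$ is the simply connected (De Concini–Kac) quantized enveloping algebra at $q=\varepsilon$: the associative $\mathbb{C}$-algebra generated by $E_i,F_i$ ($i=1,2$), $K_\beta$ ($\beta\in P$) with relations $K_0=1$, $K_\beta K_\gamma=K_{\beta+\gamma}$, $K_\beta E_iK_{-\beta}=\varepsilon^{(\beta,\alpha_i)}E_i$, $K_\beta F_iK_{-\beta}=\varepsilon^{-(\beta,\alpha_i)}F_i$, $[E_i,F_j]=\delta_{ij}(K_{\alpha_i}-K_{-\alpha_i})/(\varepsilon_i-\varepsilon_i^{-1})$,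 and the quantum Serre relations for the $E_i$'s and for the $F_i$'s. The map to $G$. Let $Z_0$ be the smallest subalgebra of $\mathcal{U}_\varepsilon(\mathfrak g)$ containing all $E_i^\ell,F_i^\ell,K_\beta^\ell$ and stable under Lusztig's braid group action (equivalently, generated by the $\ell$-th powers of the $K_\beta$ and of all the root vectors $E_\alpha,F_\alpha$). $Z_0$ is a central Hopf subalgebra, finitely generated, and $\mathcal{U}_\varepsilon(\mathfrak g)$ is a finite $Z_0$-module, so every simple module is finite-dimensional and $Z_0$ acts on it by a character. $Z_0$ carries a Poisson bracket (obtained, up to a nonzero scalar, by dividing commutators of lifts to generic $q$ by $q^\ell-q^{-\ell}$ and specializing to $q=\varepsilon$). By De Concini–Kac–Procesi, $\mathrm{Spec}\,Z_0$ is identified, as a Poisson algebraic group, with $$\{(t^{-1}u^-,tu)\mid t\in T,\ u\in U,\ u^-\in U^-\}\subset B^-\times B$$ (the Poisson dual of $G$ with its standard Poisson structure), where the subalgebra generated by the $K_\beta^\ell$ is identified with $\mathbb{C}[T]$ via the identification of $P$ with the character group of $T$ (up to the inversion of $T$, depending on the convention for the comultiplication). Let $\pi:\mathrm{Spec}\,Z_0\to G$, $\pi(t^{-1}u^-,tu)=(u^-)^{-1}t^2u$ (an unramified covering of the big cell $B^-B$). For a simple module $V$, let $\varphi(V)=\pi(\chi_V)$ where $\chi_V\in\mathrm{Spec}\,Z_0$ is the character by which $Z_0$ acts on $V$; $\mathcal{O}_V$ is the conjugacy class of $\varphi(V)$ in $G$. *)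

(* Defs.v *)
From HB Require Import structures.
From mathcomp Require Import all_boot all_order all_algebra.
From mathcomp Require Import boolp.
From mathcomp Require Import mpoly.

Set Implicit Arguments.
Unset Strict Implicit.
Unset Printing Implicit Defensive.

Import GRing.Theory.
Local Open Scope ring_scope.

(* Root datum of type C_2: index 0 is the short simple root, index 1 the long
   one; weights are written in the basis of fundamental weights. *)

Definition weight := 'rV[int]_2.

Definition cartan (i j : 'I_2) : int :=
  if i == j then 2 else if i == 0 then - 2 else - 1.

Definition symd (i : 'I_2) : nat := if i == 0 then 1%N else 2%N.

(* The j-th coordinate of alpha_i is <alpha_i, alpha_j^vee> = a_ji. *)
Definition simple_root (i : 'I_2) : weight := \row_j cartan j i.

(* (beta, alpha_i), since (omega_j, alpha_i) = d_i if i = j, and 0 otherwise. *)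
Definition form_root (b : weight) (i : 'I_2) : int := (symd i)%:Z * b 0 i.

Definition refl (i : 'I_2) (b : weight) : weight := b - b 0 i *: simple_root i.

Section QuantumNumbers.
Variable C : fieldType.
Implicit Types q : C.

Definition qi q (i : 'I_2) : C := q ^+ symd i.

(* (q^n - q^-n) / (q - q^-1), in a form that also makes sense at q = 1. *)
Definition qint q (n : nat) : C := \sum_(j < n) q ^ (n%:Z - 1 - (2 * j)%N%:Z).

Definition qfact q (n : nat) : C := \prod_(1 <= k < n.+1) qint q k.

(* Symmetric Gaussian binomials as Laurent polynomials in q (by the q-Pascal
   rule): a quotient of q-factorials would be 0 / 0 at small roots of unity. *)
Fixpoint qbinom q (n k : nat) : C :=
  match n, k with
  | _, 0%N => 1
  | 0%N, _.+1 => 0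
  | n'.+1, k'.+1 => q ^+ k'.+1 * qbinom q n' k'.+1
                    + q ^ (k'%:Z - n'%:Z) * qbinom q n' k'
  end.

End QuantumNumbers.

Record generators (A : Type) := Generators {
  gE : 'I_2 -> A;
  gF : 'I_2 -> A;
  gK : weight -> A }.

Section QuantumGroup.
Variable C : fieldType.
Implicit Types (A : algType C) (q : C) (l : nat).

Definition serre A q (X : 'I_2 -> A) (i j : 'I_2) : A :=
  let m := `|1 - cartan i j|%N in
  \sum_(s < m.+1)
    ((-1) ^+ s * qbinom (qi q i) m s) *: (X i ^+ (m - s) * X j * X i ^+ s).

Record Uq_relations A q (g : generators A) : Prop := UqRelations {
  rel_K0 : gK g 0 = 1;
  rel_KD : forall b c, gK g b * gK g c = gK g (b + c);
  rel_KE : forall b i,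
    gK g b * gE g i * gK g (- b) = q ^ form_root b i *: gE g i;
  rel_KF : forall b i,
    gK g b * gF g i * gK g (- b) = q ^ (- form_root b i) *: gF g i;
  rel_EF : forall i j, gE g i * gF g j - gF g j * gE g i =
    if i == j
    then (qi q i - (qi q i)^-1)^-1
           *: (gK g (simple_root i) - gK g (- simple_root i))
    else 0;
  rel_SE : forall i j, i != j -> serre q (gE g) i j = 0;
  rel_SF : forall i j, i != j -> serre q (gF g) i j = 0 }.

Definition maps_generators A B (f : A -> B)
    (g : generators A) (h : generators B) : Prop :=
  [/\ forall i, f (gE g i) = gE h i,
      forall i, f (gF g i) = gF h i
    & forall b, f (gK g b) = gK h b].

Inductive generated_by A (g : generators A) : A -> Prop :=
| gen_E i : generated_by g (gE g i)
| gen_F i : generated_by g (gF g i)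
| gen_K b : generated_by g (gK g b)
| gen_scalar (c : C) : generated_by g c%:A
| gen_add x y : generated_by g x -> generated_by g y -> generated_by g (x + y)
| gen_mul x y : generated_by g x -> generated_by g y -> generated_by g (x * y).

(* U, with the generators g, is the algebra presented by the relations above. *)
Definition is_Uq q (U : algType C) (g : generators U) : Prop :=
  [/\ Uq_relations q g,
      forall x, generated_by g x
    & forall (A : algType C) (h : generators A), Uq_relations q h ->
        exists f : {lrmorphism U -> A}, maps_generators f g h].

Definition divpow A q (x : A) (k : nat) : A := (qfact q k)^-1 *: x ^+ k.

(* The images of the generators under Lusztig's automorphism T_i, in the
   normalization of De Concini, Kac and Procesi:
     T_i E_i = - F_i K_i,  T_i F_i = - K_i^-1 E_i,  T_i K_b = K_(s_i b),
     T_i E_j = sum_s (-1)^(s+m) q_i^-s E_i^(m-s) E_j E_i^(s),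
     T_i F_j = sum_s (-1)^(s+m) q_i^s  F_i^(s) F_j F_i^(m-s),   m = - a_ij.
   As T_i (T_j x) is obtained from x by first replacing the generators g by
   [braid i g] and then applying [braid j] to the result, a product
   T_(i_1) ... T_(i_k) is computed by applying [braid i_1] first. *)
Definition braid A q (i : 'I_2) (g : generators A) : generators A :=
  let m j := `|cartan i j|%N in
  Generators
    (fun j => if j == i then - (gF g i * gK g (simple_root i)) else
       \sum_(s < (m j).+1) ((-1) ^+ (s + m j) * (qi q i) ^- s) *:
         (divpow (qi q i) (gE g i) (m j - s) * gE g j
            * divpow (qi q i) (gE g i) s))
    (fun j => if j == i then - (gK g (- simple_root i) * gE g i) else
       \sum_(s < (m j).+1) ((-1) ^+ (s + m j) * (qi q i) ^+ s) *:
         (divpow (qi q i) (gF g i) s * gF g j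
            * divpow (qi q i) (gF g i) (m j - s)))
    (fun b => gK g (refl i b)).

(* The reduced expression s_0 s_1 s_0 s_1 of the longest element, giving the
   enumeration beta_k = s_(i_1) ... s_(i_(k-1)) alpha_(i_k) of the positive
   roots, here with k = 0, ..., 3. *)
Definition w0_word : seq 'I_2 := [:: 0; 1; 0; 1].
Definition w0_letter (k : nat) : 'I_2 := nth 0 w0_word k.

Definition pos_root (k : nat) : weight :=
  foldr refl (simple_root (w0_letter k)) (take k w0_word).

Definition braid_prefix A q (g : generators A) (k : nat) : generators A :=
  foldl (fun h i => braid q i h) g (take k w0_word).

Definition root_E A q (g : generators A) (k : nat) : A :=
  gE (braid_prefix q g k) (w0_letter k).
Definition root_F A q (g : generators A) (k : nat) : A :=
  gF (braid_prefix q g k) (w0_letter k).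

Inductive Z0 q l (U : algType C) (g : generators U) : U -> Prop :=
| Z0_E k : (k < 4)%N -> Z0 q l g (root_E q g k ^+ l)
| Z0_F k : (k < 4)%N -> Z0 q l g (root_F q g k ^+ l)
| Z0_K b : Z0 q l g (gK g b ^+ l)
| Z0_scalar (c : C) : Z0 q l g c%:A
| Z0_add x y : Z0 q l g x -> Z0 q l g y -> Z0 q l g (x + y)
| Z0_mul x y : Z0 q l g x -> Z0 q l g y -> Z0 q l g (x * y).

Definition is_representation (U : algType C) (V : vectType C)
    (rho : {linear U -> 'End(V)}) : Prop :=
  rho 1 = \1%VF /\ forall a b, rho (a * b) = (rho a \o rho b)%VF.

Definition irreducible (U : algType C) (V : vectType C)
    (rho : {linear U -> 'End(V)}) : Prop :=
  ({:V} != 0)%VS /\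
  forall W : {vspace V}, (forall a, (rho a @: W <= W)%VS) ->
    W = 0%VS \/ W = fullv.

Definition acts_by (U : algType C) (V : vectType C)
    (rho : {linear U -> 'End(V)}) (Z : U -> Prop) (chi : U -> C) : Prop :=
  forall z, Z z -> rho z = chi z *: \1%VF.

Definition mx_of_rows (r : seq (seq C)) : 'M[C]_4 :=
  \matrix_(i, j) nth 0 (nth [::] r i) j.

Definition symp_form : 'M[C]_4 := mx_of_rows
  [:: [:: 0; 0; 0; 1]; [:: 0; 0; 1; 0]; [:: 0; -1; 0; 0]; [:: -1; 0; 0; 0]].

Definition Sp4 (h : 'M[C]_4) : Prop := h^T *m symp_form *m h = symp_form.

(* Chevalley generators of sp_4; setting all K_b to 1 and q to 1 turns [braid]
   into the classical braid group action on them. *)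
Definition sp4_generators : generators 'M[C]_4 := Generators
  (fun i => if i == 0
    then mx_of_rows [:: [:: 0; 1; 0; 0]; [:: 0; 0; 0; 0];
                        [:: 0; 0; 0; -1]; [:: 0; 0; 0; 0]]
    else mx_of_rows [:: [:: 0; 0; 0; 0]; [:: 0; 0; 1; 0];
                        [:: 0; 0; 0; 0]; [:: 0; 0; 0; 0]])
  (fun i => if i == 0
    then mx_of_rows [:: [:: 0; 0; 0; 0]; [:: 1; 0; 0; 0];
                        [:: 0; 0; 0; 0]; [:: 0; 0; -1; 0]]
    else mx_of_rows [:: [:: 0; 0; 0; 0]; [:: 0; 0; 0; 0];
                        [:: 0; 1; 0; 0]; [:: 0; 0; 0; 0]])
  (fun=> 1).

Definition root_e (k : nat) : 'M[C]_4 := root_E 1 sp4_generators k.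
Definition root_f (k : nat) : 'M[C]_4 := root_F 1 sp4_generators k.

(* The exponential series stops here because X is nilpotent of size 4. *)
Definition nilexp (X : 'M[C]_4) : 'M[C]_4 :=
  \sum_(k < 4) (k`!%:R)^-1 *: X ^+ k.

(* Weights of the vector representation C^4 of Sp_4. *)
Definition vec_weight (j : 'I_4) : weight :=
  \row_i nth 0 (nth [::]
    [:: [:: 1; 0]; [:: -1; 1]; [:: 1; -1]; [:: -1; 0]] j) i.

(* De Concini, Kac and Procesi's identification of Spec Z_0 with the group of
   the pairs (t^-1 u^-, t u), for the comultiplication
     K_b |-> K_b (x) K_b,       E_i |-> E_i (x) 1 + K_i (x) E_i,
     F_i |-> F_i (x) K_i^-1 + 1 (x) F_i.
   Its coordinates on the root subgroups are the l-th powers of the root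
   vectors, rescaled by (q_beta - q_beta^-1)^l, where q_beta = q_(i_k) for
   beta = beta_k; the factors of u are ordered by decreasing k and those of
   u^- by increasing k.  The pair does not depend on the reduced expression. *)
Section PoissonDualGroup.
Variables (q : C) (l : nat) (U : algType C) (g : generators U) (chi : U -> C).

Definition root_scale (k : nat) : C :=
  (qi q (w0_letter k) - (qi q (w0_letter k))^-1) ^+ l.

Definition coord_t : 'M[C]_4 :=
  diag_mx (\row_j chi (gK g (vec_weight j) ^+ l)).

Definition coord_u : 'M[C]_4 :=
  \prod_(k <- [:: 3; 2; 1; 0]%N)
    nilexp ((root_scale k
             * chi (gK g (- pos_root k) ^+ l * root_E q g k ^+ l)) *: root_e k).

Definition coord_u_minus : 'M[C]_4 :=
  \prod_(k <- [:: 0; 1; 2; 3]%N)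
    nilexp (- (root_scale k * chi (root_F q g k ^+ l)) *: root_f k).

Definition Spec_to_G : 'M[C]_4 :=
  invmx coord_u_minus *m coord_t ^+ 2 *m coord_u.

End PoissonDualGroup.

Definition conj_class (x : 'M[C]_4) : 'M[C]_4 -> Prop :=
  fun y => exists2 h, Sp4 h & y = h *m x *m invmx h.

(* The dimension of (the Zariski closure of) a set S of matrices: the
   transcendence degree of the algebra of polynomial functions on S, i.e. the
   largest number of matrix entries that are algebraically independent as
   functions on S. *)
Definition alg_independent_on n (S : 'M[C]_n -> Prop)
    (D : {set 'I_n * 'I_n}) : Prop :=
  forall p : {mpoly C[#|D|]},
    (forall x, S x ->
       p.@[fun i => x (@enum_val _ (mem D) i).1 (@enum_val _ (mem D) i).2] = 0)
    -> p = 0.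

Definition dim_of n (S : 'M[C]_n -> Prop) : nat :=
  \max_(D : {set 'I_n * 'I_n} | `[< alg_independent_on S D >]) #|D|.

End QuantumGroup.

(* Main.v *)
(* Rescaling the generators makes the l-th powers of the root vectors act by
   scalars that are polynomial in the parameters of explicit "quantum" flows.
   These flows turn an n-dimensional representation into another one and move
   the point of the big cell by conjugation with elements of U (De Concini, Kac
   and Procesi's quantum coadjoint action), so that divisibility of n can be
   tested after a generic conjugation.  When certain entries or minors of the
   matrix do not vanish, pairs of operators obeying q-commutation relations
   split the space into pieces of equal dimension and give l^2, l^3 or l^4
   dividing n.  If l^2 (l^3, l^4) does not divide n, the corresponding functions
   vanish on all conjugates, which forces the matrix to be central (respectively
   an involution or a central multiple of a transvection, and to differ from a
   scalar by a matrix of rank at most 2).  Rational parametrizations then bound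
   the dimension of its class by 0, 5 and 7; every class has dimension at most 9. *)
From HB Require Import structures.
From mathcomp Require Import all_boot all_order all_algebra all_fingroup zify ring.
From mathcomp Require Import boolp mpoly.
From mathcomp Require Import reals complex.
Require Import Defs.
Set Implicit Arguments.
Unset Strict Implicit.
Unset Printing Implicit Defensive.
Import Order.TTheory GRing.Theory Num.Theory.
Local Open Scope ring_scope.

(** * Noncommutative words *)

(** Two obstacles shape the proof. The formulas for the flows are checked by cancelling root
    vectors, which is impossible where these act nilpotently. So the relations are first deformed:
    polynomial parameters times q-commuting toral elements are added to the simple root vectors,
    which makes them regular, and the identities are specialized back. Toral elements of a
    representation commute, and the missing power of q is supplied by clock and shift matrices.
    Secondly, a flow moves a point only as long as it stays in the big cell. Every conjugate by an
    upper unipotent element that lies in the big cell is nevertheless reached, by a generic detour.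
    Each criterion is therefore a polynomial condition on the conjugating element, and its failure
    for all good conjugates becomes an identity. For [l ^ 4] the test vectors must lie on the
    quadric [om (v *m M) v = 0], which is parametrized rationally when it is irreducible. In the
    remaining case [M ^ 2 - 1] has rank 2 and square zero, and an exchange of positive and negative
    generators is needed besides conjugation. *)

Definition qc (C : fieldType) (B : nzRingType) (io : C -> B) (q : C) (i : int) : B :=
  io (q ^ i).

Section WordRewriting.
Variables (C : fieldType) (B : nzRingType) (io : {rmorphism C -> B}).
Hypothesis ioC : forall c x, io c * x = x * io c.
Variable q : C.
Hypothesis q_neq0 : q != 0.
Variable v : nat -> B.

(** A term is a word together with its scalar [q ^ i * m], with [m] an integer. Exponents of [q] are
    compared as integers, so only Laurent polynomial identities are decided; that [q] is a root of
    unity has to enter through the rewriting rules. *)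
Definition ncterm := (seq nat * (int * int))%type.
Definition ncpoly := seq ncterm.

Inductive ncexpr :=
| NCV of nat | NCC of int | NC0 | NC1
| NCD of ncexpr & ncexpr | NCN of ncexpr | NCM of ncexpr & ncexpr.

Fixpoint nceval (e : ncexpr) : B :=
  match e with
  | NCV i => v i | NCC m => qc io q m | NC0 => 0 | NC1 => 1
  | NCD e1 e2 => nceval e1 + nceval e2
  | NCN e1 => - nceval e1
  | NCM e1 e2 => nceval e1 * nceval e2
  end.

Definition wval (w : seq nat) : B := foldr (fun i x => v i * x) 1 w.
Definition tval (t : ncterm) : B := io (q ^ t.2.1 * t.2.2%:~R) * wval t.1.
Definition pval (p : ncpoly) : B := foldr (fun t x => tval t + x) 0 p.

Fixpoint ncins (t : ncterm) (p : ncpoly) : ncpoly :=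
  match p with
  | [::] => [:: t]
  | t' :: r =>
    if (t.1 == t'.1) && (t.2.1 == t'.2.1) then
      let z := t.2.2 + t'.2.2 in
      if z == 0 then r else (t.1, (t.2.1, z)) :: r
    else t' :: ncins t r
  end.

Definition ncadd (p p' : ncpoly) : ncpoly := foldr ncins p' p.
Definition ncmulc (c : int * int) (u w : seq nat) (p : ncpoly) : ncpoly :=
  [seq (u ++ t.1 ++ w, (c.1 + t.2.1, c.2 * t.2.2)) | t <- p].
Definition ncmul (p p' : ncpoly) : ncpoly :=
  foldr (fun t s => ncadd (ncmulc t.2 t.1 [::] p') s) [::] p.

Fixpoint nctop (e : ncexpr) : ncpoly :=
  match e with
  | NCV i => [:: ([:: i], (0, 1))]
  | NCC m => [:: ([::], (m, 1))]
  | NC0 => [::] | NC1 => [:: ([::], (0, 1))]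
  | NCD e1 e2 => ncadd (nctop e1) (nctop e2)
  | NCN e1 => [seq (t.1, (t.2.1, - t.2.2)) | t <- nctop e1]
  | NCM e1 e2 => ncmul (nctop e1) (nctop e2)
  end.

Definition ncrule := (nat * nat * ncexpr)%type.
Definition ncrulep := (nat * nat * ncpoly)%type.

Fixpoint nclook (rs : seq ncrulep) (a b : nat) : option ncpoly :=
  match rs with
  | [::] => None
  | r :: rs' =>
      if (r.1.1 == a) && (r.1.2 == b) then Some r.2 else nclook rs' a b
  end.

Fixpoint ncred (rs : seq ncrulep) (w : seq nat) :
    option (seq nat * ncpoly * seq nat) :=
  match w with
  | a :: ((b :: r) as w') =>
    match nclook rs a b with
    | Some p => Some ([::], p, r)
    | None =>
      match ncred rs w' with
      | Some (u, p, s) => Some (a :: u, p, s)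
      | None => None
      end
    end
  | _ => None
  end.

Fixpoint ncnorm (fuel : nat) (rs : seq ncrulep) (todo done : ncpoly) : ncpoly :=
  match fuel, todo with
  | fuel'.+1, t :: r =>
    match ncred rs t.1 with
    | None => ncnorm fuel' rs r (ncins t done)
    | Some (u, p, s) => ncnorm fuel' rs (ncadd (ncmulc t.2 u s p) r) done
    end
  | _, _ => ncadd todo done
  end.

Definition rule_holds (r : ncrule) : Prop := v r.1.1 * v r.1.2 = nceval r.2.
Definition rules_hold (rs : seq ncrule) : Prop :=
  foldr (fun r P => rule_holds r /\ P) True rs.

Definition nc_check (fuel : nat) (rs : seq ncrule) (e1 e2 : ncexpr) : bool :=
  ncnorm fuel [seq (r.1, nctop r.2) | r <- rs] (nctop (NCD e1 (NCN e2))) [::]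
    == [::].

Lemma pval_ins t p : pval (ncins t p) = tval t + pval p.
Proof.
elim: p => [|t' r IH] //=; case: ifP => [/andP[/eqP e1 /eqP e2]|_] /=.
  have E : tval t + tval t' = tval (t.1, (t.2.1, t.2.2 + t'.2.2)).
    by rewrite /tval /= -e1 -e2 -mulrDl -rmorphD -mulrDr -rmorphD.
  case: eqP => [z0|_] /=; last by rewrite addrA E.
  by rewrite addrA E z0 /tval /= mulr0 rmorph0 mul0r add0r.
by rewrite IH addrCA.
Qed.

Lemma pval_add p p' : pval (ncadd p p') = pval p + pval p'.
Proof. by elim: p => [|t r IH] /=; rewrite ?add0r // pval_ins IH addrA. Qed.

Lemma wval_cat u w : wval (u ++ w) = wval u * wval w.
Proof. by elim: u => [|a u IH] /=; rewrite ?mul1r // IH mulrA. Qed.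

Lemma pval_mulc c u w p :
  pval (ncmulc c u w p) = io (q ^ c.1 * c.2%:~R) * (wval u * pval p * wval w).
Proof.
elim: p => [|t r IH] /=; first by rewrite mulr0 mul0r mulr0.
rewrite IH /tval /= !wval_cat expfzDr // intrM mulrACA.
rewrite (rmorphM io (_ * _)) /= mulrDr mulrDl mulrDr; congr (_ + _).
by rewrite -!mulrA; congr (_ * _); rewrite mulrA ioC -!mulrA.
Qed.

Lemma pval_mul p p' : pval (ncmul p p') = pval p * pval p'.
Proof.
elim: p => [|t r IH] /=; first by rewrite mul0r.
by rewrite pval_add IH pval_mulc mulr1 mulrDl /tval mulrA.
Qed.

Lemma nctopE e : pval (nctop e) = nceval e.
Proof.
elim: e => [i|m|||e1 IH1 e2 IH2|e IH|e1 IH1 e2 IH2] /=.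
- by rewrite /tval /= expr0z !mulr1 rmorph1 mul1r addr0.
- by rewrite /tval /= !mulr1 addr0 /qc.
- by [].
- by rewrite /tval /= expr0z !mulr1 rmorph1 addr0.
- by rewrite pval_add IH1 IH2.
- rewrite -IH; elim: (nctop e) => [|t r IHr] /=; first by rewrite oppr0.
  by rewrite IHr /tval /= rmorphN mulrN rmorphN mulNr opprD.
- by rewrite pval_mul IH1 IH2.
Qed.

Lemma nclookP rs a b p : rules_hold rs ->
  nclook [seq (r.1, nctop r.2) | r <- rs] a b = Some p -> v a * v b = pval p.
Proof.
elim: rs => [|r rs IH] //= [hr /IH{}IH]; case: ifP => [/andP[/eqP<- /eqP<-] [<-]|_ /IH//].
by rewrite nctopE.
Qed.

Lemma ncredP rs w u p s : rules_hold rs ->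
  ncred [seq (r.1, nctop r.2) | r <- rs] w = Some (u, p, s) ->
  wval w = wval u * pval p * wval s.
Proof.
move=> hr; elim: w u p s => [|a [|b w] IH] u p s //.
set rs' := [seq _ | r <- rs] in IH *.
have -> : ncred rs' [:: a, b & w] = match nclook rs' a b with
  | Some p => Some ([::], p, w)
  | None => match ncred rs' (b :: w) with
    | Some (u, p, s) => Some (a :: u, p, s) | None => None end end by [].
case E: nclook => [p'|].
  by case=> <- <- <-; rewrite /= mul1r -(nclookP hr E) mulrA.
case E': (ncred _ _) => [[[u' p'] s']|] //; case=> <- <- <-.
rewrite -[wval (a :: _)]/(v a * wval (b :: w)) (IH _ _ _ E') /= !mulrA //.
Qed.

Lemma ncnormP fuel rs todo dn : rules_hold rs ->
  pval (ncnorm fuel [seq (r.1, nctop r.2) | r <- rs] todo dn) = pval todo + pval dn.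
Proof.
move=> hr; elim: fuel todo dn => [|n IH] [|t r] dn /=; rewrite ?add0r //.
  by rewrite pval_ins pval_add addrA.
case E: ncred => [[[u p] s]|]; rewrite IH; last by rewrite pval_ins addrCA addrA.
by rewrite pval_add pval_mulc -(ncredP hr E) -addrA.
Qed.

Lemma nc_eq fuel rs e1 e2 : rules_hold rs -> nc_check fuel rs e1 e2 ->
  nceval e1 = nceval e2.
Proof.
move=> hr /eqP E; apply/eqP; rewrite -subr_eq0; apply/eqP.
rewrite -[LHS]/(nceval (NCD e1 (NCN e2))) -nctopE.
by have := ncnormP fuel (nctop (NCD e1 (NCN e2))) [::] hr; rewrite E /= addr0.
Qed.

End WordRewriting.

Ltac nc_index x l :=
  lazymatch l with
  | cons x _ => constr:(0%N)
  | cons _ ?l' => let i := nc_index x l' in constr:(S i)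
  | _ => fail 100 "no atom" x
  end.

Ltac nc_reify l e :=
  lazymatch e with
  | GRing.add ?a ?b =>
      let a' := nc_reify l a in let b' := nc_reify l b in constr:(NCD a' b')
  | GRing.opp ?a => let a' := nc_reify l a in constr:(NCN a')
  | GRing.mul ?a ?b =>
      let a' := nc_reify l a in let b' := nc_reify l b in constr:(NCM a' b')
  | (0%R) => constr:(NC0)
  | (1%R) => constr:(NC1)
  | qc _ _ ?i => constr:(NCC i)
  | _ => let i := nc_index e l in constr:(NCV i)
  end.

Ltac nc_rule l t :=
  lazymatch t with
  | GRing.mul ?a ?b = ?r =>
      let i := nc_index a l in let j := nc_index b l in
      let r' := nc_reify l r in constr:((i, j, r'))
  end.

Ltac nc_rules l hs :=
  lazymatch hs with
  | (?hs', (?a, ?b)) => nc_rules l (hs', a, b)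
  | (?hs', tt) => nc_rules l hs'
  | (?hs', ?h) =>
      let rs := nc_rules l hs' in let t := type of h in
      let r := nc_rule l t in constr:(cons r rs)
  | tt => constr:(@nil ncrule)
  end.

Ltac nc_conj hs :=
  lazymatch hs with
  | (?hs', (?a, ?b)) => nc_conj (hs', a, b)
  | (?hs', tt) => nc_conj hs'
  | (?hs', ?h) => let c := nc_conj hs' in constr:(conj h c)
  | tt => constr:(I)
  end.

(* [nc ioC q0 l hs] proves an identity between words in the atoms [l], with
   scalars [qc io q i], by rewriting with the hypotheses [hs = (tt, h1, ..)],
   each of the form [x * y = r]. *)
Ltac nc ioC q0 l hs :=
  lazymatch goal with
  | |- ?e1 = ?e2 =>
      let r1 := nc_reify l e1 in let r2 := nc_reify l e2 in
      let rs := nc_rules l hs in let c := nc_conj hs in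
      refine (@nc_eq _ _ _ ioC _ q0 (fun i => nth 0 l i) 100000 rs r1 r2 c _);
      vm_compute; reflexivity
  end.

(** * Factorization of a difference of l-th powers *)

Section CommutingProduct.
Variables (C : fieldType) (B : nzRingType) (io : {rmorphism C -> B}).
Hypothesis ioC : forall c x, io c * x = x * io c.

(** This is the homogenized polynomial with roots [s], evaluated at a commuting pair. Evaluation is
    not a ring morphism over a noncommutative ring, whence the induction on the roots. *)
Lemma prod_homog (s : seq C) (X Y : B) : X * Y = Y * X ->
  \prod_(c <- s) (Y - io c * X) =
  \sum_(k < (size s).+1)
    io ((\prod_(c <- s) ('X - c%:P))`_k) * Y ^+ k * X ^+ (size s - k).
Proof.
move=> XY; elim: s => [|c s IH].
  by rewrite !big_nil big_ord_recl big_ord0 coef1 rmorph1 !mulr1 addr0.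
rewrite !big_cons IH; set p := \prod_(_ <- s) _.
have szp : size p = (size s).+1 by rewrite /p size_prod_XsubC.
have YX k : GRing.comm Y (X ^+ k) by apply: commrX.
rewrite mulrBl !mulr_sumr [in RHS]big_ord_recl.
under [in RHS]eq_bigr => k _ do
  rewrite /= /bump /= add1n subSS mulrBl coefB coefCM coefXM /= rmorphB mulrBl mulrBl.
rewrite big_split sumrN /= addrCA.
rewrite mulrBl coefB coefXM coefCM eqxx sub0r rmorphN mulNr mulr1 mulNr subn0.
congr (_ + _); first by apply: eq_bigr => k _; rewrite exprS !mulrA ioC.
rewrite -opprD; congr (- _).
rewrite big_ord_recl /= subn0 mulr1 [X in _ = _ + X]big_ord_recr /=.
have -> : p`_(size s).+1 = 0 by rewrite nth_default ?szp.
rewrite mulr0 rmorph0 !mul0r addr0; congr (_ + _).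
  by rewrite rmorphM exprS -!mulrA; congr (_ * _); rewrite !mulrA ioC.
apply: eq_bigr => k _; rewrite /bump /= add1n rmorphM -!mulrA; congr (_ * _).
rewrite [LHS]mulrA -ioC -mulrA; congr (_ * _).
rewrite [LHS]mulrA (commrX k.+1 XY) -mulrA -exprS; congr (_ * X ^+ _).
by rewrite subnSK.
Qed.

Lemma prod_root_comm (l : nat) (w : C) (X Y : B) : l.-primitive_root w ->
  X * Y = Y * X -> \prod_(j < l) (Y - io (w ^+ j) * X) = Y ^+ l - X ^+ l.
Proof.
move=> pw XY; have l0 := prim_order_gt0 pw.
case: l pw l0 => // l pw _.
rewrite -(big_mkord predT (fun j => Y - io (w ^+ j) * X)).
rewrite -(big_map (fun j => w ^+ j) predT (fun c => Y - io c * X)).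
rewrite prod_homog // big_map (factor_Xn_sub_1 pw) size_map size_iota subn0.
rewrite big_ord_recl big_ord_recr /= big1 ?add0r => [|i _]; last first.
  rewrite coefB coefXn coef1 /bump /= add1n eqSS (ltn_eqF (ltn_ord i)) subr0.
  by rewrite rmorph0 !mul0r.
rewrite /bump /= add1n !coefB !coefXn !coef1 eqxx subr0 expr0 subnn.
by rewrite subn0 !mulr1 sub0r rmorphN !rmorph1 mulN1r mul1r addrC.
Qed.

End CommutingProduct.

(** * Quantum flows *)

(** The Levendorskii-Soibelman relations in the positive part of type C_2: [f] and [g] belong to the
    short and the long simple root, [y] to their sum and [h] to twice the short root plus the long
    one. The normalization is such that every commutator vanishes at [q = 1]. *)
Record IQ (C : fieldType) (B : nzRingType) (io : C -> B) (q : C)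
    (f g y h : B) : Prop := IQuad {
  iq_fg : f * g = qc io q (-2) * g * f + (qc io q 2 - qc io q (-2)) * y;
  iq_fy : f * y = y * f + (qc io q 1 - qc io q (-1)) * h;
  iq_fh : f * h = qc io q 2 * h * f;
  iq_gy : g * y = qc io q (-2) * y * g;
  iq_yh : y * h = qc io q (-2) * h * y;
  iq_gh : g * h = h * g + (qc io q (-1) - qc io q 3) * y * y }.

Section Powers.
Variables (C : fieldType) (B : nzRingType) (io : {rmorphism C -> B}).
Hypothesis ioC : forall c x, io c * x = x * io c.
Variables (q : C) (l : nat).
Hypotheses (l_odd : odd l) (q_prim : l.-primitive_root q).
Local Notation k := (qc io q).

Lemma prim_neq0 : q != 0.
Proof.
rewrite (prim_root_eq0 q_prim); apply/eqP => l0.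
by move: (prim_order_gt0 q_prim); rewrite l0.
Qed.
Let q0 := prim_neq0.

Lemma qcD i j : k (i + j) = k i * k j.
Proof. by rewrite /qc expfzDr // rmorphM. Qed.

Lemma qcX i n : k i ^+ n = k (i * n%:Z).
Proof. by rewrite /qc -rmorphXn /= -exprz_exp. Qed.

Lemma qc0 : k 0 = 1. Proof. by rewrite /qc expr0z rmorph1. Qed.

Lemma qcl i : k (i * l%:Z) = 1.
Proof. by rewrite mulrC /qc -exprz_exp -exprnP (prim_expr_order q_prim) exp1rz rmorph1. Qed.

Lemma qcK i : k i * k (- i) = 1. Proof. by rewrite -qcD subrr qc0. Qed.

Lemma qc_comm i x : k i * x = x * k i. Proof. exact: ioC. Qed.

Lemma prim_exprz (i : int) : coprime `|i| l -> l.-primitive_root (q ^ i).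
Proof.
case: i => i co; first by rewrite -exprnP prim_root_exp_coprime.
have l0 := prim_order_gt0 q_prim.
suff -> : q ^ Negz i = q ^+ (i.+1 * l.-1).
  by rewrite prim_root_exp_coprime // coprimeMl co coprimePn.
rewrite NegzE; apply: (mulfI (expfz_neq0 i.+1%:Z q0)).
by rewrite -expfzDr // subrr expr0z -exprD -mulnS prednK // mulnC exprM
   (prim_expr_order q_prim) expr1n.
Qed.

Lemma coprime2l : coprime 2 l. Proof. by rewrite coprime2n. Qed.
Lemma coprime4l : coprime 4 l. Proof. by rewrite (@coprimeXl 2 2) ?coprime2l. Qed.

Lemma comm_k_pow (c : int) x y : x * y = k c * y * x ->
  forall n, x * y ^+ n = k (c * n%:Z) * y ^+ n * x.
Proof.
move=> xy; elim=> [|n IH]; first by rewrite mulr0 qc0 !mulr1 !mul1r.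
rewrite exprSr mulrA IH -!mulrA xy -!mulrA.
rewrite [y ^+ n * _]mulrA -(qc_comm c) !mulrA -qcD.
by rewrite -[n.+1]addn1 PoszD mulrDr mulr1.
Qed.

(** As [H] commutes with [f] and [h], the product [y ^+ n * f ^+ n] telescopes into factors
    [H - q^(-2j) h], and for [n = l] these run over all l-th roots of unity. So the l-th powers
    satisfy the relation defining [H] with [q] set to 1. *)
Lemma power_short (f y h H : B) :
  f * h = k 2 * h * f -> f * H = H * f -> h * H = H * h ->
  k 1 * y * f = h - H -> y ^+ l * f ^+ l = h ^+ l - H ^+ l.
Proof.
move=> fh fH hH yf.
have hf : h * f = k (-2) * f * h.
  by rewrite -mulrA fh !mulrA -qcD addNr qc0 mul1r.
have {}yf : y * f = - k (-1) * (H - h).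
  by rewrite mulNr -mulrN opprB -yf !mulrA -qcD addNr qc0 mul1r.
suff E n : y ^+ n * f ^+ n = (- k (-1)) ^+ n * \prod_(j < n) (H - io ((q ^ (-2)) ^+ j) * h).
  rewrite E prod_root_comm ?prim_exprz ?coprime2l //.
  rewrite exprNn -signr_odd l_odd expr1 mulN1r qcX qcl mulNr mul1r opprB.
  by [].
elim: n => [|n IH]; first by rewrite !expr0 big_ord0.
have cC x : - k (-1) * x = x * - k (-1) by rewrite mulNr mulrN qc_comm.
rewrite exprSr exprS mulrA -[y ^+ n * y * f]mulrA yf -!mulrA.
have -> : (H - h) * f ^+ n = f ^+ n * (H - io ((q ^ (-2)) ^+ n) * h).
  rewrite mulrBl mulrBr (commrX n (esym fH)) (comm_k_pow hf).
  by rewrite /qc -exprz_exp -exprnP mulrA ioC.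
rewrite big_ord_recr /= exprSr -!mulrA cC -!mulrA -cC !mulrA.
by rewrite -(cC (y ^+ n)) -[- k (-1) * _ * _]mulrA IH -(cC (_ * _)) !mulrA.
Qed.

(** The same telescoping for the quantum minor [D], with ratio [q ^ 4], again of order [l] because
    [l] is odd. *)
Lemma power_long (g y h : B) (D := h * g - k 3 * y * y) :
  g * y = k (-2) * y * g -> y * h = k (-2) * h * y ->
  g * h = h * g + (k (-1) - k 3) * y * y ->
  h ^+ l * g ^+ l = D ^+ l + (y * y) ^+ l.
Proof.
move=> gy yh gh.
have gD : g * D = D * g by rewrite /D; nc ioC q0 [:: g; y; h] (tt, gy, yh, gh).
have Dyy : D * (y * y) = y * y * D.
  by rewrite /D; nc ioC q0 [:: g; y; h] (tt, gy, yh, gh).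
have yyg : (y * y) * g = k 4 * g * (y * y).
  by nc ioC q0 [:: g; y; h] (tt, gy).
have hg : h * g = D - - k 3 * (y * y) by rewrite /D mulNr opprK mulrA subrK.
have Dy : - k 3 * (y * y) * D = D * (- k 3 * (y * y)).
  by rewrite -mulrA -Dyy !mulrA; congr (_ * _ * _); rewrite mulrN mulNr qc_comm.
suff E n : h ^+ n * g ^+ n = \prod_(j < n) (D - io ((q ^ 4) ^+ j) * (- k 3 * (y * y))).
  rewrite E prod_root_comm ?prim_exprz ?coprime4l //.
  have cN : GRing.comm (- k 3) (y * y) by rewrite /GRing.comm mulNr mulrN qc_comm.
  rewrite (exprMn_comm l cN).
  by rewrite exprNn -signr_odd l_odd expr1 mulN1r qcX qcl mulN1r opprK.
elim: n => [|n IH]; first by rewrite !expr0 big_ord0 mulr1.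
rewrite exprSr exprS mulrA -[h ^+ n * h * g]mulrA hg big_ord_recr /= -IH -!mulrA.
congr (_ * _); rewrite mulrBl mulrBr (commrX n (esym gD)); congr (_ - _).
rewrite -[- k 3 * _ * _]mulrA (comm_k_pow yyg) /qc -exprz_exp -exprnP -rmorphN.
rewrite [RHS]mulrA -ioC -!mulrA [g ^+ n * (io _ * _)]mulrA -[g ^+ n * io _]ioC.
by rewrite !mulrA -[io (- _) * io _]ioC.
Qed.

End Powers.

Section RegularFlows.
Variables (C : fieldType) (B : nzRingType) (io : {rmorphism C -> B}).
Hypothesis ioC : forall c x, io c * x = x * io c.
Variables (q : C) (l : nat).
Hypotheses (l_odd : odd l) (q_prim : l.-primitive_root q).
Local Notation k := (qc io q).
Let q0 : q != 0 := prim_neq0 q_prim.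

(** The images of the root vectors under the flow of [f ^+ l]. Here [L] stands for [1 + t f ^+ l],
    and [Z1], [Z2] for [(L - 1) / f] and [(L - 1) / f ^+ 2], which are polynomials in [f]; the
    formulas thus make sense for a nilpotent [f]. *)
Definition shortg (L Z1 Z2 g y h : B) :=
  g + (k 2 + 1) * y * Z1 + (L - k 2) * k (-1) * h * Z2.
Definition shorty (Z1 y h : B) := y + k (-1) * h * Z1.
Definition longf (L Z1 f y : B) := L * f - k 2 * y * Z1.
Definition longh (L Z1 h y : B) := L * h - k 3 * y * y * Z1.

(** The terms with [m.-1] and [m.-2] have coefficients that vanish for [m = 0] and for [m <= 1]
    respectively, so truncation of the predecessors is harmless. The case [m = l] gives centrality
    of [f ^+ l], and [m = l - 1] the commutation of [Z1] with [g]. *)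
Lemma iq_pow_fg f g y h : IQ io q f g y h -> forall m,
  f ^+ m * g = k (- 2 * m%:Z) * g * f ^+ m
    + (k 2 + 1) * (1 - k (- 2 * m%:Z)) * y * f ^+ m.-1
    + k (-1) * k (2 * m%:Z) * (1 - k (-2 * m%:Z))
      * (1 - k 2 * k (-2 * m%:Z)) * h * f ^+ m.-2.
Proof.
case=> fg fy fh gy yh gh; case=> [|[|m]] /=.
- by rewrite !expr0; nc ioC q0 [:: f; g; y; h] (tt, fg).
- by rewrite !expr0 !expr1; nc ioC q0 [:: f; g; y; h] (tt, fg).
have E c n (p : nat) : k (c * (n + p)%N%:Z) = k (c * p%:Z) * k (c * n%:Z).
  by rewrite -(qcD io q_prim) PoszD mulrDr addrC.
elim: m => [|m IH].
  by rewrite !exprS expr0 !mulr1; nc ioC q0 [:: f; g; y; h] (tt, fg, fy, fh).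
rewrite exprS -mulrA IH -[m.+3]addn3 -[m.+2]addn2 !E !exprD.
have := qcK io q_prim (2 * m%:Z); rewrite -mulNr.
have := qc_comm ioC q (2 * m%:Z); have := qc_comm ioC q (- 2 * m%:Z).
move: (k (2 * m%:Z)) (k (- 2 * m%:Z)) => U Ui Uic Uc UU.
have fW : f ^+ m * f = f * f ^+ m by rewrite -exprSr exprS.
rewrite !exprS expr0 !mulr1; move: (f ^+ m) fW => W fW.
have [UiU [] ] : Ui * U = 1 /\ True by rewrite Uic UU.
nc ioC q0 [:: f; g; y; h; W; U; Ui] (tt, fg, fy, fh, fW, UU, UiU,
  esym (Uc f), esym (Uc g), esym (Uc y), esym (Uc h), esym (Uc W),
  esym (Uic f), esym (Uic g), esym (Uic y), esym (Uic h), esym (Uic W)).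
Qed.

Lemma iq_pow_gf f g y h : IQ io q f g y h -> forall m,
  f * g ^+ m = k (- 2 * m%:Z) * g ^+ m * f
    + (k (2 * m%:Z) - k (- 2 * m%:Z)) * g ^+ m.-1 * y.
Proof.
case=> fg fy fh gy yh gh; case=> [|m] /=.
  by rewrite !expr0; nc ioC q0 [:: f; g; y; h] (tt, fg).
have E c n (p : nat) : k (c * (n + p)%N%:Z) = k (c * p%:Z) * k (c * n%:Z).
  by rewrite -(qcD io q_prim) PoszD mulrDr addrC.
elim: m => [|m IH].
  by rewrite !expr0 !expr1; nc ioC q0 [:: f; g; y; h] (tt, fg).
rewrite exprSr mulrA IH -[m.+2]addn2 -[m.+1]addn1 !E !exprD.
have := qcK io q_prim (2 * m%:Z); rewrite -mulNr.
have := qc_comm ioC q (2 * m%:Z); have := qc_comm ioC q (- 2 * m%:Z).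
move: (k (2 * m%:Z)) (k (- 2 * m%:Z)) => U Ui Uic Uc UU.
have gW : g ^+ m * g = g * g ^+ m by rewrite -exprSr exprS.
rewrite !exprS expr0 !mulr1; move: (g ^+ m) gW => W gW.
have [UiU [] ] : Ui * U = 1 /\ True by rewrite Uic UU.
have yg : y * g = k 2 * g * y by nc ioC q0 [:: f; g; y; h] (tt, gy).
nc ioC q0 [:: f; g; y; h; W; U; Ui] (tt, fg, yg, gW, UU, UiU,
  esym (Uc f), esym (Uc g), esym (Uc y), esym (Uc h), esym (Uc W),
  esym (Uic f), esym (Uic g), esym (Uic y), esym (Uic h), esym (Uic W)).
Qed.

Lemma iq_pow_fy f g y h : IQ io q f g y h -> forall m,
  f ^+ m * y = y * f ^+ m + k (-1) * (k (2 * m%:Z) - 1) * h * f ^+ m.-1.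
Proof.
case=> fg fy fh gy yh gh; case=> [|m] /=.
  by rewrite !expr0; nc ioC q0 [:: f; g; y; h] (tt, fg).
have E c n (p : nat) : k (c * (n + p)%N%:Z) = k (c * p%:Z) * k (c * n%:Z).
  by rewrite -(qcD io q_prim) PoszD mulrDr addrC.
elim: m => [|m IH].
  by rewrite !expr0 !expr1; nc ioC q0 [:: f; g; y; h] (tt, fy).
rewrite exprS -mulrA IH -[m.+2]addn2 -[m.+1]addn1 !E !exprD.
have := qc_comm ioC q (2 * m%:Z); move: (k (2 * m%:Z)) => U Uc.
have fW : f ^+ m * f = f * f ^+ m by rewrite -exprSr exprS.
rewrite !exprS expr0 !mulr1; move: (f ^+ m) fW => W fW.
nc ioC q0 [:: f; g; y; h; W; U] (tt, fg, fy, fh, fW,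
  esym (Uc f), esym (Uc g), esym (Uc y), esym (Uc h), esym (Uc W)).
Qed.

Lemma iq_central_f f g y h : IQ io q f g y h ->
  [/\ f ^+ l * g = g * f ^+ l, f ^+ l * y = y * f ^+ l & f ^+ l * h = h * f ^+ l].
Proof.
move=> H; split; first by
  rewrite (iq_pow_fg H) (qcl io q_prim (-2)) subrr !mulr0 !mul0r !addr0 mul1r.
  by rewrite (iq_pow_fy H) (qcl io q_prim 2) subrr !mulr0 !mul0r !addr0.
have hf : h * f = k (-2) * f * h by nc ioC q0 [:: f; h] (tt, iq_fh H).
by rewrite (comm_k_pow ioC q_prim hf) (qcl io q_prim) mul1r.
Qed.

Lemma iq_pow_gh f g y h : IQ io q f g y h -> forall m,
  g ^+ m * h = h * g ^+ m - k 3 * (1 - k (-4 * m%:Z)) * y * y * g ^+ m.-1.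
Proof.
case=> fg fy fh gy yh gh; case=> [|m] /=.
  by rewrite !expr0; nc ioC q0 [:: f; g; y; h] (tt, fg).
have E c n (p : nat) : k (c * (n + p)%N%:Z) = k (c * p%:Z) * k (c * n%:Z).
  by rewrite -(qcD io q_prim) PoszD mulrDr addrC.
elim: m => [|m IH].
  by rewrite !expr0 !expr1; nc ioC q0 [:: f; g; y; h] (tt, gh).
rewrite exprS -mulrA IH -[m.+2]addn2 -[m.+1]addn1 !E !exprD.
have := qc_comm ioC q (-4 * m%:Z); move: (k (-4 * m%:Z)) => U Uc.
have gW : g ^+ m * g = g * g ^+ m by rewrite -exprSr exprS.
rewrite !exprS expr0 !mulr1; move: (g ^+ m) gW => W gW.
nc ioC q0 [:: f; g; y; h; W; U] (tt, gh, gy, yh, gW,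
  esym (Uc f), esym (Uc g), esym (Uc y), esym (Uc h), esym (Uc W)).
Qed.

Lemma iq_central_g f g y h : IQ io q f g y h ->
  [/\ g ^+ l * f = f * g ^+ l, g ^+ l * y = y * g ^+ l & g ^+ l * h = h * g ^+ l].
Proof.
move=> H; have yg : y * g = k 2 * g * y by nc ioC q0 [:: g; y] (tt, iq_gy H).
split.
- by rewrite (iq_pow_gf H) (qcl io q_prim 2) (qcl io q_prim (-2)) subrr !mul0r !addr0 mul1r.
- by rewrite (comm_k_pow ioC q_prim yg) (qcl io q_prim) mul1r.
by rewrite (iq_pow_gh H) (qcl io q_prim (-4)) subrr !mulr0 !mul0r subr0.
Qed.

Section Short.
Variables (f g y h L Z1 Z2 : B).
Hypotheses (H : IQ io q f g y h) (f_reg : GRing.rreg f) (h_reg : GRing.lreg h).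
Hypotheses (Lf : L * f = f * L) (Lg : L * g = g * L) (Ly : L * y = y * L)
  (Lh : L * h = h * L) (Z1f : Z1 * f = L - 1) (Z2f : Z2 * f = Z1).
Local Notation g' := (shortg L Z1 Z2 g y h).
Local Notation y' := (shorty Z1 y h).

(** Multiplication by [f ^+ 3] on the right eliminates [Z1] and [Z2]; both sides then become words
    in the remaining letters. *)
Let reg3 u v : u * f * f * f = v * f * f * f -> u = v.
Proof. by move/f_reg/f_reg/f_reg. Qed.
Let gf : g * f = k 2 * f * g - (k 4 - 1) * y.
Proof. nc ioC q0 [:: f; g; y; h] (tt, iq_fg H). Qed.
Let yf : y * f = f * y - (k 1 - k (-1)) * h.
Proof. nc ioC q0 [:: f; g; y; h] (tt, iq_fy H). Qed.
Let hf : h * f = k (-2) * f * h.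
Proof. nc ioC q0 [:: f; g; y; h] (tt, iq_fh H). Qed.
Let ZL1 : Z1 * L = L * Z1.
Proof. by apply: f_reg; rewrite -!mulrA Lf !mulrA Z1f -!mulrA Z1f mulrBl mulrBr mul1r mulr1. Qed.
Let ZL2 : Z2 * L = L * Z2.
Proof. by apply: f_reg; rewrite -!mulrA Lf !mulrA Z2f -!mulrA Z2f ZL1. Qed.
Ltac ncs := apply: reg3; rewrite /shortg /shorty;
  nc ioC q0 [:: f; g; y; h; Z1; Z2; L] (tt, gf, yf, hf, iq_gy H, iq_yh H, iq_gh H,
   Z1f, Z2f, Lf, Lg, Ly, Lh, esym ZL1, esym ZL2).

Lemma short_fg : f * g' = k (-2) * g' * f + (k 2 - k (-2)) * (L * y').
Proof. ncs. Qed.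
Lemma short_fy : f * y' = y' * f + (k 1 - k (-1)) * (L * h).
Proof. ncs. Qed.
Lemma short_gy : g' * y' = k (-2) * y' * g'.
Proof. ncs. Qed.
Lemma short_yh : y' * h = k (-2) * h * y'.
Proof. ncs. Qed.
Lemma short_gh : g' * h = h * g' + (k (-1) - k 3) * y' * y'.
Proof. ncs. Qed.
(** The flow preserves the quantum minor, and by the next lemma also [h - q y f] once [h] is scaled
    by [L]. These two invariants determine the l-th powers of the moved [y] and [g]. *)
Lemma short_D : h * g' - k 3 * y' * y' = h * g - k 3 * y * y.
Proof. ncs. Qed.
Lemma short_H : L * h - k 1 * y' * f = h - k 1 * y * f.
Proof. ncs. Qed.

End Short.
End RegularFlows.

Section RegularFlowPowers.
Variables (C : fieldType) (B : nzRingType) (io : {rmorphism C -> B}).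
Hypothesis ioC : forall c x, io c * x = x * io c.
Variables (q : C) (l : nat).
Hypotheses (l_odd : odd l) (q_prim : l.-primitive_root q).
Local Notation k := (qc io q).
Let q0 : q != 0 := prim_neq0 q_prim.

Lemma rregX (x : B) n : GRing.rreg x -> GRing.rreg (x ^+ n).
Proof.
move=> xr; elim: n => [|n IH] u v; first by rewrite !mulr1.
by rewrite exprSr !mulrA => /xr/IH.
Qed.

Section Short.
Variables (f g y h L Z1 Z2 s : B).
Hypotheses (H : IQ io q f g y h) (f_reg : GRing.rreg f) (h_reg : GRing.lreg h).
Hypotheses (Lf : L * f = f * L) (Lg : L * g = g * L) (Ly : L * y = y * L)
  (Lh : L * h = h * L) (Z1f : Z1 * f = L - 1) (Z2f : Z2 * f = Z1)
  (sf : s * f ^+ l = L ^+ l - 1) (sh : s * h = h * s) (sy : s * y = y * s).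
Local Notation g' := (shortg io q L Z1 Z2 g y h).
Local Notation y' := (shorty io q Z1 y h).

Let yhl : y ^+ l * h ^+ l = h ^+ l * y ^+ l.
Proof.
have := comm_k_pow ioC q_prim (iq_yh H) l; rewrite (qcl io q_prim) mul1r => E.
exact/esym/commrX/esym.
Qed.
Let shl : s * h ^+ l = h ^+ l * s. Proof. exact: commrX. Qed.
Let syl : s * y ^+ l = y ^+ l * s. Proof. exact: commrX. Qed.

Lemma iq_H_comm : let X := h - k 1 * y * f in
  [/\ f * X = X * f, h * X = X * h & y * X = X * y].
Proof.
by split; nc ioC q0 [:: f; g; y; h]
  (tt, iq_fg H, iq_fy H, iq_fh H, iq_gy H, iq_yh H, iq_gh H).
Qed.

(** Both sides are compared after multiplication by [f ^+ l]: by [power_short], [y' ^+ l * f ^+ l]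
    is the difference of the l-th powers of [L * h] and of the invariant [h - q y f]. *)
Lemma short_pow_y : y' ^+ l = y ^+ l + s * h ^+ l.
Proof.
apply: (rregX f_reg (n := l)); have [fX hX yX] := iq_H_comm.
have [_ _ flh] := iq_central_f ioC q_prim H.
rewrite (power_short ioC l_odd q_prim (h := L * h) (H := h - k 1 * y * f)).
- rewrite exprMn_comm; last exact: Lh.
  rewrite mulrDl (power_short ioC l_odd q_prim (iq_fh H) fX hX); last first.
    by nc ioC q0 [:: f; y; h] tt.
  have Llh : L ^+ l * h ^+ l = h ^+ l * L ^+ l by apply/commrX/esym/commrX/esym.
  by nc ioC q0 [:: f ^+ l; h ^+ l; L ^+ l; (h - k 1 * y * f) ^+ l; s]
     (tt, sf, shl, Llh).
- by nc ioC q0 [:: f; h; L] (tt, iq_fh H, Lf, Lh).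
- by [].
- rewrite -[L * h * _]mulrA hX [LHS]mulrA [RHS]mulrA; congr (_ * _).
  by nc ioC q0 [:: f; y; h; L] (tt, Lf, Lh, Ly).
by rewrite -(short_H ioC q_prim H f_reg Lf Lg Ly Lh Z1f Z2f); nc ioC q0 [:: f; h; L; y'] tt.
Qed.

(** Left multiplication by [h ^+ l] and [power_long] reduce this to [short_pow_y] and the invariance
    of the minor. *)
Lemma short_pow_g : g' ^+ l = g ^+ l + s * y ^+ l + s * y ^+ l + s * s * h ^+ l.
Proof.
have hrl : GRing.lreg (h ^+ l) by apply: lregX.
apply: hrl.
have E (a b : B) : a * b = b * a -> (a * a) ^+ l = a ^+ l * a ^+ l.
  by move=> _; rewrite exprMn_comm.
rewrite (power_long ioC l_odd q_prim (short_gy ioC q_prim H f_reg Lf Lg Ly Lh Z1f Z2f)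
  (short_yh ioC q_prim H f_reg Lf Lg Ly Lh Z1f Z2f) (short_gh ioC q_prim H f_reg Lf Lg Ly Lh Z1f Z2f)).
rewrite (short_D ioC q_prim H f_reg Lf Lg Ly Lh Z1f Z2f) (E _ _ (erefl (y' * y'))).
rewrite short_pow_y.
have := power_long ioC l_odd q_prim (iq_gy H) (iq_yh H) (iq_gh H).
rewrite (E _ _ (erefl (y * y))) => P.
have -> : (h * g - k 3 * y * y) ^+ l = h ^+ l * g ^+ l - y ^+ l * y ^+ l.
  by rewrite P addrK.
by nc ioC q0 [:: y ^+ l; h ^+ l; g ^+ l; s] (tt, yhl, shl, syl).
Qed.

End Short.

Section Long.
Variables (f g y h L Z1 s : B).
Hypotheses (H : IQ io q f g y h) (g_reg : GRing.rreg g) (y_reg : GRing.lreg y).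
Hypotheses (Lf : L * f = f * L) (Lg : L * g = g * L) (Ly : L * y = y * L)
  (Lh : L * h = h * L) (Z1g : Z1 * g = L - 1)
  (sg : s * g ^+ l = L ^+ l - 1) (sy : s * y = y * s).
Local Notation f' := (longf io q L Z1 f y).
Local Notation h' := (longh io q L Z1 h y).

Let reg3 u v : u * g * g * g = v * g * g * g -> u = v.
Proof. by move/g_reg/g_reg/g_reg. Qed.
Let yg : y * g = k 2 * g * y.
Proof. nc ioC q0 [:: f; g; y; h] (tt, iq_gy H). Qed.
Let hg : h * g = g * h - (k (-1) - k 3) * y * y.
Proof. nc ioC q0 [:: f; g; y; h] (tt, iq_gh H). Qed.
Let ZL1 : Z1 * L = L * Z1.
Proof. by apply: g_reg; rewrite -!mulrA Lg !mulrA Z1g -!mulrA Z1g mulrBl mulrBr mul1r mulr1. Qed.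
Ltac ncs := apply: reg3; rewrite /longf /longh;
  nc ioC q0 [:: f; g; y; h; Z1; L] (tt, iq_fg H, iq_fy H, iq_fh H, yg, hg, iq_yh H,
   Z1g, Lf, Lg, Ly, Lh, esym ZL1).

Lemma long_iq : IQ io q f' g y h'.
Proof. by split; ncs. Qed.
(** Under the long flow the two minors are not fixed but multiplied by [L], which is central enough
    for l-th powers to be taken factor by factor. *)
Lemma long_D : h' * g - k 3 * y * y = L * (h * g - k 3 * y * y).
Proof. ncs. Qed.
Lemma long_H : h' - k 1 * y * f' = L * (h - k 1 * y * f).
Proof. ncs. Qed.

Let syl : s * y ^+ l = y ^+ l * s. Proof. exact: commrX. Qed.
Let Lcom x : L * x = x * L -> L ^+ l * x ^+ l = x ^+ l * L ^+ l.
Proof. by move=> E; apply/commrX/esym/commrX/esym. Qed.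
Let E (a : B) : (a * a) ^+ l = a ^+ l * a ^+ l.
Proof. by rewrite exprMn_comm. Qed.

Lemma long_pow_h : h' ^+ l = L ^+ l * h ^+ l - s * y ^+ l * y ^+ l.
Proof.
have I := long_iq; apply: (rregX g_reg (n := l)).
rewrite (power_long ioC l_odd q_prim (iq_gy I) (iq_yh I) (iq_gh I)) E long_D.
rewrite exprMn_comm; last first.
  by rewrite /GRing.comm; nc ioC q0 [:: g; y; h; L] (tt, Lg, Ly, Lh).
have := power_long ioC l_odd q_prim (iq_gy H) (iq_yh H) (iq_gh H); rewrite E => P.
have -> : (h * g - k 3 * y * y) ^+ l = h ^+ l * g ^+ l - y ^+ l * y ^+ l.
  by rewrite P addrK.
have [_ gly _] := iq_central_g ioC q_prim H.
have ygl : y ^+ l * g ^+ l = g ^+ l * y ^+ l by apply/esym/commrX.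
nc ioC q0 [:: y ^+ l; h ^+ l; g ^+ l; L ^+ l; s] (tt, ygl, syl, sg, Lcom Lh, Lcom Lg, Lcom Ly).
Qed.

Lemma long_pow_f : f' ^+ l = L ^+ l * f ^+ l - s * y ^+ l.
Proof.
have I := long_iq; have yrl : GRing.lreg (y ^+ l) by apply: lregX.
apply: yrl; have [fX hX _] := iq_H_comm H; have [fX' hX' _] := iq_H_comm I.
have y1 : k 1 * y * f' = h' - (h' - k 1 * y * f') by rewrite opprB addrC subrK.
have y2 : k 1 * y * f = h - (h - k 1 * y * f) by rewrite opprB addrC subrK.
rewrite (power_short ioC l_odd q_prim (iq_fh I) fX' hX' y1) long_pow_h long_H.
rewrite exprMn_comm; last first.
  by rewrite /GRing.comm; nc ioC q0 [:: f; y; h; L] (tt, Lf, Ly, Lh).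
have P := power_short ioC l_odd q_prim (iq_fh H) fX hX y2.
have -> : (h - k 1 * y * f) ^+ l = h ^+ l - y ^+ l * f ^+ l by rewrite P opprB addrCA subrr addr0.
nc ioC q0 [:: y ^+ l; h ^+ l; f ^+ l; L ^+ l; s] (tt, syl, Lcom Lh, Lcom Lf, Lcom Ly).
Qed.

End Long.
End RegularFlowPowers.

Section FlowEquations.
Variables (C : fieldType) (B : nzRingType) (io : {rmorphism C -> B}).
Variables (q : C) (l : nat) (t : C) (f g y h : B).
Local Notation k := (qc io q).

Definition fL (x : B) := 1 + io t * x ^+ l.
Definition fZ (x : B) i := io t * x ^+ (l - i).
(** The quotient [(L ^+ l - 1) / x ^+ l] as a geometric sum; it is the time by which the l-th powers
    move. *)
Definition fs (x : B) := io t * \sum_(j < l) fL x ^+ j.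
Definition short_g := shortg io q (fL f) (fZ f 1) (fZ f 2) g y h.
Definition short_y := shorty io q (fZ f 1) y h.
Definition long_f := longf io q (fL g) (fZ g 1) f y.
Definition long_h := longh io q (fL g) (fZ g 1) h y.

(** Equations are stored as pairs, so that a whole list can be pushed forward along a specialization
    and pulled back along the injective embedding by scalar matrices. *)
Definition short_eqs : seq (B * B) :=
  [:: (f * short_g, k (-2) * short_g * f + (k 2 - k (-2)) * (fL f * short_y));
      (f * short_y, short_y * f + (k 1 - k (-1)) * (fL f * h));
      (short_g * short_y, k (-2) * short_y * short_g);
      (short_y * h, k (-2) * h * short_y);
      (short_g * h, h * short_g + (k (-1) - k 3) * short_y * short_y);
      (short_y ^+ l, y ^+ l + fs f * h ^+ l);
      (short_g ^+ l, g ^+ l + fs f * y ^+ l + fs f * y ^+ l + fs f * fs f * h ^+ l)].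

Definition long_eqs : seq (B * B) :=
  [:: (long_f * g, k (-2) * g * long_f + (k 2 - k (-2)) * y);
      (long_f * y, y * long_f + (k 1 - k (-1)) * long_h);
      (long_f * long_h, k 2 * long_h * long_f);
      (y * long_h, k (-2) * long_h * y);
      (g * long_h, long_h * g + (k (-1) - k 3) * y * y);
      (long_h ^+ l, fL g ^+ l * h ^+ l - fs g * y ^+ l * y ^+ l);
      (long_f ^+ l, fL g ^+ l * f ^+ l - fs g * y ^+ l)].

Definition eqs_hold (s : seq (B * B)) : Prop := foldr (fun e P => e.1 = e.2 /\ P) True s.

End FlowEquations.

Section FlowMorphism.
Variables (C : fieldType) (B1 B2 : nzRingType) (io1 : {rmorphism C -> B1})
  (io2 : {rmorphism C -> B2}) (sp : {rmorphism B1 -> B2}).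
Hypothesis spE : forall c, sp (io1 c) = io2 c.
Variables (q : C) (l : nat) (t : C) (f g y h : B1).

Let spq i : sp (qc io1 q i) = qc io2 q i. Proof. exact: spE. Qed.
Let spL x : sp (fL io1 l t x) = fL io2 l t (sp x).
Proof. by rewrite /fL rmorphD rmorph1 rmorphM spE rmorphXn. Qed.
Let spZ x i : sp (fZ io1 l t x i) = fZ io2 l t (sp x) i.
Proof. by rewrite /fZ rmorphM spE rmorphXn. Qed.
Let sps x : sp (fs io1 l t x) = fs io2 l t (sp x).
Proof.
rewrite /fs rmorphM spE rmorph_sum; congr (_ * _).
by apply: eq_bigr => j _; rewrite rmorphXn spL.
Qed.

Let sp2 (e : B1 * B1) := (sp e.1, sp e.2).
Lemma short_eqs_morph :
  map sp2 (short_eqs io1 q l t f g y h)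
  = short_eqs io2 q l t (sp f) (sp g) (sp y) (sp h).
Proof.
rewrite /short_eqs /short_g /short_y /shortg /shorty /sp2 /=.
rewrite !(spq, spL, spZ, sps, rmorphB, rmorphD, rmorphN, rmorphM, rmorphXn, rmorph1).
by [].
Qed.
Lemma long_eqs_morph :
  map sp2 (long_eqs io1 q l t f g y h)
  = long_eqs io2 q l t (sp f) (sp g) (sp y) (sp h).
Proof.
rewrite /long_eqs /long_f /long_h /longf /longh /sp2 /=.
by rewrite !(spq, spL, spZ, sps, rmorphB, rmorphD, rmorphN, rmorphM, rmorphXn, rmorph1).
Qed.

Lemma eqs_hold_morph s : eqs_hold s -> eqs_hold (map sp2 s).
Proof. by elim: s => //= e s IH [-> /IH]. Qed.
Lemma eqs_hold_inj s : injective sp -> eqs_hold (map sp2 s) -> eqs_hold s.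
Proof. by move=> i; elim: s => //= e s IH [/i-> /IH]. Qed.

Lemma IQ_morph : IQ io1 q f g y h -> IQ io2 q (sp f) (sp g) (sp y) (sp h).
Proof.
by case=> h1 h2 h3 h4 h5 h6; split; rewrite -rmorphM ?(h1, h2, h3, h4, h5, h6) !(spq, rmorphB, rmorphD, rmorphM).
Qed.
End FlowMorphism.

Section RegularEquations.
Variables (C : fieldType) (B : nzRingType) (io : {rmorphism C -> B}).
Hypothesis ioC : forall c x, io c * x = x * io c.
Variables (q : C) (l : nat).
Hypotheses (l_odd : odd l) (l_gt1 : (1 < l)%N) (q_prim : l.-primitive_root q).
Variables (t : C) (f g y h : B).
Hypothesis H : IQ io q f g y h.

Lemma fL_comm x z : x ^+ l * z = z * x ^+ l -> fL io l t x * z = z * fL io l t x.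
Proof. by move=> E; rewrite /fL mulrDl mulrDr mul1r mulr1 -mulrA E mulrA ioC -mulrA. Qed.

Lemma fs_comm x z : x ^+ l * z = z * x ^+ l -> fs io l t x * z = z * fs io l t x.
Proof.
move=> /fL_comm E; rewrite /fs -mulrA [RHS]mulrA -ioC -mulrA; congr (_ * _).
by apply/commr_sym/commr_sum => j _; apply/commrX/esym.
Qed.

Lemma fs_pow x : fs io l t x * x ^+ l = fL io l t x ^+ l - 1.
Proof.
rewrite subrX1 {1}/fL addrAC subrr add0r -mulrA /fs -!mulrA; congr (_ * _); symmetry.
by apply/commr_sum => j _; apply/commrX/esym/fL_comm.
Qed.

Lemma fZ1_mul x : fZ io l t x 1 * x = fL io l t x - 1.
Proof. by rewrite /fZ /fL addrAC subrr add0r -mulrA -exprSr subn1 prednK // ltnW. Qed.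

Lemma fZ2_mul x : fZ io l t x 2 * x = fZ io l t x 1.
Proof. by rewrite /fZ -mulrA -exprSr subnSK. Qed.

Lemma short_eqs_reg : GRing.rreg f -> GRing.lreg h ->
  eqs_hold (short_eqs io q l t f g y h).
Proof.
move=> fr hr; have [/[dup]/fL_comm Lg _ /[dup]/fL_comm Ly /fs_comm sy
   /[dup]/fL_comm Lh /fs_comm sh] := iq_central_f ioC q_prim H.
have Lf : fL io l t f * f = f * fL io l t f by apply: fL_comm; rewrite -exprSr exprS.
have sf := fs_pow f; have Z1f := fZ1_mul f; have Z2f := fZ2_mul f.
do ![split=> /=].
- exact: (short_fg ioC q_prim H fr Lf Lg Ly Lh Z1f Z2f).
- exact: (short_fy ioC q_prim H fr Lf Lg Ly Lh Z1f Z2f).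
- exact: (short_gy ioC q_prim H fr Lf Lg Ly Lh Z1f Z2f).
- exact: (short_yh ioC q_prim H fr Lf Lg Ly Lh Z1f Z2f).
- exact: (short_gh ioC q_prim H fr Lf Lg Ly Lh Z1f Z2f).
- exact: (short_pow_y ioC l_odd q_prim H fr Lf Lg Ly Lh Z1f Z2f sf sh).
exact: (short_pow_g ioC l_odd q_prim H fr hr Lf Lg Ly Lh Z1f Z2f sf sh sy).
Qed.

Lemma long_eqs_reg : GRing.rreg g -> GRing.lreg y ->
  eqs_hold (long_eqs io q l t f g y h).
Proof.
move=> gr yr; have [/[dup]/fL_comm Lf _ /[dup]/fL_comm Ly /fs_comm sy
   /[dup]/fL_comm Lh /fs_comm sh] := iq_central_g ioC q_prim H.
have Lg : fL io l t g * g = g * fL io l t g by apply: fL_comm; rewrite -exprSr exprS.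
have sg := fs_pow g; have Z1g := fZ1_mul g.
have I := long_iq ioC q_prim H gr Lf Lg Ly Lh Z1g.
do ![split=> /=].
- exact: (iq_fg I).
- exact: (iq_fy I).
- exact: (iq_fh I).
- exact: (iq_yh I).
- exact: (iq_gh I).
- exact: (long_pow_h ioC l_odd q_prim H gr Lf Lg Ly Lh Z1g sg sy).
exact: (long_pow_f ioC l_odd q_prim H gr yr Lf Lg Ly Lh Z1g sg sy).
Qed.

End RegularEquations.

(** The substitution imitates a comultiplication: [kf] and [kg] have the weights under which the
    relations survive for central [X] and [Y], provided that [kf] and [kg] q-commute. For
    indeterminate [X] and [Y] the leading coefficients are products of scalars, [kf] and [kg], hence
    regular. *)
Lemma deform_iq_central (C : fieldType) (B : nzRingType) (io : {rmorphism C -> B})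
    (ioC : forall c x, io c * x = x * io c) (q : C) (q0 : q != 0)
    (f g y h kf kg X Y : B) (F := f + X * kf) (G := g + Y * kg) :
  let k := qc io q in
  IQ io q f g y h ->
  kf * f = k 2 * f * kf -> kf * g = k (-2) * g * kf ->
  kf * y = y * kf -> kf * h = k 2 * h * kf ->
  kg * f = k (-2) * f * kg -> kg * g = k 4 * g * kg ->
  kg * y = k 2 * y * kg -> kg * h = h * kg -> kf * kg = k 2 * kg * kf ->
  (forall x, X * x = x * X) -> (forall x, Y * x = x * Y) ->
  IQ io q F G (y + Y * kg * F) (h + Y * k 1 * kg * F * F).
Proof.
rewrite /F /G /=; case=> h1 h2 h3 h4 h5 h6 e1 e2 e3 e4 e5 e6 e7 e8 e9 XC YC.
split; nc ioC q0 [:: f; g; y; h; kf; kg; X; Y]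
  (tt, e1, e2, e3, e4, e5, e6, e7, e8, e9, h1, h2, h3, h4, h5, h6,
   esym (XC f), esym (XC g), esym (XC y), esym (XC h), esym (XC kf), esym (XC kg),
   esym (YC f), esym (YC g), esym (YC y), esym (YC h), esym (YC kf), esym (YC kg),
   esym (XC Y)).
Qed.

Section Deformation.
Variables (C : fieldType) (B : nzRingType) (io : {rmorphism C -> B}).
Hypothesis ioC : forall c x, io c * x = x * io c.
Variables (q : C) (l : nat).
Hypotheses (l_odd : odd l) (l_gt1 : (1 < l)%N) (q_prim : l.-primitive_root q).
Local Notation k := (qc io q).
Let q0 : q != 0 := prim_neq0 q_prim.
Variables (t : C) (f g y h kf kg : B).
Hypothesis H : IQ io q f g y h.
Hypotheses (kff : kf * f = k 2 * f * kf) (kfg : kf * g = k (-2) * g * kf)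
  (kfy : kf * y = y * kf) (kfh : kf * h = k 2 * h * kf)
  (kgf : kg * f = k (-2) * f * kg) (kgg : kg * g = k 4 * g * kg)
  (kgy : kg * y = k 2 * y * kg) (kgh : kg * h = h * kg)
  (kfkg : kf * kg = k 2 * kg * kf).
Hypotheses (kfl : GRing.lreg kf) (kfr : GRing.rreg kf)
  (kgl : GRing.lreg kg) (kgr : GRing.rreg kg).

Local Notation PP := {poly {poly B}}.
Definition io2 : {rmorphism C -> PP} := (polyC \o polyC) \o io.
Definition emb : {rmorphism B -> PP} := polyC \o polyC.
Definition ev0 : {rmorphism PP -> B} := coefp 0 \o coefp 0.
Lemma ev0K x : ev0 (emb x) = x. Proof. by rewrite /= /coefp !coefC. Qed.

Lemma polyC_central (R : nzRingType) (c : R) : (forall x, c * x = x * c) ->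
  forall p : {poly R}, c%:P * p = p * c%:P.
Proof. by move=> cC p; apply/polyP=> i; rewrite coefCM coefMC. Qed.

Lemma io2C c x : io2 c * x = x * io2 c.
Proof. by apply/polyC_central/polyC_central/ioC. Qed.

Let X : PP := 'X%:P.
Let Y : PP := 'X.
Let XC x : X * x = x * X.
Proof. by apply: polyC_central => p; rewrite -commr_polyX. Qed.
Let YC x : Y * x = x * Y. Proof. by rewrite -commr_polyX. Qed.

Let F := emb f + X * emb kf.
Let G := emb g + Y * emb kg.
Let Yt := emb y + Y * emb kg * F.
Let Ht := emb h + Y * qc io2 q 1 * emb kg * F * F.

Lemma deform_iq : IQ io2 q F G Yt Ht.
Proof.
have m a b c (d e : B) : a * b = qc io q c * d * e ->
    emb a * emb b = qc io2 q c * emb d * emb e by move=> E; rewrite -rmorphM E !rmorphM.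
have m1 (a b c d : B) : a * b = c * d -> emb a * emb b = emb c * emb d.
  by move=> E; rewrite -!rmorphM E.
apply: (deform_iq_central io2C q0 (IQ_morph (io2 := io2) (sp := emb) (fun=> erefl) H));
  by [apply: m | apply: m1 | apply: XC | apply: YC].
Qed.

Lemma lreg_linear (R : nzRingType) (a b : R) : GRing.lreg b -> GRing.lreg (a%:P + 'X * b%:P).
Proof.
move=> br; apply: lreg_lead; have b0 : b != 0 by apply: lreg_neq0.
rewrite addrC -commr_polyX lead_coefDl ?lead_coefMX ?lead_coefC //.
by rewrite size_polyC size_mulX ?polyC_eq0 // size_polyC b0; case: (a != 0).
Qed.

Lemma rreg_linear (R : nzRingType) (a b : R) : GRing.rreg b -> GRing.rreg (a%:P + 'X * b%:P).
Proof.
move=> br; apply: rreg_lead; have b0 : b != 0 by apply: rreg_neq0.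
rewrite addrC -commr_polyX lead_coefDl ?lead_coefMX ?lead_coefC //.
by rewrite size_polyC size_mulX ?polyC_eq0 // size_polyC b0; case: (a != 0).
Qed.

Lemma lreg_polyC (R : nzRingType) (a : R) : GRing.lreg a -> GRing.lreg a%:P.
Proof. by move=> ar; apply: lreg_lead; rewrite lead_coefC. Qed.
Lemma rreg_polyC (R : nzRingType) (a : R) : GRing.rreg a -> GRing.rreg a%:P.
Proof. by move=> ar; apply: rreg_lead; rewrite lead_coefC. Qed.

Let F0 : {poly B} := f%:P + 'X * kf%:P.
Let FE : F = F0%:P. Proof. by rewrite /F0 polyCD polyCM. Qed.

Lemma qc_lreg i : GRing.lreg (k i).
Proof.
move=> u v /(congr1 (fun x => k (-i) * x)).
by rewrite !mulrA -(qcD io q_prim) addNr qc0 !mul1r.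
Qed.

Let evE c : ev0 (io2 c) = io c. Proof. exact: ev0K. Qed.
Let evX a b : ev0 (emb a + X * b) = a.
Proof. by rewrite rmorphD rmorphM ev0K [ev0 X]/= /coefp coefC coefX mul0r addr0. Qed.
Let evY a b : ev0 (emb a + Y * b) = a.
Proof. by rewrite rmorphD rmorphM ev0K [ev0 Y]/= /coefp coefX coef0 mul0r addr0. Qed.
Let F0l : GRing.lreg F0. Proof. exact: lreg_linear. Qed.
Let F0r : GRing.rreg F0. Proof. exact: rreg_linear. Qed.
Let YtE : Yt = emb y + Y * (kg%:P * F0)%:P.
Proof. by rewrite /Yt FE polyCM mulrA. Qed.
Let HtE : Ht = emb h + Y * ((k 1)%:P * kg%:P * F0 * F0)%:P.
Proof. by rewrite /Ht FE !polyCM !mulrA. Qed.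

Lemma short_eqs_deform : eqs_hold (short_eqs io q l t f g y h).
Proof.
have Fr : GRing.rreg F by rewrite FE; apply/rreg_polyC.
have Hl : GRing.lreg Ht.
  rewrite HtE; apply: lreg_linear.
  by do !apply: lregM => //; apply: lreg_polyC => //; apply: qc_lreg.
have := short_eqs_reg io2C l_odd l_gt1 q_prim t deform_iq Fr Hl.
(* [ev0] sets both indeterminates to zero, which returns the undeformed quadruple. *)
move/(eqs_hold_morph ev0); rewrite (short_eqs_morph evE).
by rewrite evX evY YtE evY HtE evY.
Qed.

Lemma long_eqs_deform : eqs_hold (long_eqs io q l t f g y h).
Proof.
have Gr : GRing.rreg G by apply/rreg_linear/rreg_polyC.
have Yl : GRing.lreg Yt.
  by rewrite YtE; apply/lreg_linear/lregM => //; apply: lreg_polyC.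
have := long_eqs_reg io2C l_odd l_gt1 q_prim t deform_iq Gr Yl.
move/(eqs_hold_morph ev0); rewrite (long_eqs_morph evE).
by rewrite evX evY YtE evY HtE evY.
Qed.

End Deformation.

Section QuantumNumbersNonzero.
Variables (C : fieldType) (q : C) (l : nat).
Hypotheses (l_odd : odd l) (l_gt1 : (1 < l)%N) (q_prim : l.-primitive_root q).

Lemma prim_exprz_eq1 (n : nat) : coprime n l -> q ^+ n == 1 -> False.
Proof.
move=> co; rewrite -(prim_order_dvd q_prim) => dv.
by move: co l_gt1; rewrite /coprime gcdnC (gcdn_idPl dv) => /eqP ->.
Qed.

Lemma exprz_sub_neq0 (n : nat) : coprime n.*2 l -> q ^ n%:Z - q ^ (- n%:Z) != 0.
Proof.
move=> co; apply/negP; rewrite subr_eq0 => /eqP E; apply: (prim_exprz_eq1 co).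
have q0 := prim_neq0 q_prim.
by rewrite -addnn exprD exprnP {2}E -expfzDr // subrr expr0z.
Qed.

Lemma d0_neq0 : q ^ 1 - q ^ (-1) != 0.
Proof. exact: (@exprz_sub_neq0 1 (coprime2l l_odd)). Qed.
Lemma d1_neq0 : q ^ 2 - q ^ (-2) != 0.
Proof. exact: (@exprz_sub_neq0 2 (coprime4l l_odd)). Qed.
End QuantumNumbersNonzero.

Section Torus.
Variables (C : fieldType) (B : nzRingType) (io : {rmorphism C -> B}).
Hypothesis ioC : forall c x, io c * x = x * io c.
Variables (q : C) (l : nat).
Hypotheses (l_odd : odd l) (l_gt1 : (1 < l)%N) (q_prim : l.-primitive_root q).
Local Notation k := (qc io q).
Let q0 : q != 0 := prim_neq0 q_prim.

Lemma io_reg c (x y : B) : c != 0 -> io c * x = io c * y -> x = y.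
Proof.
by move=> c0 /(congr1 (fun z => io c^-1 * z)); rewrite !mulrA -rmorphM mulVf // rmorph1 !mul1r.
Qed.

Lemma d0_reg (x y : B) : (k 1 - k (-1)) * x = (k 1 - k (-1)) * y -> x = y.
Proof. rewrite -rmorphB; apply: io_reg; exact: d0_neq0 q_prim. Qed.
Lemma d1_reg (x y : B) : (k 2 - k (-2)) * x = (k 2 - k (-2)) * y -> x = y.
Proof. rewrite -rmorphB; apply: io_reg; exact: d1_neq0 q_prim. Qed.

Variables (f g y h tf tg : B).
Hypothesis H : IQ io q f g y h.
Hypotheses (tff : tf * f = k 2 * f * tf) (tfg : tf * g = k (-2) * g * tf)
  (tgf : tg * f = k (-2) * f * tg) (tgg : tg * g = k 4 * g * tg)
  (tft : tf * tg = tg * tf) (tfu tgu : B)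
  (tfK : tf * tfu = 1) (Ktf : tfu * tf = 1) (tgK : tg * tgu = 1) (Ktg : tgu * tg = 1).

Lemma weight_y c (a b : int) : c * f = k a * f * c -> c * g = k b * g * c ->
  c * y = k a * k b * y * c.
Proof.
move=> cf cg; apply: d1_reg.
have Uc x := qc_comm ioC q a x; have Vc x := qc_comm ioC q b x.
move: (k a) (k b) Uc Vc cf cg => U V Uc Vc cf cg.
transitivity (c * (f * g - k (-2) * g * f)).
  nc ioC q0 [:: f; g; c; y] (tt, iq_fg H).
transitivity (U * V * (f * g - k (-2) * g * f) * c).
  nc ioC q0 [:: f; g; c; U; V]
    (tt, cf, cg, esym (Uc f), esym (Uc g), esym (Vc f), esym (Vc g), esym (Uc V)).
nc ioC q0 [:: f; g; c; y; U; V] (tt, iq_fg H).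
Qed.

Lemma weight_h c (a b : int) : c * f = k a * f * c -> c * g = k b * g * c ->
  c * h = k a * k a * k b * h * c.
Proof.
move=> cf cg; have cy := weight_y cf cg; apply: d0_reg.
have Uc x := qc_comm ioC q a x; have Vc x := qc_comm ioC q b x.
move: (k a) (k b) Uc Vc cf cg cy => U V Uc Vc cf cg cy.
transitivity (c * (f * y - y * f)).
  nc ioC q0 [:: f; y; c; h] (tt, iq_fy H).
transitivity (U * U * V * (f * y - y * f) * c).
  nc ioC q0 [:: f; y; c; U; V]
    (tt, cf, cy, esym (Uc f), esym (Uc y), esym (Vc f), esym (Vc y), esym (Uc V)).
nc ioC q0 [:: f; y; c; h; U; V] (tt, iq_fy H).
Qed.

Section ClockShift.
Variables (n : nat) (ln : l = n.+1).
Let sm : {rmorphism B -> 'M[B]_n.+1} := @scalar_mx B n.+1.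
Let io' : {rmorphism C -> 'M[B]_n.+1} := sm \o io.
(** The toral elements [tf] and [tg] commute, whereas the deformation needs a pair with
    [kf * kg = q^2 kg * kf]. Tensoring with clock and shift matrices of size [l] supplies this
    factor, and since [sm] is injective the equations descend to [B]. *)
Let clock : 'M[B]_n.+1 := diag_mx (\row_i io ((q ^ 2) ^+ i)).
Let shift : 'M[B]_n.+1 := perm_mx (perm (can_inj (@ord_predK n.+1))).

Let smE a : sm a = diag_mx (const_mx a). Proof. by rewrite diag_const_mx. Qed.
Let sml a x i j : (sm a * x) i j = a * x i j.
Proof. by rewrite smE [_ * _](mul_diag_mx _ x) !mxE. Qed.
Let smr a x i j : (x * sm a) i j = x i j * a.
Proof. by rewrite smE [_ * _](mul_mx_diag x) !mxE. Qed.
Let cll x i j : (clock * x) i j = io ((q ^ 2) ^+ i) * x i j.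
Proof. by rewrite [_ * _](mul_diag_mx _ x) !mxE. Qed.
Let clr x i j : (x * clock) i j = x i j * io ((q ^ 2) ^+ j).
Proof. by rewrite [_ * _](mul_mx_diag x) !mxE. Qed.
Let shE i j : shift i j = (ord_pred i == j)%:R.
Proof. by rewrite !mxE permE. Qed.

Let io'C c x : io' c * x = x * io' c.
Proof. by apply/matrixP=> i j; rewrite (sml (io c)) (smr (io c)) ioC. Qed.

Let clockC x : clock * sm x = sm x * clock.
Proof. by apply/matrixP=> i j; rewrite clr cll !mxE; case: eqP => [->|] /=; rewrite ?mulr0n ?mulr0 ?mul0r // ioC. Qed.

Let shiftC x : shift * sm x = sm x * shift.
Proof.
by apply/matrixP=> i j; rewrite smr sml shE; case: eqP; rewrite ?mulr1 ?mul1r ?mulr0 ?mul0r.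
Qed.

Let clock_shift : clock * shift = qc io' q 2 * shift * clock.
Proof.
apply/matrixP=> i j; rewrite cll clr (sml (io (q ^ 2))) shE.
case: eqP => [<-|]; last by rewrite !(mulr0, mul0r).
rewrite !mulr1 -(rmorphM io); congr (io _).
have pq : n.+1.-primitive_root (q ^ 2).
  by rewrite -ln; apply: prim_exprz q_prim _ _; exact: coprime2l l_odd.
by rewrite (prim_expr_mod pq) addnS /= exprD mulrCA -exprS (prim_expr_order pq) mulr1.
Qed.

Let clock_reg : exists2 u, clock * u = 1 & u * clock = 1.
Proof.
exists (diag_mx (\row_i io ((q ^ (-2)) ^+ i))); apply/matrixP=> i j;
  rewrite (cll, clr) !mxE; case: eqP => [->|]; rewrite ?(mulr0, mul0r) //;
  by rewrite -rmorphM -exprMn -expfzDr // expr1n rmorph1.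
Qed.
Let shift_reg : exists2 u, shift * u = 1 & u * shift = 1.
Proof.
by exists (perm_mx (perm (can_inj (@ord_predK n.+1)))^-1); rewrite -[LHS]perm_mxM ?mulgV ?mulVg perm_mx1.
Qed.

Let kf := sm tf * clock.
Let kg := sm tg * shift.

Let inv_reg (R : nzRingType) (x u : R) : x * u = 1 -> u * x = 1 -> GRing.lreg x /\ GRing.rreg x.
Proof.
move=> xu ux; split=> a b /=.
  by move/(congr1 (fun z => u * z)); rewrite !mulrA ux !mul1r.
by move/(congr1 (fun z => z * u)); rewrite -!mulrA xu !mulr1.
Qed.

Let rel x a b c (y1 : B) : a * b = qc io q c * y1 * a -> x * sm b = sm b * x ->
  sm a * x * sm b = qc io' q c * sm y1 * (sm a * x).
Proof.
by move=> E xb; rewrite -mulrA xb !mulrA -[sm a * _](rmorphM sm) E !rmorphM.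
Qed.

Lemma clock_shift_eqs t : eqs_hold (short_eqs io q l t f g y h) /\
  eqs_hold (long_eqs io q l t f g y h).
Proof.
have smi : injective sm by move=> a b /matrixP/(_ 0 0); rewrite !mxE eqxx !mulr1n.
have io'E c : sm (io c) = io' c by [].
have [u1 cu uc] := clock_reg; have [u2 su us] := shift_reg.
have smK a b : a * b = 1 -> sm a * sm b = 1 by rewrite -rmorphM => ->; rewrite rmorph1.
have [tfl tfr] := inv_reg (smK _ _ tfK) (smK _ _ Ktf).
have [tgl tgr] := inv_reg (smK _ _ tgK) (smK _ _ Ktg).
have [cl cr] := inv_reg cu uc; have [sl sr] := inv_reg su us.
have r x a b c y1 : a * b = qc io q c * y1 * a -> (forall z, x * sm z = sm z * x) ->
  sm a * x * sm b = qc io' q c * sm y1 * (sm a * x).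
  by move=> e xC; apply: rel.
have r1 x a b : a * b = b * a -> (forall z, x * sm z = sm z * x) ->
  sm a * x * sm b = sm b * (sm a * x).
  by move=> e xC; rewrite -mulrA xC mulrA -rmorphM e rmorphM mulrA.
have k22 : k 2 * k (-2) = 1 by rewrite -(qcD io q_prim) subrr qc0.
have tfy : tf * y = y * tf by rewrite (weight_y tff tfg) k22 mul1r.
have tfh : tf * h = k 2 * h * tf by rewrite (weight_h tff tfg) -(mulrA (k 2)) k22 mulr1.
have tgy : tg * y = k 2 * y * tg by rewrite (weight_y tgf tgg) -(qcD io q_prim).
have tgh : tg * h = h * tg.
  by rewrite (weight_h tgf tgg) -!(qcD io q_prim) qc0 mul1r.
have kfkg : kf * kg = qc io' q 2 * kg * kf.
  rewrite /kf /kg -(mulrA (sm tf)) (mulrA clock) clockC -!mulrA clock_shift !mulrA.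
  have <- : qc io' q 2 * (sm tf * sm tg) = sm tf * sm tg * qc io' q 2 by rewrite io'C.
  by rewrite -[sm tf * _]rmorphM tft rmorphM -!mulrA [shift * (_ * _)]mulrA shiftC -!mulrA.
have I := IQ_morph (sp := sm) io'E H.
have [kfl kfr] : GRing.lreg kf /\ GRing.rreg kf by split; [apply: lregM | apply: rregM].
have [kgl kgr] : GRing.lreg kg /\ GRing.rreg kg by split; [apply: lregM | apply: rregM].
split; apply: (@eqs_hold_inj _ _ sm) => //.
  rewrite (short_eqs_morph io'E).
  apply: (short_eqs_deform io'C l_odd l_gt1 q_prim t I _ _ _ _ _ _ _ _ kfkg) => //;
    by [apply: r | apply: r1].
rewrite (long_eqs_morph io'E).
apply: (long_eqs_deform io'C l_odd l_gt1 q_prim t I _ _ _ _ _ _ _ _ kfkg) => //;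
    by [apply: r | apply: r1].
Qed.
End ClockShift.

Theorem short_flow t : eqs_hold (short_eqs io q l t f g y h).
Proof.
exact: (clock_shift_eqs (esym (prednK (ltnW l_gt1))) t).1.
Qed.
Theorem long_flow t : eqs_hold (long_eqs io q l t f g y h).
Proof.
exact: (clock_shift_eqs (esym (prednK (ltnW l_gt1))) t).2.
Qed.
End Torus.

(* [a], [b], [f], [g] are the generators rescaled by q_i - q_i^-1, [yE], [hE],
   [yF], [hF] the other root vectors up to scalars, and [w0], [w1] the group-like
   elements of the fundamental weights, with inverses [v0], [v1]. *)
Record UQ (C : fieldType) (B : nzRingType) (io : C -> B) (q : C)
    (a b yE hE f g yF hF w0 w1 v0 v1 : B) : Prop := UQuantum {
  uq_E : IQ io q a b yE hE;
  uq_F : IQ io q f g yF hF;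
  uq_w0v0 : w0 * v0 = 1; uq_v0w0 : v0 * w0 = 1;
  uq_w1v1 : w1 * v1 = 1; uq_v1w1 : v1 * w1 = 1;
  uq_w1w0 : w1 * w0 = w0 * w1;
  uq_w0a : w0 * a = qc io q 1 * a * w0; uq_w0b : w0 * b = b * w0;
  uq_w1a : w1 * a = a * w1; uq_w1b : w1 * b = qc io q 2 * b * w1;
  uq_w0f : w0 * f = qc io q (-1) * f * w0; uq_w0g : w0 * g = g * w0;
  uq_w1f : w1 * f = f * w1; uq_w1g : w1 * g = qc io q (-2) * g * w1;
  uq_af : a * f = f * a
    + (qc io q 1 - qc io q (-1)) * (w0 * w0 * v1 - v0 * v0 * w1);
  uq_bg : b * g = g * b
    + (qc io q 2 - qc io q (-2)) * (v0 * v0 * w1 * w1 - w0 * w0 * v1 * v1);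
  uq_ag : a * g = g * a; uq_bf : b * f = f * b }.

(** * Commutation of root vectors with simple generators of the opposite sign *)

Section Cross.
Variables (C : fieldType) (B : nzRingType) (io : {rmorphism C -> B}).
Hypothesis ioC : forall c x, io c * x = x * io c.
Variables (q : C) (l : nat).
Hypotheses (l_odd : odd l) (l_gt1 : (1 < l)%N) (q_prim : l.-primitive_root q).
Local Notation k := (qc io q).
Let q0 : q != 0 := prim_neq0 q_prim.
Variables (a b yE hE f g yF hF w0 w1 v0 v1 : B).
Hypothesis U : UQ io q a b yE hE f g yF hF w0 w1 v0 v1.
Let E := uq_E U.
Let F := uq_F U.

Lemma comm_inv (w v x y : B) : w * v = 1 -> v * w = 1 -> w * x = y * w -> v * y = x * v.
Proof. by move=> wv vw wx; rewrite -[y]mulr1 -wv [y * _]mulrA -wx !mulrA vw mul1r. Qed.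

Lemma inv_comm (w v x : B) (i : int) : w * v = 1 -> v * w = 1 ->
  w * x = k i * x * w -> v * x = k (- i) * x * v.
Proof.
move=> wv vw wx; have E1 := comm_inv wv vw wx.
have IJ : k (- i) * k i = 1 by rewrite -(qcD io q_prim) addNr qc0.
by rewrite -mulrA -E1 [RHS]mulrA qc_comm // -!mulrA [k (-i) * _]mulrA IJ mul1r.
Qed.
Lemma inv_comm0 (w v x : B) : w * v = 1 -> v * w = 1 -> w * x = x * w -> v * x = x * v.
Proof. exact: comm_inv. Qed.

Lemma uq_v0a : v0 * a = k (-1) * a * v0. Proof. exact: inv_comm (uq_w0v0 U) (uq_v0w0 U) (uq_w0a U). Qed.
Lemma uq_v0b : v0 * b = b * v0. Proof. exact: inv_comm0 (uq_w0v0 U) (uq_v0w0 U) (uq_w0b U). Qed.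
Lemma uq_v1a : v1 * a = a * v1. Proof. exact: inv_comm0 (uq_w1v1 U) (uq_v1w1 U) (uq_w1a U). Qed.
Lemma uq_v1b : v1 * b = k (-2) * b * v1. Proof. exact: inv_comm (uq_w1v1 U) (uq_v1w1 U) (uq_w1b U). Qed.
Lemma uq_v0f : v0 * f = k 1 * f * v0. Proof. exact: inv_comm (uq_w0v0 U) (uq_v0w0 U) (uq_w0f U). Qed.
Lemma uq_v0g : v0 * g = g * v0. Proof. exact: inv_comm0 (uq_w0v0 U) (uq_v0w0 U) (uq_w0g U). Qed.
Lemma uq_v1f : v1 * f = f * v1. Proof. exact: inv_comm0 (uq_w1v1 U) (uq_v1w1 U) (uq_w1f U). Qed.
Lemma uq_v1g : v1 * g = k 2 * g * v1. Proof. exact: inv_comm (uq_w1v1 U) (uq_v1w1 U) (uq_w1g U). Qed.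
Lemma uq_v0w1 : v0 * w1 = w1 * v0.
Proof. exact: inv_comm0 (uq_w0v0 U) (uq_v0w0 U) (esym (uq_w1w0 U)). Qed.
Lemma uq_v1w0 : v1 * w0 = w0 * v1. Proof. exact: inv_comm0 (uq_w1v1 U) (uq_v1w1 U) (uq_w1w0 U). Qed.
Lemma uq_v1v0 : v1 * v0 = v0 * v1.
Proof. exact: inv_comm0 (uq_w1v1 U) (uq_v1w1 U) (esym uq_v0w1). Qed.

Let weights x y z u w (i j : int) : IQ io q x y z u ->
  w * x = k i * x * w -> w * y = k j * y * w ->
  w * z = k (i + j) * z * w /\ w * u = k (i + i + j) * u * w.
Proof.
move=> I wx wy; rewrite !(qcD io q_prim).
split; first exact: (weight_y ioC l_odd l_gt1 q_prim I wx wy).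
exact: (weight_h ioC l_odd l_gt1 q_prim I wx wy).
Qed.
Let k0 x w : w * x = x * w -> w * x = k 0 * x * w. Proof. by rewrite (qc0 io) mul1r. Qed.

Lemma uq_w0yE : w0 * yE = k (1) * yE * w0. Proof. exact: (weights E (uq_w0a U) (k0 (uq_w0b U))).1. Qed.
Lemma uq_w0hE : w0 * hE = k (2) * hE * w0. Proof. exact: (weights E (uq_w0a U) (k0 (uq_w0b U))).2. Qed.
Lemma uq_v0yE : v0 * yE = k (-1) * yE * v0. Proof. exact: inv_comm (uq_w0v0 U) (uq_v0w0 U) uq_w0yE. Qed.
Lemma uq_v0hE : v0 * hE = k (-2) * hE * v0. Proof. exact: inv_comm (uq_w0v0 U) (uq_v0w0 U) uq_w0hE. Qed.
Lemma uq_w0yF : w0 * yF = k (-1) * yF * w0. Proof. exact: (weights F (uq_w0f U) (k0 (uq_w0g U))).1. Qed.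
Lemma uq_w0hF : w0 * hF = k (-2) * hF * w0. Proof. exact: (weights F (uq_w0f U) (k0 (uq_w0g U))).2. Qed.
Lemma uq_v0yF : v0 * yF = k (1) * yF * v0. Proof. exact: inv_comm (uq_w0v0 U) (uq_v0w0 U) uq_w0yF. Qed.
Lemma uq_v0hF : v0 * hF = k (2) * hF * v0. Proof. exact: inv_comm (uq_w0v0 U) (uq_v0w0 U) uq_w0hF. Qed.
Lemma uq_w1yE : w1 * yE = k (2) * yE * w1. Proof. exact: (weights E (k0 (uq_w1a U)) (uq_w1b U)).1. Qed.
Lemma uq_w1hE : w1 * hE = k (2) * hE * w1. Proof. exact: (weights E (k0 (uq_w1a U)) (uq_w1b U)).2. Qed.
Lemma uq_v1yE : v1 * yE = k (-2) * yE * v1. Proof. exact: inv_comm (uq_w1v1 U) (uq_v1w1 U) uq_w1yE. Qed.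
Lemma uq_v1hE : v1 * hE = k (-2) * hE * v1. Proof. exact: inv_comm (uq_w1v1 U) (uq_v1w1 U) uq_w1hE. Qed.
Lemma uq_w1yF : w1 * yF = k (-2) * yF * w1. Proof. exact: (weights F (k0 (uq_w1f U)) (uq_w1g U)).1. Qed.
Lemma uq_w1hF : w1 * hF = k (-2) * hF * w1. Proof. exact: (weights F (k0 (uq_w1f U)) (uq_w1g U)).2. Qed.
Lemma uq_v1yF : v1 * yF = k (2) * yF * v1. Proof. exact: inv_comm (uq_w1v1 U) (uq_v1w1 U) uq_w1yF. Qed.
Lemma uq_v1hF : v1 * hF = k (2) * hF * v1. Proof. exact: inv_comm (uq_w1v1 U) (uq_v1w1 U) uq_w1hF. Qed.

Ltac uqi := nc ioC q0 [:: a; b; yE; hE; f; g; yF; hF; w0; w1; v0; v1]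
  (tt, iq_fg E, iq_fy E, iq_fh E, iq_gy E, iq_yh E, iq_gh E,
   iq_fg F, iq_fy F, iq_fh F, iq_gy F, iq_yh F, iq_gh F).
Ltac uqx ex := nc ioC q0 [:: a; b; yE; hE; f; g; yF; hF; w0; w1; v0; v1]
  (ex, uq_af U, uq_bg U, uq_ag U, uq_bf U, uq_w0a U, uq_w0b U, uq_w1a U, uq_w1b U,
   uq_w0f U, uq_w0g U, uq_w1f U, uq_w1g U, uq_v0a, uq_v0b, uq_v1a, uq_v1b,
   uq_v0f, uq_v0g, uq_v1f, uq_v1g, uq_w0v0 U, uq_v0w0 U, uq_w1v1 U, uq_v1w1 U,
   uq_w1w0 U, uq_v0w1, uq_v1w0, uq_v1v0, uq_w0yE, uq_w0yF, uq_w0hE, uq_w0hF, uq_w1yE, uq_w1yF, uq_w1hE, uq_w1hF, uq_v0yE, uq_v0yF, uq_v0hE, uq_v0hF, uq_v1yE, uq_v1yF, uq_v1hE, uq_v1hF).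

Lemma uq_yEf : yE * f = f * yE - (k 1 - k (-1)) * b * v0 * v0 * w1.
Proof.
apply: (d1_reg l_odd l_gt1 q_prim).
transitivity ((a * b - k (-2) * b * a) * f); first by uqi.
transitivity (f * (a * b - k (-2) * b * a) - (k 2 - k (-2)) * ((k 1 - k (-1)) * b * v0 * v0 * w1)); last by uqi.
uqx tt.
Qed.
Lemma uq_yEg : yE * g = g * yE + (1 - k (-4)) * a * v0 * v0 * w1 * w1.
Proof.
apply: (d1_reg l_odd l_gt1 q_prim).
transitivity ((a * b - k (-2) * b * a) * g); first by uqi.
transitivity (g * (a * b - k (-2) * b * a) + (k 2 - k (-2)) * ((1 - k (-4)) * a * v0 * v0 * w1 * w1)); last by uqi.
uqx tt.
Qed.
Lemma uq_ayF : a * yF = yF * a + (k 1 - k (-1)) * g * w0 * w0 * v1.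
Proof.
apply: (d1_reg l_odd l_gt1 q_prim).
transitivity (a * (f * g - k (-2) * g * f)); first by uqi.
transitivity ((f * g - k (-2) * g * f) * a + (k 2 - k (-2)) * ((k 1 - k (-1)) * g * w0 * w0 * v1)); last by uqi.
uqx tt.
Qed.
Lemma uq_byF : b * yF = yF * b - (1 - k (-4)) * f * w0 * w0 * v1 * v1.
Proof.
apply: (d1_reg l_odd l_gt1 q_prim).
transitivity (b * (f * g - k (-2) * g * f)); first by uqi.
transitivity ((f * g - k (-2) * g * f) * b - (k 2 - k (-2)) * ((1 - k (-4)) * f * w0 * w0 * v1 * v1)); last by uqi.
uqx tt.
Qed.
Lemma uq_hEf : hE * f = f * hE - (k 2 - k (-2)) * yE * v0 * v0 * w1.
Proof.
apply: (d0_reg l_odd l_gt1 q_prim).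
transitivity ((a * yE - yE * a) * f); first by uqi.
transitivity (f * (a * yE - yE * a) - (k 1 - k (-1)) * ((k 2 - k (-2)) * yE * v0 * v0 * w1)); last by uqi.
uqx (tt, uq_yEf, iq_fg E).
Qed.
Lemma uq_hEg : hE * g = g * hE + k (-1) * (1 - k (-4)) * a * a * v0 * v0 * w1 * w1.
Proof.
apply: (d0_reg l_odd l_gt1 q_prim).
transitivity ((a * yE - yE * a) * g); first by uqi.
transitivity (g * (a * yE - yE * a) + (k 1 - k (-1)) * (k (-1) * (1 - k (-4)) * a * a * v0 * v0 * w1 * w1)); last by uqi.
uqx (tt, uq_yEg).
Qed.
Lemma uq_ahF : a * hF = hF * a + (k 2 - k (-2)) * yF * w0 * w0 * v1.
Proof.
apply: (d0_reg l_odd l_gt1 q_prim).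
transitivity (a * (f * yF - yF * f)); first by uqi.
transitivity ((f * yF - yF * f) * a + (k 1 - k (-1)) * ((k 2 - k (-2)) * yF * w0 * w0 * v1)); last by uqi.
uqx (tt, uq_ayF, iq_fg F).
Qed.
Lemma uq_bhF : b * hF = hF * b - k (-1) * (1 - k (-4)) * f * f * w0 * w0 * v1 * v1.
Proof.
apply: (d0_reg l_odd l_gt1 q_prim).
transitivity (b * (f * yF - yF * f)); first by uqi.
transitivity ((f * yF - yF * f) * b - (k 1 - k (-1)) * (k (-1) * (1 - k (-4)) * f * f * w0 * w0 * v1 * v1)); last by uqi.
uqx (tt, uq_byF).
Qed.
End Cross.

Section PowerCross.
Variables (C : fieldType) (B : nzRingType) (io : {rmorphism C -> B}).
Hypothesis ioC : forall c x, io c * x = x * io c.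
Variables (q : C) (l : nat).
Hypotheses (l_odd : odd l) (l_gt1 : (1 < l)%N) (q_prim : l.-primitive_root q).
Local Notation k := (qc io q).
Let q0 : q != 0 := prim_neq0 q_prim.
Variables (a b yE hE f g yF hF w0 w1 v0 v1 : B).
Hypothesis U : UQ io q a b yE hE f g yF hF w0 w1 v0 v1.

Let kS c n (p : nat) : k (c * (n + p)%N%:Z) = k (c * p%:Z) * k (c * n%:Z).
Proof. by rewrite -(qcD io q_prim) PoszD mulrDr addrC. Qed.

Ltac powx ex at_ := nc ioC q0 at_ (ex, uq_af U, uq_bg U, uq_ag U, uq_bf U, uq_w0a U, uq_w0b U, uq_w1a U, uq_w1b U,
   uq_w0f U, uq_w0g U, uq_w1f U, uq_w1g U, uq_w0v0 U, uq_v0w0 U, uq_w1v1 U, uq_v1w1 U,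
   uq_w1w0 U, (uq_v0w1 U), (uq_v1w0 U), (uq_v1v0 U), (uq_v0a ioC q_prim U), (uq_v0b U), (uq_v0f ioC q_prim U), (uq_v0g U), (uq_v1a U), (uq_v1b ioC q_prim U), (uq_v1f U), (uq_v1g ioC q_prim U), (uq_w0yE ioC l_odd l_gt1 q_prim U), (uq_w0yF ioC l_odd l_gt1 q_prim U), (uq_w0hE ioC l_odd l_gt1 q_prim U), (uq_w0hF ioC l_odd l_gt1 q_prim U), (uq_w1yE ioC l_odd l_gt1 q_prim U), (uq_w1yF ioC l_odd l_gt1 q_prim U), (uq_w1hE ioC l_odd l_gt1 q_prim U), (uq_w1hF ioC l_odd l_gt1 q_prim U), (uq_v0yE ioC l_odd l_gt1 q_prim U), (uq_v0yF ioC l_odd l_gt1 q_prim U), (uq_v0hE ioC l_odd l_gt1 q_prim U), (uq_v0hF ioC l_odd l_gt1 q_prim U), (uq_v1yE ioC l_odd l_gt1 q_prim U), (uq_v1yF ioC l_odd l_gt1 q_prim U), (uq_v1hE ioC l_odd l_gt1 q_prim U), (uq_v1hF ioC l_odd l_gt1 q_prim U)).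
(** Applied with [m = l - 1] and [m = l - 2], where it moves [a] past [Z 1] and [Z 2]. The
    coefficient of [f ^+ m.-1] vanishes at [m = 0]. *)
Lemma uq_a_fX m : a * f ^+ m = f ^+ m * a + f ^+ m.-1 * (k 1 * (1 - k (- 2 * m%:Z)) * w0 * w0 * v1 - k (-1) * (k (2 * m%:Z) - 1) * v0 * v0 * w1).
Proof.
case: m => [|m] /=; first by rewrite !expr0; powx tt [:: a; b; yE; hE; f; g; yF; hF; w0; w1; v0; v1].
elim: m => [|m IH].
  by rewrite !expr0 !expr1; powx tt [:: a; b; yE; hE; f; g; yF; hF; w0; w1; v0; v1].
rewrite -[in LHS](addn1 m.+1) [in LHS]exprD expr1 mulrA IH -[m.+2]addn2 -[m.+1]addn1 !kS !exprD.
have := qc_comm ioC q (2 * m%:Z); have := qc_comm ioC q (- 2 * m%:Z).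
move: (k (2 * m%:Z)) (k (- 2 * m%:Z)) => V V' V'c Vc.
have fW : f ^+ m * f = f * f ^+ m by rewrite -exprSr exprS.
rewrite !exprS expr0 !mulr1; move: (f ^+ m) fW => W fW.
powx (tt, tt, fW, esym (V'c V), esym (Vc a), esym (V'c a), esym (Vc b), esym (V'c b), esym (Vc yE), esym (V'c yE), esym (Vc hE), esym (V'c hE), esym (Vc f), esym (V'c f), esym (Vc g), esym (V'c g), esym (Vc w0), esym (V'c w0), esym (Vc w1), esym (V'c w1), esym (Vc v0), esym (V'c v0), esym (Vc v1), esym (V'c v1), esym (Vc W), esym (V'c W)) ([:: a; b; yE; hE; f; g; yF; hF; w0; w1; v0; v1; W; V; V']).
Qed.
Lemma uq_yE_fX m : yE * f ^+ m = f ^+ m * yE - k (-1) * (k (2 * m%:Z) - 1) * f ^+ m.-1 * b * v0 * v0 * w1.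
Proof.
case: m => [|m] /=; first by rewrite !expr0; powx tt [:: a; b; yE; hE; f; g; yF; hF; w0; w1; v0; v1].
elim: m => [|m IH].
  by rewrite !expr0 !expr1; powx (tt, (uq_yEf ioC l_odd l_gt1 q_prim U)) [:: a; b; yE; hE; f; g; yF; hF; w0; w1; v0; v1].
rewrite -[in LHS](addn1 m.+1) [in LHS]exprD expr1 mulrA IH -[m.+2]addn2 -[m.+1]addn1 !kS !exprD.
have := qc_comm ioC q (2 * m%:Z); have := qc_comm ioC q (- 2 * m%:Z).
move: (k (2 * m%:Z)) (k (- 2 * m%:Z)) => V V' V'c Vc.
have fW : f ^+ m * f = f * f ^+ m by rewrite -exprSr exprS.
rewrite !exprS expr0 !mulr1; move: (f ^+ m) fW => W fW.
powx (tt, (uq_yEf ioC l_odd l_gt1 q_prim U), fW, esym (V'c V), esym (Vc a), esym (V'c a), esym (Vc b), esym (V'c b), esym (Vc yE), esym (V'c yE), esym (Vc hE), esym (V'c hE), esym (Vc f), esym (V'c f), esym (Vc g), esym (V'c g), esym (Vc w0), esym (V'c w0), esym (Vc w1), esym (V'c w1), esym (Vc v0), esym (V'c v0), esym (Vc v1), esym (V'c v1), esym (Vc W), esym (V'c W)) ([:: a; b; yE; hE; f; g; yF; hF; w0; w1; v0; v1; W; V; V']).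
Qed.
Lemma uq_hE_fX m : hE * f ^+ m = f ^+ m * hE - (1 + k (-2)) * (k (2 * m%:Z) - 1) * f ^+ m.-1 * yE * v0 * v0 * w1 + k (-3) * (k (2 * m%:Z) - 1) * (k (2 * m%:Z) - k 2) * f ^+ m.-2 * b * v0 * v0 * w1 * v0 * v0 * w1.
Proof.
case: m => [|[|m]] /=; first by rewrite !expr0; powx tt [:: a; b; yE; hE; f; g; yF; hF; w0; w1; v0; v1].
  by rewrite !expr0 !expr1; powx (tt, (uq_yEf ioC l_odd l_gt1 q_prim U), (uq_hEf ioC l_odd l_gt1 q_prim U)) [:: a; b; yE; hE; f; g; yF; hF; w0; w1; v0; v1].
elim: m => [|m IH].
  by rewrite !exprS expr0 !mulr1; powx (tt, (uq_yEf ioC l_odd l_gt1 q_prim U), (uq_hEf ioC l_odd l_gt1 q_prim U)) [:: a; b; yE; hE; f; g; yF; hF; w0; w1; v0; v1].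
rewrite -[in LHS](addn1 m.+2) [in LHS]exprD expr1 mulrA IH -[m.+3]addn3 -[m.+2]addn2 -[m.+1]addn1 !kS !exprD.
have := qc_comm ioC q (2 * m%:Z); have := qc_comm ioC q (- 2 * m%:Z).
move: (k (2 * m%:Z)) (k (- 2 * m%:Z)) => V V' V'c Vc.
have fW : f ^+ m * f = f * f ^+ m by rewrite -exprSr exprS.
rewrite !exprS expr0 !mulr1; move: (f ^+ m) fW => W fW.
powx (tt, (tt, (uq_yEf ioC l_odd l_gt1 q_prim U), (uq_hEf ioC l_odd l_gt1 q_prim U)), fW, esym (V'c V), esym (Vc a), esym (V'c a), esym (Vc b), esym (V'c b), esym (Vc yE), esym (V'c yE), esym (Vc hE), esym (V'c hE), esym (Vc f), esym (V'c f), esym (Vc g), esym (V'c g), esym (Vc w0), esym (V'c w0), esym (Vc w1), esym (V'c w1), esym (Vc v0), esym (V'c v0), esym (Vc v1), esym (V'c v1), esym (Vc W), esym (V'c W)) ([:: a; b; yE; hE; f; g; yF; hF; w0; w1; v0; v1; W; V; V']).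
Qed.
Lemma uq_b_gX m : b * g ^+ m = g ^+ m * b + g ^+ m.-1 * (k 2 * (1 - k (-4 * m%:Z)) * v0 * v0 * w1 * w1 - k (-2) * (k (4 * m%:Z) - 1) * w0 * w0 * v1 * v1).
Proof.
case: m => [|m] /=; first by rewrite !expr0; powx tt [:: a; b; yE; hE; f; g; yF; hF; w0; w1; v0; v1].
elim: m => [|m IH].
  by rewrite !expr0 !expr1; powx tt [:: a; b; yE; hE; f; g; yF; hF; w0; w1; v0; v1].
rewrite -[in LHS](addn1 m.+1) [in LHS]exprD expr1 mulrA IH -[m.+2]addn2 -[m.+1]addn1 !kS !exprD.
have := qc_comm ioC q (4 * m%:Z); have := qc_comm ioC q (-4 * m%:Z).
move: (k (4 * m%:Z)) (k (-4 * m%:Z)) => V V' V'c Vc.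
have fW : g ^+ m * g = g * g ^+ m by rewrite -exprSr exprS.
rewrite !exprS expr0 !mulr1; move: (g ^+ m) fW => W fW.
powx (tt, tt, fW, esym (V'c V), esym (Vc a), esym (V'c a), esym (Vc b), esym (V'c b), esym (Vc yE), esym (V'c yE), esym (Vc hE), esym (V'c hE), esym (Vc f), esym (V'c f), esym (Vc g), esym (V'c g), esym (Vc w0), esym (V'c w0), esym (Vc w1), esym (V'c w1), esym (Vc v0), esym (V'c v0), esym (Vc v1), esym (V'c v1), esym (Vc W), esym (V'c W)) ([:: a; b; yE; hE; f; g; yF; hF; w0; w1; v0; v1; W; V; V']).
Qed.
Lemma uq_yE_gX m : yE * g ^+ m = g ^+ m * yE + (1 - k (-4 * m%:Z)) * g ^+ m.-1 * a * v0 * v0 * w1 * w1.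
Proof.
case: m => [|m] /=; first by rewrite !expr0; powx tt [:: a; b; yE; hE; f; g; yF; hF; w0; w1; v0; v1].
elim: m => [|m IH].
  by rewrite !expr0 !expr1; powx (tt, (uq_yEg ioC l_odd l_gt1 q_prim U)) [:: a; b; yE; hE; f; g; yF; hF; w0; w1; v0; v1].
rewrite -[in LHS](addn1 m.+1) [in LHS]exprD expr1 mulrA IH -[m.+2]addn2 -[m.+1]addn1 !kS !exprD.
have := qc_comm ioC q (4 * m%:Z); have := qc_comm ioC q (-4 * m%:Z).
move: (k (4 * m%:Z)) (k (-4 * m%:Z)) => V V' V'c Vc.
have fW : g ^+ m * g = g * g ^+ m by rewrite -exprSr exprS.
rewrite !exprS expr0 !mulr1; move: (g ^+ m) fW => W fW.
powx (tt, (uq_yEg ioC l_odd l_gt1 q_prim U), fW, esym (V'c V), esym (Vc a), esym (V'c a), esym (Vc b), esym (V'c b), esym (Vc yE), esym (V'c yE), esym (Vc hE), esym (V'c hE), esym (Vc f), esym (V'c f), esym (Vc g), esym (V'c g), esym (Vc w0), esym (V'c w0), esym (Vc w1), esym (V'c w1), esym (Vc v0), esym (V'c v0), esym (Vc v1), esym (V'c v1), esym (Vc W), esym (V'c W)) ([:: a; b; yE; hE; f; g; yF; hF; w0; w1; v0; v1; W; V; V']).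
Qed.
Lemma uq_hE_gX m : hE * g ^+ m = g ^+ m * hE + k (-1) * (1 - k (-4 * m%:Z)) * g ^+ m.-1 * a * a * v0 * v0 * w1 * w1.
Proof.
case: m => [|m] /=; first by rewrite !expr0; powx tt [:: a; b; yE; hE; f; g; yF; hF; w0; w1; v0; v1].
elim: m => [|m IH].
  by rewrite !expr0 !expr1; powx (tt, (uq_hEg ioC l_odd l_gt1 q_prim U)) [:: a; b; yE; hE; f; g; yF; hF; w0; w1; v0; v1].
rewrite -[in LHS](addn1 m.+1) [in LHS]exprD expr1 mulrA IH -[m.+2]addn2 -[m.+1]addn1 !kS !exprD.
have := qc_comm ioC q (4 * m%:Z); have := qc_comm ioC q (-4 * m%:Z).
move: (k (4 * m%:Z)) (k (-4 * m%:Z)) => V V' V'c Vc.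
have fW : g ^+ m * g = g * g ^+ m by rewrite -exprSr exprS.
rewrite !exprS expr0 !mulr1; move: (g ^+ m) fW => W fW.
powx (tt, (uq_hEg ioC l_odd l_gt1 q_prim U), fW, esym (V'c V), esym (Vc a), esym (V'c a), esym (Vc b), esym (V'c b), esym (Vc yE), esym (V'c yE), esym (Vc hE), esym (V'c hE), esym (Vc f), esym (V'c f), esym (Vc g), esym (V'c g), esym (Vc w0), esym (V'c w0), esym (Vc w1), esym (V'c w1), esym (Vc v0), esym (V'c v0), esym (Vc v1), esym (V'c v1), esym (Vc W), esym (V'c W)) ([:: a; b; yE; hE; f; g; yF; hF; w0; w1; v0; v1; W; V; V']).
Qed.
End PowerCross.

Section Flows.
Variables (C : fieldType) (B : nzRingType) (io : {rmorphism C -> B}).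
Hypothesis ioC : forall c x, io c * x = x * io c.
Variables (q : C) (l : nat).
Hypotheses (l_odd : odd l) (l_gt1 : (1 < l)%N) (q_prim : l.-primitive_root q).
Local Notation k := (qc io q).
Let q0 : q != 0 := prim_neq0 q_prim.
Variables (a b yE hE f g yF hF w0 w1 v0 v1 : B).
Hypothesis U : UQ io q a b yE hE f g yF hF w0 w1 v0 v1.

Lemma l_gt2 : (2 < l)%N. Proof. by move: l_odd l_gt1; case: l => [|[|[|n]]]. Qed.

Let kl c i : (i <= l)%N -> k (c * (l - i)%N%:Z) = k (- c * i%:Z).
Proof. by move=> il; rewrite -subzn // mulrBr (qcD io q_prim) (qcl io q_prim) mul1r mulNr. Qed.

Variables (t lam : C).
Hypothesis lam0 : lam != 0.
Local Notation L := (io lam).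
Local Notation L' := (io lam^-1).
Let LL : L * L' = 1. Proof. by rewrite -rmorphM divff // rmorph1. Qed.
Let L'L : L' * L = 1. Proof. by rewrite ioC LL. Qed.
Let T := io t.

(** Monomials in the group-like elements with the weights that [short_flow] and [long_flow] ask of
    [tf] and [tg]. *)
Lemma uq_torus_rel : [/\ v0 * v0 * w1 * f = k 2 * f * (v0 * v0 * w1),
   v0 * v0 * w1 * g = k (-2) * g * (v0 * v0 * w1),
   w0 * w0 * v1 * v1 * f = k (-2) * f * (w0 * w0 * v1 * v1),
   w0 * w0 * v1 * v1 * g = k 4 * g * (w0 * w0 * v1 * v1) &
   v0 * v0 * w1 * (w0 * w0 * v1 * v1) = w0 * w0 * v1 * v1 * (v0 * v0 * w1)].
Proof.
by split; nc ioC q0 [:: f; g; w0; w1; v0; v1] (tt, uq_w0f U, uq_w0g U, uq_w1f U, uq_w1g U,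
  uq_v0f ioC q_prim U, uq_v0g U, uq_v1f U, uq_v1g ioC q_prim U, uq_w0v0 U, uq_v0w0 U,
  uq_w1v1 U, uq_v1w1 U, uq_w1w0 U, esym (uq_v0w1 U), uq_v1w0 U, uq_v1v0 U).
Qed.

Lemma uq_torus_inv : [/\ v0 * v0 * w1 * (w0 * w0 * v1) = 1, w0 * w0 * v1 * (v0 * v0 * w1) = 1,
   w0 * w0 * v1 * v1 * (v0 * v0 * w1 * w1) = 1 & v0 * v0 * w1 * w1 * (w0 * w0 * v1 * v1) = 1].
Proof.
by split; nc ioC q0 [:: w0; w1; v0; v1] (tt, uq_w0v0 U, uq_v0w0 U,
  uq_w1v1 U, uq_v1w1 U, uq_w1w0 U, esym (uq_v0w1 U), uq_v1w0 U, uq_v1v0 U).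
Qed.

Lemma uq_short_flow s : eqs_hold (short_eqs io q l s f g yF hF).
Proof.
have [h1 h2 h3 h4 h5] := uq_torus_rel; have [i1 i2 i3 i4] := uq_torus_inv.
exact: (short_flow ioC l_odd l_gt1 q_prim (uq_F U) h1 h2 h3 h4 h5 i1 i2 i3 i4).
Qed.

Lemma uq_long_flow s : eqs_hold (long_eqs io q l s f g yF hF).
Proof.
have [h1 h2 h3 h4 h5] := uq_torus_rel; have [i1 i2 i3 i4] := uq_torus_inv.
exact: (long_flow ioC l_odd l_gt1 q_prim (uq_F U) h1 h2 h3 h4 h5 i1 i2 i3 i4).
Qed.

Section Flow0.
Local Notation Z := (fZ io l t f).
Hypothesis lamf : L * L = fL io l t f.
Let Z1g : Z 1 * g = k 2 * g * Z 1 + (k 2 + 1) * (1 - k 2) * yF * Z 2 + k (-1) * k (-2) * (1 - k 2) * (1 - k 4) * hF * Z 3.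
Proof.
rewrite /fZ; have := iq_pow_fg ioC q_prim (uq_F U) (l - 1)%N.
rewrite !kl ?(ltnW l_gt2, ltnW (ltnW l_gt2)) // -!subnS => E.
have TC x := esym (ioC t x).
nc ioC q0 [:: a; b; yE; hE; f; g; yF; hF; w0; w1; v0; v1; io t; f ^+ (l - 1); f ^+ (l - 2); f ^+ (l - 3); f ^+ (l - 4)] (tt, E, TC a, TC b, TC yE, TC hE, TC f, TC g, TC yF, TC hF, TC w0, TC w1, TC v0, TC v1, TC (f ^+ (l - 1)), TC (f ^+ (l - 2)), TC (f ^+ (l - 3)), TC (f ^+ (l - 4))).
Qed.
Let Z1y : Z 1 * yF = yF * Z 1 + k (-1) * (k (-2) - 1) * hF * Z 2.
Proof.
rewrite /fZ; have := iq_pow_fy ioC q_prim (uq_F U) (l - 1)%N.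
rewrite !kl ?(ltnW l_gt2, ltnW (ltnW l_gt2)) // -!subnS => E.
have TC x := esym (ioC t x).
nc ioC q0 [:: a; b; yE; hE; f; g; yF; hF; w0; w1; v0; v1; io t; f ^+ (l - 1); f ^+ (l - 2); f ^+ (l - 3); f ^+ (l - 4)] (tt, E, TC a, TC b, TC yE, TC hE, TC f, TC g, TC yF, TC hF, TC w0, TC w1, TC v0, TC v1, TC (f ^+ (l - 1)), TC (f ^+ (l - 2)), TC (f ^+ (l - 3)), TC (f ^+ (l - 4))).
Qed.
Let aZ1 : a * Z 1 = Z 1 * a + Z 2 * (k 1 * (1 - k 2) * w0 * w0 * v1 - k (-1) * (k (-2) - 1) * v0 * v0 * w1).
Proof.
rewrite /fZ; have := uq_a_fX ioC l_odd l_gt1 q_prim U (l - 1)%N.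
rewrite !kl ?(ltnW l_gt2, ltnW (ltnW l_gt2)) // -!subnS => E.
have TC x := esym (ioC t x).
nc ioC q0 [:: a; b; yE; hE; f; g; yF; hF; w0; w1; v0; v1; io t; f ^+ (l - 1); f ^+ (l - 2); f ^+ (l - 3); f ^+ (l - 4)] (tt, E, TC a, TC b, TC yE, TC hE, TC f, TC g, TC yF, TC hF, TC w0, TC w1, TC v0, TC v1, TC (f ^+ (l - 1)), TC (f ^+ (l - 2)), TC (f ^+ (l - 3)), TC (f ^+ (l - 4))).
Qed.
Let aZ2 : a * Z 2 = Z 2 * a + Z 3 * (k 1 * (1 - k 4) * w0 * w0 * v1 - k (-1) * (k (-4) - 1) * v0 * v0 * w1).
Proof.
rewrite /fZ; have := uq_a_fX ioC l_odd l_gt1 q_prim U (l - 2)%N.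
rewrite !kl ?(ltnW l_gt2, ltnW (ltnW l_gt2)) // -!subnS => E.
have TC x := esym (ioC t x).
nc ioC q0 [:: a; b; yE; hE; f; g; yF; hF; w0; w1; v0; v1; io t; f ^+ (l - 1); f ^+ (l - 2); f ^+ (l - 3); f ^+ (l - 4)] (tt, E, TC a, TC b, TC yE, TC hE, TC f, TC g, TC yF, TC hF, TC w0, TC w1, TC v0, TC v1, TC (f ^+ (l - 1)), TC (f ^+ (l - 2)), TC (f ^+ (l - 3)), TC (f ^+ (l - 4))).
Qed.
Let yZ1 : yE * Z 1 = Z 1 * yE - k (-1) * (k (-2) - 1) * Z 2 * b * v0 * v0 * w1.
Proof.
rewrite /fZ; have := uq_yE_fX ioC l_odd l_gt1 q_prim U (l - 1)%N.
rewrite !kl ?(ltnW l_gt2, ltnW (ltnW l_gt2)) // -!subnS => E.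
have TC x := esym (ioC t x).
nc ioC q0 [:: a; b; yE; hE; f; g; yF; hF; w0; w1; v0; v1; io t; f ^+ (l - 1); f ^+ (l - 2); f ^+ (l - 3); f ^+ (l - 4)] (tt, E, TC a, TC b, TC yE, TC hE, TC f, TC g, TC yF, TC hF, TC w0, TC w1, TC v0, TC v1, TC (f ^+ (l - 1)), TC (f ^+ (l - 2)), TC (f ^+ (l - 3)), TC (f ^+ (l - 4))).
Qed.
Let yZ2 : yE * Z 2 = Z 2 * yE - k (-1) * (k (-4) - 1) * Z 3 * b * v0 * v0 * w1.
Proof.
rewrite /fZ; have := uq_yE_fX ioC l_odd l_gt1 q_prim U (l - 2)%N.
rewrite !kl ?(ltnW l_gt2, ltnW (ltnW l_gt2)) // -!subnS => E.
have TC x := esym (ioC t x).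
nc ioC q0 [:: a; b; yE; hE; f; g; yF; hF; w0; w1; v0; v1; io t; f ^+ (l - 1); f ^+ (l - 2); f ^+ (l - 3); f ^+ (l - 4)] (tt, E, TC a, TC b, TC yE, TC hE, TC f, TC g, TC yF, TC hF, TC w0, TC w1, TC v0, TC v1, TC (f ^+ (l - 1)), TC (f ^+ (l - 2)), TC (f ^+ (l - 3)), TC (f ^+ (l - 4))).
Qed.
Let hZ1 : hE * Z 1 = Z 1 * hE - (1 + k (-2)) * (k (-2) - 1) * Z 2 * yE * v0 * v0 * w1 + k (-3) * (k (-2) - 1) * (k (-2) - k 2) * Z 3 * b * v0 * v0 * w1 * v0 * v0 * w1.
Proof.
rewrite /fZ; have := uq_hE_fX ioC l_odd l_gt1 q_prim U (l - 1)%N.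
rewrite !kl ?(ltnW l_gt2, ltnW (ltnW l_gt2)) // -!subnS => E.
have TC x := esym (ioC t x).
nc ioC q0 [:: a; b; yE; hE; f; g; yF; hF; w0; w1; v0; v1; io t; f ^+ (l - 1); f ^+ (l - 2); f ^+ (l - 3); f ^+ (l - 4)] (tt, E, TC a, TC b, TC yE, TC hE, TC f, TC g, TC yF, TC hF, TC w0, TC w1, TC v0, TC v1, TC (f ^+ (l - 1)), TC (f ^+ (l - 2)), TC (f ^+ (l - 3)), TC (f ^+ (l - 4))).
Qed.

Let ZX (w x : B) i c : w * x = k c * x * w -> (i <= l)%N ->
  w * fZ io l t x i = k (- c * i%:Z) * fZ io l t x i * w.
Proof.
move=> wx il; rewrite /fZ mulrA -ioC -mulrA (comm_k_pow ioC q_prim wx) kl //.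
by rewrite !mulrA ioC.
Qed.
Let w0Z1 : w0 * Z 1 = k (1) * Z 1 * w0.
Proof. by rewrite (ZX (uq_w0f U)) ?(l_gt2, ltnW l_gt2, ltnW (ltnW l_gt2)) //. Qed.
Let w0Z2 : w0 * Z 2 = k (2) * Z 2 * w0.
Proof. by rewrite (ZX (uq_w0f U)) ?(l_gt2, ltnW l_gt2, ltnW (ltnW l_gt2)) //. Qed.
Let w0Z3 : w0 * Z 3 = k (3) * Z 3 * w0.
Proof. by rewrite (ZX (uq_w0f U)) ?(l_gt2, ltnW l_gt2, ltnW (ltnW l_gt2)) //. Qed.
Let v0Z1 : v0 * Z 1 = k (-1) * Z 1 * v0.
Proof. by rewrite (ZX (uq_v0f ioC q_prim U)) ?(l_gt2, ltnW l_gt2, ltnW (ltnW l_gt2)) //. Qed.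
Let v0Z2 : v0 * Z 2 = k (-2) * Z 2 * v0.
Proof. by rewrite (ZX (uq_v0f ioC q_prim U)) ?(l_gt2, ltnW l_gt2, ltnW (ltnW l_gt2)) //. Qed.
Let v0Z3 : v0 * Z 3 = k (-3) * Z 3 * v0.
Proof. by rewrite (ZX (uq_v0f ioC q_prim U)) ?(l_gt2, ltnW l_gt2, ltnW (ltnW l_gt2)) //. Qed.
Let ZX0 (w x : B) i : w * x = x * w -> w * fZ io l t x i = fZ io l t x i * w.
Proof. by move=> wx; rewrite /fZ mulrA -ioC -!mulrA; congr (_ * _); apply: commrX. Qed.
Let w1Z1 : w1 * Z 1 = Z 1 * w1. Proof. exact: ZX0 (uq_w1f U). Qed.
Let w1Z2 : w1 * Z 2 = Z 2 * w1. Proof. exact: ZX0 (uq_w1f U). Qed.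
Let w1Z3 : w1 * Z 3 = Z 3 * w1. Proof. exact: ZX0 (uq_w1f U). Qed.
Let v1Z1 : v1 * Z 1 = Z 1 * v1. Proof. exact: ZX0 (uq_v1f U). Qed.
Let v1Z2 : v1 * Z 2 = Z 2 * v1. Proof. exact: ZX0 (uq_v1f U). Qed.
Let v1Z3 : v1 * Z 3 = Z 3 * v1. Proof. exact: ZX0 (uq_v1f U). Qed.
Let bZ1 : b * Z 1 = Z 1 * b. Proof. exact: ZX0 (uq_bf U). Qed.
Let bZ2 : b * Z 2 = Z 2 * b. Proof. exact: ZX0 (uq_bf U). Qed.
Let bZ3 : b * Z 3 = Z 3 * b. Proof. exact: ZX0 (uq_bf U). Qed.
Let Z1h : Z 1 * hF = k (-2) * hF * Z 1.
Proof.
have hf : hF * f = k (-2) * f * hF by nc ioC q0 [:: f; hF] (tt, iq_fh (uq_F U)).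
have E : hF * Z 1 = k 2 * Z 1 * hF by rewrite (ZX hf) // ltnW.
by nc ioC q0 [:: hF; Z 1] (tt, E).
Qed.
Let fZ1 : f * Z 1 = L * L - 1.
Proof. by rewrite (ZX0 1 (erefl (f * f))) (fZ1_mul io l_gt1) lamf. Qed.
Let Z1f : Z 1 * f = L * L - 1. Proof. by rewrite (fZ1_mul io l_gt1) lamf. Qed.
Let Z2f : Z 2 * f = Z 1. Proof. exact: fZ2_mul. Qed.
Let fZ2 : f * Z 2 = Z 1. Proof. by rewrite (ZX0 2 (erefl (f * f))) fZ2_mul. Qed.
Let fZ3 : f * Z 3 = Z 2.
Proof. by rewrite /fZ mulrA -ioC -mulrA -exprS subnSK // l_gt2. Qed.
Let ZZ i j : (i + j <= l)%N -> Z i * Z j = (L * L - 1) * Z (i + j).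
Proof.
move=> ij; rewrite lamf /fL addrC addKr /fZ.
rewrite mulrA -[io t * f ^+ (l - i) * io t]mulrA -ioC -!mulrA -!exprD; congr (_ * _).
rewrite [RHS]mulrA -ioC -mulrA -exprD; congr (_ * (_ ^+ _)).
by lia.
Qed.
Let ZZ11 : Z 1 * Z 1 = (L * L - 1) * Z 2.
Proof. by rewrite ZZ ?(l_gt2, ltnW l_gt2, ltnW (ltnW l_gt2)). Qed.
Let ZZ12 : Z 1 * Z 2 = (L * L - 1) * Z 3.
Proof. by rewrite ZZ ?(l_gt2, ltnW l_gt2, ltnW (ltnW l_gt2)). Qed.
Let ZZ21 : Z 2 * Z 1 = (L * L - 1) * Z 3.
Proof. by rewrite ZZ ?(l_gt2, ltnW l_gt2, ltnW (ltnW l_gt2)). Qed.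

(** Closed form of the exponential of the derivation given by the commutator with [f ^+ l], divided
    by its zero at the root of unity. Time is reparametrized by [L ^ 2 = 1 + t f ^+ l], which keeps
    all formulas polynomial in [t], [L] and [L^-1]. *)
Definition flow0_a := a + (k 1 * L' * L' * v0 * v0 * w1 - k (-1) * w0 * w0 * v1) * Z 1.
Definition flow0_g := L' * L' * (g + (k 2 + 1) * yF * Z 1 + (L * L - k 2) * k (-1) * hF * Z 2).
Definition flow0_yF := yF + k (-1) * hF * Z 1.
Definition flow0_hF := L * L * hF.
Definition flow0_yE := yE + k 1 * L' * L' * b * v0 * v0 * w1 * Z 1.
Definition flow0_hE := hE + (k 2 + 1) * L' * L' * yE * v0 * v0 * w1 * Z 1
  - (L' * L' - k (-2)) * k 1 * L' * L' * b * v0 * v0 * w1 * Z 2 * v0 * v0 * w1.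
Ltac ncf := rewrite /flow0_a /flow0_g /flow0_yF /flow0_hF /flow0_yE /flow0_hE;
 nc ioC q0 [:: a; b; yE; hE; f; g; yF; hF; w0; w1; v0; v1; Z 1; Z 2; Z 3; L; L'] (tt, LL, L'L, ioC lam a, ioC lam^-1 a, ioC lam b, ioC lam^-1 b, ioC lam yE, ioC lam^-1 yE, ioC lam hE, ioC lam^-1 hE, ioC lam f, ioC lam^-1 f, ioC lam g, ioC lam^-1 g, ioC lam yF, ioC lam^-1 yF, ioC lam hF, ioC lam^-1 hF, ioC lam w0, ioC lam^-1 w0, ioC lam w1, ioC lam^-1 w1, ioC lam v0, ioC lam^-1 v0, ioC lam v1, ioC lam^-1 v1, ioC lam (Z 1), ioC lam^-1 (Z 1), ioC lam (Z 2), ioC lam^-1 (Z 2), ioC lam (Z 3), ioC lam^-1 (Z 3), ioC lam L',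
 iq_fg (uq_E U), iq_fy (uq_E U), iq_fh (uq_E U), iq_gy (uq_E U), iq_yh (uq_E U), iq_gh (uq_E U), iq_fg (uq_F U), iq_fy (uq_F U), iq_fh (uq_F U), iq_gy (uq_F U), iq_yh (uq_F U), iq_gh (uq_F U),
 (uq_yEf ioC l_odd l_gt1 q_prim U), (uq_yEg ioC l_odd l_gt1 q_prim U), (uq_hEf ioC l_odd l_gt1 q_prim U), (uq_hEg ioC l_odd l_gt1 q_prim U), (uq_ayF ioC l_odd l_gt1 q_prim U), (uq_byF ioC l_odd l_gt1 q_prim U), (uq_ahF ioC l_odd l_gt1 q_prim U), (uq_bhF ioC l_odd l_gt1 q_prim U),
 fZ1, Z1f, Z2f, fZ2, fZ3, ZZ11, ZZ12, ZZ21, Z1h, Z1g, Z1y, aZ1, aZ2, yZ1, yZ2, hZ1, w0Z1, w0Z2, w0Z3, v0Z1, v0Z2, v0Z3, w1Z1, w1Z2, w1Z3, v1Z1, v1Z2, v1Z3, bZ1, bZ2, bZ3, uq_af U, uq_bg U, uq_ag U, uq_bf U, uq_w0a U, uq_w0b U, uq_w1a U, uq_w1b U, uq_w0f U, uq_w0g U, uq_w1f U, uq_w1g U, uq_w0v0 U, uq_v0w0 U, uq_w1v1 U, uq_v1w1 U, uq_w1w0 U, esym (uq_v0w1 U), (uq_v1w0 U), (uq_v1v0 U), (uq_v0a ioC q_prim U), (uq_v0b U), (uq_v0f ioC q_prim U), (uq_v0g U), (uq_v1a U), (uq_v1b ioC q_prim U), (uq_v1f U), (uq_v1g ioC q_prim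 U), (uq_w0yE ioC l_odd l_gt1 q_prim U), (uq_w0yF ioC l_odd l_gt1 q_prim U), (uq_w0hE ioC l_odd l_gt1 q_prim U), (uq_w0hF ioC l_odd l_gt1 q_prim U), (uq_w1yE ioC l_odd l_gt1 q_prim U), (uq_w1yF ioC l_odd l_gt1 q_prim U), (uq_w1hE ioC l_odd l_gt1 q_prim U), (uq_w1hF ioC l_odd l_gt1 q_prim U), (uq_v0yE ioC l_odd l_gt1 q_prim U), (uq_v0yF ioC l_odd l_gt1 q_prim U), (uq_v0hE ioC l_odd l_gt1 q_prim U), (uq_v0hF ioC l_odd l_gt1 q_prim U), (uq_v1yE ioC l_odd l_gt1 q_prim U), (uq_v1yF ioC l_odd l_gt1 q_prim U), (uq_v1hE ioC l_odd l_gt1 q_prim U), (uq_v1hF ioC l_odd l_gt1 q_prim U)).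

Lemma flow0_E : IQ io q flow0_a b flow0_yE flow0_hE.
Proof. by split; ncf. Qed.
Lemma flow0_F : IQ io q f flow0_g flow0_yF flow0_hF.
Proof.
have [/= e1 [/= e2 [/= e4 [/= e5 [/= e6 _]]]]] := uq_short_flow t.
have gE : flow0_g = L' * L' * short_g io q l t f g yF hF.
  by rewrite /flow0_g /short_g /shortg -lamf.
change (short_y io q l t f yF hF) with flow0_yF in e1, e2, e4, e5, e6.
rewrite -lamf in e1 e2 e4 e5 e6.
rewrite gE /flow0_hF; move: (short_g _ _ _ _ _ _ _ _) flow0_yF e1 e2 e4 e5 e6 => sg sy.
move=> e1 e2 e4 e5 e6.
split; nc ioC q0 [:: f; sg; sy; hF; L; L'] (tt, LL, L'L, e1, e2, e4, e5, e6,
  iq_fh (uq_F U), ioC lam f, ioC lam^-1 f, ioC lam sg, ioC lam^-1 sg, ioC lam sy,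
  ioC lam^-1 sy, ioC lam hF, ioC lam^-1 hF, ioC lam L').
Qed.

Lemma flow0_UQ : UQ io q flow0_a b flow0_yE flow0_hE f flow0_g flow0_yF flow0_hF
  (L * w0) w1 (L' * v0) v1.
Proof. by split; [exact: flow0_E | exact: flow0_F | ncf ..]. Qed.
End Flow0.
End Flows.

Section Flows.
Variables (C : fieldType) (B : nzRingType) (io : {rmorphism C -> B}).
Hypothesis ioC : forall c x, io c * x = x * io c.
Variables (q : C) (l : nat).
Hypotheses (l_odd : odd l) (l_gt1 : (1 < l)%N) (q_prim : l.-primitive_root q).
Local Notation k := (qc io q).
Let q0 : q != 0 := prim_neq0 q_prim.
Variables (a b yE hE f g yF hF w0 w1 v0 v1 : B).
Hypothesis U : UQ io q a b yE hE f g yF hF w0 w1 v0 v1.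

Let l3 := l_gt2 l_odd l_gt1.

Let kl c i : (i <= l)%N -> k (c * (l - i)%N%:Z) = k (- c * i%:Z).
Proof. by move=> il; rewrite -subzn // mulrBr (qcD io q_prim) (qcl io q_prim) mul1r mulNr. Qed.

Variables (t lam : C).
Hypothesis lam0 : lam != 0.
Local Notation L := (io lam).
Local Notation L' := (io lam^-1).
Let LL : L * L' = 1. Proof. by rewrite -rmorphM divff // rmorph1. Qed.
Let L'L : L' * L = 1. Proof. by rewrite ioC LL. Qed.
Let T := io t.

Section Flow1.
Local Notation Z := (fZ io l t g).
Hypothesis lamg : L * L = fL io l t g.

Let ZX (w x : B) i c : w * x = k c * x * w -> (i <= l)%N ->
  w * fZ io l t x i = k (- c * i%:Z) * fZ io l t x i * w.
Proof.
move=> wx il; rewrite /fZ mulrA -ioC -mulrA (comm_k_pow ioC q_prim wx) kl //.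
by rewrite !mulrA ioC.
Qed.
Let ZX0 (w x : B) i : w * x = x * w -> w * fZ io l t x i = fZ io l t x i * w.
Proof. by move=> wx; rewrite /fZ mulrA -ioC -!mulrA; congr (_ * _); apply: commrX. Qed.
Let fZ1 : f * Z 1 = k 2 * Z 1 * f + (k (-2) - k 2) * Z 2 * yF.
Proof.
rewrite /fZ; have := iq_pow_gf ioC q_prim (uq_F U) (l - 1)%N.
rewrite !kl ?(l3, ltnW l3, ltnW (ltnW l3)) // -!subnS => E.
have TC x := esym (ioC t x).
nc ioC q0 [:: a; b; yE; hE; f; g; yF; hF; w0; w1; v0; v1; io t; g ^+ (l - 1); g ^+ (l - 2); g ^+ (l - 3)] (tt, E, TC a, TC b, TC yE, TC hE, TC f, TC g, TC yF, TC hF, TC w0, TC w1, TC v0, TC v1, TC (g ^+ (l - 1)), TC (g ^+ (l - 2)), TC (g ^+ (l - 3))).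
Qed.
Let bZ1 : b * Z 1 = Z 1 * b + Z 2 * (k 2 * (1 - k 4) * v0 * v0 * w1 * w1 - k (-2) * (k (-4) - 1) * w0 * w0 * v1 * v1).
Proof.
rewrite /fZ; have := uq_b_gX ioC l_odd l_gt1 q_prim U (l - 1)%N.
rewrite !kl ?(l3, ltnW l3, ltnW (ltnW l3)) // -!subnS => E.
have TC x := esym (ioC t x).
nc ioC q0 [:: a; b; yE; hE; f; g; yF; hF; w0; w1; v0; v1; io t; g ^+ (l - 1); g ^+ (l - 2); g ^+ (l - 3)] (tt, E, TC a, TC b, TC yE, TC hE, TC f, TC g, TC yF, TC hF, TC w0, TC w1, TC v0, TC v1, TC (g ^+ (l - 1)), TC (g ^+ (l - 2)), TC (g ^+ (l - 3))).
Qed.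
Let yZ1 : yE * Z 1 = Z 1 * yE + (1 - k 4) * Z 2 * a * v0 * v0 * w1 * w1.
Proof.
rewrite /fZ; have := uq_yE_gX ioC l_odd l_gt1 q_prim U (l - 1)%N.
rewrite !kl ?(l3, ltnW l3, ltnW (ltnW l3)) // -!subnS => E.
have TC x := esym (ioC t x).
nc ioC q0 [:: a; b; yE; hE; f; g; yF; hF; w0; w1; v0; v1; io t; g ^+ (l - 1); g ^+ (l - 2); g ^+ (l - 3)] (tt, E, TC a, TC b, TC yE, TC hE, TC f, TC g, TC yF, TC hF, TC w0, TC w1, TC v0, TC v1, TC (g ^+ (l - 1)), TC (g ^+ (l - 2)), TC (g ^+ (l - 3))).
Qed.
Let hZ1 : hE * Z 1 = Z 1 * hE + k (-1) * (1 - k 4) * Z 2 * a * a * v0 * v0 * w1 * w1.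
Proof.
rewrite /fZ; have := uq_hE_gX ioC l_odd l_gt1 q_prim U (l - 1)%N.
rewrite !kl ?(l3, ltnW l3, ltnW (ltnW l3)) // -!subnS => E.
have TC x := esym (ioC t x).
nc ioC q0 [:: a; b; yE; hE; f; g; yF; hF; w0; w1; v0; v1; io t; g ^+ (l - 1); g ^+ (l - 2); g ^+ (l - 3)] (tt, E, TC a, TC b, TC yE, TC hE, TC f, TC g, TC yF, TC hF, TC w0, TC w1, TC v0, TC v1, TC (g ^+ (l - 1)), TC (g ^+ (l - 2)), TC (g ^+ (l - 3))).
Qed.
Let yg : yF * g = k 2 * g * yF.
Proof. nc ioC q0 [:: g; yF] (tt, iq_gy (uq_F U)). Qed.
Let hg : hF * g = g * hF - (k (-1) - k 3) * yF * yF.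
Proof. nc ioC q0 [:: g; yF; hF] (tt, iq_gh (uq_F U)). Qed.
Let w1Z1 : w1 * Z 1 = k (2) * Z 1 * w1.
Proof. by rewrite (ZX (uq_w1g U)) ?(l3, ltnW l3, ltnW (ltnW l3)) //. Qed.
Let w1Z2 : w1 * Z 2 = k (4) * Z 2 * w1.
Proof. by rewrite (ZX (uq_w1g U)) ?(l3, ltnW l3, ltnW (ltnW l3)) //. Qed.
Let v1Z1 : v1 * Z 1 = k (-2) * Z 1 * v1.
Proof. by rewrite (ZX (uq_v1g ioC q_prim U)) ?(l3, ltnW l3, ltnW (ltnW l3)) //. Qed.
Let v1Z2 : v1 * Z 2 = k (-4) * Z 2 * v1.
Proof. by rewrite (ZX (uq_v1g ioC q_prim U)) ?(l3, ltnW l3, ltnW (ltnW l3)) //. Qed.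
Let yFZ1 : yF * Z 1 = k (-2) * Z 1 * yF.
Proof. by rewrite (ZX (yg)) ?(l3, ltnW l3, ltnW (ltnW l3)) //. Qed.
Let yFZ2 : yF * Z 2 = k (-4) * Z 2 * yF.
Proof. by rewrite (ZX (yg)) ?(l3, ltnW l3, ltnW (ltnW l3)) //. Qed.
Let w0Z1 : w0 * Z 1 = Z 1 * w0. Proof. exact: ZX0 (uq_w0g U). Qed.
Let w0Z2 : w0 * Z 2 = Z 2 * w0. Proof. exact: ZX0 (uq_w0g U). Qed.
Let v0Z1 : v0 * Z 1 = Z 1 * v0. Proof. exact: ZX0 (uq_v0g U). Qed.
Let v0Z2 : v0 * Z 2 = Z 2 * v0. Proof. exact: ZX0 (uq_v0g U). Qed.
Let aZ1 : a * Z 1 = Z 1 * a. Proof. exact: ZX0 (uq_ag U). Qed.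
Let aZ2 : a * Z 2 = Z 2 * a. Proof. exact: ZX0 (uq_ag U). Qed.
Let gZ1 : g * Z 1 = L * L - 1.
Proof. by rewrite (ZX0 1 (erefl (g * g))) (fZ1_mul io l_gt1) lamg. Qed.
Let Z1g : Z 1 * g = L * L - 1. Proof. by rewrite (fZ1_mul io l_gt1) lamg. Qed.
Let Z2g : Z 2 * g = Z 1. Proof. exact: fZ2_mul. Qed.
Let gZ2 : g * Z 2 = Z 1. Proof. by rewrite (ZX0 2 (erefl (g * g))) fZ2_mul. Qed.
Let ZZ11 : Z 1 * Z 1 = (L * L - 1) * Z 2.
Proof.
rewrite lamg /fL addrC addKr /fZ.
rewrite mulrA -[io t * g ^+ (l - 1) * io t]mulrA -ioC -!mulrA -!exprD; congr (_ * _).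
rewrite [RHS]mulrA -ioC -mulrA -exprD; congr (_ * (_ ^+ _)).
by move: l3; lia.
Qed.
Let hFZ1 : hF * Z 1 = Z 1 * hF + k (-5) * (1 - k 4) * Z 2 * yF * yF.
Proof.
have := iq_pow_gh ioC q_prim (uq_F U) (l - 1).
rewrite !kl ?(ltnW (ltnW l3)) // -!subnS => E.
have E2 : Z 1 * hF = hF * Z 1 - k 3 * (1 - k 4) * yF * yF * Z 2.
  rewrite /fZ; have TC x := esym (ioC t x).
  nc ioC q0 [:: yF; hF; io t; g ^+ (l - 1); g ^+ (l - 2)] (tt, E, TC yF, TC hF, TC (g ^+ (l - 1)), TC (g ^+ (l - 2))).
nc ioC q0 [:: yF; hF; Z 1; Z 2] (tt, E2, yFZ2).
Qed.

(** The analogous flow for the long root, with [L ^ 2 = 1 + t g ^+ l]. *)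
Definition flow1_b := b + (k 2 * L' * L' * w0 * w0 * v1 * v1 - k (-2) * v0 * v0 * w1 * w1) * Z 1.
Definition flow1_f := L' * (L * L * f - k 2 * yF * Z 1).
Definition flow1_yF := L' * yF.
Definition flow1_hF := L' * L' * (L * L * hF - k 3 * yF * yF * Z 1).
Definition flow1_yE := yE - k (-4) * a * v0 * v0 * w1 * w1 * Z 1.
Definition flow1_hE := hE - k (-5) * a * a * v0 * v0 * w1 * w1 * Z 1.
Ltac ncf := rewrite /flow1_b /flow1_f /flow1_yF /flow1_hF /flow1_yE /flow1_hE;
 nc ioC q0 [:: a; b; yE; hE; f; g; yF; hF; w0; w1; v0; v1; Z 1; Z 2; L; L'] (tt, LL, L'L, ioC lam a, ioC lam^-1 a, ioC lam b, ioC lam^-1 b, ioC lam yE, ioC lam^-1 yE, ioC lam hE, ioC lam^-1 hE, ioC lam f, ioC lam^-1 f, ioC lam g, ioC lam^-1 g, ioC lam yF, ioC lam^-1 yF, ioC lam hF, ioC lam^-1 hF, ioC lam w0, ioC lam^-1 w0, ioC lam w1, ioC lam^-1 w1, ioC lam v0, ioC lam^-1 v0, ioC lam v1, ioC lam^-1 v1, ioC lam (Z 1), ioC lam^-1 (Z 1), ioC lam (Z 2), ioC lam^-1 (Z 2), ioC lam L',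
 iq_fg (uq_E U), iq_fy (uq_E U), iq_fh (uq_E U), iq_gy (uq_E U), iq_yh (uq_E U), iq_gh (uq_E U), iq_fg (uq_F U), iq_fy (uq_F U), iq_fh (uq_F U), yg, iq_yh (uq_F U), hg,
 (uq_yEf ioC l_odd l_gt1 q_prim U), (uq_yEg ioC l_odd l_gt1 q_prim U), (uq_hEf ioC l_odd l_gt1 q_prim U), (uq_hEg ioC l_odd l_gt1 q_prim U), (uq_ayF ioC l_odd l_gt1 q_prim U), (uq_byF ioC l_odd l_gt1 q_prim U), (uq_ahF ioC l_odd l_gt1 q_prim U), (uq_bhF ioC l_odd l_gt1 q_prim U),
 fZ1, bZ1, yZ1, hZ1, w1Z1, w1Z2, v1Z1, v1Z2, yFZ1, yFZ2, w0Z1, w0Z2, v0Z1, v0Z2, aZ1, aZ2, gZ1, Z1g, Z2g, gZ2, ZZ11, hFZ1, uq_af U, uq_bg U, uq_ag U, uq_bf U, uq_w0a U, uq_w0b U, uq_w1a U, uq_w1b U, uq_w0f U, uq_w0g U, uq_w1f U, uq_w1g U, uq_w0v0 U, uq_v0w0 U, uq_w1v1 U, uq_v1w1 U, uq_w1w0 U, esym (uq_v0w1 U), (uq_v1w0 U), (uq_v1v0 U), (uq_v0a ioC q_prim U), (uq_v0b U), (uq_v0f ioC q_prim U), (uq_v0g U), (uq_v1a U), (uq_v1b ioC q_prim U), (uq_v1f U), (uq_v1g ioC q_prim U), (uq_w0yE ioC l_odd l_gt1 q_prim U), (uq_w0yF ioC l_odd l_gt1 q_prim U), (uq_w0hE ioC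 l_odd l_gt1 q_prim U), (uq_w0hF ioC l_odd l_gt1 q_prim U), (uq_w1yE ioC l_odd l_gt1 q_prim U), (uq_w1yF ioC l_odd l_gt1 q_prim U), (uq_w1hE ioC l_odd l_gt1 q_prim U), (uq_w1hF ioC l_odd l_gt1 q_prim U), (uq_v0yE ioC l_odd l_gt1 q_prim U), (uq_v0yF ioC l_odd l_gt1 q_prim U), (uq_v0hE ioC l_odd l_gt1 q_prim U), (uq_v0hF ioC l_odd l_gt1 q_prim U), (uq_v1yE ioC l_odd l_gt1 q_prim U), (uq_v1yF ioC l_odd l_gt1 q_prim U), (uq_v1hE ioC l_odd l_gt1 q_prim U), (uq_v1hF ioC l_odd l_gt1 q_prim U)).

Lemma flow1_E : IQ io q a flow1_b flow1_yE flow1_hE.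
Proof. by split; ncf. Qed.

Lemma flow1_F : IQ io q flow1_f g flow1_yF flow1_hF.
Proof.
have [/= e1 [/= e2 [/= e3 [/= e5 [/= e6 _]]]]] := uq_long_flow ioC l_odd l_gt1 q_prim U t.
have fE : flow1_f = L' * long_f io q l t f g yF by rewrite /flow1_f lamg.
have hE' : flow1_hF = L' * L' * long_h io q l t g yF hF by rewrite /flow1_hF lamg.
rewrite fE hE' /flow1_yF; move: (long_f _ _ _ _ _ _ _) (long_h _ _ _ _ _ _ _) e1 e2 e3 e5 e6.
move=> sf sh e1 e2 e3 e5 e6.
split; nc ioC q0 [:: sf; g; yF; sh; L; L'] (tt, LL, L'L, e1, e2, e3, e5, e6,
  iq_gy (uq_F U), ioC lam sf, ioC lam^-1 sf, ioC lam g, ioC lam^-1 g, ioC lam yF,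
  ioC lam^-1 yF, ioC lam sh, ioC lam^-1 sh, ioC lam L').
Qed.

Lemma flow1_UQ : UQ io q a flow1_b flow1_yE flow1_hE flow1_f g flow1_yF flow1_hF
  w0 (L * w1) v0 (L' * v1).
Proof. by split; [exact: flow1_E | exact: flow1_F | ncf ..]. Qed.
End Flow1.
End Flows.

Lemma prod_comm_split (B : nzRingType) n (a b : nat -> B) :
  (forall i j, a i * b j = b j * a i) ->
  \prod_(j < n) (a j * b j) = \prod_(j < n) a j * \prod_(j < n) b j.
Proof.
move=> ab; elim: n => [|n IH]; first by rewrite !big_ord0 mulr1.
rewrite !big_ord_recr /= IH -!mulrA; congr (_ * _); rewrite !mulrA; congr (_ * _).
by apply/esym/commr_prod => i _; apply: ab.
Qed.

Section TwoByTwo.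
Variable B : nzRingType.
Definition mk2 (a b c d : B) : 'M[B]_2 :=
  \matrix_(i, j) if i == 0 then if j == 0 then a else b else if j == 0 then c else d.

Lemma mk2M a b c d a' b' c' d' : mk2 a b c d * mk2 a' b' c' d' =
  mk2 (a * a' + b * c') (a * b' + b * d') (c * a' + d * c') (c * b' + d * d').
Proof.
apply/matrixP=> i j; rewrite [LHS]mxE big_ord_recl big_ord1 !mxE /=.
by case: (i == 0); case: (j == 0).
Qed.
Lemma mk2D a b c d a' b' c' d' : mk2 a b c d + mk2 a' b' c' d' =
  mk2 (a + a') (b + b') (c + c') (d + d').
Proof. by apply/matrixP=> i j; rewrite !mxE; case: (i == 0); case: (j == 0). Qed.
Lemma mk2N a b c d : - mk2 a b c d = mk2 (- a) (- b) (- c) (- d).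
Proof. by apply/matrixP=> i j; rewrite !mxE; case: (i == 0); case: (j == 0). Qed.
Lemma mk2_scalar a : mk2 a 0 0 a = a%:M.
Proof.
apply/matrixP=> i j; rewrite !mxE.
by case: i => -[|[|[]]] // ?; case: j => -[|[|[]]] // ?.
Qed.
Lemma mk2_inj a b c d a' b' c' d' : mk2 a b c d = mk2 a' b' c' d' ->
  [/\ a = a', b = b', c = c' & d = d'].
Proof.
move=> E; split; [move: (congr1 (fun M : 'M[B]_2 => M 0 0) E)|
  move: (congr1 (fun M : 'M[B]_2 => M 0 1) E)|move: (congr1 (fun M : 'M[B]_2 => M 1 0) E)|
  move: (congr1 (fun M : 'M[B]_2 => M 1 1) E)]; by rewrite !mxE.
Qed.
End TwoByTwo.

(** * Casimir products for [sl_2] at a root of unity *)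

Section Casimir.
Variables (C : fieldType) (B : nzRingType) (io : {rmorphism C -> B}).
Hypothesis ioC : forall c x, io c * x = x * io c.
Variables (p : C) (l : nat).
Hypotheses (l_odd : odd l) (p_prim : l.-primitive_root p).
Local Notation k := (qc io p).
Let p0 : p != 0 := prim_neq0 p_prim.

Definition cas_factor (Cs K Ki : B) (j : int) : B :=
  Cs - k (-1 - 2 * j) * K - k (1 + 2 * j) * Ki.

(** With [c = p ^ (1 + 2 j)] the factor of index [j] splits as [(z - c^-1 K) (1 - c z^-1 K^-1)], and
    over all [j] both kinds of factors run through the l-th roots of unity. *)
Lemma casimir_split (Cs K Ki z zi : B) : K * Ki = 1 -> Ki * K = 1 ->
  z * zi = 1 -> zi * z = 1 -> Cs = z + zi -> z * K = K * z ->
  \prod_(j < l) cas_factor Cs K Ki j%:Z + K ^+ l + Ki ^+ l = z ^+ l + zi ^+ l.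
Proof.
move=> KKi KiK zzi ziz CE zK.
have ziK : zi * K = K * zi.
  by rewrite -[K in LHS]mulr1 -zzi [K * _]mulrA -zK !mulrA ziz mul1r.
have inv_c (x y : B) : x * K = K * x -> x * Ki = Ki * x.
  by move=> xK; rewrite -[x in LHS]mul1r -KiK -[Ki * K * x]mulrA -xK -!mulrA KKi mulr1.
have zKi := inv_c z z zK; have ziKi := inv_c zi zi ziK.
have e1 j : k (-1 - 2 * j%:Z) = io ((p ^ (-2)) ^+ j) * k (-1).
  by rewrite /qc -rmorphM; congr (io _); rewrite exprnP exprz_exp -expfzDr // mulNr addrC.
have e2 j : k (1 + 2 * j%:Z) = io ((p ^ 2) ^+ j) * k 1.
  by rewrite /qc -rmorphM; congr (io _); rewrite exprnP exprz_exp -expfzDr // addrC.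
pose a j := z - io ((p ^ (-2)) ^+ j) * (k (-1) * K).
pose b j := 1 - io ((p ^ 2) ^+ j) * (k 1 * (zi * Ki)).
have ab j : cas_factor Cs K Ki j%:Z = a j * b j.
  rewrite /cas_factor e1 e2 /a /b CE.
  have kk : io ((p ^ (-2)) ^+ j) * io ((p ^ 2) ^+ j) = 1.
    by rewrite -rmorphM -exprMn -expfzDr // expr1n rmorph1.
  have c1 x := ioC ((p ^ (-2)) ^+ j) x; have c2 x := ioC ((p ^ 2) ^+ j) x.
  move: (io ((p ^ (-2)) ^+ j)) (io ((p ^ 2) ^+ j)) kk c1 c2 => u v uv uc vc.
  nc ioC p0 [:: z; zi; K; Ki; u; v] (tt, zzi, ziz, KKi, KiK, esym zK, esym ziK, esym zKi,
    esym ziKi, uc z, uc zi, uc K, uc Ki, vc z, vc zi, vc K, vc Ki, uv).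
under eq_bigr => j _ do rewrite ab.
rewrite prod_comm_split; last first.
  move=> i j; rewrite /a /b.
  have c1 x := ioC ((p ^ (-2)) ^+ i) x; have c2 x := ioC ((p ^ 2) ^+ j) x.
  move: (io ((p ^ (-2)) ^+ i)) (io ((p ^ 2) ^+ j)) c1 c2 => u v uc vc.
  nc ioC p0 [:: z; zi; K; Ki; u; v] (tt, zzi, ziz, KKi, KiK, esym zK, esym ziK, esym zKi,
    esym ziKi, uc z, uc zi, uc K, uc Ki, vc z, vc zi, vc K, vc Ki, uc v).
have kl i x : (k i * x) ^+ l = x ^+ l.
  rewrite exprMn_comm; last exact: qc_comm.
  by rewrite (qcX io p) (qcl io p_prim) mul1r.
rewrite /a /b (prod_root_comm ioC) ?(prim_exprz p_prim, coprime2l) //; last first.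
  by nc ioC p0 [:: z; K] (tt, zK).
rewrite (prod_root_comm ioC) ?(prim_exprz p_prim, coprime2l) //; last by rewrite mulr1 mul1r.
rewrite !kl expr1n exprMn_comm //.
have zzl : z ^+ l * zi ^+ l = 1 by rewrite -exprMn_comm ?zzi ?expr1n // /GRing.comm zzi.
have KKl : K ^+ l * Ki ^+ l = 1 by rewrite -exprMn_comm ?KKi ?expr1n // /GRing.comm KKi.
have Kzi : K ^+ l * zi ^+ l = zi ^+ l * K ^+ l by apply/commrX/esym/commrX.
nc ioC p0 [:: z ^+ l; zi ^+ l; K ^+ l; Ki ^+ l] (tt, zzl, KKl, Kzi).
Qed.

End Casimir.

Section CasimirInvariance.
Variables (C : fieldType) (B : nzRingType) (io : {rmorphism C -> B}).
Hypothesis ioC : forall c x, io c * x = x * io c.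
Variables (p : C) (l : nat).
Hypotheses (l_odd : odd l) (p_prim : l.-primitive_root p).

(** An element [z] with [z + z^-1 = Cs] need not exist in [B]; it is adjoined as the companion
    matrix of [T^2 - Cs T + 1]. The right-hand side no longer contains [K], which is the source of
    [casimir_invariance]. *)
Lemma casimir_companion (Cs K Ki : B) : K * Ki = 1 -> Ki * K = 1 -> Cs * K = K * Cs ->
  (\prod_(j < l) cas_factor io p Cs K Ki j%:Z + K ^+ l + Ki ^+ l)%:M =
  mk2 0 (-1) 1 Cs ^+ l + mk2 Cs 1 (-1) 0 ^+ l.
Proof.
move=> KKi KiK CK; pose sm : {rmorphism B -> 'M[B]_2} := @scalar_mx B 2.
pose io' : {rmorphism C -> 'M[B]_2} := sm \o io.
have smE a : sm a = mk2 a 0 0 a by rewrite mk2_scalar.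
have mk2E (M : 'M[B]_2) : M = mk2 (M 0 0) (M 0 1) (M 1 0) (M 1 1).
  by apply/matrixP=> -[[|[|[]]] // ?] [[|[|[]]] // ?]; rewrite !mxE /=; congr (M _ _); apply: val_inj.
have mk2_1 : 1 = mk2 1 0 0 1 :> 'M[B]_2 by rewrite mk2_scalar.
have io'C c x : io' c * x = x * io' c.
  rewrite [io' c]smE [x]mk2E !mk2M.
  by rewrite !(mulr0, mul0r, addr0, add0r) !ioC.
rewrite -[LHS]/(sm _) !rmorphD /= !rmorphXn rmorph_prod /=.
have := casimir_split (B := 'M[B]_2) io'C l_odd p_prim (K := sm K) (Ki := sm Ki) (Cs := sm Cs)
  (z := mk2 0 (-1) 1 Cs) (zi := mk2 Cs 1 (-1) 0).
rewrite /cas_factor => <-.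
- congr (_ + _ + _); apply: eq_bigr => j _.
  by rewrite !rmorphB !rmorphM.
- by rewrite -rmorphM KKi rmorph1.
- by rewrite -rmorphM KiK rmorph1.
- by rewrite mk2M mk2_1 !(mul0r, mulr0, mulr1, mul1r, mulN1r, mulrN1, opprK, add0r, addr0, addrN, addNr).
- by rewrite mk2M mk2_1 !(mul0r, mulr0, mulr1, mul1r, mulN1r, mulrN1, opprK, add0r, addr0, addrN, addNr).
- by rewrite mk2D smE !(add0r, addr0, addrN, addNr).
by rewrite smE !mk2M !(mul0r, mulr0, mulr1, mul1r, mulN1r, mulrN1, add0r, addr0) CK.
Qed.

Lemma casimir_invariance (Cs K Ki J Ji : B) :
  K * Ki = 1 -> Ki * K = 1 -> Cs * K = K * Cs ->
  J * Ji = 1 -> Ji * J = 1 -> Cs * J = J * Cs ->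
  \prod_(j < l) cas_factor io p Cs K Ki j%:Z + K ^+ l + Ki ^+ l =
  \prod_(j < l) cas_factor io p Cs J Ji j%:Z + J ^+ l + Ji ^+ l.
Proof.
move=> h1 h2 h3 h4 h5 h6.
have := casimir_companion h1 h2 h3; rewrite -(casimir_companion h4 h5 h6).
by rewrite -!mk2_scalar => /mk2_inj[].
Qed.
End CasimirInvariance.

Section SL2.
Variables (C : fieldType) (B : nzRingType) (io : {rmorphism C -> B}).
Hypothesis ioC : forall c x, io c * x = x * io c.
Variables (p : C) (l : nat).
Hypotheses (l_odd : odd l) (l_gt1 : (1 < l)%N) (p_prim : l.-primitive_root p).
Local Notation k := (qc io p).
Let p0 : p != 0 := prim_neq0 p_prim.
Variables (E F K Ki : B).
Hypotheses (EF : E * F = F * E + (k 1 - k (-1)) * (K - Ki)).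
Hypotheses (KF : K * F = k (-2) * F * K) (KiF : Ki * F = k 2 * F * Ki).
Hypotheses (KE : K * E = k 2 * E * K) (KiE : Ki * E = k (-2) * E * Ki).
Hypotheses (KKi : K * Ki = 1) (KiK : Ki * K = 1).

Let Cs := E * F + k (-1) * K + k 1 * Ki.
Local Notation cas := (cas_factor io p Cs K Ki).

Lemma prod_EF (X Y J Ji D : B) : X * Y = D - k (-1) * J - k 1 * Ji -> D * Y = Y * D ->
  J * Y = k (-2) * Y * J -> Ji * Y = k 2 * Y * Ji ->
  forall m, X ^+ m * Y ^+ m = \prod_(j < m) cas_factor io p D J Ji j%:Z.
Proof.
move=> XY DY JY JiY; elim=> [|m IH]; first by rewrite !expr0 big_ord0 mulr1.
rewrite big_ord_recr /= -IH exprSr exprS -!mulrA; congr (_ * _).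
rewrite [X * _]mulrA XY /cas_factor.
have DYm : D * Y ^+ m = Y ^+ m * D by apply/commrX.
rewrite !mulrBl !mulrBr DYm -!mulrA (comm_k_pow ioC p_prim JY) (comm_k_pow ioC p_prim JiY).
rewrite !mulrA -!(qcD io p_prim) mulNr.
by rewrite -!(qc_comm ioC p (_ - _)) -!(qc_comm ioC p (_ + _)).
Qed.

Lemma CsF : Cs * F = F * Cs.
Proof. rewrite /Cs; nc ioC p0 [:: E; F; K; Ki] (tt, EF, KF, KiF). Qed.
Lemma CsK : Cs * K = K * Cs.
Proof. rewrite /Cs; nc ioC p0 [:: E; F; K; Ki] (tt, EF, KE, KiE, KF, KiF, KKi, KiK). Qed.
Lemma CsKi : Cs * Ki = Ki * Cs.
Proof. rewrite /Cs; nc ioC p0 [:: E; F; K; Ki] (tt, EF, KE, KiE, KF, KiF, KKi, KiK). Qed.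

Let cas_com i j : cas i * cas j = cas j * cas i.
Proof.
rewrite /cas_factor.
have c1 := qc_comm ioC p (-1 - 2 * i); have c2 := qc_comm ioC p (1 + 2 * i).
have c3 := qc_comm ioC p (-1 - 2 * j); have c4 := qc_comm ioC p (1 + 2 * j).
have CK := CsK; have CKi := CsKi; move: Cs (k (-1 - 2 * i)) (k (1 + 2 * i)) (k (-1 - 2 * j)) (k (1 + 2 * j)) CK CKi c1 c2 c3 c4.
move=> D x1 x2 x3 x4 CK CKi c1 c2 c3 c4.
nc ioC p0 [:: D; K; Ki; x1; x2; x3; x4] (tt, esym CK, esym CKi, KKi, KiK,
  c1 D, c2 D, c3 D, c4 D, c1 K, c2 K, c3 K, c4 K, c1 Ki, c2 Ki, c3 Ki, c4 Ki,
  c2 x1, c3 x1, c4 x1, c3 x2, c4 x2, c4 x3).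
Qed.

Let cas_l j : cas (j + l%:Z) = cas j.
Proof.
have e c i : k (i + c * l%:Z) = k i by rewrite (qcD io p_prim) (qcl io p_prim) mulr1.
rewrite /cas_factor -(e (-2) (-1 - 2 * j)) -(e 2 (1 + 2 * j)).
by congr (_ - k _ * _ - k _ * _); ring.
Qed.

(** [F * E] is the Casimir factor of index -1, and the factors depend on the index modulo [l] only;
    hence the last [m] indices. *)
Lemma prod_FE m : (m <= l)%N -> F ^+ m * E ^+ m = \prod_(l - m <= j < l) cas j%:Z.
Proof.
elim: m => [|m IH] ml; first by rewrite !expr0 subn0 big_geq ?mulr1.
rewrite big_ltn; last by lia.
have -> : (l - m.+1).+1 = (l - m)%N by lia.
rewrite -IH ?(ltnW ml) // exprSr exprS -!mulrA [F * (_ * _)]mulrA.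
have -> : F * E = cas (-1) by rewrite /cas_factor /Cs; nc ioC p0 [:: E; F; K; Ki] (tt, EF).
have E1 : F ^+ m * cas (-1) = cas (l - m.+1)%N%:Z * F ^+ m.
  have -> : (l - m.+1)%N%:Z = -1 - m%:Z + l%:Z by rewrite -subzn // -addn1 PoszD; ring.
  rewrite cas_l /cas_factor.
  have FK : F * K = k 2 * K * F by nc ioC p0 [:: F; K] (tt, KF).
  have FKi : F * Ki = k (-2) * Ki * F by nc ioC p0 [:: F; Ki] (tt, KiF).
  have pow c x : F * x = k c * x * F -> F ^+ m * x = k (c * m%:Z) * x * F ^+ m.
    move=> Fx; have xF : x * F = k (- c) * F * x.
      have cc : k (- c) * k c = 1 by rewrite -(qcD io p_prim) addNr qc0.
      by rewrite -mulrA Fx !mulrA cc mul1r.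
    rewrite -[RHS]mulrA (comm_k_pow ioC p_prim xF).
    by rewrite !mulrA -(qcD io p_prim) mulNr subrr qc0 mul1r.
  have FmC : F ^+ m * Cs = Cs * F ^+ m by apply/esym/commrX/CsF.
  rewrite !mulrBl !mulrBr FmC.
  rewrite [F ^+ m * (_ * K)]mulrA -(qc_comm ioC) -mulrA (pow _ _ FK).
  rewrite [F ^+ m * (_ * Ki)]mulrA -(qc_comm ioC) -[_ * _ * Ki]mulrA (pow _ _ FKi).
  rewrite !mulrA -!(qcD io p_prim).
  by congr (_ - k _ * _ * _ - k _ * _ * _); ring.
by rewrite mulrA E1 mulrA.
Qed.

Lemma prod_EF_cas m : E ^+ m * F ^+ m = \prod_(j < m) cas j%:Z.
Proof.
apply: prod_EF CsF KF KiF m; rewrite /Cs.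
by nc ioC p0 [:: E; F; K; Ki] tt.
Qed.

(** The derivative of [casimir_invariance] in the direction of [K]: that lemma is applied to
    [K (1 + e)] with [e ^ 2 = 0], realized by upper triangular matrices of size 2, and the corner
    entry is read off. *)
Lemma casimir_derivative : \sum_(a < l) \prod_(j < a) cas j%:Z *
  (k (1 + 2 * a%:Z) * Ki - k (-1 - 2 * a%:Z) * K) * \prod_(a.+1 <= j < l) cas j%:Z
  = l%:R * (Ki ^+ l - K ^+ l).
Proof.
pose sm : {rmorphism B -> 'M[B]_2} := @scalar_mx B 2.
pose io' : {rmorphism C -> 'M[B]_2} := sm \o io.
have smE a : sm a = mk2 a 0 0 a by rewrite mk2_scalar.
have io'C c x : io' c * x = x * io' c.
  have -> : x = mk2 (x 0 0) (x 0 1) (x 1 0) (x 1 1).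
    by apply/matrixP=> -[[|[|[]]] // ?] [[|[|[]]] // ?]; rewrite !mxE /=; congr (x _ _); apply: val_inj.
  by rewrite [io' c]smE !mk2M !(mulr0, mul0r, addr0, add0r) !ioC.
have mk2_1 : 1 = mk2 1 0 0 1 :> 'M[B]_2 by rewrite mk2_scalar.
pose KK := mk2 K K 0 K; pose LL := mk2 Ki (- Ki) 0 Ki.
have simp := (mul0r, mulr0, mulr1, mul1r, add0r, addr0, mulrN, mulNr, addrN, addNr).
have h1 : KK * LL = 1 by rewrite mk2M mk2_1 !simp KKi ?addrN ?addNr.
have h2 : LL * KK = 1 by rewrite mk2M mk2_1 !simp KiK ?addrN ?addNr.
have h3 : sm Cs * KK = KK * sm Cs by rewrite smE !mk2M !simp CsK.
have h4 : sm K * sm Ki = 1 by rewrite -rmorphM KKi rmorph1.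
have h5 : sm Ki * sm K = 1 by rewrite -rmorphM KiK rmorph1.
have h6 : sm Cs * sm K = sm K * sm Cs by rewrite -!rmorphM CsK.
have := casimir_invariance io'C l_odd p_prim h1 h2 h3 h4 h5 h6.
have pK m : KK ^+ m = mk2 (K ^+ m) (m%:R * K ^+ m) 0 (K ^+ m).
  elim: m => [|m IH]; first by rewrite !expr0 mul0r mk2_1.
  by rewrite exprSr IH mk2M !simp -mulrA -exprSr -[m.+1%:R]natr1 mulrDl mul1r addrC.
have pL m : LL ^+ m = mk2 (Ki ^+ m) (- (m%:R * Ki ^+ m)) 0 (Ki ^+ m).
  elim: m => [|m IH]; first by rewrite !expr0 mul0r oppr0 mk2_1.
  by rewrite exprSr IH mk2M !simp -mulrA -exprSr -[m.+1%:R]natr1 mulrDl mul1r opprD addrC.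
pose d (a : nat) := k (1 + 2 * a%:Z) * Ki - k (-1 - 2 * a%:Z) * K.
have cE (j : nat) : cas_factor io' p (sm Cs) KK LL j%:Z = mk2 (cas j%:Z) (d j) 0 (cas j%:Z).
  rewrite /cas_factor ![qc io' _ _]smE smE !mk2M !simp !mk2N !mk2D !simp opprK.
  congr (mk2 _ _ _ _); [exact: addrC | by rewrite oppr0 addr0].
have PE m : \prod_(j < m) cas_factor io' p (sm Cs) KK LL j%:Z = mk2 (\prod_(j < m) cas j%:Z)
   (\sum_(a < m) \prod_(j < a) cas j%:Z * d a * \prod_(a.+1 <= j < m) cas j%:Z) 0
   (\prod_(j < m) cas j%:Z).
  elim: m => [|m IH]; first by rewrite !big_ord0 mk2_1.
  rewrite !big_ord_recr /= IH cE mk2M !simp; congr mk2.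
  rewrite addrC big_geq // mulr1; congr (_ + _); rewrite mulr_suml; apply: eq_bigr => a _.
  by rewrite [in RHS]big_nat_recr //= mulrA.
have PE' m : \prod_(j < m) cas_factor io' p (sm Cs) (sm K) (sm Ki) j%:Z =
    mk2 (\prod_(j < m) cas j%:Z) 0 0 (\prod_(j < m) cas j%:Z).
  rewrite -smE rmorph_prod; apply: eq_bigr => j _.
  by rewrite /cas_factor !rmorphB !rmorphM.
rewrite PE PE' pK pL -!rmorphXn !smE !mk2D => /mk2_inj[_ + _ _].
rewrite !addr0 => /eqP; rewrite -addrA addr_eq0 => /eqP ->.
by rewrite opprD opprK mulrBr addrC.
Qed.

Variables (t lam2 e : C).
Hypotheses (Fl : F ^+ l = io e) (lamE : lam2 = 1 + t * e) (lam0 : lam2 != 0).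
Let Z := io t * F ^+ (l - 1).
Let E' := E + (k 1 * io lam2^-1 * Ki - k (-1) * K) * Z.
Let s := t * \sum_(j < l) lam2 ^+ j.

Let s_e : s * e = lam2 ^+ l - 1.
Proof. by rewrite subrX1 /s {2}lamE addrAC subrr add0r mulrAC. Qed.

Let ZF : Z * F = io (lam2 - 1).
Proof. by rewrite /Z -mulrA -exprSr subn1 prednK ?(ltnW l_gt1) // Fl -rmorphM lamE addrAC subrr add0r. Qed.

(** [E' * F] is a Casimir factor with [K] replaced by [lam2 K], so invariance evaluates
    [E' ^+ l * F ^+ l], and the scalar [F ^+ l = e] can be cancelled. *)
Lemma sl2_flow_regular : e != 0 ->
  E' ^+ l = E ^+ l - io s * K ^+ l + io (lam2 ^- l * s) * Ki ^+ l.
Proof.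
move=> e0; set M := io lam2; set M' := io lam2^-1.
have MM : M * M' = 1 by rewrite -rmorphM divff // rmorph1.
have M'M : M' * M = 1 by rewrite -rmorphM mulVf // rmorph1.
have cM x : M * x = x * M := ioC lam2 x; have cM' x : M' * x = x * M' := ioC _ x.
have ZF' : Z * F = M - 1 by rewrite ZF rmorphB rmorph1.
have E'F : E' * F = Cs - k (-1) * (M * K) - k 1 * (M' * Ki).
  rewrite /E' /Cs -/M'; nc ioC p0 [:: E; F; K; Ki; M; M'; Z] (tt, MM, M'M, ZF', cM K, cM Ki, cM' K, cM' Ki).
have JF : M * K * F = k (-2) * F * (M * K).
  by nc ioC p0 [:: F; K; M] (tt, KF, cM K, cM F).
have JiF : M' * Ki * F = k 2 * F * (M' * Ki).
  by nc ioC p0 [:: F; Ki; M'] (tt, KiF, cM' Ki, cM' F).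
have P1 := prod_EF E'F CsF JF JiF l; have P2 := prod_EF_cas l.
have JJ : M * K * (M' * Ki) = 1.
  by nc ioC p0 [:: K; Ki; M; M'] (tt, MM, M'M, KKi, KiK, cM K, cM Ki, cM' K, cM' Ki).
have JJ' : M' * Ki * (M * K) = 1.
  by nc ioC p0 [:: K; Ki; M; M'] (tt, MM, M'M, KKi, KiK, cM K, cM Ki, cM' K, cM' Ki).
have CJ : Cs * (M * K) = M * K * Cs by rewrite mulrA -cM -!mulrA CsK.
have := casimir_invariance ioC l_odd p_prim JJ JJ' CJ KKi KiK CsK.
rewrite -P1 -P2 Fl !exprMn_comm; [|exact: ioC..].
move=> Q.
have {}Q : E' ^+ l * io e = E ^+ l * io e + K ^+ l + Ki ^+ l - M' ^+ l * Ki ^+ l - M ^+ l * K ^+ l.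
  by rewrite -Q !addrK.
have se : io s * io e = M ^+ l - 1 by rewrite -rmorphM s_e rmorphB rmorph1 rmorphXn.
have se' : io (lam2 ^- l * s) * io e = 1 - M' ^+ l.
  by rewrite -rmorphM -mulrA s_e mulrBr mulr1 mulVf ?expf_neq0 // rmorphB rmorph1 -exprVn rmorphXn.
apply: (@io_reg _ _ io e _ _ e0); rewrite !(ioC e).
nc ioC p0 [:: E' ^+ l; E ^+ l; K ^+ l; Ki ^+ l; M ^+ l; M' ^+ l; io e; io s; io (lam2 ^- l * s)]
  (tt, Q, se, se', esym (ioC e (K ^+ l)), esym (ioC e (Ki ^+ l))).
Qed.

(** A word of length at most [n] with two letters [N] contains some [N * E ^+ i * N] with
    [i + 1 < n], so only the linear terms survive. *)
Lemma pow_add_sparse (N : B) n : (forall i, (i.+1 < n)%N -> N * E ^+ i * N = 0) ->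
  forall m, (m <= n)%N -> (E + N) ^+ m = E ^+ m + \sum_(i < m) E ^+ i * N * E ^+ (m - i.+1).
Proof.
move=> NN; elim=> [|m IH] mn; first by rewrite !expr0 big_ord0 addr0.
rewrite exprS IH ?(ltnW mn) // mulrDl !mulrDr -exprS big_ord_recl expr0 mul1r subSS subn0.
rewrite [X in _ + X](_ : _ = N * E ^+ m); last first.
  rewrite mulr_sumr big1 ?addr0 // => i _; rewrite !mulrA NN ?mul0r //.
  by apply: leq_ltn_trans mn; rewrite ltn_ord.
rewrite -addrA; congr (_ + _); rewrite addrC; congr (_ + _).
rewrite mulr_sumr; apply: eq_bigr => i _.
by rewrite lift0 subSS exprS !mulrA.
Qed.

(** Cancelling [e] is impossible here, but [E' - E] is then divisible by [F ^+ (l - 1)] and the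
    expansion of [E' ^+ l] stops after the linear terms. Each of these is one summand of
    [casimir_derivative]. *)
Lemma sl2_flow_nilpotent : e = 0 ->
  E' ^+ l = E ^+ l - io s * K ^+ l + io (lam2 ^- l * s) * Ki ^+ l.
Proof.
move=> e0; have lam1 : lam2 = 1 by rewrite lamE e0 mulr0 addr0.
have Fl0 : F ^+ l = 0 by rewrite Fl e0 rmorph0.
pose kap := k 1 * Ki - k (-1) * K.
pose nrm x := exists y, x * F ^+ (l - 1) = F ^+ (l - 1) * y.
have nM x y : nrm x -> nrm y -> nrm (x * y).
  by case=> x' hx [y' hy]; exists (x' * y'); rewrite -mulrA hy !mulrA hx.
have nB x y : nrm x -> nrm y -> nrm (x - y).
  by case=> x' hx [y' hy]; exists (x' - y'); rewrite mulrBl hx hy mulrBr.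
have nk i : nrm (k i) by exists (k i); rewrite qc_comm.
have nK : nrm K.
  by exists (k (-2 * (l - 1)%N%:Z) * K); rewrite (comm_k_pow ioC p_prim KF) !mulrA qc_comm.
have nKi : nrm Ki.
  by exists (k (2 * (l - 1)%N%:Z) * Ki); rewrite (comm_k_pow ioC p_prim KiF) !mulrA qc_comm.
have nC : nrm Cs by exists Cs; apply/commrX/CsF.
have ncas j : nrm (cas j) by apply: (nB); [apply: nB => //; apply: nM | apply: nM].
have nkap : nrm kap by apply: nB; apply: nM.
have E'E : E' = E + kap * Z by rewrite /E' lam1 invr1 rmorph1 mulr1.
have TC x : io t * x = x * io t := ioC t x.
have NN i : (i.+1 < l)%N -> kap * Z * E ^+ i * (kap * Z) = 0.
  (* [F ^+ i * E ^+ i] is a product of Casimir factors and can be moved across [F ^+ (l - 1)]; at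
     least [l] letters [F] then stand together. *)
  move=> il; have [y hy] : nrm (F ^+ i * E ^+ i * kap).
    apply: (nM _ _ _ nkap); rewrite prod_FE; last by lia.
    elim/big_rec: _ => [|j x _ nx]; last exact: nM.
    by exists 1; rewrite mul1r mulr1.
  have W0 : F ^+ (l - 1) * E ^+ i * kap * F ^+ (l - 1) = 0.
    have -> : F ^+ (l - 1) * E ^+ i = F ^+ (l - 1 - i) * (F ^+ i * E ^+ i).
      by rewrite mulrA -exprD subnK //; lia.
    rewrite -!mulrA [F ^+ i * _]mulrA [F ^+ i * _ * _]mulrA hy mulrA -exprD.
    have -> : (l - 1 - i + (l - 1) = l + (l - 2 - i))%N by lia.
    by rewrite exprD Fl0 !mul0r.
  transitivity (kap * io t * io t * (F ^+ (l - 1) * E ^+ i * kap * F ^+ (l - 1))).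
    rewrite /Z; nc ioC p0 [:: kap; io t; F ^+ (l - 1); E ^+ i]
      (tt, esym (TC kap), esym (TC (F ^+ (l - 1))), esym (TC (E ^+ i))).
  by rewrite W0 mulr0.
rewrite E'E (pow_add_sparse NN) // -addrA; congr (_ + _).
have term (i : 'I_l) : E ^+ i * (kap * Z) * E ^+ (l - i.+1) =
   io t * (\prod_(j < i) cas j%:Z * (k (1 + 2 * i%:Z) * Ki - k (-1 - 2 * i%:Z) * K) *
     \prod_(i.+1 <= j < l) cas j%:Z).
  have il := ltn_ord i.
  have -> : \prod_(i.+1 <= j < l) cas j%:Z = F ^+ (l - i.+1) * E ^+ (l - i.+1).
    by rewrite prod_FE ?leq_subr // subKn.
  set d := _ - k (-1 - _) * K.
  have dP : \prod_(j < i) cas j%:Z * d = d * \prod_(j < i) cas j%:Z.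
    apply/esym/commr_prod => j _; rewrite /d /cas_factor.
    have c1 := qc_comm ioC p (-1 - 2 * i%:Z); have c2 := qc_comm ioC p (1 + 2 * i%:Z).
    have c3 := qc_comm ioC p (-1 - 2 * j%:Z); have c4 := qc_comm ioC p (1 + 2 * j%:Z).
    have CK := CsK; have CKi := CsKi.
    move: Cs (k (-1 - 2 * i%:Z)) (k (1 + 2 * i%:Z)) (k (-1 - 2 * j%:Z)) (k (1 + 2 * j%:Z)) CK CKi c1 c2 c3 c4.
    move=> D x1 x2 x3 x4 CK CKi c1 c2 c3 c4; rewrite /GRing.comm.
    nc ioC p0 [:: D; K; Ki; x1; x2; x3; x4] (tt, esym CK, esym CKi, KKi, KiK,
     c1 D, c2 D, c3 D, c4 D, c1 K, c2 K, c3 K, c4 K, c1 Ki, c2 Ki, c3 Ki, c4 Ki,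
     c2 x1, c3 x1, c4 x1, c3 x2, c4 x2, c4 x3).
  rewrite dP -prod_EF_cas.
  have Ek : E ^+ i * kap = d * E ^+ i.
    have EK : K * E = k 2 * E * K := KE.
    have pow c x : x * E = k c * E * x -> E ^+ i * x = k (- c * i%:Z) * x * E ^+ i.
      move=> xE; rewrite -[RHS]mulrA (comm_k_pow ioC p_prim xE) !mulrA -(qcD io p_prim).
      by rewrite mulNr addNr qc0 mul1r.
    rewrite /kap /d mulrBr [E ^+ i * (_ * Ki)]mulrA -(qc_comm ioC) -mulrA (pow _ _ KiE).
    rewrite [E ^+ i * (_ * K)]mulrA -(qc_comm ioC) -[_ * _ * K]mulrA (pow _ _ KE).
    rewrite !mulrA -!(qcD io p_prim) mulrBl.
    by congr (k _ * _ * _ - k _ * _ * _); ring.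
  rewrite mulrA Ek /Z.
  have -> : F ^+ (l - 1) = F ^+ i * F ^+ (l - i.+1) by rewrite -exprD; congr (_ ^+ _); lia.
  nc ioC p0 [:: d; io t; E ^+ i; F ^+ i; F ^+ (l - i.+1); E ^+ (l - i.+1)]
    (tt, TC d, TC (E ^+ i), TC (F ^+ i), TC (F ^+ (l - i.+1)), TC (E ^+ (l - i.+1))).
under eq_bigr => i _ do rewrite term.
rewrite -mulr_sumr casimir_derivative.
have sE : s = t * l%:R.
  by rewrite /s lam1; under eq_bigr => j _ do rewrite expr1n; rewrite sumr_const card_ord.
rewrite lam1 expr1n invr1 mul1r sE rmorphM rmorph_nat mulrBr mulrBr -!mulrA.
by rewrite addrC mulrA.
Qed.

Lemma sl2_flow : E' ^+ l = E ^+ l - io s * K ^+ l + io (lam2 ^- l * s) * Ki ^+ l.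
Proof. by have [/sl2_flow_nilpotent|/sl2_flow_regular] := eqVneq e 0. Qed.

End SL2.

(** * Action of the flows on l-th powers *)

Section FlowPowers.
Variables (C : fieldType) (B : nzRingType) (io : {rmorphism C -> B}).
Hypothesis ioC : forall c x, io c * x = x * io c.
Variables (q : C) (l : nat).
Hypotheses (l_odd : odd l) (l_gt1 : (1 < l)%N) (q_prim : l.-primitive_root q).
Local Notation k := (qc io q).
Let q0 : q != 0 := prim_neq0 q_prim.
Variables (a b yE hE f g yF hF w0 w1 v0 v1 : B).
Hypothesis U : UQ io q a b yE hE f g yF hF w0 w1 v0 v1.
Variables (A Bb Ye He e G Yf Hf c0 c1 : C).
Hypotheses (al : a ^+ l = io A) (bl : b ^+ l = io Bb) (yEl : yE ^+ l = io Ye)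
  (hEl : hE ^+ l = io He) (gl : g ^+ l = io G) (fl : f ^+ l = io e)
  (yFl : yF ^+ l = io Yf) (hFl : hF ^+ l = io Hf) (w0l : w0 ^+ l = io c0)
  (w1l : w1 ^+ l = io c1) (c00 : c0 != 0) (c10 : c1 != 0).
Variables (t lam : C).
Hypothesis lam0 : lam != 0.

Let qV_prim : l.-primitive_root q^-1.
Proof. exact: (prim_exprz q_prim (i := -1) (coprime1n l)). Qed.

Lemma qc_inv i : qc io q^-1 i = k (- i).
Proof. by rewrite /qc exprz_inv. Qed.

Lemma qc_expz (c i : int) : qc io (q ^ c) i = k (c * i).
Proof. by rewrite /qc exprz_exp. Qed.

Lemma io_pow_inv w v c : c != 0 -> w * v = 1 -> v * w = 1 -> w ^+ l = io c -> v ^+ l = io c^-1.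
Proof.
move=> c0' wv vw wl; apply: (@io_reg _ _ io c) => //.
by rewrite -rmorphM divff // rmorph1 -wl -exprMn_comm ?wv ?expr1n // /GRing.comm wv.
Qed.

Lemma pow_qcomm (x y : B) c m : y * x = k (2 * c) * x * y ->
  (x * y) ^+ m = k (c * (m%:Z * (m%:Z - 1))) * x ^+ m * y ^+ m.
Proof.
move=> yx; elim: m => [|m IH]; first by rewrite !expr0 mul0r mulr0 qc0 !mulr1.
rewrite exprS IH -!mulrA [y * (k _ * _)]mulrA -qc_comm // -!mulrA [y * (_ * _)]mulrA.
rewrite (comm_k_pow ioC q_prim yx) !mulrA -[x * k _]qc_comm // -[k _ * x * k _]mulrA -[x * k _]qc_comm //.
rewrite !mulrA -(qcD io q_prim) -[k _ * x * x ^+ m]mulrA -exprS -[_ * y * y ^+ m]mulrA -exprS.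
by congr (k _ * _ * _); rewrite -[m.+1]addn1 PoszD; ring.
Qed.

Let kl c i : (i <= l)%N -> k (c * ((l - i)%N%:Z * ((l - i)%N%:Z - 1))) = k (c * (i%:Z * (i%:Z + 1))).
Proof.
move=> il; rewrite -subzn //.
have -> : c * ((l%:Z - i%:Z) * (l%:Z - i%:Z - 1)) =
  c * (i%:Z * (i%:Z + 1)) + (c * (l%:Z - 2 * i%:Z - 1)) * l%:Z by ring.
by rewrite (qcD io q_prim) (qcl io q_prim) mulr1.
Qed.

Lemma sum_expV (x : C) : x != 0 -> \sum_(j < l) x^-1 ^+ j = x ^- l * x * \sum_(j < l) x ^+ j.
Proof.
move=> x0; rewrite (reindex_inj rev_ord_inj) mulr_sumr; apply: eq_bigr => j _ /=.
apply: (mulfI (expf_neq0 l x0)); rewrite !mulrA mulfV ?expf_neq0 // mul1r -exprS.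
by rewrite exprVn -{1}(subnK (ltn_ord j)) exprD mulrAC mulfV ?expf_neq0 // mul1r.
Qed.

Section Flow0.
Hypothesis lamf : lam * lam = 1 + t * e.
Let Lam := lam * lam.
Let s := t * \sum_(j < l) Lam ^+ j.
Let kap := c0 ^+ 2 / c1.
Let Lam0 : Lam != 0. Proof. by rewrite mulf_neq0. Qed.

Lemma uq_K0l : (w0 * w0 * v1) ^+ l = io kap /\ (v0 * v0 * w1) ^+ l = io kap^-1.
Proof.
have v0l := io_pow_inv c00 (uq_w0v0 U) (uq_v0w0 U) w0l.
have v1l := io_pow_inv c10 (uq_w1v1 U) (uq_v1w1 U) w1l.
have e1 : GRing.comm (w0 * w0) v1 by apply/commr_sym/commrM; apply: (uq_v1w0 U).
have e2 : GRing.comm (v0 * v0) w1 by apply/commr_sym/commrM; apply/commr_sym/(uq_v0w1 U).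
split; rewrite exprMn_comm // exprMn_comm // ?w0l ?v0l ?w1l ?v1l -!rmorphM /kap.
  by congr (io _); rewrite expr2.
by congr (io _); rewrite invf_div expr2 invfM mulrC.
Qed.

Let fLE : fL io l t f = io Lam. Proof. by rewrite /fL fl -rmorphM -[1](rmorph1 io) -rmorphD /Lam lamf. Qed.
Let fsE : fs io l t f = io s.
Proof.
rewrite /fs fLE /s rmorphM rmorph_sum; congr (_ * _); apply: eq_bigr => j _.
by rewrite rmorphXn.
Qed.

Lemma flow0_F_pow :
  [/\ flow0_g io q l f g yF hF t lam ^+ l = io (Lam ^- l * (G + 2 * s * Yf + s ^+ 2 * Hf)),
      flow0_yF io q l f yF hF t ^+ l = io (Yf + s * Hf)
    & flow0_hF io hF lam ^+ l = io (Lam ^+ l * Hf)].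
Proof.
have [_ [_ [_ [_ [_ [/= p1 [/= p2 _]]]]]]] := uq_short_flow ioC l_odd l_gt1 q_prim U t.
rewrite fsE yFl hFl gl -!rmorphM -!rmorphD in p1 p2.
split.
- have -> : flow0_g io q l f g yF hF t lam = io Lam^-1 * short_g io q l t f g yF hF.
    by rewrite /flow0_g /short_g /shortg fLE rmorphM invfM rmorphM.
  rewrite exprMn_comm; last exact: ioC.
  rewrite p2 -rmorphXn -rmorphM exprVn; congr (io (_ * _)); ring.
- by rewrite [LHS]p1.
by rewrite /flow0_hF -rmorphM exprMn_comm ?hFl -?rmorphXn -?rmorphM; last exact: ioC.
Qed.

Lemma flow0_a_pow : flow0_a io q l a f w0 w1 v0 v1 t lam ^+ l =
  io (A - s * kap + Lam ^- l * s / kap).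
Proof.
have [K0l K0il] := uq_K0l.
have e1 : (w0 * w0 * v1) * f = k (-2) * f * (w0 * w0 * v1).
  nc ioC q0 [:: f; w0; v1] (tt, uq_w0f U, uq_v1f U).
have e2 : (v0 * v0 * w1) * f = k 2 * f * (v0 * v0 * w1).
  nc ioC q0 [:: f; v0; w1] (tt, uq_v0f ioC q_prim U, uq_w1f U).
have e3 : (w0 * w0 * v1) * a = k 2 * a * (w0 * w0 * v1).
  nc ioC q0 [:: a; w0; v1] (tt, uq_w0a U, uq_v1a U).
have e4 : (v0 * v0 * w1) * a = k (-2) * a * (v0 * v0 * w1).
  nc ioC q0 [:: a; v0; w1] (tt, uq_v0a ioC q_prim U, uq_w1a U).
have r := (uq_w0v0 U, uq_v0w0 U, uq_w1v1 U, uq_v1w1 U).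
have e5 : (w0 * w0 * v1) * (v0 * v0 * w1) = 1.
  nc ioC q0 [:: w0; v0; w1; v1] (tt, uq_w0v0 U, uq_v0w0 U, uq_w1v1 U, uq_v1w1 U, uq_v1v0 U).
have e6 : (v0 * v0 * w1) * (w0 * w0 * v1) = 1.
  nc ioC q0 [:: w0; v0; w1; v1] (tt, uq_w0v0 U, uq_v0w0 U, uq_w1v1 U, uq_v1w1 U, uq_w1w0 U).
have := sl2_flow ioC l_odd l_gt1 q_prim (uq_af U) e1 e2 e3 e4 e5 e6 fl lamf Lam0.
rewrite al K0l K0il => E; rewrite rmorphD rmorphB [io (s * _)]rmorphM [io (_ / kap)]rmorphM.
rewrite -E; congr (_ ^+ l); by rewrite /flow0_a /Lam invfM rmorphM !mulrA.
Qed.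

(** Up to scalars this is the image of the positive part under the reflection in the short simple
    root. It turns the effect of the flow on [yE] and [hE] into a short flow with parameter [q^-1],
    so that their l-th powers are given by [short_flow]. *)
Lemma flow0_hat : IQ io q^-1 (f * (w0 * w0 * v1)) hE (- k 2 * yE) (k 2 * b).
Proof.
have E := uq_E U.
split; rewrite !qc_inv ?opprK; nc ioC q0 [:: f; b; yE; hE; w0; v0; w1; v1]
 (tt, uq_w0f U, uq_v1f U, uq_w0b U, uq_v1b ioC q_prim U, uq_w0hE ioC l_odd l_gt1 q_prim U,
  uq_v1hE ioC l_odd l_gt1 q_prim U, uq_w0yE ioC l_odd l_gt1 q_prim U, uq_v1yE ioC l_odd l_gt1 q_prim U,
  uq_hEf ioC l_odd l_gt1 q_prim U, uq_yEf ioC l_odd l_gt1 q_prim U, uq_bf U,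
  iq_gy E, iq_yh E, iq_gh E, uq_w0v0 U, uq_v0w0 U, uq_w1v1 U, uq_v1w1 U, uq_w1w0 U, uq_v1w0 U).
Qed.

Lemma flow0_E_pow :
  flow0_yE io q l b yE f w1 v0 t lam ^+ l = io (Ye + Lam ^- l * s / kap * Bb) /\
  flow0_hE io q l b yE hE f w1 v0 t lam ^+ l =
    io (He + 2 * (Lam ^- l * s / kap) * Ye + (Lam ^- l * s / kap) ^+ 2 * Bb).
Proof.
have [K0l K0il] := uq_K0l; have kap0 : kap != 0 by rewrite mulf_neq0 ?expf_neq0 ?invr_neq0.
pose K := w0 * w0 * v1; pose Ki := v0 * v0 * w1; pose fh := f * K.
have KKi : K * Ki = 1.
  rewrite /K /Ki; nc ioC q0 [:: w0; v0; w1; v1] (tt, uq_w0v0 U, uq_v0w0 U, uq_w1v1 U, uq_v1w1 U, uq_v1v0 U).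
have KiK : Ki * K = 1.
  rewrite /K /Ki; nc ioC q0 [:: w0; v0; w1; v1] (tt, uq_w0v0 U, uq_v0w0 U, uq_w1v1 U, uq_v1w1 U, uq_w1w0 U).
have Kf : K * f = k (2 * -1) * f * K by rewrite /K; nc ioC q0 [:: f; w0; v1] (tt, uq_w0f U, uq_v1f U).
have Kif : Ki * f = k 2 * f * Ki by rewrite /Ki; nc ioC q0 [:: f; v0; w1] (tt, uq_v0f ioC q_prim U, uq_w1f U).
have Kb : K * b = k (-2) * b * K.
  by rewrite /K; nc ioC q0 [:: b; w0; v1] (tt, uq_w0b U, uq_v1b ioC q_prim U).
have KhE : K * hE = k 2 * hE * K.
  by rewrite /K; nc ioC q0 [:: hE; w0; v1] (tt, uq_w0hE ioC l_odd l_gt1 q_prim U, uq_v1hE ioC l_odd l_gt1 q_prim U).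
have Kv : K * (v0 * v0) = v0 * v0 * K.
  by rewrite /K; nc ioC q0 [:: w0; v0; v1] (tt, uq_w0v0 U, uq_v0w0 U, uq_v1v0 U).
have vf : v0 * v0 * fh = k 2 * fh * (v0 * v0).
  by rewrite /fh /K; nc ioC q0 [:: f; w0; v0; v1] (tt, uq_w0v0 U, uq_v0w0 U, uq_v1v0 U, uq_v0f ioC q_prim U).
have vh : v0 * v0 * hE = k (-4) * hE * (v0 * v0).
  by nc ioC q0 [:: hE; v0] (tt, uq_v0hE ioC l_odd l_gt1 q_prim U).
have Kfh : K * fh = k (-2) * fh * K by rewrite /fh; nc ioC q0 [:: f; K] (tt, Kf).
have vw : v0 * v0 * (w0 * w0) = 1 by nc ioC q0 [:: w0; v0] (tt, uq_w0v0 U, uq_v0w0 U).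
have wv : w0 * w0 * (v0 * v0) = 1 by nc ioC q0 [:: w0; v0] (tt, uq_w0v0 U, uq_v0w0 U).
(* As [fh ^+ l = e * kap], this time makes [1 + th * fh ^+ l] equal to [Lam^-1]. *)
pose th := - (t / (Lam * kap)).
have R c x y w : w * x = k c * y * w -> w * x = qc io q^-1 (- c) * y * w by rewrite qc_inv opprK.
have [_ [_ [_ [_ [_ [/= p1 [/= p2 _]]]]]]] := short_flow ioC l_odd l_gt1 qV_prim flow0_hat
  (R _ _ _ _ Kfh) (R _ _ _ _ KhE) (R _ _ _ _ vf) (R _ _ _ _ vh) Kv KKi KiK vw wv th.
have l3 := l_gt2 l_odd l_gt1.
have fhl : fh ^+ l = io (e * kap).
  rewrite (pow_qcomm l Kf) [k _](_ : _ = 1) ?mul1r ?fl ?K0l ?rmorphM //.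
  by rewrite mulrCA mulrC; exact: (qcl io q_prim).
have LhE : fL io l th fh = io Lam^-1.
  rewrite /fL fhl -rmorphM -[1](rmorph1 io) -rmorphD; congr (io _).
  have -> : th * (e * kap) = - (t * e) / Lam by rewrite /th; field; rewrite ?Lam0 ?kap0.
  have -> : t * e = Lam - 1 by rewrite /Lam lamf addrC addKr.
  by field.
have sh : fs io l th fh = io (- (Lam ^- l * s / kap)).
  rewrite /fs LhE (_ : \sum_(j < l) io Lam^-1 ^+ j = io (\sum_(j < l) Lam^-1 ^+ j)); last first.
    by rewrite rmorph_sum; apply: eq_bigr => j _; rewrite rmorphXn.
  rewrite -rmorphM sum_expV // /th /s; congr (io _).
  by field; rewrite ?Lam0 ?kap0 expf_neq0 ?Lam0.
have KX i : (i <= l)%N -> K ^+ (l - i) = io kap * Ki ^+ i.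
  move=> il; have Kii : K ^+ i * Ki ^+ i = 1.
    by rewrite -exprMn_comm ?KKi ?expr1n // /GRing.comm KKi.
  by rewrite -K0l -[in RHS](subnK il) exprD -mulrA Kii mulr1.
have Z i : (i <= l)%N -> fZ io l th fh i =
    - io Lam^-1 * k (-1 * (i%:Z * (i%:Z + 1))) * (io t * f ^+ (l - i)) * Ki ^+ i.
  move=> il; rewrite /fZ (pow_qcomm _ Kf) kl // KX // /th.
  rewrite (_ : io (- (t / (Lam * kap))) = - io Lam^-1 * io t * io kap^-1); last first.
    by rewrite !mulNr -!rmorphM -rmorphN; congr (io _); field; rewrite ?Lam0 ?kap0.
  have kk : io kap^-1 * io kap = 1 by rewrite -rmorphM mulVf // rmorph1.
  have ck1 x := ioC kap x; have ck4 x := ioC kap^-1 x; have ck2 x := ioC t x; have ck3 x := ioC Lam^-1 x.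
  move: (k _) (qc_comm ioC q (-1 * (i%:Z * (i%:Z + 1)))) => u uC.
  nc ioC q0 [:: u; io Lam^-1; io t; io kap^-1; io kap; f ^+ (l - i); Ki ^+ i]
   (tt, kk, ck4 u, ck4 (f ^+ (l - i)), ck1 (f ^+ (l - i)), ck1 u, uC (f ^+ (l - i)), uC (io Lam^-1), uC (io t), ck2 (io Lam^-1), ck2 (f ^+ (l - i)),
    ck3 (f ^+ (l - i))).
have v0X i : (i <= l)%N -> v0 * f ^+ (l - i) = k (- i%:Z) * f ^+ (l - i) * v0.
  move=> il; rewrite (comm_k_pow ioC q_prim (uq_v0f ioC q_prim U)) mul1r -subzn //.
  by rewrite -{1}[l%:Z]mul1r (qcD io q_prim) (qcl io q_prim) mul1r.
have w1X i : w1 * f ^+ (l - i) = f ^+ (l - i) * w1 by apply/commrX/(uq_w1f U).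
have LL : io Lam^-1 = io lam^-1 * io lam^-1 by rewrite -rmorphM /Lam invfM.
have ck2 x := ioC t x; have ck3 x := ioC lam^-1 x.
have bX i : b * f ^+ (l - i) = f ^+ (l - i) * b by apply/commrX/(uq_bf U).
have vx1 := v0X 1%N (ltnW l_gt1); have vx2 := v0X 2%N (ltnW l3).
have yE' : short_y io q^-1 l th fh (- k 2 * yE) (k 2 * b) = - k 2 * flow0_yE io q l b yE f w1 v0 t lam.
  rewrite /short_y /shorty Z ?(ltnW l_gt1) // qc_inv opprK /flow0_yE expr1 /Ki LL /fZ.
  nc ioC q0 [:: b; yE; io t; f ^+ (l - 1); v0; w1; io lam^-1]
    (tt, vx1, w1X 1%N, bX 1%N, esym (ck2 b), esym (ck2 yE), esym (ck2 v0), esym (ck2 w1), esym (ck2 (f ^+ (l - 1))),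
     ck3 b, ck3 (f ^+ (l - 1)), ck3 v0, ck3 w1, ck3 yE, ck3 (io t), esym (uq_v0w1 U)).
have hE' : short_g io q^-1 l th fh hE (- k 2 * yE) (k 2 * b) = flow0_hE io q l b yE hE f w1 v0 t lam.
  rewrite /short_g /shortg LhE !Z ?(ltnW l_gt1) ?(ltnW l3) // !qc_inv opprK /flow0_hE expr1 expr2 /Ki LL /fZ.
  nc ioC q0 [:: b; yE; hE; io t; f ^+ (l - 1); f ^+ (l - 2); v0; w1; io lam^-1]
    (tt, vx1, vx2, w1X 1%N, w1X 2%N, bX 1%N, bX 2%N, esym (ck2 b), esym (ck2 yE), esym (ck2 v0), esym (ck2 w1),
     esym (ck2 (f ^+ (l - 1))), esym (ck2 (f ^+ (l - 2))), ck3 (f ^+ (l - 2)),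
     ck3 b, ck3 (f ^+ (l - 1)), ck3 v0, ck3 w1, ck3 yE, ck3 (io t), esym (uq_v0w1 U)).
rewrite yE' sh in p1; rewrite hE' sh in p2.
have kx c x : (k c * x) ^+ l = x ^+ l.
  by rewrite exprMn_comm ?(qcX io) ?(qcl io q_prim) ?mul1r //; apply: qc_comm.
have nx c x : (- k c * x) ^+ l = - x ^+ l.
  by rewrite mulNr exprNn kx -signr_odd l_odd expr1 mulN1r.
rewrite !nx !kx yEl bl in p1 p2; rewrite hEl in p2.
split; first by apply: oppr_inj; rewrite p1 -rmorphM -!rmorphN -rmorphD; congr (io _); ring.
by rewrite p2 !mulrN -!rmorphM -!rmorphN -!rmorphD; congr (io _); ring.
Qed.
End Flow0.

Section Flow1.
Hypothesis lamg : lam * lam = 1 + t * G.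
Let Lam := lam * lam.
Let s := t * \sum_(j < l) Lam ^+ j.
Let kap := c1 ^+ 2 / c0 ^+ 2.
Let Lam0 : Lam != 0. Proof. by rewrite mulf_neq0. Qed.
Let l3 := l_gt2 l_odd l_gt1.
Let K := v0 * v0 * w1 * w1.
Let Ki := w0 * w0 * v1 * v1.

Lemma uq_K1l : K ^+ l = io kap /\ Ki ^+ l = io kap^-1.
Proof.
have v0l := io_pow_inv c00 (uq_w0v0 U) (uq_v0w0 U) w0l.
have v1l := io_pow_inv c10 (uq_w1v1 U) (uq_v1w1 U) w1l.
have E1 : GRing.comm (w0 * w0) v1 by apply/commr_sym/commrM; apply: (uq_v1w0 U).
have E2 : GRing.comm (v0 * v0) w1 by apply/commr_sym/commrM; apply/commr_sym/(uq_v0w1 U).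
have E3 : GRing.comm (w0 * w0 * v1) v1 by apply/commr_sym/commrM => //; apply/commr_sym.
have E4 : GRing.comm (v0 * v0 * w1) w1 by apply/commr_sym/commrM => //; apply/commr_sym.
rewrite /K /Ki; split; rewrite exprMn_comm // exprMn_comm // exprMn_comm // ?w0l ?v0l ?w1l ?v1l -!rmorphM /kap.
  by congr (io _); field.
by congr (io _); field; rewrite c00.
Qed.

Let gLE : fL io l t g = io Lam. Proof. by rewrite /fL gl -rmorphM -[1](rmorph1 io) -rmorphD /Lam lamg. Qed.
Let gsE : fs io l t g = io s.
Proof.
rewrite /fs gLE /s rmorphM rmorph_sum; congr (_ * _); apply: eq_bigr => j _.
by rewrite rmorphXn.
Qed.

Lemma flow1_F_pow :
  [/\ flow1_f io q l f g yF t lam ^+ l = io (lam ^- l * (Lam ^+ l * e - s * Yf)),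
      flow1_yF io yF lam ^+ l = io (lam ^- l * Yf)
    & flow1_hF io q l g yF hF t lam ^+ l = io (Lam ^- l * (Lam ^+ l * Hf - s * Yf ^+ 2))].
Proof.
have [_ [_ [_ [_ [_ [/= p1 [/= p2 _]]]]]]] := uq_long_flow ioC l_odd l_gt1 q_prim U t.
rewrite gsE gLE yFl hFl -rmorphXn -!rmorphM -!rmorphB in p1; rewrite gsE gLE yFl fl -rmorphXn -!rmorphM -!rmorphB in p2.
have Lx c x : (io c * x) ^+ l = io (c ^+ l) * x ^+ l by rewrite exprMn_comm ?rmorphXn //; apply: ioC.
split.
- have -> : flow1_f io q l f g yF t lam = io lam^-1 * long_f io q l t f g yF.
    by rewrite /flow1_f /long_f /longf gLE [io Lam]rmorphM.
  by rewrite Lx p2 -rmorphM exprVn.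
- by rewrite /flow1_yF Lx yFl -rmorphM exprVn.
have -> : flow1_hF io q l g yF hF t lam = io Lam^-1 * long_h io q l t g yF hF.
  by rewrite /flow1_hF /long_h /longh gLE [io Lam]rmorphM /Lam invfM [io (_^-1 * _)]rmorphM.
by rewrite Lx p1 -rmorphM exprVn; congr (io _); ring.
Qed.

Let Kg : K * g = k (-4) * g * K.
Proof. rewrite /K; nc ioC q0 [:: g; v0; w1] (tt, uq_v0g U, uq_w1g U). Qed.
Let Kig : Ki * g = k (2 * 2) * g * Ki.
Proof. rewrite /Ki; nc ioC q0 [:: g; w0; v1] (tt, uq_w0g U, uq_v1g ioC q_prim U). Qed.
Let Kb : K * b = k 4 * b * K.
Proof. rewrite /K; nc ioC q0 [:: b; v0; w1] (tt, uq_v0b U, uq_w1b U). Qed.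
Let Kib : Ki * b = k (-4) * b * Ki.
Proof. rewrite /Ki; nc ioC q0 [:: b; w0; v1] (tt, uq_w0b U, uq_v1b ioC q_prim U). Qed.
Let KKi : K * Ki = 1.
Proof.
rewrite /K /Ki; nc ioC q0 [:: w0; v0; w1; v1] (tt, uq_w0v0 U, uq_v0w0 U, uq_w1v1 U, uq_v1w1 U,
  uq_v1v0 U, uq_w1w0 U, esym (uq_v0w1 U), uq_v1w0 U).
Qed.
Let KiK : Ki * K = 1.
Proof.
rewrite /K /Ki; nc ioC q0 [:: w0; v0; w1; v1] (tt, uq_w0v0 U, uq_v0w0 U, uq_w1v1 U, uq_v1w1 U,
  uq_v1v0 U, uq_w1w0 U, esym (uq_v0w1 U), uq_v1w0 U).
Qed.

Lemma flow1_b_pow : flow1_b io q l b g w0 w1 v0 v1 t lam ^+ l =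
  io (Bb - s * kap + Lam ^- l * s / kap).
Proof.
have [K1l K1il] := uq_K1l.
have q2 : l.-primitive_root (q ^ 2) by apply: prim_exprz q_prim _ _; exact: coprime2l l_odd.
have R c x y w : w * x = k (2 * c) * y * w -> w * x = qc io (q ^ 2) c * y * w by rewrite qc_expz.
have bg : b * g = g * b + (qc io (q ^ 2) 1 - qc io (q ^ 2) (-1)) * (K - Ki).
  by rewrite !qc_expz (uq_bg U).
have := sl2_flow ioC l_odd l_gt1 q2 bg (R (-2) _ _ _ Kg) (R 2 _ _ _ Kig) (R 2 _ _ _ Kb) (R (-2) _ _ _ Kib)
  KKi KiK gl lamg Lam0.
rewrite bl K1l K1il !qc_expz => E; rewrite rmorphD rmorphB [io (s * _)]rmorphM [io (_ / kap)]rmorphM.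
by rewrite -E; congr (_ ^+ l); rewrite /flow1_b /Lam invfM rmorphM /K /Ki !mulrA.
Qed.

(** The reflection in the long simple root plays the same part: it sends the simple roots to those
    of [yE] and of [g * Ki], exchanges the roots of [a] and [yE], and fixes that of [hE]. *)
Lemma flow1_hat : IQ io q^-1 yE (g * Ki) (- k (-2) * a) (- k (-2) * hE).
Proof.
have E := uq_E U; rewrite /Ki.
split; rewrite !qc_inv ?opprK; nc ioC q0 [:: g; a; yE; hE; w0; v0; w1; v1]
 (tt, uq_w0g U, uq_v1g ioC q_prim U, uq_w0a U, uq_v1a U, uq_w0hE ioC l_odd l_gt1 q_prim U,
  uq_v1hE ioC l_odd l_gt1 q_prim U, uq_w0yE ioC l_odd l_gt1 q_prim U, uq_v1yE ioC l_odd l_gt1 q_prim U,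
  uq_hEg ioC l_odd l_gt1 q_prim U, uq_yEg ioC l_odd l_gt1 q_prim U, uq_ag U,
  uq_v0a ioC q_prim U, uq_w1a U, uq_v0yE ioC l_odd l_gt1 q_prim U, uq_w1yE ioC l_odd l_gt1 q_prim U,
  uq_v0hE ioC l_odd l_gt1 q_prim U, uq_w1hE ioC l_odd l_gt1 q_prim U,
  iq_fy E, iq_fh E, iq_yh E, uq_w0v0 U, uq_v0w0 U, uq_w1v1 U, uq_v1w1 U, uq_w1w0 U, uq_v1w0 U,
  uq_v1v0 U, esym (uq_v0w1 U)).
Qed.

Lemma flow1_E_pow :
  flow1_yE io q l a yE g w1 v0 t ^+ l = io (Ye - s * kap * A) /\
  flow1_hE io q l a hE g w1 v0 t ^+ l = io (He - s * kap * A ^+ 2).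
Proof.
have [K1l K1il] := uq_K1l; have kap0 : kap != 0 by rewrite mulf_neq0 ?invr_neq0 ?expf_neq0.
pose gh := g * Ki; pose th := - (t * kap / Lam).
have R c x y w : w * x = k c * y * w -> w * x = qc io q^-1 (- c) * y * w by rewrite qc_inv opprK.
have h1 : v1 * yE = k (-2) * yE * v1 := uq_v1yE ioC l_odd l_gt1 q_prim U.
have h2 : v1 * gh = k 2 * gh * v1.
  rewrite /gh /Ki; nc ioC q0 [:: g; w0; v1] (tt, uq_v1g ioC q_prim U, uq_v1w0 U).
have h3 : K * yE = k 2 * yE * K.
  rewrite /K; nc ioC q0 [:: yE; v0; w1] (tt, uq_v0yE ioC l_odd l_gt1 q_prim U, uq_w1yE ioC l_odd l_gt1 q_prim U).
have h4 : K * gh = k (-4) * gh * K by rewrite /gh; nc ioC q0 [:: g; K; Ki] (tt, Kg, KKi, KiK).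
have h5 : v1 * K = K * v1.
  rewrite /K; nc ioC q0 [:: v0; w1; v1] (tt, uq_v1v0 U, uq_v1w1 U, uq_w1v1 U).
have [_ [_ [_ [_ [_ [/= p1 [/= p2 _]]]]]]] := long_flow ioC l_odd l_gt1 qV_prim flow1_hat
  (R _ _ _ _ h1) (R _ _ _ _ h2) (R _ _ _ _ h3) (R _ _ _ _ h4) h5 (uq_v1w1 U) (uq_w1v1 U) KKi KiK th.
have ghl : gh ^+ l = io (G / kap).
  rewrite (pow_qcomm l Kig) [k _](_ : _ = 1) ?mul1r ?gl ?K1il ?rmorphM //.
  by rewrite mulrCA mulrC; exact: (qcl io q_prim).
have LhE : fL io l th gh = io Lam^-1.
  rewrite /fL ghl -rmorphM -[1](rmorph1 io) -rmorphD; congr (io _).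
  have -> : th * (G / kap) = - (t * G) / Lam by rewrite /th; field; rewrite ?Lam0 ?kap0.
  have -> : t * G = Lam - 1 by rewrite /Lam lamg addrC addKr.
  by field.
have sh : fs io l th gh = io (- (Lam ^- l * s * kap)).
  rewrite /fs LhE (_ : \sum_(j < l) io Lam^-1 ^+ j = io (\sum_(j < l) Lam^-1 ^+ j)); last first.
    by rewrite rmorph_sum; apply: eq_bigr => j _; rewrite rmorphXn.
  rewrite -rmorphM sum_expV // /th /s; congr (io _).
  by field; rewrite ?expf_neq0 ?Lam0.
have KX : Ki ^+ (l - 1) = io kap^-1 * K.
  have il := ltnW l_gt1.
  by rewrite -K1il -[in RHS](subnK il) exprD expr1 -mulrA KiK mulr1.
have Z : fZ io l th gh 1 = - io Lam^-1 * k 4 * (io t * g ^+ (l - 1)) * K.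
  rewrite /fZ (pow_qcomm _ Kig) kl ?(ltnW l_gt1) // KX /th.
  rewrite (_ : io (- (t * kap / Lam)) = - io Lam^-1 * io t * io kap); last first.
    by rewrite !mulNr -!rmorphM -rmorphN; congr (io _); field; rewrite ?Lam0.
  have kk : io kap * io kap^-1 = 1 by rewrite -rmorphM mulfV // rmorph1.
  have ck1 x := ioC kap x; have ck2 x := ioC t x; have ck3 x := ioC Lam^-1 x.
  nc ioC q0 [:: io Lam^-1; io t; io kap; io kap^-1; g ^+ (l - 1); K]
   (tt, kk, ck1 (g ^+ (l - 1))).
have v0X : v0 * g ^+ (l - 1) = g ^+ (l - 1) * v0 by apply/commrX/(uq_v0g U).
have aX : a * g ^+ (l - 1) = g ^+ (l - 1) * a by apply/commrX/(uq_ag U).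
have w1X : w1 * g ^+ (l - 1) = k 2 * g ^+ (l - 1) * w1.
  rewrite (comm_k_pow ioC q_prim (uq_w1g U)) -subzn ?(ltnW l_gt1) // mulrBr.
  by rewrite (qcD io q_prim) (qcl io q_prim) mul1r.
have LL : io Lam^-1 = io lam^-1 * io lam^-1 by rewrite -rmorphM /Lam invfM.
have L1 : io Lam^-1 * io Lam = 1 by rewrite -rmorphM mulVf // rmorph1.
have L1' : io Lam * io Lam^-1 = 1 by rewrite -rmorphM mulfV // rmorph1.
have ck2 x := ioC t x; have ck3 x := ioC Lam^-1 x.
have fE : long_f io q^-1 l th yE gh (- k (-2) * a) = io Lam^-1 * flow1_yE io q l a yE g w1 v0 t.
  rewrite /long_f /longf Z LhE !qc_inv /flow1_yE /K /fZ.
  nc ioC q0 [:: a; yE; io t; g ^+ (l - 1); v0; w1; io Lam^-1]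
    (tt, v0X, aX, w1X, esym (ck2 a), esym (ck2 yE), esym (ck2 v0), esym (ck2 w1), esym (ck2 (g ^+ (l - 1))),
     ck3 a, ck3 yE, ck3 (g ^+ (l - 1)), ck3 v0, ck3 w1, ck3 (io t)).
have hE' : long_h io q^-1 l th gh (- k (-2) * a) (- k (-2) * hE) =
   - k (-2) * (io Lam^-1 * flow1_hE io q l a hE g w1 v0 t).
  rewrite /long_h /longh Z LhE !qc_inv /flow1_hE /K /fZ.
  nc ioC q0 [:: a; hE; io t; g ^+ (l - 1); v0; w1; io Lam^-1]
    (tt, v0X, aX, w1X, esym (ck2 a), esym (ck2 hE), esym (ck2 v0), esym (ck2 w1), esym (ck2 (g ^+ (l - 1))),
     ck3 a, ck3 hE, ck3 (g ^+ (l - 1)), ck3 v0, ck3 w1, ck3 (io t)).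
rewrite hE' sh LhE in p1; rewrite fE sh LhE in p2.
have Lx c x : (io c * x) ^+ l = io (c ^+ l) * x ^+ l by rewrite exprMn_comm ?rmorphXn //; apply: ioC.
have kx c x : (k c * x) ^+ l = x ^+ l.
  by rewrite exprMn_comm ?(qcX io) ?(qcl io q_prim) ?mul1r //; apply: qc_comm.
have nx c x : (- k c * x) ^+ l = - x ^+ l.
  by rewrite mulNr exprNn kx -signr_odd l_odd expr1 mulN1r.
rewrite !nx !Lx hEl al in p1; rewrite nx Lx yEl al in p2.
have Ll : Lam^-1 ^+ l != 0 by rewrite expf_neq0 ?invr_neq0.
split; apply: (@io_reg _ _ io _ _ _ Ll).
  rewrite p2 -rmorphXn mulrN -!rmorphM -rmorphN -rmorphB; congr (io _); rewrite exprVn; ring.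
apply: oppr_inj; rewrite p1 -!rmorphXn -!rmorphN -!rmorphM -!rmorphN -!rmorphD.
by congr (io _); rewrite exprVn; ring.
Qed.
End Flow1.
End FlowPowers.

(** * The group element attached to the values of the l-th powers *)

Section Phi.
Variable C : fieldType.

Notation mx4 a11 a12 a13 a14 a21 a22 a23 a24 a31 a32 a33 a34 a41 a42 a43 a44 :=
  (mx_of_rows [:: [:: a11; a12; a13; a14]; [:: a21; a22; a23; a24];
                  [:: a31; a32; a33; a34]; [:: a41; a42; a43; a44]]).

Lemma mx4_mul (a11 a12 a13 a14 a21 a22 a23 a24 a31 a32 a33 a34 a41 a42 a43 a44
  b11 b12 b13 b14 b21 b22 b23 b24 b31 b32 b33 b34 b41 b42 b43 b44 : C) :
  mx4 a11 a12 a13 a14 a21 a22 a23 a24 a31 a32 a33 a34 a41 a42 a43 a44 *m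
  mx4 b11 b12 b13 b14 b21 b22 b23 b24 b31 b32 b33 b34 b41 b42 b43 b44 =
  mx4
  (a11 * b11 + a12 * b21 + a13 * b31 + a14 * b41) (a11 * b12 + a12 * b22 + a13 * b32 + a14 * b42)
  (a11 * b13 + a12 * b23 + a13 * b33 + a14 * b43) (a11 * b14 + a12 * b24 + a13 * b34 + a14 * b44)
  (a21 * b11 + a22 * b21 + a23 * b31 + a24 * b41) (a21 * b12 + a22 * b22 + a23 * b32 + a24 * b42)
  (a21 * b13 + a22 * b23 + a23 * b33 + a24 * b43) (a21 * b14 + a22 * b24 + a23 * b34 + a24 * b44)
  (a31 * b11 + a32 * b21 + a33 * b31 + a34 * b41) (a31 * b12 + a32 * b22 + a33 * b32 + a34 * b42)
  (a31 * b13 + a32 * b23 + a33 * b33 + a34 * b43) (a31 * b14 + a32 * b24 + a33 * b34 + a34 * b44)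
  (a41 * b11 + a42 * b21 + a43 * b31 + a44 * b41) (a41 * b12 + a42 * b22 + a43 * b32 + a44 * b42)
  (a41 * b13 + a42 * b23 + a43 * b33 + a44 * b43) (a41 * b14 + a42 * b24 + a43 * b34 + a44 * b44).
Proof.
apply/matrixP=> i j; rewrite !mxE !big_ord_recl big_ord0 !mxE /= addr0 !addrA.
by case: i => -[|[|[|[|]]]] //= _; case: j => -[|[|[|[|]]]] //= _.
Qed.

Lemma mx4_eta (X : 'M[C]_4) : X = mx4
  (X 0 0) (X 0 1) (X 0 2%:R) (X 0 3%:R) (X 1 0) (X 1 1) (X 1 2%:R) (X 1 3%:R)
  (X 2%:R 0) (X 2%:R 1) (X 2%:R 2%:R) (X 2%:R 3%:R) (X 3%:R 0) (X 3%:R 1) (X 3%:R 2%:R) (X 3%:R 3%:R).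
Proof.
apply/matrixP=> i j; rewrite mxE.
by case: i => -[|[|[|[|]]]] //= ?; case: j => -[|[|[|[|]]]] //= ?; congr (X _ _); apply: val_inj.
Qed.

(* The scalars by which the l-th powers of the root vectors, and of [w0], [w1],
   act; [phi] below is [Spec_to_G] in these coordinates. *)
Record zdata := ZData { zA : C; zB : C; zYe : C; zHe : C; zF : C; zG : C; zYf : C; zHf : C; zc0 : C; zc1 : C }.

(** A general element of [U], in the coordinates of the ordered product of root subgroups computed
    in [exp_plus]. *)
Definition unip_plus (u y h b : C) : 'M[C]_4 :=
  mx4 1 u y (h - u * y)  0 1 b (y - u * b)  0 0 1 (- u)  0 0 0 1.
Definition unip_minus (F Yf Hf G : C) : 'M[C]_4 :=
  mx4 1 0 0 0  F 1 0 0  (F * G - Yf) G 1 0  (Hf - F * Yf) (- Yf) (- F) 1.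
Definition diag4 (a b c d : C) : 'M[C]_4 :=
  mx4 a 0 0 0  0 b 0 0  0 0 c 0  0 0 0 d.

Definition phi (d : zdata) : 'M[C]_4 :=
  unip_minus (zF d) (zYf d) (zHf d) (zG d) *m
  diag4 (zc0 d ^+ 2) (zc1 d ^+ 2 / zc0 d ^+ 2) (zc0 d ^+ 2 / zc1 d ^+ 2) (zc0 d ^- 2) *m
  unip_plus (zA d / zc0 d ^+ 2 * zc1 d) (zYe d / zc1 d) (zHe d / zc0 d ^+ 2)
    (zB d * zc0 d ^+ 2 / zc1 d ^+ 2).

(** The effect of the first flow on the l-th powers, with [m = lam ^+ l] and [s] the value of [fs],
    so that [m ^+ 2 = 1 + s F]. *)
Definition flow0_data (d : zdata) (s m : C) : zdata :=
  let: ZData A B Ye He F G Yf Hf c0 c1 := d in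
  let kap := c0 ^+ 2 / c1 in let M := m ^+ 2 in let s' := M^-1 * s / kap in
  ZData (A - s * kap + M^-1 * s / kap) B (Ye + s' * B) (He + 2 * s' * Ye + s' ^+ 2 * B)
    F (M^-1 * (G + 2 * s * Yf + s ^+ 2 * Hf)) (Yf + s * Hf) (M * Hf) (m * c0) c1.

Definition flow1_data (d : zdata) (s m : C) : zdata :=
  let: ZData A B Ye He F G Yf Hf c0 c1 := d in
  let kap := c1 ^+ 2 / c0 ^+ 2 in let M := m ^+ 2 in
  ZData A (B - s * kap + M^-1 * s / kap) (Ye - s * kap * A) (He - s * kap * A ^+ 2)
    (m^-1 * (M * F - s * Yf)) G (m^-1 * Yf) (M^-1 * (M * Hf - s * Yf ^+ 2)) c0 (m * c1).

Definition xroot0 (s : C) := unip_plus s 0 0 0.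
Definition xroot1 (s : C) := unip_plus 0 0 0 s.

Ltac mx4_field := rewrite /phi /xroot0 /xroot1 /unip_plus /unip_minus /diag4 /= !mx4_mul;
  congr (mx4 _ _ _ _ _ _ _ _ _ _ _ _ _ _ _ _).

(** On the group the flow is conjugation by a simple root element times a torus element. The toral
    factor is later removed by rescaling the generators, in [Realized_undo]. *)
Lemma phi_flow0 d s m : zc0 d != 0 -> zc1 d != 0 -> m != 0 -> m ^+ 2 = 1 + s * zF d ->
  phi (flow0_data d s m) *m (diag4 m^-1 m m^-1 m *m xroot0 s) =
  diag4 m^-1 m m^-1 m *m xroot0 s *m phi d.
Proof.
case: d => A B Ye He F G Yf Hf c0 c1 /= c00 c10 m0.
(* The constraint expresses [s] through [m] only for nonzero [F]; otherwise it forces [m = 1] or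
   [m = -1] and leaves [s] free. *)
have [->|F0] := eqVneq F 0.
  rewrite mulr0 addr0 => m1; rewrite m1.
  have [->|->] : m = 1 \/ m = -1 by move/eqP: m1; rewrite sqrf_eq1 => /orP[]/eqP; [left|right].
    by mx4_field; field; rewrite ?c00 ?c10 ?oppr_eq0 ?oner_eq0.
  rewrite invrN1 invr1; by mx4_field; field; rewrite ?c00 ?c10 ?oppr_eq0 ?oner_eq0.
move=> E; have -> : s = (m ^+ 2 - 1) / F by rewrite E addrC addKr mulfK.
by mx4_field; field; rewrite ?c00 ?c10 ?m0 ?F0.
Qed.

Lemma phi_flow1 d s m : zc0 d != 0 -> zc1 d != 0 -> m != 0 -> m ^+ 2 = 1 + s * zG d ->
  phi (flow1_data d s m) *m (diag4 1 m^-1 m 1 *m xroot1 s) =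
  diag4 1 m^-1 m 1 *m xroot1 s *m phi d.
Proof.
case: d => A B Ye He F G Yf Hf c0 c1 /= c00 c10 m0.
have [->|G0] := eqVneq G 0.
  rewrite mulr0 addr0 => m1; rewrite m1.
  have [->|->] : m = 1 \/ m = -1 by move/eqP: m1; rewrite sqrf_eq1 => /orP[]/eqP; [left|right].
    by mx4_field; field; rewrite ?c00 ?c10 ?oner_eq0 ?oppr_eq0.
  rewrite invrN1 invr1; by mx4_field; field; rewrite ?c00 ?c10 ?oppr_eq0 ?oner_eq0.
move=> E; have -> : s = (m ^+ 2 - 1) / G by rewrite E addrC addKr mulfK.
by mx4_field; field; rewrite ?c00 ?c10 ?m0 ?G0.
Qed.

End Phi.

Record UQdata (C : fieldType) (B : nzRingType) (io : C -> B) (q : C) (l : nat) (d : zdata C)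
    (a b yE hE f g yF hF w0 w1 v0 v1 : B) : Prop := UQData {
  ud_UQ : UQ io q a b yE hE f g yF hF w0 w1 v0 v1;
  ud_a : a ^+ l = io (zA d); ud_b : b ^+ l = io (zB d);
  ud_yE : yE ^+ l = io (zYe d); ud_hE : hE ^+ l = io (zHe d);
  ud_f : f ^+ l = io (zF d); ud_g : g ^+ l = io (zG d);
  ud_yF : yF ^+ l = io (zYf d); ud_hF : hF ^+ l = io (zHf d);
  ud_w0 : w0 ^+ l = io (zc0 d); ud_w1 : w1 ^+ l = io (zc1 d);
  ud_c0 : zc0 d != 0; ud_c1 : zc1 d != 0 }.

Section Scale.
Variables (C : fieldType) (B : nzRingType) (io : {rmorphism C -> B}).
Hypothesis ioC : forall c x, io c * x = x * io c.
Variables (q : C) (q0 : q != 0).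
Lemma UQ_scale (a b yE hE f g yF hF w0 w1 v0 v1 : B) (x y : C) : x != 0 -> y != 0 ->
  UQ io q a b yE hE f g yF hF w0 w1 v0 v1 ->
  UQ io q (io x * a) (io y * b) (io (x * y) * yE) (io (x * x * y) * hE)
     (io x^-1 * f) (io y^-1 * g) (io (x * y)^-1 * yF) (io (x * x * y)^-1 * hF) w0 w1 v0 v1.
Proof.
move=> x0 y0 [E F h1 h2 h3 h4 h5 h6 h7 h8 h9 h10 h11 h12 h13 h14 h15 h16 h17].
have xC z := ioC x z; have yC z := ioC y z; have xC' z := ioC x^-1 z; have yC' z := ioC y^-1 z.
rewrite !invfM !rmorphM.
have xx : io x * io x^-1 = 1 by rewrite -rmorphM mulfV // rmorph1.
have yy : io y * io y^-1 = 1 by rewrite -rmorphM mulfV // rmorph1.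
have xx' : io x^-1 * io x = 1 by rewrite xC' xx.
have yy' : io y^-1 * io y = 1 by rewrite yC' yy.
move: (io x) (io y) (io x^-1) (io y^-1) xC yC xC' yC' xx yy xx' yy' => X Y Xi Yi xC yC xC' yC' xx yy xx' yy'.
split=> //; try split; nc ioC q0 [:: a; b; yE; hE; f; g; yF; hF; w0; w1; v0; v1; X; Y; Xi; Yi]
 (tt, h6, h7, h8, h9, h10, h11, h12, h13, h14, h15, h16, h17,
  iq_fg E, iq_fy E, iq_fh E, iq_gy E, iq_yh E, iq_gh E,
  iq_fg F, iq_fy F, iq_fh F, iq_gy F, iq_yh F, iq_gh F, xx, yy, xx', yy',
  xC a, xC b, xC yE, xC hE, xC f, xC g, xC yF, xC hF, xC w0, xC w1, xC v0, xC v1,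
  yC a, yC b, yC yE, yC hE, yC f, yC g, yC yF, yC hF, yC w0, yC w1, yC v0, yC v1,
  xC' a, xC' b, xC' yE, xC' hE, xC' f, xC' g, xC' yF, xC' hF, xC' w0, xC' w1, xC' v0, xC' v1,
  yC' a, yC' b, yC' yE, yC' hE, yC' f, yC' g, yC' yF, yC' hF, yC' w0, yC' w1, yC' v0, yC' v1,
  yC X, yC Xi, yC' X, yC' Xi).
Qed.
End Scale.

(** * Matrices realized by representations of a given dimension *)

Section Realize.
Variables (C : numClosedFieldType) (q : C) (l : nat).
Hypotheses (l_odd : odd l) (l_gt1 : (1 < l)%N) (q_prim : l.-primitive_root q).

Definition scm n : {rmorphism C -> 'M[C]_n.+1} := @scalar_mx C n.+1.
Lemma scmC n c x : scm n c * x = x * scm n c. Proof. by rewrite [LHS]mul_scalar_mx [RHS]mul_mx_scalar. Qed.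

Definition realizes n (d : zdata C) : Prop := exists a b yE hE f g yF hF w0 w1 v0 v1,
  UQdata (scm n) q l d a b yE hE f g yF hF w0 w1 v0 v1.

Let l_gt0 : (0 < l)%N := ltnW l_gt1.

(** This inverts the change of time: by geometric summation the two conditions amount to
    [lam ^+ (2 l) = 1 + s F]. For [F = 0] the sum has [l] terms equal to 1, whence [t = s / l]. *)
Lemma flow_parameters (s F : C) : 1 + s * F != 0 -> exists lam t,
  [/\ lam != 0, lam * lam = 1 + t * F & t * \sum_(j < l) (lam * lam) ^+ j = s].
Proof.
move=> nz; have [F0|F0] := eqVneq F 0.
  exists 1, (s / l%:R); rewrite oner_eq0 F0 mulr0 addr0 mulr1; split=> //.
  under eq_bigr => j _ do rewrite expr1n.
  by rewrite sumr_const card_ord mulfVK // pnatr_eq0 -lt0n.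
pose m := sqrtC (1 + s * F); pose lam := l.-root m.
have lamm : lam ^+ l = m by rewrite rootCK.
have m2 : m ^+ 2 = 1 + s * F by rewrite sqrtCK.
have m0 : m != 0 by apply: contraNneq nz => m00; rewrite -m2 m00 expr0n.
exists lam, ((lam * lam - 1) / F); split.
- by rewrite rootC_eq0.
- by rewrite mulfVK // addrC subrK.
apply: (mulIf F0); rewrite mulrAC mulfVK // -subrX1 -expr2 -exprM mulnC exprM lamm m2.
by rewrite addrC addKr.
Qed.

Lemma realizes_flow0 n d s : realizes n d -> 1 + s * zF d != 0 ->
  exists m, [/\ m != 0, m ^+ 2 = 1 + s * zF d & realizes n (flow0_data d s m)].
Proof.
move=> [a [b [yE [hE [f [g [yF [hF [w0 [w1 [v0 [v1 D]]]]]]]]]]]] nz.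
have [lam [t [lam0 lamt ts]]] := flow_parameters nz.
have [U al bl yEl hEl fl gl yFl hFl w0l w1l c00 c10] := D.
exists (lam ^+ l); have ml : (lam ^+ l) ^+ 2 = (lam * lam) ^+ l by rewrite -expr2 -!exprM mulnC.
split; [exact: expf_neq0| |].
  rewrite ml; apply/eqP; rewrite addrC -subr_eq; apply/eqP.
  by rewrite subrX1 -ts lamt addrAC subrr add0r mulrAC.
have LL : scm n lam * scm n lam = fL (scm n) l t f.
  by rewrite /fL fl -!rmorphM lamt rmorphD rmorph1.
have U' := flow0_UQ (@scmC n) l_odd l_gt1 q_prim U lam0 LL.
have [pg py ph] := flow0_F_pow (@scmC n) l_odd l_gt1 q_prim U gl fl yFl hFl lamt.
have pa := flow0_a_pow (@scmC n) l_odd l_gt1 q_prim U al fl w0l w1l c00 c10 lam0 lamt.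
have [pyE phE] := flow0_E_pow (@scmC n) l_odd l_gt1 q_prim U bl yEl hEl fl w0l w1l c00 c10 lam0 lamt.
do 12!eexists; split; first exact: U'.
all: case: d D al bl yEl hEl fl gl yFl hFl w0l w1l c00 c10 nz lamt pg py ph pa pyE phE {ml} =>
  A Bb Ye He F G Yf Hf c0 c1 /= D al bl yEl hEl fl gl yFl hFl w0l w1l c00 c10 nz lamt pg py ph pa pyE phE.
all: rewrite -?exprM ?(mulnC l 2) ?[lam ^+ (2 * l)]exprM ?expr2 //.
all: rewrite ?(pa, pyE, phE, pg, py, ph, ts) //.
- by rewrite exprMn_comm ?w0l -?rmorphXn -?rmorphM //; apply: scmC.
by rewrite mulf_neq0 ?expf_neq0.
Qed.

Lemma realizes_flow1 n d s : realizes n d -> 1 + s * zG d != 0 ->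
  exists m, [/\ m != 0, m ^+ 2 = 1 + s * zG d & realizes n (flow1_data d s m)].
Proof.
move=> [a [b [yE [hE [f [g [yF [hF [w0 [w1 [v0 [v1 D]]]]]]]]]]]] nz.
have [lam [t [lam0 lamt ts]]] := flow_parameters nz.
have [U al bl yEl hEl fl gl yFl hFl w0l w1l c00 c10] := D.
exists (lam ^+ l); have ml : (lam ^+ l) ^+ 2 = (lam * lam) ^+ l by rewrite -expr2 -!exprM mulnC.
split; [exact: expf_neq0| |].
  rewrite ml; apply/eqP; rewrite addrC -subr_eq; apply/eqP.
  by rewrite subrX1 -ts lamt addrAC subrr add0r mulrAC.
have LL : scm n lam * scm n lam = fL (scm n) l t g.
  by rewrite /fL gl -!rmorphM lamt rmorphD rmorph1.
have U' := flow1_UQ (@scmC n) l_odd l_gt1 q_prim U lam0 LL.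
have [pf py ph] := flow1_F_pow (@scmC n) l_odd l_gt1 q_prim U gl fl yFl hFl lamt.
have pb := flow1_b_pow (@scmC n) l_odd l_gt1 q_prim U bl gl w0l w1l c00 c10 lam0 lamt.
have [pyE phE] := flow1_E_pow (@scmC n) l_odd l_gt1 q_prim U al yEl hEl gl w0l w1l c00 c10 lam0 lamt.
do 12!eexists; split; first exact: U'.
all: case: d D al bl yEl hEl fl gl yFl hFl w0l w1l c00 c10 nz lamt pf py ph pb pyE phE {ml} =>
  A Bb Ye He F G Yf Hf c0 c1 /= D al bl yEl hEl fl gl yFl hFl w0l w1l c00 c10 nz lamt pf py ph pb pyE phE.
all: rewrite -?exprM ?(mulnC l 2) ?[lam ^+ (2 * l)]exprM ?expr2 //.
all: rewrite ?(pb, pyE, phE, pf, py, ph, ts) ?expr2 //.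
- by rewrite exprMn_comm ?w1l -?rmorphXn -?rmorphM //; apply: scmC.
by rewrite mulf_neq0 ?expf_neq0.
Qed.

Definition scale_data (d : zdata C) (x y : C) : zdata C :=
  let: ZData A B Ye He F G Yf Hf c0 c1 := d in
  ZData (x * A) (y * B) (x * y * Ye) (x * x * y * He)
    (x^-1 * F) (y^-1 * G) ((x * y)^-1 * Yf) ((x * x * y)^-1 * Hf) c0 c1.

Lemma realizes_scale n d x y : x != 0 -> y != 0 -> realizes n d ->
  realizes n (scale_data d x y).
Proof.
move=> x0 y0 [a [b [yE [hE [f [g [yF [hF [w0 [w1 [v0 [v1 D]]]]]]]]]]]].
have [U al bl yEl hEl fl gl yFl hFl w0l w1l c00 c10] := D.
pose u := l.-root x; pose v := l.-root y.
have ul : u ^+ l = x by rewrite rootCK. have vl : v ^+ l = y by rewrite rootCK.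
have u0 : u != 0 by rewrite rootC_eq0. have v00 : v != 0 by rewrite rootC_eq0.
have U' := UQ_scale (@scmC n) (prim_neq0 q_prim) u0 v00 U.
have Lx c z : (scm n c * z) ^+ l = scm n (c ^+ l) * z ^+ l.
  by rewrite exprMn_comm ?rmorphXn //; apply: scmC.
do 12!eexists; split; first exact: U'.
all: case: d D al bl yEl hEl fl gl yFl hFl w0l w1l c00 c10 =>
  A Bb Ye He F G Yf Hf c0 c1 /= D al bl yEl hEl fl gl yFl hFl w0l w1l c00 c10 //.
all: rewrite Lx ?(al, bl, yEl, hEl, fl, gl, yFl, hFl) -rmorphM ?exprVn ?exprMn ?ul ?vl //.
Qed.

Definition tor4 (t1 t2 : C) := diag4 t1 t2 t2^-1 t1^-1.

Lemma phi_scale (d : zdata C) t1 t2 : t1 != 0 -> t2 != 0 -> zc0 d != 0 -> zc1 d != 0 ->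
  phi (scale_data d (t1 / t2) (t2 ^+ 2)) *m tor4 t1 t2 = tor4 t1 t2 *m phi d.
Proof.
case: d => A B Ye He F G Yf Hf c0 c1 /= t10 t20 c00 c10.
rewrite /phi /tor4 /unip_plus /unip_minus /diag4 /= !mx4_mul;
  congr (mx_of_rows [:: [:: _; _; _; _]; [:: _; _; _; _]; [:: _; _; _; _]; [:: _; _; _; _]]).
all: by field; rewrite ?t10 ?t20 ?c00 ?c10.
Qed.

Definition Realized n (M : 'M[C]_4) : Prop := exists2 d, realizes n d & M = phi d.

Lemma diag4_mul (a b c d a' b' c' d' : C) :
  diag4 a b c d *m diag4 a' b' c' d' = diag4 (a * a') (b * b') (c * c') (d * d').
Proof. by rewrite /diag4 mx4_mul !(mulr0, mul0r, addr0, add0r). Qed.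
Lemma diag4_1 : diag4 1 1 1 1 = 1%:M :> 'M[C]_4.
Proof.
apply/matrixP=> i j; rewrite !mxE.
by case: i => -[|[|[|[|]]]] //= ?; case: j => -[|[|[|[|]]]] //= ?.
Qed.
Lemma tor4_mul t1 t2 : t1 != 0 -> t2 != 0 -> tor4 t1 t2 *m tor4 t1^-1 t2^-1 = 1%:M.
Proof. by move=> h1 h2; rewrite /tor4 diag4_mul !invrK !mulVf // !mulfV // diag4_1. Qed.
Lemma tor4_mulV t1 t2 : t1 != 0 -> t2 != 0 -> tor4 t1^-1 t2^-1 *m tor4 t1 t2 = 1%:M.
Proof. by move=> h1 h2; rewrite /tor4 diag4_mul !invrK !mulVf // !mulfV // diag4_1. Qed.

Lemma Realized_torus n M t1 t2 : t1 != 0 -> t2 != 0 -> Realized n M ->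
  Realized n (tor4 t1 t2 *m M *m tor4 t1^-1 t2^-1).
Proof.
move=> t10 t20 [d rd ->].
have [a [b [yE [hE [f [g [yF [hF [w0 [w1 [v0 [v1 D]]]]]]]]]]]] := rd.
exists (scale_data d (t1 / t2) (t2 ^+ 2)).
  by apply: realizes_scale; rewrite ?mulf_neq0 ?invr_neq0 ?expf_neq0.
by rewrite -phi_scale ?(ud_c0 D) ?(ud_c1 D) // -mulmxA tor4_mul // mulmx1.
Qed.

Lemma xroot0_mulV s : xroot0 s *m xroot0 (- s) = 1%:M :> 'M[C]_4.
Proof.
rewrite /xroot0 /unip_plus mx4_mul -diag4_1 /diag4.
by congr (mx_of_rows [:: [:: _; _; _; _]; [:: _; _; _; _]; [:: _; _; _; _]; [:: _; _; _; _]]); ring.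
Qed.
Lemma xroot1_mulV s : xroot1 s *m xroot1 (- s) = 1%:M :> 'M[C]_4.
Proof.
rewrite /xroot1 /unip_plus mx4_mul -diag4_1 /diag4.
by congr (mx_of_rows [:: [:: _; _; _; _]; [:: _; _; _; _]; [:: _; _; _; _]; [:: _; _; _; _]]); ring.
Qed.

Lemma Realized_undo n M N (X Xi : 'M[C]_4) t1 t2 : t1 != 0 -> t2 != 0 -> X *m Xi = 1%:M ->
  Realized n N -> N *m (tor4 t1 t2 *m X) = tor4 t1 t2 *m X *m M -> Realized n (X *m M *m Xi).
Proof.
move=> t10 t20 XX RN E; have t1' : t1^-1 != 0 by rewrite invr_neq0.
have t2' : t2^-1 != 0 by rewrite invr_neq0.
have := Realized_torus t1' t2' RN; rewrite !invrK.
have -> // : tor4 t1^-1 t2^-1 *m N *m tor4 t1 t2 = X *m M *m Xi.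
rewrite -[LHS]mulmx1 -XX mulmxA -(mulmxA (_ *m N)) -(mulmxA _ N) E !mulmxA.
by rewrite tor4_mulV // mul1mx.
Qed.

Lemma phi_D1 (d : zdata C) : phi d 0 0 = zc0 d ^+ 2 /\ phi d 1 0 = zc0 d ^+ 2 * zF d.
Proof.
rewrite /phi /unip_plus /unip_minus /diag4 !mx4_mul !mxE /=.
by split; rewrite !(mulr0, mul0r, addr0, add0r, mulr1, mul1r) // mulrC.
Qed.

Definition minor2 (M : 'M[C]_4) (i j : 'I_4) := M i 0 * M j 1 - M i 1 * M j 0.

Lemma phi_D2 (d : zdata C) : zc0 d != 0 -> zc1 d != 0 -> minor2 (phi d) 0 1 = zc1 d ^+ 2 /\ minor2 (phi d) 0 2%:R = zc1 d ^+ 2 * zG d.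
Proof.
move=> c0 c1; rewrite /minor2 /phi /unip_plus /unip_minus /diag4 !mx4_mul !mxE /=.
by split; field; rewrite ?c0 ?c1.
Qed.

(** [1 + s zF] is the upper left entry of the conjugate divided by that of [M], so the condition
    says that the flow does not leave the big cell; the leading minor of size 2 does not change. *)
Lemma Realized_x0 n M s : Realized n M -> M 0 0 + s * M 1 0 != 0 ->
  Realized n (xroot0 s *m M *m xroot0 (- s)).
Proof.
move=> [d rd ->]; have [-> ->] := phi_D1 d => nz.
have [a [b [yE [hE [f [g [yF [hF [w0 [w1 [v0 [v1 D]]]]]]]]]]]] := rd.
have nz' : 1 + s * zF d != 0.
  by apply: contraNneq nz => E; rewrite mulrCA -[X in X + _]mulr1 -mulrDr E mulr0.
have [m [m0 m2 rd']] := realizes_flow0 rd nz'.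
have := phi_flow0 (ud_c0 D) (ud_c1 D) m0 m2.
have -> : diag4 m^-1 m m^-1 m = tor4 m^-1 m by rewrite /tor4 invrK.
apply: Realized_undo; rewrite ?invr_neq0 //; first exact: xroot0_mulV.
by exists (flow0_data d s m).
Qed.

Lemma Realized_x1 n M s : Realized n M -> minor2 M 0 1 + s * minor2 M 0 2%:R != 0 ->
  Realized n (xroot1 s *m M *m xroot1 (- s)).
Proof.
move=> [d rd ->].
have [a [b [yE [hE [f [g [yF [hF [w0 [w1 [v0 [v1 D]]]]]]]]]]]] := rd.
have [-> ->] := phi_D2 (ud_c0 D) (ud_c1 D) => nz.
have nz' : 1 + s * zG d != 0.
  by apply: contraNneq nz => E; rewrite mulrCA -[X in X + _]mulr1 -mulrDr E mulr0.
have [m [m0 m2 rd']] := realizes_flow1 rd nz'.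
have := phi_flow1 (ud_c0 D) (ud_c1 D) m0 m2.
have -> : diag4 1 m^-1 m 1 = tor4 1 m^-1 by rewrite /tor4 invrK invr1.
apply: Realized_undo; rewrite ?oner_neq0 ?invr_neq0 //; first exact: xroot1_mulV.
by exists (flow1_data d s m).
Qed.

End Realize.

(** * Divisibility criteria *)

Section SubspaceDimension.
Variables (C : fieldType) (V : vectType C).
Implicit Types (S : {vspace V}) (X w G u k : 'End(V)).

Definition stable S X := forall x, x \in S -> X x \in S.

Lemma stable_iter S X m x : stable S X -> x \in S -> iter m X x \in S.
Proof. by move=> sX xS; elim: m => //= m IH; apply: sX. Qed.

(* A nilpotent operator all of whose Jordan blocks have maximal size. *)
Lemma dim_blocks S X l : stable S X -> (forall x, x \in S -> iter l X x = 0) ->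
  (forall x, x \in S -> X x = 0 -> exists2 y, y \in S & x = iter l.-1 X y) ->
  (0 < l)%N -> (\dim S = l * \dim (S :&: lker X))%N.
Proof.
move=> sX nil surj l0; set d := \dim (S :&: lker X).
pose T m := iter m (fun W => (X @: W)%VS) S.
have memT m x : reflect (exists2 y, y \in S & x = iter m X y) (x \in T m).
  elim: m x => [|m IH] x; first by apply: (iffP idP) => [xS|[y yS ->]] //; exists x.
  rewrite -[T m.+1]/(X @: T m)%VS; apply: (iffP memv_imgP) => [[y /IH[z zS ->] ->]|[y yS ->]].
    by exists z.
  by exists (iter m X y) => //; apply/IH; exists y.
have TS m : (T m <= S)%VS.
  by apply/subvP => x /memT[y yS ->]; apply: stable_iter.
have dT m : (m < l)%N -> (\dim (T m) = d + \dim (T m.+1))%N.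
  move=> ml; rewrite -(limg_ker_dim X (T m)); congr (_ + _)%N; rewrite /d; congr (\dim _).
  apply/eqP; rewrite eqEsubv; apply/andP; split.
    by apply/subvP => x; rewrite !memv_cap => /andP[/(subvP (TS m)) -> ->].
  apply/subvP => x; rewrite !memv_cap memv_ker => /andP[xS /eqP Xx].
  have [y yS xE] := surj x xS Xx; apply/andP; split; last exact/eqP.
  apply/memT; exists (iter (l.-1 - m) X y); first exact: stable_iter.
  by rewrite -iterD subnKC //; move: ml; rewrite -{1}(prednK l0).
have T0 : \dim (T l) = 0%N.
  apply/eqP; rewrite dimv_eq0 -subv0; apply/subvP => x /memT[y yS ->].
  by rewrite nil // mem0v.
have E m : (m <= l)%N -> (\dim S = m * d + \dim (T m))%N.
  elim: m => [|m IH] ml; first by rewrite mul0n.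
  by rewrite IH ?(ltnW ml) // dT // mulSn; lia.
by rewrite (E l) // T0 addn0.
Qed.

(** For [y] in the kernel of [X], the vector [X ^ m w ^ m y] is a nonzero multiple of [G ^ m y], the
    multiples being products of the sums in the last hypothesis; the term in [u] drops out since it
    contains two more factors [X]. As [G] maps the kernel onto itself, the kernel lies in the image
    of [X ^ (l - 1)]. *)
Lemma dim_weyl S X w G u l (al be be' : C) :
  (0 < l)%N -> stable S X -> stable S w ->
  (forall x, x \in S -> X (w x) = al *: w (X x) + G x + u (X (X x))) ->
  (forall x, x \in S -> X (G x) = be *: G (X x)) ->
  (forall x, x \in S -> X (u x) = be' *: u (X x)) ->
  (forall x, x \in S -> iter l X x = 0) ->
  (forall x, x \in S -> X x = 0 -> G x \in S) ->
  (forall x, x \in S -> X x = 0 -> exists y, [/\ y \in S, X y = 0 & x = G y]) ->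
  (forall m, (0 < m < l)%N -> \sum_(i < m) al ^+ i * be ^+ (m.-1 - i) != 0) ->
  (\dim S = l * \dim (S :&: lker X))%N.
Proof.
move=> l0 sX sw Xw XG Xu nil GS Gs sum0; apply: dim_blocks => //.
pose s m := \sum_(i < m) al ^+ i * be ^+ (m.-1 - i).
pose t m := \sum_(i < m) al ^+ i * be' ^+ (m.-1 - i).
have rec (b : C) m : \sum_(i < m.+1) al ^+ i * b ^+ (m - i) =
    al ^+ m + b * \sum_(i < m) al ^+ i * b ^+ (m.-1 - i).
  rewrite big_ord_recr /= subnn mulr1 addrC; congr (_ + _).
  rewrite mulr_sumr; apply: eq_bigr => i _; rewrite mulrCA -exprS; congr (_ * _ ^+ _).
  by case: m i => [|m] i; [case: i | rewrite /= subSn // -ltnS].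
have Xm m x : x \in S -> iter m.+1 X (w x) =
   al ^+ m.+1 *: w (iter m.+1 X x) + s m.+1 *: G (iter m X x) + t m.+1 *: u (iter m.+2 X x).
  move=> xS; elim: m => [|m IH].
    by rewrite /= Xw // /s /t !big_ord_recl !big_ord0 /= !mulr1 !addr0 !scale1r expr1.
  have xm : iter m X x \in S by apply: stable_iter.
  have xm1 : iter m.+1 X x \in S by apply: stable_iter.
  have xm2 : iter m.+2 X x \in S by apply: stable_iter.
  rewrite iterS IH !linearD !linearZ /= Xw // XG // Xu // !scalerDr !scalerA.
  rewrite -exprSr /s /t (rec be m.+1) (rec be' m.+1) !scalerDl.
  rewrite [s m.+1 * be]mulrC [t m.+1 * be']mulrC -/(s m.+1) -/(t m.+1).
  by rewrite !addrA; congr (_ + _); rewrite addrAC.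
have XGm m y : y \in S -> X y = 0 -> iter m G y \in S /\ X (iter m G y) = 0.
  move=> yS Xy; elim: m => //= m [IH1 IH2]; split; first exact: GS.
  by rewrite XG // IH2 linear0 scaler0.
have key m y : (m < l)%N -> y \in S -> X y = 0 ->
    exists2 c, c != 0 & iter m X (iter m w y) = c *: iter m G y.
  move=> ml yS Xy; elim: m ml => [|m IH] ml; first by exists 1; rewrite ?oner_neq0 ?scale1r.
  have [c c0 E] := IH (ltnW ml); exists (s m.+1 * c); first by rewrite mulf_neq0 // sum0.
  have zS : iter m w y \in S by apply: stable_iter.
  rewrite [iter m.+1 w y]iterS Xm // E.
  have X1 : iter m.+1 X (iter m w y) = 0 by rewrite iterS E linearZ /= (XGm m y yS Xy).2 scaler0.
  have X2 : iter m.+2 X (iter m w y) = 0 by rewrite iterS X1 linear0.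
  by rewrite X1 X2 !linear0 ?scaler0 add0r addr0 linearZ /= scalerA.
move=> x xS Xx.
have : exists y, [/\ y \in S, X y = 0 & x = iter l.-1 G y].
  elim: l.-1 => [|m [y [yS Xy ->]]]; first by exists x.
  have [z [zS Xz ->]] := Gs _ yS Xy; exists z; split=> //.
  by rewrite -iterSr.
case=> y [yS Xy ->]; have [|c c0 E] := key l.-1 y _ yS Xy; first by rewrite prednK.
exists (c^-1 *: iter l.-1 w y); first by apply/memvZ/stable_iter.
have -> : iter l.-1 X (c^-1 *: iter l.-1 w y) = c^-1 *: iter l.-1 X (iter l.-1 w y).
  by elim: l.-1 (iter l.-1 w y) => //= m IH z; rewrite IH linearZ.
by rewrite E scalerA mulVf // scale1r.
Qed.

(** Induction on the roots: the image of [k - r] has the same eigenspaces as [S] for the other roots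
    and is annihilated by their product. *)
Lemma dim_eigen (rs : seq C) S k : seq.uniq rs -> stable S k ->
  (forall x, x \in S -> foldr (fun r y => k y - r *: y) x rs = 0) ->
  \dim S = (\sum_(r <- rs) \dim (S :&: lker (k - r *: \1%VF)%R))%N.
Proof.
elim: rs S => [|r rs IH] S /=.
  move=> _ _ S0; rewrite big_nil; apply/eqP; rewrite dimv_eq0 -subv0.
  by apply/subvP => x /S0 ->; rewrite mem0v.
move=> /andP[rn ur] sk ann; rewrite big_cons.
set K := (k - r *: \1%VF)%VF.
have KE x : K x = k x - r *: x by rewrite /K !lfunE /= !lfunE /= !lfunE /= id_lfunE.
rewrite -(limg_ker_dim K S); congr (_ + _)%N.
have fc x : foldr (fun r y => k y - r *: y) (K x) rs = K (foldr (fun r y => k y - r *: y) x rs).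
  have kK z : k (K z) = K (k z) by rewrite !KE linearB linearZ.
  by elim: (rs) => //= a rs' ->; rewrite kK -[a *: K _]linearZ -linearB.
rewrite (IH (K @: S)%VS) //.
- apply: eq_big_seq => a ars; congr (\dim _); apply/eqP; rewrite eqEsubv; apply/andP; split.
    apply/subvP => x; rewrite !memv_cap => /andP[/memv_imgP[y yS ->] ->].
    by rewrite KE memvB ?memvZ // sk.
  apply/subvP => x; rewrite !memv_cap => /andP[xS xK]; rewrite xK andbT.
  have kx : k x = a *: x.
    move: xK; rewrite memv_ker !lfunE /= !lfunE /= !lfunE /= id_lfunE subr_eq0 => /eqP.
    by [].
  have ar : a - r != 0 by rewrite subr_eq0; apply: contraNneq rn => <-.
  apply/memv_imgP; exists ((a - r)^-1 *: x); first exact: memvZ.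
  by rewrite KE linearZ /= kx !scalerA -scalerBl [r * _]mulrC -mulrBr mulVf // scale1r.
- move=> x /memv_imgP[y yS ->]; apply/memv_imgP; exists (k y); first exact: sk.
  by rewrite !KE linearB linearZ.
by move=> x /memv_imgP[y yS ->]; rewrite fc KE; apply: ann.
Qed.

Lemma foldr_prod_XsubC k (rs : seq C) x n : (size rs < n)%N ->
  foldr (fun r y => k y - r *: y) x rs =
  \sum_(i < n) (\prod_(r <- rs) ('X - r%:P))`_i *: iter i k x.
Proof.
elim: rs n => [|r rs IH] [|n] //= ln.
  rewrite big_nil big_ord_recl /= coef1 scale1r big1 ?addr0 // => i _.
  by rewrite coef1 scale0r.
rewrite big_cons mulrBl mul_polyC; under eq_bigr do rewrite coefB coefXM coefZ scalerBl -scalerA.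
rewrite sumrB -scaler_sumr -IH 1?ltnW // big_ord_recl /= scale0r add0r (IH n) // linear_sum.
by congr (_ - _); apply: eq_bigr => i _; rewrite linearZ.
Qed.

(** [X] embeds each eigenspace of [k] into the next, and after [l] steps one is back at the first,
    so the [l] eigenspaces have the same dimension. *)
Lemma dim_clock S k X l (om mu c : C) : l.-primitive_root om -> mu ^+ l = c -> mu != 0 ->
  stable S k -> stable S X -> (forall x, x \in S -> iter l k x = c *: x) ->
  (forall x, x \in S -> k (X x) = om *: X (k x)) ->
  (forall x, x \in S -> X x = 0 -> x = 0) ->
  (\dim S = l * \dim (S :&: lker (k - mu *: \1%VF)%R))%N.
Proof.
move=> pom muc mu0 sk sX kl kX Xinj; have l0 := prim_order_gt0 pom.
pose ev a := (S :&: lker (k - a *: \1%VF)%R)%VS.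
have evP a x : reflect (x \in S /\ k x = a *: x) (x \in ev a).
  rewrite /ev memv_cap memv_ker !lfunE /= !lfunE /= !lfunE /= id_lfunE subr_eq0.
  by apply: (iffP andP) => -[-> /eqP].
have le a : (\dim (ev a) <= \dim (ev (om * a)%R))%N.
  rewrite -(@limg_dim_eq _ _ _ X (ev a)).
    apply: dimvS; apply/subvP => y /memv_imgP[x /evP[xS kx] ->]; apply/evP.
    by split; [exact: sX | rewrite kX // kx linearZ scalerA].
  apply/eqP; rewrite -subv0; apply/subvP => x; rewrite memv_cap memv_ker => /andP[/evP[xS _] /eqP Xx].
  by rewrite (Xinj x xS Xx) mem0v.
have lej j a : (\dim (ev a) <= \dim (ev (om ^+ j * a)%R))%N.
  elim: j a => [|j IH] a; first by rewrite mul1r.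
  by rewrite exprSr -mulrA; apply: leq_trans (le a) (IH _).
have eqj j : \dim (ev (om ^+ j * mu)) = \dim (ev mu).
  apply/eqP; rewrite eqn_leq lej andbT.
  have := lej (l - j %% l)%N (om ^+ j * mu); rewrite mulrA -exprD.
  rewrite -[om ^+ (l - _ + j)](prim_expr_mod pom) -modnDmr subnK ?modnn ?expr0 ?mul1r //.
  by rewrite ltnW // ltn_mod.
have -> : \dim S = (\sum_(r <- [seq (om ^+ j * mu)%R | j <- iota 0 l]) \dim (ev r))%N.
  apply: dim_eigen => //.
    rewrite map_inj_in_uniq ?iota_uniq // => i j; rewrite !mem_iota !add0n => il jl /(mulIf mu0)/eqP.
    by rewrite (eq_prim_root_expr pom) !modn_small // => /eqP.
  move=> x xS.
  rewrite (@foldr_prod_XsubC _ _ _ l.+1) ?size_map ?size_iota //.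
  have := @all_roots_prod_XsubC _ ('X^l - c%:P) [seq om ^+ j * mu | j <- iota 0 l].
  rewrite size_XnsubC // size_map size_iota lead_coefXnsubC // scale1r => <- //.
  - rewrite big_ord_recr (bigD1 (Ordinal l0)) //= !coefB !coefXn !coefC eqxx eq_sym (gtn_eqF l0) /=.
    rewrite subr0 scale1r kl // sub0r big1 ?addr0 ?scaleNr ?addNr // => i i0.
    rewrite coefB coefXn coefC (ltn_eqF (ltn_ord i)).
    by move: i0; rewrite -val_eqE /= => /negPf ->; rewrite subrr scale0r.
  - apply/allP => z /mapP[j _ ->]; rewrite rootE !hornerE exprMn muc -exprM mulnC exprM.
    by rewrite (prim_expr_order pom) expr1n mul1r subrr.
  rewrite uniq_rootsE map_inj_in_uniq ?iota_uniq // => i j; rewrite !mem_iota !add0n => il jl /(mulIf mu0)/eqP.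
  by rewrite (eq_prim_root_expr pom) !modn_small // => /eqP.
by rewrite big_map; under eq_bigr do rewrite eqj; rewrite big_const_seq count_predT size_iota iter_addn_0 mulnC.
Qed.
End SubspaceDimension.

Section CommonKernel.
Variables (C : numClosedFieldType) (n : nat).
Local Notation M := 'M[C]_n.+1.
Local Notation V := 'cV[C]_n.+1.
Implicit Types (L : seq M) (X w G u p : M).

Definition op X : 'End(V) := linfun (mulmx X).
Lemma opE X x : op X x = X *m x. Proof. exact: lfunE. Qed.

(** Vectors are replaced by square matrices, so that membership in a common kernel becomes a set of
    rules [s * p = 0] usable by [nc]; [spread] and [col0] translate back and forth. *)
Definition annih L p := forall s, s \in L -> s * p = 0.
Definition preserves L X := forall p, annih L p -> annih L (X * p).
Definition ker_space L : {vspace V} := (\bigcap_(s <- L) lker (op s))%VS.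

Lemma annih_cons s L p : annih (s :: L) p <-> s * p = 0 /\ annih L p.
Proof.
split=> [h|[h1 h2] t]; last by rewrite inE => /orP[/eqP-> //|/h2].
by split=> [|t tL]; apply: h; rewrite ?mem_head // inE tL orbT.
Qed.

Lemma mem_ker_space L (x : V) : reflect (forall s, s \in L -> s *m x = 0) (x \in ker_space L).
Proof.
rewrite /ker_space; elim: L => [|s L IH]; first by rewrite big_nil memvf; constructor.
rewrite big_cons memv_cap memv_ker opE.
apply: (iffP andP) => [[/eqP sx /IH Lx] t|h].
  by rewrite inE => /orP[/eqP-> //|/Lx].
split; first by apply/eqP/h/mem_head.
by apply/IH => t tL; apply: h; rewrite inE tL orbT.
Qed.

Lemma ker_space_cons s L : (ker_space L :&: lker (op s))%VS = ker_space (s :: L).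
Proof. by rewrite /ker_space big_cons capvC. Qed.

Let e0 : 'rV[C]_n.+1 := delta_mx 0 0.
Let col0 (p : M) : V := p *m delta_mx 0 0.
Let spread (x : V) : M := x *m e0.
Let col0_spread x : col0 (spread x) = x.
Proof. by rewrite /col0 /spread -mulmxA mul_delta_mx -[RHS]mulmx1; congr (_ *m _); apply/matrixP=> i j; rewrite !ord1 !mxE. Qed.
Let col0M X p : col0 (X * p) = X *m col0 p. Proof. by rewrite /col0 mulmxA. Qed.
Let spreadM X x : X * spread x = spread (X *m x). Proof. exact: mulmxA. Qed.
Let spread0 : spread 0 = 0. Proof. exact: mul0mx. Qed.
Let annih_spread L x : x \in ker_space L -> annih L (spread x).
Proof. by move/mem_ker_space => h s sL; rewrite spreadM h // spread0. Qed.
Let ker_col0 L p : annih L p -> col0 p \in ker_space L.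
Proof. by move=> h; apply/mem_ker_space => s sL; rewrite -col0M h // /col0 mul0mx. Qed.
Let stableP L X : preserves L X -> stable (ker_space L) (op X).
Proof.
by move=> h x /annih_spread/h/ker_col0; rewrite col0M col0_spread opE.
Qed.
Let iter_op X m x : iter m (op X) x = X ^+ m *m x.
Proof. by elim: m => [|m IH]; rewrite ?mul1mx // iterS IH opE mulmxA exprS. Qed.

(** The sums of [dim_weyl] are quotients of [al ^+ m - be ^+ m] by [al - be], nonzero for
    [0 < m < l] because [al / be] is primitive. Invertibility is asked of an element [G'] that
    agrees with [G] only on the kernel of [X]. *)
Lemma dim_ker_weyl L X w G G' u (l : nat) (al be be' : C) :
  (0 < l)%N -> preserves L X -> preserves L w ->
  (forall p, annih L p -> X * w * p = al *: (w * X * p) + G * p + u * X * X * p) ->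
  (forall p, annih L p -> X * G * p = be *: (G * X * p)) ->
  (forall p, annih L p -> X * u * p = be' *: (u * X * p)) ->
  X ^+ l = 0 -> be != 0 -> l.-primitive_root (al / be) -> G' \is a GRing.unit ->
  (forall p, annih (X :: L) p -> G * p = G' * p) -> preserves (X :: L) G' ->
  (\dim (ker_space L) = l * \dim (ker_space (X :: L)))%N.
Proof.
move=> l0 pX pw Xw XG Xu Xl be0 pr uG GG' pG'.
have inK x : x \in ker_space L -> (op X) x = 0 -> x \in ker_space (X :: L).
  by rewrite opE -ker_space_cons memv_cap memv_ker opE => -> ->; rewrite eqxx.
have tr (Y Z : M) x : Y * spread x = Z * spread x -> Y *m x = Z *m x.
  by move=> h; rewrite -[x in LHS]col0_spread -[x in RHS]col0_spread -!col0M h.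
rewrite -ker_space_cons; apply: (@dim_weyl _ _ (ker_space L) (op X) (op w) (op G) (op u) l al be be') => //.
- exact: stableP.
- exact: stableP.
- move=> x /annih_spread/Xw h; rewrite !opE !mulmxA; have := tr (X * w) (al *: (w * X) + G + u * X * X) x.
  by rewrite !mulmxDl -scalemxAl; apply; rewrite h !mulrDl scalerAl.
- move=> x /annih_spread/XG h; rewrite !opE !mulmxA; have := tr (X * G) (be *: (G * X)) x.
  by rewrite -scalemxAl; apply; rewrite h scalerAl.
- move=> x /annih_spread/Xu h; rewrite !opE !mulmxA; have := tr (X * u) (be' *: (u * X)) x.
  by rewrite -scalemxAl; apply; rewrite h scalerAl.
- by move=> x _; rewrite iter_op Xl mul0mx.
- move=> x xL Xx; have K := inK x xL Xx; rewrite opE (tr G G') ?GG' //; last exact: annih_spread.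
  by have := stableP pG' K; rewrite -ker_space_cons memv_cap opE => /andP[].
- move=> x xL Xx; have K := inK x xL Xx.
  have S : (op G' @: ker_space (X :: L) <= ker_space (X :: L))%VS.
    by apply/subvP => z /memv_imgP[y yK ->]; exact: stableP.
  have kerG : lker (op G') = 0%VS.
    apply/eqP; rewrite -subv0; apply/subvP => z; rewrite memv_ker opE => /eqP h.
    by rewrite -[z]mul1mx -(mulVmx uG) -mulmxA h mulmx0 mem0v.
  have E : (op G' @: ker_space (X :: L))%VS = ker_space (X :: L).
    apply/eqP; rewrite eqEdim S (limg_dim_eq (f := op G') (U := ker_space (X :: L))) ?leqnn //.
    by rewrite kerG capv0.
  have : x \in (op G' @: ker_space (X :: L))%VS by rewrite E.
  case/memv_imgP => y yK ->; have := yK; rewrite -ker_space_cons memv_cap memv_ker => /andP[yL /eqP Xy].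
  by exists y; split=> //; rewrite !opE (tr G G') // GG' //; exact: annih_spread.
move=> m /andP[m0 ml]; apply/eqP => s0.
have := subrXX al be m.
have -> : \sum_(i < m) al ^+ (m.-1 - i) * be ^+ i = \sum_(i < m) al ^+ i * be ^+ (m.-1 - i).
  rewrite (reindex_inj rev_ord_inj); apply: eq_bigr => i _ /=.
  by congr (_ ^+ _ * _ ^+ _); have := ltn_ord i; lia.
rewrite s0 mulr0 => /eqP; rewrite subr_eq0 => /eqP E.
have : (al / be) ^+ m == 1 by rewrite exprMn exprVn E mulfV ?expf_neq0.
by rewrite -(prim_order_dvd pr) gtnNdvd.
Qed.

Lemma dim_ker_clock L (k X : M) (l : nat) (om c d : C) : l.-primitive_root om ->
  k ^+ l = c%:M -> c != 0 -> X ^+ l = d%:M -> d != 0 -> k * X = om%:M * X * k ->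
  preserves L k -> preserves L X ->
  exists mu, (\dim (ker_space L) = l * \dim (ker_space ((k - mu%:M)%R :: L)))%N.
Proof.
move=> pom kl c0 Xl d0 kX pk pX; have l0 := prim_order_gt0 pom.
exists (l.-root c); rewrite -ker_space_cons.
have -> : (op (k - (l.-root c)%:M)) =
    (op k - l.-root c *: \1)%VF :> 'End(V).
  by apply/lfunP => x; rewrite opE !lfunE /= !lfunE /= mulmxBl ?lfunE /= ?lfunE mul_scalar_mx.
apply: (@dim_clock _ _ _ _ (op X) l om _ c) => //.
- by rewrite rootCK.
- by rewrite rootC_eq0.
- exact: stableP.
- exact: stableP.
- by move=> x _; rewrite iter_op kl mul_scalar_mx.
- by move=> x _; rewrite !opE [LHS]mulmxA -[k *m X]/(k * X) kX [X *m _]mulmxA -mul_scalar_mx !mulmxA.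
move=> x _; rewrite opE => Xx.
have : X ^+ l *m x = 0 by rewrite -(prednK l0) exprSr -mulmxA Xx mulmx0.
by rewrite Xl mul_scalar_mx => /eqP; rewrite scaler_eq0 (negPf d0) => /eqP.
Qed.

Lemma dim_ker_nil : \dim (ker_space [::]) = n.+1.
Proof. by rewrite /ker_space big_nil dimvf /dim /= muln1. Qed.
End CommonKernel.

(** * Sufficient conditions for divisibility by [l ^ 2], [l ^ 3] and [l ^ 4] *)

Section Criteria.
Variables (C : numClosedFieldType) (q : C) (l n : nat).
Hypotheses (l_odd : odd l) (l_gt1 : (1 < l)%N) (q_prim : l.-primitive_root q).
Local Notation M := 'M[C]_n.+1.
Local Notation io := (scm C n).
Local Notation k := (qc io q).
Let ioC c (x : M) : io c * x = x * io c. Proof. exact: scmC. Qed.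
Let q0 : q != 0 := prim_neq0 q_prim.
Let l0 : (0 < l)%N := ltnW l_gt1.
Implicit Types (L : seq M) (X w G u p : M).

Lemma ker_weyl L X w G G' u (i j j' : int) (d : C) :
  coprime `|i - j| l -> preserves L X -> preserves L w ->
  (forall p, annih L p -> X * w * p = k i * w * X * p + G * p + u * X * X * p) ->
  (forall p, annih L p -> X * G * p = k j * G * X * p) ->
  (forall p, annih L p -> X * u * p = k j' * u * X * p) ->
  X ^+ l = 0 -> G' \is a GRing.unit ->
  (forall p, annih (X :: L) p -> G * p = G' * p) -> preserves (X :: L) G' ->
  (\dim (ker_space L) = l * \dim (ker_space (X :: L)))%N.
Proof.
have kE (c : int) p : k c * p = q ^ c *: p by exact: mul_scalar_mx.
move=> co pX pw Xw XG Xu Xl uG GG pG.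
apply: (@dim_ker_weyl _ _ L X w G G' u l (q ^ i) (q ^ j) (q ^ j')) => //.
- by move=> p /Xw->; rewrite -!mulrA kE !mulrA.
- by move=> p /XG->; rewrite -!mulrA kE !mulrA.
- by move=> p /Xu->; rewrite -!mulrA kE !mulrA.
- exact: expfz_neq0.
by rewrite invr_expz -expfzDr //; apply: prim_exprz.
Qed.

Lemma ker_clock L (w X : M) (i : int) (c d : C) : coprime `|i| l ->
  w ^+ l = io c -> c != 0 -> X ^+ l = io d -> d != 0 -> w * X = k i * X * w ->
  preserves L w -> preserves L X ->
  exists mu, (\dim (ker_space L) = l * \dim (ker_space ((w - mu%:M)%R :: L)))%N.
Proof. by move=> co wl c0 Xl d0 wX; apply: dim_ker_clock wl c0 Xl d0 wX; apply: prim_exprz. Qed.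

Lemma preserves_cons L s X Y : preserves L X -> s * X = Y * s -> preserves (s :: L) X.
Proof.
move=> pX sX p /annih_cons[sp Lp]; apply/annih_cons; split; last exact: pX.
by rewrite mulrA sX -mulrA sp mulr0.
Qed.
Lemma preserves_nil X : preserves [::] X. Proof. by []. Qed.
Lemma preserves_eigen L w mu X : preserves L X -> w * X = X * w -> preserves ((w - mu%:M) :: L) X.
Proof.
move=> pX wX; apply: preserves_cons (X) pX _.
by rewrite mulrBl mulrBr wX; congr (_ - _); exact: scmC.
Qed.

(** The second pair commutes with [w] and hence acts on each of its eigenspaces. *)
Lemma two_clocks L (w X w' X' : M) (i i' : int) (c d c' d' : C) :
  coprime `|i| l -> coprime `|i'| l ->
  w ^+ l = io c -> c != 0 -> X ^+ l = io d -> d != 0 -> w * X = k i * X * w ->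
  w' ^+ l = io c' -> c' != 0 -> X' ^+ l = io d' -> d' != 0 -> w' * X' = k i' * X' * w' ->
  w * w' = w' * w -> w * X' = X' * w ->
  preserves L w -> preserves L X -> preserves L w' -> preserves L X' ->
  (l ^ 2 %| \dim (ker_space L))%N.
Proof.
move=> co co' wl c0 Xl d0 wX wl' c0' Xl' d0' wX' ww wX'' pw pX pw' pX'.
have [mu ->] := ker_clock co wl c0 Xl d0 wX pw pX.
have [|nu ->] := ker_clock co' wl' c0' Xl' d0' wX' (@preserves_eigen _ _ mu _ pw' ww) _.
  exact: preserves_eigen.
by rewrite mulnA -mulnn dvdn_mulr.
Qed.

Variables (d : zdata C) (a b y h f g yF hF w0 w1 v0 v1 : M).
Hypothesis D : UQdata io q l d a b y h f g yF hF w0 w1 v0 v1.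
Let U := ud_UQ D.
Let E := uq_E U.
Let F := uq_F U.

Let w0l := ud_w0 D. Let w1l := ud_w1 D.
Let c0 := ud_c0 D. Let c1 := ud_c1 D.
Let co1 : coprime 1 l. Proof. exact: coprime1n. Qed.
Let co2 : coprime 2 l. Proof. exact: coprime2l. Qed.
Let co4 : coprime 4 l. Proof. exact: coprime4l. Qed.

Lemma unit_of_pow (x : M) (c : C) : x ^+ l = io c -> c != 0 -> x \is a GRing.unit.
Proof.
move=> xl c00; apply/unitrP; exists (io c^-1 * x ^+ l.-1); split.
  by rewrite -mulrA -exprSr prednK // xl -rmorphM mulVf // rmorph1.
by rewrite mulrA -ioC -mulrA -exprS prednK // xl -rmorphM mulVf // rmorph1.
Qed.
Lemma unit_of_inv (x y' : M) : x * y' = 1 -> y' * x = 1 -> x \is a GRing.unit.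
Proof. by move=> xy yx; apply/unitrP; exists y'. Qed.
Let uv0 : v0 \is a GRing.unit. Proof. exact: unit_of_inv (uq_v0w0 U) (uq_w0v0 U). Qed.
Let uw1 : w1 \is a GRing.unit. Proof. exact: unit_of_inv (uq_w1v1 U) (uq_v1w1 U). Qed.

Lemma unit_qc i : k i \is a GRing.unit.
Proof. by apply: (@unit_of_inv _ (k (- i))); [|rewrite qc_comm //]; exact: qcK q_prim i. Qed.
Lemma unit_io (c : C) : c != 0 -> io c \is a GRing.unit.
Proof. by move=> c00; apply: (@unit_of_pow _ (c ^+ l)); rewrite ?rmorphXn ?expf_neq0. Qed.
Lemma unit_qcB (i j : int) : coprime `|i - j| l -> k i - k j \is a GRing.unit.
Proof.
move=> co; rewrite -rmorphB; apply: unit_io; rewrite subr_eq0; apply/eqP => ij.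
have : (q ^ (i - j)) ^+ 1 == 1 by rewrite expr1 expfzDr // ij -expfzDr // subrr.
by rewrite -(prim_order_dvd (prim_exprz q_prim co)) gtnNdvd.
Qed.

Let v0a := uq_v0a ioC q_prim U. Let v0g := uq_v0g U.
Let v1g := uq_v1g ioC q_prim U. Let v1w0 := uq_v1w0 U.
Let v0w1 := uq_v0w1 U. Let v1v0 := uq_v1v0 U.
Let w0y := uq_w0yE ioC l_odd l_gt1 q_prim U. Let w1y := uq_w1yE ioC l_odd l_gt1 q_prim U.
Let v0y := uq_v0yE ioC l_odd l_gt1 q_prim U. Let v1y := uq_v1yE ioC l_odd l_gt1 q_prim U.
Let w0h := uq_w0hE ioC l_odd l_gt1 q_prim U. Let w1h := uq_w1hE ioC l_odd l_gt1 q_prim U.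
Let v0h := uq_v0hE ioC l_odd l_gt1 q_prim U. Let v1h := uq_v1hE ioC l_odd l_gt1 q_prim U.
Let v0b := uq_v0b U. Let v1b := uq_v1b ioC q_prim U.
Let v1a := uq_v1a U.
Let v0f := uq_v0f ioC q_prim U. Let v1f := uq_v1f U.
Let hg := uq_hEg ioC l_odd l_gt1 q_prim U. Let hf := uq_hEf ioC l_odd l_gt1 q_prim U.
Let yg := uq_yEg ioC l_odd l_gt1 q_prim U. Let yf := uq_yEf ioC l_odd l_gt1 q_prim U.

Let hi := h^-1.
Ltac uqp p ex := nc ioC q0 [:: a; b; y; h; f; g; w0; w1; v0; v1; hi; p]
  (ex, iq_fg E, iq_fy E, iq_fh E, iq_gy E, iq_yh E, iq_gh E, uq_af U, uq_bg U, uq_ag U, uq_bf U, uq_w0a U, uq_w0b U, uq_w1a U, uq_w1b U,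
   uq_w0f U, uq_w0g U, uq_w1f U, uq_w1g U, v0a, v0b, v1a, v1b, v0f, v0g, v1f, v1g, uq_w0v0 U, uq_v0w0 U, uq_w1v1 U, uq_v1w1 U,
   uq_w1w0 U, v0w1, v1w0, v1v0, w0y, w1y, v0y, v1y, w0h, w1h, v0h, v1h, hg, hf, yg, yf).
Ltac uqc ex := uqp (0 : M) ex.

Let gw0 : g * w0 = w0 * g. Proof. by uqc tt. Qed.
Let gw1 : g * w1 = k 2 * w1 * g. Proof. by uqc tt. Qed.
Let gv0 : g * v0 = v0 * g. Proof. by uqc tt. Qed.
Let aw0 : a * w0 = k (-1) * w0 * a. Proof. by uqc tt. Qed.
Let aw1 : a * w1 = w1 * a. Proof. by uqc tt. Qed.
Let av0 : a * v0 = k 1 * v0 * a. Proof. by uqc tt. Qed.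
Let yw0 : y * w0 = k (-1) * w0 * y. Proof. by uqc tt. Qed.
Let yw1 : y * w1 = k (-2) * w1 * y. Proof. by uqc tt. Qed.
Let yv0 : y * v0 = k 1 * v0 * y. Proof. by uqc tt. Qed.
Let hw0 : h * w0 = k (-2) * w0 * h. Proof. by uqc tt. Qed.
Let hw1 : h * w1 = k (-2) * w1 * h. Proof. by uqc tt. Qed.
Let hv0 : h * v0 = k 2 * v0 * h. Proof. by uqc tt. Qed.
Let bw0 : b * w0 = w0 * b. Proof. by uqc tt. Qed.
Let bw1 : b * w1 = k (-2) * w1 * b. Proof. by uqc tt. Qed.
Let bv0 : b * v0 = v0 * b. Proof. by uqc tt. Qed.
Let ha : h * a = k (-2) * a * h. Proof. by uqc tt. Qed.
Let hy : h * y = k 2 * y * h. Proof. by uqc tt. Qed.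
Let ya : y * a = a * y - (k 1 - k (-1)) * h. Proof. by uqc tt. Qed.

(** The invertible [a] shifts the eigenvalues of [w0]. The second factor [l] comes from [w1] and [g]
    when [g] is invertible; otherwise from the nilpotent [g] paired with [h], their commutator being
    a unit times [a ^+ 2]. *)
Lemma sl2_criterion : zA d != 0 -> (l ^ 2 %| n.+1)%N.
Proof.
move=> A0; have [G0|G0] := eqVneq (zG d) 0; last first.
  rewrite -(dim_ker_nil C n).
  exact: (@two_clocks [::] w0 a w1 g 1 (-2) _ _ _ _ co1 co2 w0l c0 (ud_a D) A0 (uq_w0a U)
    w1l c1 (ud_g D) G0 (uq_w1g U) (esym (uq_w1w0 U)) (uq_w0g U)).
pose G := - (k (-1) * (1 - k (-4)) * a * a * v0 * v0 * w1 * w1).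
have uG : G \is a GRing.unit.
  by rewrite unitrN !unitrMl ?uv0 ?uw1 ?(unit_of_pow (ud_a D) A0) ?unit_qc // -(qc0 io q); apply: unit_qcB.
rewrite -(dim_ker_nil C n).
rewrite (@ker_weyl [::] g h G G 0 0 4 0) ?subr0 //.
- have [||mu ->] := @ker_clock [:: g] w0 a 1 _ _ co1 w0l c0 (ud_a D) A0 (uq_w0a U).
  + exact: preserves_cons (@preserves_nil _) gw0.
  + apply: preserves_cons (@preserves_nil _) (esym (uq_ag U)).
  by rewrite mulnA -mulnn dvdn_mulr.
- by move=> p _; rewrite /G; uqp p tt.
- by move=> p _; rewrite /G; uqp p (tt, gw1, gv0).
- by move=> p _; rewrite !(mul0r, mulr0).
- by rewrite (ud_g D) G0 rmorph0.
- apply: (@preserves_cons _ _ _ (k 4 * G)) (@preserves_nil _) _.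
  by rewrite /G; uqc (tt, gw1, gv0).
Qed.

(** Now [a] is nilpotent and its commutator with [y] is a multiple of the invertible [h], which also
    shifts the eigenvalues of [w0] on the kernel of [a]. *)
Lemma sl2_criterion' : zA d = 0 -> zHe d != 0 -> (l ^ 2 %| n.+1)%N.
Proof.
move=> A0 He0; pose G := (k 1 - k (-1)) * h.
have uG : G \is a GRing.unit.
  by rewrite unitrMl ?(unit_of_pow (ud_hE D) He0) //; apply: unit_qcB.
rewrite -(dim_ker_nil C n).
rewrite (@ker_weyl [::] a y G G 0 0 2 0) ?subr0 //.
- have [||mu ->] := @ker_clock [:: a] w0 h 2 _ _ co2 w0l c0 (ud_hE D) He0 w0h.
  + exact: preserves_cons (@preserves_nil _) aw0.
  + exact: preserves_cons (@preserves_nil _) (iq_fh E).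
  by rewrite mulnA -mulnn dvdn_mulr.
- by move=> p _; rewrite /G; uqp p tt.
- by move=> p _; rewrite /G; uqp p tt.
- by move=> p _; rewrite !(mul0r, mulr0).
- by rewrite (ud_a D) A0 rmorph0.
- apply: (@preserves_cons _ _ _ (k 2 * G)) (@preserves_nil _) _.
  by rewrite /G; uqc tt.
Qed.

Let H := h - k 1 * y * a.
Let D2 := h * b - k 3 * y * y.
Let H_pow : H ^+ l = io (zHe d - zYe d * zA d).
Proof.
have [aH hH yH] := iq_H_comm ioC q_prim E.
have e : k 1 * y * a = h - H by rewrite /H opprB addrC subrK.
have -> : H ^+ l = h ^+ l - y ^+ l * a ^+ l.
  by rewrite (power_short ioC l_odd q_prim (iq_fh E) aH hH e) opprB addrC subrK.
by rewrite (ud_yE D) (ud_a D) (ud_hE D) -rmorphM -rmorphB.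
Qed.
Let D2_pow : D2 ^+ l = io (zHe d * zB d - zYe d ^+ 2).
Proof.
have -> : D2 ^+ l = h ^+ l * b ^+ l - (y * y) ^+ l.
  by rewrite (power_long ioC l_odd q_prim (iq_gy E) (iq_yh E) (iq_gh E)) addrK.
by rewrite exprMn_comm // (ud_yE D) (ud_b D) (ud_hE D) -!rmorphM -rmorphB expr2.
Qed.

(** [h] and [h^-1 D2] shift the eigenvalues of [w0] and [w1]. The third factor [l] comes from [y],
    paired with the weight-zero operator [h^-1 H] when [y] is invertible and with [a] when it is
    nilpotent. *)
Lemma heisenberg_criterion : zHe d != 0 -> zHe d * zB d - zYe d ^+ 2 != 0 ->
  zHe d - zYe d * zA d != 0 -> (l ^ 3 %| n.+1)%N.
Proof.
move=> He0 D0 H0; have uh := unit_of_pow (ud_hE D) He0.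
have hhi : h * hi = 1 by rewrite divrr. have hih : hi * h = 1 by rewrite mulVr.
have yhi : y * hi = k 2 * hi * y.
  by apply: (mulrI uh); nc ioC q0 [:: h; hi; y] (tt, hhi, hih, hy).
have ahi : a * hi = k (-2) * hi * a.
  by apply: (mulrI uh); nc ioC q0 [:: h; hi; a] (tt, hhi, hih, ha).
have bhi : b * hi = hi * b - (k (-1) - k 3) * k 4 * hi * hi * y * y.
  have hb : h * b = b * h - (k (-1) - k 3) * y * y by uqc tt.
  by apply: (mulrI uh); nc ioC q0 [:: h; hi; b; y] (tt, hhi, hih, hb, yhi).
have w0hi : w0 * hi = k (-2) * hi * w0.
  by apply: (mulrI uh); nc ioC q0 [:: h; hi; w0] (tt, hhi, hih, hw0).
have w1hi : w1 * hi = k (-2) * hi * w1.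
  by apply: (mulrI uh); nc ioC q0 [:: h; hi; w1] (tt, hhi, hih, hw1).
have hil : hi ^+ l = io (zHe d)^-1.
  by rewrite /hi exprVn (ud_hE D) -rmorphV // unitfE.
rewrite -(dim_ker_nil C n).
have sD : (hi * D2) ^+ l = io ((zHe d)^-1 * (zHe d * zB d - zYe d ^+ 2)).
  rewrite exprMn_comm ?hil ?D2_pow ?rmorphM //.
  rewrite /GRing.comm /D2; uqc (tt, hhi, hih, yhi, ahi, bhi).
have H0' : (zHe d)^-1 * (zHe d * zB d - zYe d ^+ 2) != 0 by rewrite mulf_neq0 ?invr_neq0.
have stage2 L : preserves L w0 -> preserves L w1 -> preserves L h -> preserves L (hi * D2) ->
   (l ^ 2 %| \dim (ker_space L))%N.
  move=> p0 p1 ph pD.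
  apply: (@two_clocks L w0 h w1 (hi * D2) 2 2 _ _ _ _ co2 co2 w0l c0 (ud_hE D) He0 w0h
    w1l c1 sD H0' _ (esym (uq_w1w0 U)) _ p0 ph p1 pD).
    by rewrite /D2; uqc (tt, hhi, hih, yhi, ahi, bhi, w0hi, w1hi).
  by rewrite /D2; uqc (tt, hhi, hih, yhi, ahi, bhi, w0hi, w1hi).
rewrite expnS; have [Y0|Y0] := eqVneq (zYe d) 0; last first.
  have kl : (hi * H) ^+ l = io ((zHe d)^-1 * (zHe d - zYe d * zA d)).
    rewrite exprMn_comm ?hil ?H_pow ?rmorphM //.
    rewrite /GRing.comm /H; uqc (tt, hhi, hih, yhi, ahi, bhi).
  have H0'' : (zHe d)^-1 * (zHe d - zYe d * zA d) != 0 by rewrite mulf_neq0 ?invr_neq0.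
  have [|//|//|mu ->] := @ker_clock [::] (hi * H) y (-2) _ _ co2 kl H0'' (ud_yE D) Y0.
    by rewrite /H; uqc (tt, hhi, hih, yhi, ahi, bhi).
  apply: dvdn_mul => //; apply: stage2; apply: preserves_eigen => //;
    by rewrite /H ?/D2; uqc (tt, hhi, hih, yhi, ahi, bhi, w0hi, w1hi).
pose G := - ((k 1 - k (-1)) * h).
have uG : G \is a GRing.unit by rewrite unitrN unitrMl ?uh //; apply: unit_qcB.
rewrite (@ker_weyl [::] y a G G 0 0 (-2) 0) ?subr0 //.
- apply: dvdn_mul => //; apply: stage2.
  + exact: preserves_cons (@preserves_nil _) yw0.
  + exact: preserves_cons (@preserves_nil _) yw1.
  + exact: preserves_cons (@preserves_nil _) (iq_yh E).
  apply: (@preserves_cons _ _ _ (k 2 * hi * D2)) (@preserves_nil _) _.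
  by rewrite /D2; uqc (tt, hhi, hih, yhi, ahi, bhi).
- by move=> p _; rewrite /G; uqp p tt.
- by move=> p _; rewrite /G; uqp p tt.
- by move=> p _; rewrite !(mul0r, mulr0).
- by rewrite (ud_yE D) Y0 rmorph0.
- apply: (@preserves_cons _ _ _ (k (-2) * G)) (@preserves_nil _) _.
  by rewrite /G; uqc tt.
Qed.

Let bv1 : b * v1 = k 2 * v1 * b. Proof. by uqc tt. Qed.
Let yv1 : y * v1 = k 2 * v1 * y. Proof. by uqc tt. Qed.
Let hv1 : h * v1 = k 2 * v1 * h. Proof. by uqc tt. Qed.
Let av1 : a * v1 = v1 * a. Proof. by uqc tt. Qed.
Let hb : h * b = b * h - (k (-1) - k 3) * y * y. Proof. by uqc tt. Qed.
Let yb : y * b = k 2 * b * y. Proof. by uqc tt. Qed.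

Section Steinberg.
Hypotheses (A0 : zA d != 0) (Y0 : zYe d = 0) (He0 : zHe d = 0) (B0 : zB d != 0).
Let ua := unit_of_pow (ud_a D) A0.
Let ai := a^-1.
Let aai : a * ai = 1. Proof. exact: divrr. Qed.
Let aia : ai * a = 1. Proof. exact: mulVr. Qed.
Let hai : h * ai = k 2 * ai * h.
Proof. by apply: (mulrI ua); nc ioC q0 [:: a; ai; h] (tt, aai, aia, iq_fh E). Qed.
Let yai : y * ai = ai * y + (k 1 - k (-1)) * k 2 * ai * ai * h.
Proof.
apply: (mulrI ua); nc ioC q0 [:: a; ai; y; h] (tt, aai, aia, iq_fy E, hai).
Qed.
Let aiw0 : ai * w0 = k 1 * w0 * ai.
Proof. by apply: (mulrI ua); nc ioC q0 [:: a; ai; w0] (tt, aai, aia, aw0). Qed.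
Let aiw1 : ai * w1 = w1 * ai.
Proof. by apply: (mulrI ua); nc ioC q0 [:: a; ai; w1] (tt, aai, aia, aw1). Qed.
Let aiv0 : ai * v0 = k (-1) * v0 * ai.
Proof. by apply: (mulrI ua); nc ioC q0 [:: a; ai; v0] (tt, aai, aia, av0). Qed.
Let aiv1 : ai * v1 = v1 * ai.
Proof. by apply: (mulrI ua); nc ioC q0 [:: a; ai; v1] (tt, aai, aia, av1). Qed.
Let aig : ai * g = g * ai.
Proof. by apply: (mulrI ua); nc ioC q0 [:: a; ai; g] (tt, aai, aia, uq_ag U). Qed.
Let aib : ai * b = k 2 * b * ai - (k 2 - k (-2)) * k 2 * ai * (ai * y + (k 1 - k (-1)) * k 2 * ai * ai * h).
Proof.
apply: (mulrI ua); nc ioC q0 [:: a; ai; y; h; b] (tt, aai, aia, iq_fg E, yai, hai).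
Qed.
Let aif : ai * f = f * ai - (k 1 - k (-1)) * ai * (w0 * w0 * v1 - v0 * v0 * w1) * ai.
Proof.
apply: (mulrI ua); nc ioC q0 [:: a; ai; f; w0; v0; w1; v1] (tt, aai, aia, uq_af U).
Qed.

Ltac stc x ex := nc ioC q0 [:: a; ai; b; y; h; f; g; w0; w1; v0; v1; x]
 (ex, iq_fg E, hy, hb, yb, ya, ha, yai, hai, aiw0, aiw1, aiv0, aiv1, aig, aib, aif, aai, aia,
  (hw0, hw1, hv0, hv1, yw0, yw1, yv0, yv1), (aw0, aw1, av0, av1, bw0, bw1, bv0, bv1),
  (hf, hg, yf, yg, uq_af U, uq_ag U, uq_bf U, uq_w0f U, uq_w1f U, v0f, v1f), (uq_w0g U, uq_w1g U, v0g, v1g),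
  (uq_w0v0 U, uq_v0w0 U, uq_w1v1 U, uq_v1w1 U, uq_w1w0 U, esym v0w1, v1w0, v1v0)).

(** On the kernel of [h] this acts as [a^-1 * y]. Its partner [w] is the Casimir element of the
    short simple root plus a correction in [g * X], which makes [X * w - w * X] on that kernel the
    sum of [G], a unit where [X] vanishes, and of a term ending in [X * X]. *)
Let X := H * (- k (-1) * ai * ai).
Let w := a * f + k (-1) * w0 * w0 * v1 + k 1 * v0 * v0 * w1 + k (-3) * g * X * v1.
Let G := - (k 1 - k (-1)) * (b - (k 2 + 1) * X) * v0 * v0 * w1.
Let G' := - (k 1 - k (-1)) * b * v0 * v0 * w1.
Let u := (k 1 - k (-1)) * g * v1.
Let G1 := k (-1) * (1 - k (-4)) * a * a * v0 * v0 * w1 * w1.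

Let dim_stage1 : (\dim (@ker_space C n [::]) = l * \dim (ker_space [:: h]))%N.
Proof.
have uG1 : G1 \is a GRing.unit.
  by rewrite !unitrMl ?uv0 ?uw1 ?ua ?unit_qc // -(qc0 io q); apply: unit_qcB.
apply: (@ker_weyl [::] h g G1 G1 0 0 (-4) 0) => //.
- by move=> p _; rewrite /G1; uqp p tt.
- by move=> p _; rewrite /G1; nc ioC q0 [:: a; h; v0; w1; p] (tt, hw1, hv0, ha).
- by move=> p _; rewrite !(mul0r, mulr0).
- by rewrite (ud_hE D) He0 rmorph0.
- apply: (@preserves_cons _ _ _ (k (-4) * G1)) (@preserves_nil _) _.
  by rewrite /G1; nc ioC q0 [:: a; h; v0; w1] (tt, hw1, hv0, ha).
Qed.

Let h_annih p : annih [:: h] p -> h * p = 0. Proof. by case/annih_cons. Qed.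

Let preserves_h Z : (forall p, h * p = 0 -> h * (Z * p) = 0) -> preserves [:: h] Z.
Proof. by move=> hZ p /h_annih hp; apply/annih_cons; split; [exact: hZ|]. Qed.

Let annih_Xh p : annih [:: X; h] p <-> h * p = 0 /\ y * p = 0.
Proof.
split=> [/annih_cons[Xp /h_annih hp]|[hp yp]].
  split=> //; have : ai * y * p = 0 by rewrite -Xp /X /H; stc p (tt, hp).
  by move=> e; rewrite -[y * p]mul1r -aai -mulrA [ai * _]mulrA e mulr0.
apply/annih_cons; split; first by rewrite /X /H; stc p (tt, hp, yp).
exact/annih_cons.
Qed.

Let preserves_Xh Z : (forall p, h * p = 0 -> y * p = 0 -> h * (Z * p) = 0 /\ y * (Z * p) = 0) ->
  preserves [:: X; h] Z.
Proof. by move=> hZ p /annih_Xh[hp yp]; apply/annih_Xh; exact: hZ. Qed.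

Let dim_stage2 : (\dim (ker_space [:: h]) = l * \dim (ker_space [:: X; h]))%N.
Proof.
have uG' : G' \is a GRing.unit.
  rewrite !unitrMl ?uv0 ?uw1 ?(unit_of_pow (ud_b D) B0) // ?mulN1r ?unitrN; exact: unit_qcB.
have [aH _ _] := iq_H_comm ioC q_prim E.
apply: (@ker_weyl [:: h] X w G G' u 0 2 2 0) => //.
- by apply: preserves_h => p hp; rewrite /X /H; stc p (tt, hp).
- by apply: preserves_h => p hp; rewrite /w /X /H; stc p (tt, hp).
- by move=> p /h_annih hp; rewrite /w /G /u /X /H; stc p (tt, hp).
- by move=> p /h_annih hp; rewrite /G /X /H; stc p (tt, hp).
- by move=> p /h_annih hp; rewrite /u /X /H; stc p (tt, hp).
- have aiH : H * ai = ai * H by apply: (@commrV _ H a); exact: esym.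
  rewrite /X exprMn_comm ?H_pow ?He0 ?Y0 ?mul0r ?subrr ?rmorph0 ?mul0r //.
  by apply/commrM/aiH; apply/commrM/aiH; apply: commrN; apply/commr_sym/qc_comm.
- by move=> p /annih_Xh[hp yp]; rewrite /G /G' /X /H; stc p (tt, hp, yp).
- by apply: preserves_Xh => p hp yp; rewrite /G'; split; stc p (tt, hp, yp).
Qed.

(** The four factors [l] come from the nilpotent [h] against [g], from [X] against [w] on the kernel
    of [h], and from [a] and [b] shifting the eigenvalues of [w0] and [w1] on the common kernel of
    [h] and [y]. *)
Lemma steinberg_criterion : (l ^ 4 %| n.+1)%N.
Proof.
rewrite -(dim_ker_nil C n) dim_stage1 dim_stage2 mulnA mulnn (expnD l 2 2) dvdn_mul //.
apply: (@two_clocks _ w0 a w1 b 1 2 _ _ _ _ co1 co2 w0l c0 (ud_a D) A0 (uq_w0a U)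
    w1l c1 (ud_b D) B0 (uq_w1b U) (esym (uq_w1w0 U)) (uq_w0b U)).
all: by apply: preserves_Xh => p hp yp; split; stc p (tt, hp, yp).
Qed.
End Steinberg.
End Criteria.

(** * Conjugation by the upper triangular unipotent group *)

Section PolynomialFunctions.
Variable C : numClosedFieldType.
Implicit Types (f g : C -> C).

Definition polyfun f := exists p : {poly C}, forall t, f t = p.[t].

Lemma polyfun_ext f g : f =1 g -> polyfun f -> polyfun g.
Proof. by move=> e [p fp]; exists p => t; rewrite -e. Qed.
Lemma polyfun_const c : polyfun (fun=> c).
Proof. by exists c%:P => t; rewrite hornerC. Qed.
Lemma polyfun_id : polyfun (fun t => t).
Proof. by exists 'X => t; rewrite hornerX. Qed.
Lemma polyfun_add f g : polyfun f -> polyfun g -> polyfun (fun t => f t + g t).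
Proof. by move=> [p fp] [r gr]; exists (p + r) => t; rewrite hornerD fp gr. Qed.
Lemma polyfun_mul f g : polyfun f -> polyfun g -> polyfun (fun t => f t * g t).
Proof. by move=> [p fp] [r gr]; exists (p * r) => t; rewrite hornerM fp gr. Qed.
Lemma polyfun_opp f : polyfun f -> polyfun (fun t => - f t).
Proof. by move=> [p fp]; exists (- p) => t; rewrite hornerN fp. Qed.

Lemma poly_nonroot (p : {poly C}) : p != 0 -> exists t, p.[t] != 0.
Proof.
move=> p0; case: (boolP (all (root p) [seq i%:R | i <- iota 0 (size p)])) => [|/allPn[t _]].
  move=> ar; have := max_poly_roots p0 ar; rewrite size_map size_iota ltnn map_inj_uniq ?iota_uniq.
    by move=> /(_ isT).
  by move=> i j /eqP; rewrite eqr_nat => /eqP.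
by rewrite rootE => h; exists t.
Qed.

Lemma polyfun_nonzero (fs : seq (C -> C)) :
  (forall i, (i < size fs)%N -> polyfun (nth (fun=> 1) fs i) /\ exists t, nth (fun=> 1) fs i t != 0) ->
  exists t, forall i, (i < size fs)%N -> nth (fun=> 1) fs i t != 0.
Proof.
move=> H; suff [p p0 Hp] : exists2 p : {poly C}, p != 0 &
    forall t, p.[t] != 0 -> forall i, (i < size fs)%N -> nth (fun=> 1) fs i t != 0.
  by have [t /Hp] := poly_nonroot p0; exists t.
elim: fs H => [|f fs IH] H; first by exists 1; rewrite ?oner_neq0.
have [|p p0 Hp] := IH; first by move=> i ip; apply: (H i.+1).
have [[r fr] [t ft]] : polyfun f /\ exists t, f t != 0 := H 0%N isT.
have r0 : r != 0.
  by apply: contraNneq ft => r0; rewrite fr r0 horner0.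
exists (r * p); first exact: mulf_neq0.
by move=> s; rewrite hornerM mulf_eq0 negb_or => /andP[rs /Hp ps] [|i] //=; [rewrite fr | exact: ps].
Qed.

(* Both points lie on the line [t |-> x + t (y - x)]. *)
Definition linewise (E : lmodType C) (F : E -> C) := forall x d, polyfun (fun t => F (x + t *: d)).

Lemma linewise_mul_nonzero (E : lmodType C) (F G : E -> C) : linewise F -> linewise G ->
  (exists x, F x != 0) -> (exists x, G x != 0) -> exists2 x, F x != 0 & G x != 0.
Proof.
move=> lF lG [x Fx] [y Gy].
have [|t Ht] := @polyfun_nonzero [:: (fun t => F (x + t *: (y - x))); (fun t => G (x + t *: (y - x)))].
  case=> [|[|//]] _ /=; split; [exact: lF| |exact: lG|].
    by exists 0; rewrite scale0r addr0.
  by exists 1; rewrite scale1r addrC subrK.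
by exists (x + t *: (y - x)); [apply: (Ht 0%N) | apply: (Ht 1%N)].
Qed.

Section Linewise.
Variable E : lmodType C.
Implicit Types (F G : E -> C).
Lemma linewise_const c : linewise (fun _ : E => c).
Proof. by move=> x d; apply: polyfun_const. Qed.
Lemma linewise_add F G : linewise F -> linewise G -> linewise (fun x => F x + G x).
Proof. by move=> f g x d; apply: polyfun_add. Qed.
Lemma linewise_mul F G : linewise F -> linewise G -> linewise (fun x => F x * G x).
Proof. by move=> f g x d; apply: polyfun_mul. Qed.
Lemma linewise_opp F : linewise F -> linewise (fun x => - F x).
Proof. by move=> f x d; apply: polyfun_opp. Qed.
Lemma linewise_linear F : (forall x t y, F (x + t *: y) = F x + t * F y) -> linewise F.
Proof.
move=> lF x d; apply: (@polyfun_ext (fun t => F x + t * F d)) => [t|]; first by rewrite lF.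
apply: polyfun_add; first exact: polyfun_const.
by apply: polyfun_mul; [exact: polyfun_id | exact: polyfun_const].
Qed.
End Linewise.
End PolynomialFunctions.

Ltac polyfun := repeat first [exact: polyfun_const | exact: polyfun_id
  | apply: polyfun_add | apply: polyfun_mul | apply: polyfun_opp].

Section Connectedness.
Variables (C : numClosedFieldType) (q : C) (l : nat).
Hypotheses (l_odd : odd l) (l_gt1 : (1 < l)%N) (q_prim : l.-primitive_root q).

Notation mx4 a11 a12 a13 a14 a21 a22 a23 a24 a31 a32 a33 a34 a41 a42 a43 a44 :=
  (mx_of_rows [:: [:: a11; a12; a13; a14]; [:: a21; a22; a23; a24];
                  [:: a31; a32; a33; a34]; [:: a41; a42; a43; a44]]).

(** The product of [xroot0 z] and of the element with coordinates [x, y, r] of the abelian unipotent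
    radical of the Siegel parabolic. In these coordinates [xroot1 s] adds [s (z^2, -z, 1)] to
    [(x, y, r)]. *)
Definition upper (z x y r : C) : 'M[C]_4 :=
  mx4 1 z (y + z * r) (x + z * y)  0 1 r y  0 0 1 (- z)  0 0 0 1.
Definition upper_inv (z x y r : C) : 'M[C]_4 :=
  mx4 1 (- z) (- y) (- x - y * z)  0 1 (- r) (- y - r * z)  0 0 1 z  0 0 0 1.
Lemma upperK z x y r : upper z x y r *m upper_inv z x y r = 1%:M.
Proof.
rewrite /upper /upper_inv mx4_mul -diag4_1 /diag4.
by congr (mx_of_rows [:: [:: _; _; _; _]; [:: _; _; _; _]; [:: _; _; _; _]; [:: _; _; _; _]]); ring.
Qed.
Lemma upper0 : upper 0 0 0 0 = 1%:M.
Proof.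
rewrite /upper -diag4_1 /diag4.
by congr (mx_of_rows [:: [:: _; _; _; _]; [:: _; _; _; _]; [:: _; _; _; _]; [:: _; _; _; _]]); ring.
Qed.
Lemma xroot0_upper s z x y r : xroot0 s *m upper z x y r = upper (s + z) x y r.
Proof.
rewrite /upper /xroot0 /unip_plus mx4_mul.
by congr (mx_of_rows [:: [:: _; _; _; _]; [:: _; _; _; _]; [:: _; _; _; _]; [:: _; _; _; _]]); ring.
Qed.
Lemma xroot1_upper s z x y r :
  xroot1 s *m upper z x y r = upper z (x + s * z ^+ 2) (y - s * z) (r + s).
Proof.
rewrite /upper /xroot1 /unip_plus mx4_mul.
by congr (mx_of_rows [:: [:: _; _; _; _]; [:: _; _; _; _]; [:: _; _; _; _]; [:: _; _; _; _]]); ring.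
Qed.

Variable M : 'M[C]_4.
Definition twist z x y r := upper z x y r *m M *m upper_inv z x y r.
(** The first of the two leading minors that detect the big cell. It does not change when a multiple
    of [(z^2, -z, 1)] is added to [(x, y, r)], and the second minor does not involve [z]. *)
Definition lead1 z x y r := M 0 0 + z * M 1 0 + (y + z * r) * M 2%:R 0 + (x + z * y) * M 3%:R 0.
Definition lead2 x y r :=
  (M 0 0 + y * M 2%:R 0 + x * M 3%:R 0) * (M 1 1 + r * M 2%:R 1 + y * M 3%:R 1) -
  (M 0 1 + y * M 2%:R 1 + x * M 3%:R 1) * (M 1 0 + r * M 2%:R 0 + y * M 3%:R 0).

Lemma twist_lead1 z x y r : twist z x y r 0 0 = lead1 z x y r.
Proof.
rewrite /twist /upper /upper_inv [M]mx4_eta !mx4_mul /lead1 !mxE /=; ring.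
Qed.
Lemma twist_lead2 z x y r : minor2 (twist z x y r) 0 1 = lead2 x y r.
Proof.
rewrite /minor2 /twist /upper /upper_inv [M]mx4_eta !mx4_mul /lead2 !mxE /=; ring.
Qed.
Lemma twist_xroot0 s z x y r :
  xroot0 s *m twist z x y r *m xroot0 (- s) = twist (s + z) x y r.
Proof.
have E : upper_inv z x y r *m xroot0 (- s) = upper_inv (s + z) x y r.
  rewrite /upper_inv /xroot0 /unip_plus mx4_mul.
  by congr (mx_of_rows [:: [:: _; _; _; _]; [:: _; _; _; _]; [:: _; _; _; _]; [:: _; _; _; _]]); ring.
by rewrite /twist !mulmxA xroot0_upper -mulmxA E.
Qed.
Lemma twist_xroot1 s z x y r :
  xroot1 s *m twist z x y r *m xroot1 (- s) = twist z (x + s * z ^+ 2) (y - s * z) (r + s).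
Proof.
have E : upper_inv z x y r *m xroot1 (- s) = upper_inv z (x + s * z ^+ 2) (y - s * z) (r + s).
  rewrite /upper_inv /xroot1 /unip_plus mx4_mul.
  by congr (mx_of_rows [:: [:: _; _; _; _]; [:: _; _; _; _]; [:: _; _; _; _]; [:: _; _; _; _]]); ring.
by rewrite /twist !mulmxA xroot1_upper -mulmxA E.
Qed.

Variable n : nat.
Let R z x y r := Realized q l n (twist z x y r).

Lemma move_z z z' x y r : lead1 z' x y r != 0 -> R z x y r -> R z' x y r.
Proof.
move=> nz Rz; rewrite /R -[z'](subrK z) -twist_xroot0.
apply: Realized_x0 => //; rewrite -/(twist _ _ _ _).
have E : (xroot0 (z' - z) *m twist z x y r *m xroot0 (- (z' - z))) 0 0 = lead1 z' x y r.
  by rewrite twist_xroot0 subrK twist_lead1.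
move: nz; rewrite -E; move: (twist z x y r) => N; apply: contraNneq => h.
rewrite /xroot0 /unip_plus [N]mx4_eta !mx4_mul !mxE /= !(mulr0, mul0r, addr0, mulr1, mul1r).
by rewrite subrr mul0r addr0 h.
Qed.
Lemma move_S s z x y r : lead2 (x + s * z ^+ 2) (y - s * z) (r + s) != 0 ->
  R z x y r -> R z (x + s * z ^+ 2) (y - s * z) (r + s).
Proof.
move=> nz Rz; rewrite /R -twist_xroot1; apply: Realized_x1 => //.
have E : minor2 (xroot1 s *m twist z x y r *m xroot1 (- s)) 0 1 = lead2 (x + s * z ^+ 2) (y - s * z) (r + s).
  by rewrite twist_xroot1 twist_lead2.
move: nz; rewrite -E; move: (twist z x y r) => N; apply: contraNneq => h.
rewrite -h; apply/eqP; rewrite /minor2 /xroot1 /unip_plus [N]mx4_eta !mx4_mul !mxE /=; ring.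
Qed.
Lemma move_zS s z z' x y r : lead1 z' x y r != 0 -> lead2 (x + s * z' ^+ 2) (y - s * z') (r + s) != 0 ->
  R z x y r -> R z' (x + s * z' ^+ 2) (y - s * z') (r + s).
Proof. by move=> h1 h2 /(move_z h1)/(move_S h2). Qed.

Let avoid (fs : seq (C -> C)) (cs : seq C) :
  (forall i, (i < size fs)%N -> polyfun (nth (fun=> 1) fs i) /\ exists t, nth (fun=> 1) fs i t != 0) ->
  exists t, (forall i, (i < size fs)%N -> nth (fun=> 1) fs i t != 0) /\ t \notin cs.
Proof.
move=> H.
have [|t Ht] := @polyfun_nonzero _ (fs ++ [seq (fun t => t - c) | c <- cs]).
  move=> i; rewrite size_cat size_map nth_cat; case: ifP => [ifs _|ifs ilt]; first exact: H.
  have ilt' : (i - size fs < size cs)%N by rewrite ltn_subLR // leqNgt ifs.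
  rewrite (nth_map 0) //; split; first by polyfun.
  by exists (nth 0 cs (i - size fs) + 1); rewrite addrAC subrr add0r oner_neq0.
exists t; split=> [i ifs|].
  by have := Ht i; rewrite nth_cat ifs size_cat; apply; rewrite ltn_addr.
apply/negP => /(nthP 0)[j jc tj].
have := Ht (size fs + j)%N; rewrite size_cat size_map ltn_add2l => /(_ jc).
by rewrite nth_cat ltnNge leq_addr addKn (nth_map 0) //= tj subrr eqxx.
Qed.

(** Only steps along simple root subgroups inside the big cell are available. The target [(x, y, r)]
    is a sum of three multiples of vectors [(z_i^2, -z_i, 1)], each added after moving [z] to [z_i].
    The direct path may leave the big cell, so the first two coefficients pass through generic
    values [t1], [t2] and are corrected at the end. *)
Theorem Realized_twist z x y r : Realized q l n M -> M 0 0 != 0 -> minor2 M 0 1 != 0 ->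
  twist z x y r 0 0 != 0 -> minor2 (twist z x y r) 0 1 != 0 -> Realized q l n (twist z x y r).
Proof.
move=> RM M1 M2; rewrite twist_lead1 twist_lead2 => N1 N2.
have R0 : R 0 0 0 0.
  suff -> : R 0 0 0 0 = Realized q l n M by [].
  rewrite /R /twist upper0 mul1mx; congr Realized.
  have := upperK 0 0 0 0; rewrite upper0 mul1mx => ->; exact: mulmx1.
have L2 : lead2 0 0 0 != 0 by move: M2; rewrite /minor2 /lead2 !mul0r !addr0.
have L1 : lead1 0 0 0 0 != 0 by rewrite /lead1 !mul0r !addr0 ?mul0r ?addr0.
have choose_z (cs : seq C) : exists z, [/\ lead1 z 0 0 0 != 0, lead1 z x y r != 0 & z \notin cs].
  have [|t [Ht tc]] := @avoid [:: (fun z => lead1 z 0 0 0); (fun z => lead1 z x y r)] cs.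
    case=> [|[|//]] _ /=; split; try by rewrite /lead1; polyfun.
      by exists 0.
    by exists z.
  by exists t; split=> //; [apply: (Ht 0%N) | apply: (Ht 1%N)].
have [z1 [p1 r1 _]] := choose_z [::].
have [z2 [p2 r2 n21]] := choose_z [:: z1].
have [z3 [p3 r3 n31]] := choose_z [:: z1; z2].
have n12 : z1 - z2 != 0 by move: n21; rewrite inE subr_eq0 eq_sym.
have [n13 n23] : z1 - z3 != 0 /\ z2 - z3 != 0.
  by move: n31; rewrite !inE negb_or !subr_eq0 ![z3 == _]eq_sym => /andP[].
have n21' : z2 - z1 != 0 by rewrite -opprB oppr_eq0.
have n31' : z3 - z1 != 0 by rewrite -opprB oppr_eq0.
have n32' : z3 - z2 != 0 by rewrite -opprB oppr_eq0.
(* Interpolation: the coordinates of [(x, y, r)] in the basis [(z_i^2, -z_i, 1)] for three distinct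
   [z_i]. *)
pose a1 := (x + y * (z2 + z3) + r * z2 * z3) / ((z1 - z2) * (z1 - z3)).
pose a2 := (x + y * (z1 + z3) + r * z1 * z3) / ((z2 - z1) * (z2 - z3)).
pose a3 := (x + y * (z1 + z2) + r * z1 * z2) / ((z3 - z1) * (z3 - z2)).
have ex : x = a1 * z1 ^+ 2 + a2 * z2 ^+ 2 + a3 * z3 ^+ 2.
  by rewrite /a1 /a2 /a3; field; rewrite ?n12 ?n13 ?n23 ?n21' ?n31' ?n32'.
have ey : y = - (a1 * z1) - a2 * z2 - a3 * z3.
  by rewrite /a1 /a2 /a3; field; rewrite ?n12 ?n13 ?n23 ?n21' ?n31' ?n32'.
have er : r = a1 + a2 + a3.
  by rewrite /a1 /a2 /a3; field; rewrite ?n12 ?n13 ?n23 ?n21' ?n31' ?n32'.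
clearbody a1 a2 a3; subst x y r.
pose S (T : Type) t1 t2 t3 (F : C -> C -> C -> T) := F (t1 * z1 ^+ 2 + t2 * z2 ^+ 2 + t3 * z3 ^+ 2)
  (- (t1 * z1) - t2 * z2 - t3 * z3) (t1 + t2 + t3).
have S0 F : S C 0 0 0 F = F 0 0 0 by rewrite /S !mul0r !oppr0 !addr0.
have [|t1 [Ht1 _]] := @avoid [:: (fun t => S C t 0 0 lead2); (fun t => S C t a2 a3 lead2);
    (fun t => S C t 0 0 (lead1 z2)); (fun t => S C t a2 a3 (lead1 z2)); (fun t => S C t 0 0 (lead1 z3))] [::].
  case=> [|[|[|[|[|//]]]]] _ /=; split; try by rewrite /S /lead1 /lead2; polyfun.
  - by exists 0; rewrite S0.
  - by exists a1.
  - by exists 0; rewrite S0.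
  - by exists a1.
  - by exists 0; rewrite S0.
have h1 := Ht1 0%N isT; have h2 := Ht1 1%N isT; have h3 := Ht1 2%N isT.
have h4 := Ht1 3%N isT; have h5 := Ht1 4%N isT; rewrite /= in h1 h2 h3 h4 h5.
have [|t2 [Ht2 _]] := @avoid [:: (fun t => S C t1 t 0 lead2); (fun t => S C t1 t a3 lead2);
    (fun t => S C t1 t 0 (lead1 z3))] [::].
  case=> [|[|[|//]]] _ /=; split; try by rewrite /S /lead1 /lead2; polyfun.
  - by exists 0.
  - by exists a2.
  - by exists 0.
have g1 := Ht2 0%N isT; have g2 := Ht2 1%N isT; have g3 := Ht2 2%N isT; rewrite /= in g1 g2 g3.
have stepS w s u v t u' v' t' : (exists z0, R z0 u v t) ->
  u' = u + s * w ^+ 2 -> v' = v - s * w -> t' = t + s ->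
  lead1 w u v t != 0 -> lead2 u' v' t' != 0 -> exists z0, R z0 u' v' t'.
  by move=> [z0 Rz0] -> -> -> l1 l2; exists w; exact: move_zS Rz0.
have Q1 : exists z0, S Prop t1 0 0 (R z0).
  by apply: (stepS z1 t1 0 0 0) => //; first (by exists 0); ring.
have Q2 : exists z0, S Prop t1 t2 0 (R z0) by apply: (stepS z2 t2 _ _ _ _ _ _ Q1) => //; ring.
have Q3 : exists z0, S Prop t1 t2 a3 (R z0) by apply: (stepS z3 a3 _ _ _ _ _ _ Q2) => //; ring.
have Q4 : exists z0, S Prop t1 a2 a3 (R z0).
  apply: (stepS z2 (a2 - t2) _ _ _ _ _ _ Q3) => //; try ring.
  (* The coefficient of [(z2^2, -z2, 1)] does not enter [lead1 z2]. *)
  by apply: contraNneq h4 => <-; apply/eqP; rewrite /S /lead1; ring.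
suff [z0 Rz0] : exists z0, S Prop a1 a2 a3 (R z0) by exact: move_z Rz0.
apply: (stepS z1 (a1 - t1) _ _ _ _ _ _ Q4) => //; try ring.
by apply: contraNneq r1 => <-; apply/eqP; rewrite /lead1; ring.
Qed.
End Connectedness.

(** * The symplectic form and the entries of conjugates *)

Section SymplecticForm.
Variable C : numClosedFieldType.
Implicit Types (x y v w : 'rV[C]_4) (M : 'M[C]_4).
Local Notation J := (symp_form C).

Notation mx4 a11 a12 a13 a14 a21 a22 a23 a24 a31 a32 a33 a34 a41 a42 a43 a44 :=
  (mx_of_rows [:: [:: a11; a12; a13; a14]; [:: a21; a22; a23; a24];
                  [:: a31; a32; a33; a34]; [:: a41; a42; a43; a44]]).

Definition om x y : C := x 0 0 * y 0 3%:R + x 0 1 * y 0 2%:R - x 0 2%:R * y 0 1 - x 0 3%:R * y 0 0.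

Lemma omE x y : om x y = (x *m J *m y^T) 0 0.
Proof.
rewrite /om !mxE !big_ord_recl big_ord0 !mxE !big_ord_recl !big_ord0 !mxE /=.
have -> : lift ord0 (0 : 'I_3) = 1 :> 'I_4 by apply: val_inj.
have -> : lift ord0 (lift ord0 (0 : 'I_2)) = 2%:R :> 'I_4 by apply: val_inj.
have -> : lift ord0 (lift ord0 (lift ord0 (0 : 'I_1))) = 3%:R :> 'I_4 by apply: val_inj.
ring.
Qed.
Lemma omDl x y v : om (x + y) v = om x v + om y v. Proof. by rewrite /om !mxE; ring. Qed.
Lemma omDr x y v : om v (x + y) = om v x + om v y. Proof. by rewrite /om !mxE; ring. Qed.
Lemma omZl c x v : om (c *: x) v = c * om x v. Proof. by rewrite /om !mxE; ring. Qed.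
Lemma omZr c x v : om v (c *: x) = c * om v x. Proof. by rewrite /om !mxE; ring. Qed.
Lemma omNl x v : om (- x) v = - om x v. Proof. by rewrite /om !mxE; ring. Qed.
Lemma omNr x v : om v (- x) = - om v x. Proof. by rewrite /om !mxE; ring. Qed.
Lemma omC x y : om y x = - om x y. Proof. by rewrite /om; ring. Qed.
Lemma omxx x : om x x = 0. Proof. by rewrite /om; ring. Qed.

Definition omB := (omDl, omDr, omZl, omZr, omNl, omNr).

Lemma om_nondeg x : (forall y, om x y = 0) -> x = 0.
Proof.
move=> h; apply/rowP => j; rewrite mxE.
have := h (delta_mx 0 0); have := h (delta_mx 0 1); have := h (delta_mx 0 2%:R); have := h (delta_mx 0 3%:R).
rewrite /om !mxE /= !(mulr0, mulr1, addr0, subr0, add0r, sub0r) => h0 h1 /eqP; rewrite oppr_eq0 => /eqP h2 /eqP.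
rewrite oppr_eq0 => /eqP h3.
by case: j => -[|[|[|[|]]]] //= jp; [rewrite -[RHS]h0 | rewrite -[RHS]h1 | rewrite -[RHS]h2 | rewrite -[RHS]h3];
  congr (x _ _); apply: val_inj.
Qed.

(** Matrices act on row vectors here, so this is the condition of [Sp4] for the transpose;
    [Sp4_symplectic] passes from one to the other. *)
Definition symplectic M := M *m J *m M^T = J.

Lemma om_mulmx M x y : symplectic M -> om (x *m M) (y *m M) = om x y.
Proof. by move=> sM; rewrite !omE trmx_mul !mulmxA -(mulmxA x) -(mulmxA x) sM. Qed.

Lemma symplecticM M N : symplectic M -> symplectic N -> symplectic (M *m N).
Proof. by move=> sM sN; rewrite /symplectic trmx_mul !mulmxA -(mulmxA M N) -(mulmxA M) sN. Qed.

Lemma phi_symplectic (d : zdata C) : zc0 d != 0 -> zc1 d != 0 -> symplectic (phi d).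
Proof.
move=> c0 c1.
have tr (a11 a12 a13 a14 a21 a22 a23 a24 a31 a32 a33 a34 a41 a42 a43 a44 : C) :
  (mx4 a11 a12 a13 a14 a21 a22 a23 a24 a31 a32 a33 a34 a41 a42 a43 a44)^T =
  mx4 a11 a21 a31 a41 a12 a22 a32 a42 a13 a23 a33 a43 a14 a24 a34 a44.
  by apply/matrixP=> i j; rewrite !mxE; case: i => -[|[|[|[|]]]] //= ?; case: j => -[|[|[|[|]]]] //= ?.
apply: symplecticM; first apply: symplecticM.
- rewrite /symplectic /unip_minus tr /symp_form !mx4_mul.
  by congr (mx_of_rows [:: [:: _; _; _; _]; [:: _; _; _; _]; [:: _; _; _; _]; [:: _; _; _; _]]); ring.
- rewrite /symplectic /diag4 tr /symp_form !mx4_mul.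
  by congr (mx_of_rows [:: [:: _; _; _; _]; [:: _; _; _; _]; [:: _; _; _; _]; [:: _; _; _; _]]); field; rewrite ?c0 ?c1.
- rewrite /symplectic /unip_plus tr /symp_form !mx4_mul.
  by congr (mx_of_rows [:: [:: _; _; _; _]; [:: _; _; _; _]; [:: _; _; _; _]; [:: _; _; _; _]]); ring.
Qed.

(** The inverse of a symplectic matrix is its adjoint, which makes the last two coordinates
    symplectic products with the rows of [upper]. *)
Lemma upper_inv_entries (a : 'rV[C]_4) (z x y r : C) :
  [/\ (a *m upper_inv z x y r) 0 0 = a 0 0,
      (a *m upper_inv z x y r) 0 1 = a 0 1 - z * a 0 0,
      (a *m upper_inv z x y r) 0 2%:R = - om a (row 1 (upper z x y r)) &
      (a *m upper_inv z x y r) 0 3%:R = - om a (row 0 (upper z x y r))].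
Proof.
have E1 : lift ord0 (0 : 'I_3) = 1 :> 'I_4 by apply: val_inj.
have E2 : lift ord0 (lift ord0 (0 : 'I_2)) = 2%:R :> 'I_4 by apply: val_inj.
have E3 : lift ord0 (lift ord0 (lift ord0 (0 : 'I_1))) = 3%:R :> 'I_4 by apply: val_inj.
rewrite /om !mxE !big_ord_recl !big_ord0 !mxE /= ?E1 ?E2 ?E3.
split; ring.
Qed.

Lemma twist_entry M (z x y r : C) i j :
  twist M z x y r i j = (row i (upper z x y r) *m M *m upper_inv z x y r) 0 j.
Proof. by rewrite -!row_mul !mxE. Qed.

Definition wedge12 x y : C := x 0 0 * y 0 1 - x 0 1 * y 0 0.

Lemma twist_minor2 M (z x y r : C) : minor2 (twist M z x y r) 0 1 =
  wedge12 (row 0 (upper z x y r) *m M) (row 1 (upper z x y r) *m M).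
Proof.
rewrite /minor2 !twist_entry /wedge12.
have [-> -> _ _] := upper_inv_entries (row 0 (upper z x y r) *m M) z x y r.
have [-> -> _ _] := upper_inv_entries (row 1 (upper z x y r) *m M) z x y r.
ring.
Qed.

Lemma mulmx_entries (v : 'rV[C]_4) M j :
  (v *m M) 0 j = v 0 0 * M 0 j + v 0 1 * M 1 j + v 0 2%:R * M 2%:R j + v 0 3%:R * M 3%:R j.
Proof.
rewrite mxE !big_ord_recl big_ord0 addr0 !addrA.
by congr (_ * M _ _ + v _ _ * M _ _ + v _ _ * M _ _ + v _ _ * M _ _); apply: val_inj.
Qed.
End SymplecticForm.

Section MatrixCriteria.
Variables (C : numClosedFieldType) (q : C) (l n : nat).
Hypotheses (l_odd : odd l) (l_gt1 : (1 < l)%N) (q_prim : l.-primitive_root q).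
Variable M : 'M[C]_4.
Hypothesis RM : Realized q l n M.

Lemma Realized_symplectic : symplectic M.
Proof.
have [d [a [b [yE [hE [f [g [yF [hF [w0 [w1 [v0 [v1 D]]]]]]]]]]]] ->] := RM.
exact: phi_symplectic (ud_c0 D) (ud_c1 D).
Qed.
Lemma Realized_lead : M 0 0 != 0 /\ minor2 M 0 1 != 0.
Proof.
have [d [a [b [yE [hE [f [g [yF [hF [w0 [w1 [v0 [v1 D]]]]]]]]]]]] ->] := RM.
have [-> _] := phi_D1 d; have [-> _] := phi_D2 (ud_c0 D) (ud_c1 D).
by rewrite !expf_neq0 ?(ud_c0 D) ?(ud_c1 D).
Qed.

Let phi_row0 (d : zdata C) : zc0 d != 0 -> zc1 d != 0 ->
  [/\ phi d 0 0 = zc0 d ^+ 2, phi d 0 1 = zc1 d * zA d, phi d 0 2%:R = zc0 d ^+ 2 * zYe d / zc1 d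
    & phi d 0 3%:R = zHe d - zA d * zYe d] /\
  [/\ phi d 1 2%:R = zF d * phi d 0 2%:R + zB d + zF d * 0
    & phi d 0 2%:R * phi d 1 3%:R - phi d 0 3%:R * phi d 1 2%:R = - (zHe d * zB d - zYe d ^+ 2)].
Proof.
move=> c0 c1; rewrite /phi /unip_plus /unip_minus /diag4 !mx4_mul !mxE /=.
by split; split; field; rewrite ?c0 ?c1.
Qed.

Lemma Realized_dvd2 : M 0 1 != 0 \/ M 0 3%:R != 0 -> (l ^ 2 %| n.+1)%N.
Proof.
have [d [a [b [yE [hE [f [g [yF [hF [w0 [w1 [v0 [v1 D]]]]]]]]]]]] ->] := RM.
have [[_ -> _ ->] _] := phi_row0 (ud_c0 D) (ud_c1 D).
have [A0|A0] := eqVneq (zA d) 0; last first.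
  by move=> _; have := sl2_criterion l_odd l_gt1 q_prim D A0.
rewrite A0 mulr0 mul0r subr0 eqxx => -[//|He0].
by have := sl2_criterion' l_odd l_gt1 q_prim D A0 He0.
Qed.

(** Up to nonzero factors the three quantities are [zHe - zYe zA], [zHe] and the minor
    [zHe zB - zYe ^+ 2] of [heisenberg_criterion]. *)
Lemma Realized_dvd3 : M 0 3%:R != 0 -> M 0 3%:R * M 0 0 + M 0 1 * M 0 2%:R != 0 ->
  M 0 2%:R * M 1 3%:R - M 0 3%:R * M 1 2%:R != 0 -> (l ^ 3 %| n.+1)%N.
Proof.
have [d [a [b [yE [hE [f [g [yF [hF [w0 [w1 [v0 [v1 D]]]]]]]]]]]] ->] := RM.
have [[-> -> E2 E3] [_ ->]] := phi_row0 (ud_c0 D) (ud_c1 D); rewrite E2 E3 oppr_eq0.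
have -> : (zHe d - zA d * zYe d) * zc0 d ^+ 2 + zc1 d * zA d * (zc0 d ^+ 2 * zYe d / zc1 d) =
   zHe d * zc0 d ^+ 2 by field; exact: ud_c1 D.
rewrite mulf_eq0 negb_or => h1 /andP[h2 _] h3.
rewrite [zA d * _]mulrC in h1.
by have := heisenberg_criterion l_odd l_gt1 q_prim D h2 h3 h1.
Qed.

Lemma Realized_dvd4 : M 0 2%:R = 0 -> M 0 3%:R = 0 -> M 0 1 != 0 -> M 1 2%:R != 0 ->
  (l ^ 4 %| n.+1)%N.
Proof.
have [d [a [b [yE [hE [f [g [yF [hF [w0 [w1 [v0 [v1 D]]]]]]]]]]]] ->] := RM.
have [[_ -> E2 ->] [-> _]] := phi_row0 (ud_c0 D) (ud_c1 D).
move=> h; have Y0 : zYe d = 0.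
  move/eqP: h; rewrite E2 !mulf_eq0 invr_eq0 (negPf (ud_c1 D)) ?expf_eq0 (negPf (ud_c0 D)) /= orbF.
  by move/eqP.
rewrite E2 Y0 !(mulr0, mul0r) subr0 add0r addr0 mulf_eq0 negb_or => He0 /andP[_ A0] B0.
by have := steinberg_criterion l_odd l_gt1 q_prim D A0 Y0 He0 B0.
Qed.
End MatrixCriteria.

Section LinewiseMore.
Variables (C : numClosedFieldType) (E : lmodType C).
Implicit Types (F G : E -> C).
Lemma linewise_ext F G : F =1 G -> linewise F -> linewise G.
Proof. by move=> e lF x d; apply: polyfun_ext (lF x d) => t; apply: e. Qed.
Lemma linewise_sum (I : finType) (F : I -> E -> C) : (forall i, linewise (F i)) ->
  linewise (fun x => \sum_i F i x).
Proof.
move=> lF; elim: (index_enum I) => [|i s IH].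
  by apply: linewise_ext (@linewise_const _ _ 0) => x; rewrite big_nil.
by apply: linewise_ext (linewise_add (lF i) IH) => x; rewrite big_cons.
Qed.
Lemma linewise_mulmx m n p (A : E -> 'M[C]_(m, n)) (B : E -> 'M[C]_(n, p)) :
  (forall i j, linewise (fun x => A x i j)) -> (forall i j, linewise (fun x => B x i j)) ->
  forall i j, linewise (fun x => (A x *m B x) i j).
Proof.
move=> lA lB i j; apply: (@linewise_ext (fun x => \sum_k A x i k * B x k j)).
  by move=> x; rewrite mxE.
by apply: linewise_sum => k; apply: linewise_mul.
Qed.
(** Functions that are polynomial on every line have no zero divisors; this takes the place of the
    irreducibility of affine space, without polynomials in several variables. *)
Lemma linewise_integral F G : linewise F -> linewise G -> (forall x, F x * G x = 0) ->
  (forall x, F x = 0) \/ (forall x, G x = 0).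
Proof.
move=> lF lG FG; have [|/existsNP[x /eqP Fx]] := pselect (forall x, F x = 0); first by left.
right=> y; apply/eqP/negPn/negP => Gy.
have [z Fz Gz] := linewise_mul_nonzero lF lG (ex_intro _ x Fx) (ex_intro _ y Gy).
by have := mulf_neq0 Fz Gz; rewrite FG eqxx.
Qed.
Lemma linewise_coord m n (i : 'I_m) (j : 'I_n) : linewise (fun x : 'M[C]_(m, n) => x i j).
Proof. by apply: linewise_linear => x t y; rewrite !mxE. Qed.
End LinewiseMore.

Ltac linewise := repeat first [exact: linewise_const | exact: linewise_coord
  | apply: linewise_add | apply: linewise_mul | apply: linewise_opp].

Lemma quartic_eq0 (C : numClosedFieldType) (a b c d e : C) :
  (forall t, t != 0 -> a * t ^+ 4 + b * t ^+ 3 + c * t ^+ 2 + d * t + e = 0) ->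
  [/\ a = 0, b = 0, c = 0, d = 0 & e = 0].
Proof.
move=> h; pose p := Poly [:: e; d; c; b; a].
have [p0|p0] := eqVneq p 0.
  have co i : [:: e; d; c; b; a]`_i = 0 by rewrite -coef_Poly -/p p0 coef0.
  by split; [apply: (co 4%N) | apply: (co 3%N) | apply: (co 2%N) | apply: (co 1%N) | apply: (co 0%N)].
have [|t] := @poly_nonroot _ (p * 'X); first by rewrite mulf_neq0 ?polyX_eq0.
rewrite hornerM hornerX mulf_eq0 negb_or => /andP[pt t0].
case/eqP: pt; rewrite /p horner_Poly /= -[RHS](h t t0); ring.
Qed.

Lemma row4P (T : Type) (a b : 'rV[T]_4) : a 0 0 = b 0 0 -> a 0 1 = b 0 1 ->
  a 0 2%:R = b 0 2%:R -> a 0 3%:R = b 0 3%:R -> a = b.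
Proof.
move=> h0 h1 h2 h3; apply/rowP => -[[|[|[|[|//]]]] jp].
- by rewrite (_ : Ordinal jp = 0) //; apply: val_inj.
- by rewrite (_ : Ordinal jp = 1) //; apply: val_inj.
- by rewrite (_ : Ordinal jp = 2%:R) //; apply: val_inj.
by rewrite (_ : Ordinal jp = 3%:R) //; apply: val_inj.
Qed.

Lemma lin_comb1 (C : comRingType) (a x y : C) : y = 0 -> x = a * y -> x = 0.
Proof. by move=> -> ->; rewrite mulr0. Qed.
Lemma lin_comb2 (C : comRingType) (a b x y z : C) : y = 0 -> z = 0 -> x = a * y + b * z -> x = 0.
Proof. by move=> -> -> ->; rewrite !mulr0 addr0. Qed.

(** * Matrices all of whose conjugates fail a criterion *)

Section Geometry.
Variables (C : numClosedFieldType) (q : C) (l n : nat).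
Hypotheses (l_odd : odd l) (l_gt1 : (1 < l)%N) (q_prim : l.-primitive_root q).
Variable M : 'M[C]_4.
Hypothesis RM : Realized q l n M.
Let sM := Realized_symplectic RM.
Local Notation vec := 'rV[C]_4.
Implicit Types (v w a b : vec).

Definition param (p : vec) := twist M (p 0 0) (p 0 1) (p 0 2%:R) (p 0 3%:R).
Lemma linewise_upper i j :
  linewise (fun p : vec => upper (p 0 0) (p 0 1) (p 0 2%:R) (p 0 3%:R) i j).
Proof.
apply: (@linewise_ext _ _ (fun p : vec => _)) => [p|]; first by rewrite mxE.
case: i => -[|[|[|[|]]]] //= ?; case: j => -[|[|[|[|]]]] //= ?; linewise.
Qed.
Lemma linewise_upper_inv i j :
  linewise (fun p : vec => upper_inv (p 0 0) (p 0 1) (p 0 2%:R) (p 0 3%:R) i j).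
Proof.
apply: (@linewise_ext _ _ (fun p : vec => _)) => [p|]; first by rewrite mxE.
case: i => -[|[|[|[|]]]] //= ?; case: j => -[|[|[|[|]]]] //= ?; linewise.
Qed.
Lemma linewise_param i j : linewise (fun p => param p i j).
Proof.
apply: linewise_mulmx => [i' j'|]; last exact: linewise_upper_inv.
by apply: linewise_mulmx => // [|i'' j'']; [exact: linewise_upper | exact: linewise_const].
Qed.

Definition good p := (param p 0 0 != 0) && (minor2 (param p) 0 1 != 0).
Lemma param0 : param 0 = M.
Proof.
rewrite /param !mxE /twist upper0 mul1mx.
by have := upperK (0 : C) 0 0 0; rewrite upper0 mul1mx => ->; rewrite mulmx1.
Qed.
Lemma good0 : good 0. Proof. by rewrite /good param0; have [-> ->] := Realized_lead RM. Qed.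
Lemma Realized_param p : good p -> Realized q l n (param p).
Proof.
move=> /andP[g1 g2]; have [m1 m2] := Realized_lead RM.
by have := Realized_twist l_odd l_gt1 q_prim RM m1 m2 g1 g2.
Qed.
(** The good parameters are those where a linewise function, nonzero at the origin, does not
    vanish. *)
Lemma linewise_generic F : linewise F -> (forall p, good p -> F p = 0) -> forall p, F p = 0.
Proof.
move=> lF h.
have lg : linewise (fun p => param p 0 0 * minor2 (param p) 0 1).
  by rewrite /minor2; apply: linewise_mul; [|apply: linewise_add; [|apply: linewise_opp]; apply: linewise_mul];
     exact: linewise_param.
have [p|//|] := linewise_integral lF lg.
  have [/h->|] := boolP (good p); first by rewrite mul0r.
  by rewrite /good negb_and !negbK => /orP[]/eqP->; rewrite ?mul0r ?mulr0.
by move=> /(_ 0)/eqP; rewrite mulf_eq0 => /norP; have /andP[-> ->] := good0 => -[].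
Qed.

Definition vec4 (z x y r : C) : vec := \row_j nth 0 [:: z; x; y; r] j.
Lemma param_vec4 z x y r : param (vec4 z x y r) = twist M z x y r.
Proof. by rewrite /param !mxE. Qed.

Lemma upper_row0 v : v 0 0 = 1 -> row 0 (upper (v 0 1) (v 0 3%:R - v 0 1 * v 0 2%:R) (v 0 2%:R) 0) = v.
Proof.
move=> v1; apply/rowP => j; rewrite !mxE.
by case: j => -[|[|[|[|]]]] //= jp; rewrite ?mulr0 ?addr0 ?subrK -?v1; congr (v _ _); apply: val_inj.
Qed.

Let S x y := om (x *m M) y.
Let SDl x y v : S (x + y) v = S x v + S y v. Proof. by rewrite /S mulmxDl omDl. Qed.
Let SDr x y v : S v (x + y) = S v x + S v y. Proof. exact: omDr. Qed.
Let SZl c x v : S (c *: x) v = c * S x v. Proof. by rewrite /S -scalemxAl omZl. Qed.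
Let SZr c x v : S v (c *: x) = c * S v x. Proof. exact: omZr. Qed.
Let SNl x v : S (- x) v = - S x v. Proof. by rewrite /S mulNmx omNl. Qed.
Let SNr x v : S v (- x) = - S v x. Proof. exact: omNr. Qed.
Let SB := (SDl, SDr, SZl, SZr, SNl, SNr).

(** The first row of [upper] is an arbitrary vector with first coordinate 1, so [S] is alternating.
    This makes [M] equal to its adjoint, which is its inverse. *)
Lemma isotropic_quadratic_involution :
  (forall p, param p 0 3%:R = 0) -> M *m M = 1%:M.
Proof.
move=> h.
have Q1 v : v 0 0 = 1 -> S v v = 0.
  move=> /upper_row0 e; have := h (vec4 (v 0 1) (v 0 3%:R - v 0 1 * v 0 2%:R) (v 0 2%:R) 0).
  rewrite param_vec4 twist_entry.
  have [_ _ _ ->] := upper_inv_entries (row 0 (upper (v 0 1) (v 0 3%:R - v 0 1 * v 0 2%:R) (v 0 2%:R) 0) *m M)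
    (v 0 1) (v 0 3%:R - v 0 1 * v 0 2%:R) (v 0 2%:R) 0.
  by rewrite e => /eqP; rewrite oppr_eq0 => /eqP.
have Q v : S v v = 0.
  have [v0|v0] := eqVneq (v 0 0) 0; last first.
    have := Q1 ((v 0 0)^-1 *: v); rewrite mxE mulVf // => /(_ erefl)/eqP.
    by rewrite !SB !mulf_eq0 invr_eq0 (negPf v0) /= => /eqP.
  (* If [v] has first coordinate zero, [e + v] and [e - v] are covered by [Q1], and the sum of their
     values is [2 S v v + 2 S e e]. *)
  pose e := vec4 1 0 0 0 : vec.
  have h0 := Q1 e; have h1 := Q1 (e + v); have h2 := Q1 (e - v).
  rewrite !mxE v0 /= oppr0 !addr0 in h0 h1 h2.
  have {}h0 := h0 erefl; have {}h1 := h1 erefl; have {}h2 := h2 erefl.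
  move: h1 h2; rewrite !SB h0 => h1 h2; apply/eqP.
  suff : 2%:R * S v v == 0 by rewrite mulf_eq0 pnatr_eq0.
  by apply/eqP; transitivity ((0 + S v e + (S e v + S v v)) + (0 - S v e - (S e v - S v v))); [ring | rewrite h1 h2 addr0].
have anti x y : S x y = - S y x.
  by apply/eqP; rewrite -addr_eq0; have := Q (x + y); rewrite !SB !Q add0r addr0 addrC => ->.
apply/row_matrixP => i; rewrite row1 rowE mulmxA; move: (delta_mx 0 i) => x.
apply/eqP; rewrite -subr_eq0; apply/eqP/om_nondeg => y.
by rewrite omDl omNl -/(S (x *m M) y) anti /S om_mulmx // omC opprK subrr.
Qed.

Lemma twist_entries z x y r :
  [/\ twist M z x y r 0 2%:R = - S (row 0 (upper z x y r)) (row 1 (upper z x y r)),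
      twist M z x y r 0 3%:R = - S (row 0 (upper z x y r)) (row 0 (upper z x y r)),
      twist M z x y r 1 2%:R = - S (row 1 (upper z x y r)) (row 1 (upper z x y r)) &
      twist M z x y r 1 3%:R = - S (row 1 (upper z x y r)) (row 0 (upper z x y r))].
Proof.
rewrite !twist_entry.
have [_ _ -> ->] := upper_inv_entries (row 0 (upper z x y r) *m M) z x y r.
by have [_ _ -> ->] := upper_inv_entries (row 1 (upper z x y r) *m M) z x y r.
Qed.

(* Conjugation by [xroot1 s] fixes the first row of [upper] and shifts the
   second one, so that the coefficient of [s] below is [- (param p 0 1) ^ 2]. *)
Lemma heisenberg_degenerate :
  (forall p, param p 0 3%:R * param p 0 0 + param p 0 1 * param p 0 2%:R = 0) ->
  forall p, param p 0 3%:R = 0.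
Proof.
move=> h.
have h01 p : param p 0 1 = 0.
  have := h p; have := h (vec4 (p 0 0) (p 0 1 + 1 * p 0 0 ^+ 2) (p 0 2%:R - 1 * p 0 0) (p 0 3%:R + 1)).
  rewrite param_vec4 -twist_xroot1 -/(param p); move: (param p) => N.
  rewrite /xroot1 /unip_plus [N]mx4_eta !mx4_mul !mxE /= !(mulr0, mul0r, addr0, mulr1, mul1r, add0r, oppr0, subr0) => h1 h2.
  apply/eqP; rewrite -sqrf_eq0; apply/eqP.
  transitivity (N 0 3%:R * N 0 0 + N 0 1 * N 0 2%:R - (N 0 3%:R * N 0 0 + N 0 1 * (N 0 1 * -1 + N 0 2%:R))); first by ring.
  by rewrite h2 h1 subrr.
have lp i j : linewise (fun p => param p i j) := @linewise_param i j.
have [p|//|h0] := linewise_integral (lp 0 3%:R) (lp 0 0).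
  by have := h p; rewrite h01 mul0r addr0.
by have := h0 0; rewrite param0; have [/eqP] := Realized_lead RM.
Qed.

Section RankOne.
(** Minus the Gram determinant of [S] on [a, b], so its vanishing depends only on the plane that
    they span. The hypothesis below is the case of isotropic planes in the big cell. *)
Let P a b := S a b * S b a - S a a * S b b.
Hypothesis P_upper : forall x y r : C,
  P (row 0 (upper 0 x y r)) (row 1 (upper 0 x y r)) = 0.

Let P_cell a b : om a b = 0 -> wedge12 a b != 0 -> P a b = 0.
Proof.
move=> ab w0; set w := wedge12 a b in w0.
pose a' := w^-1 *: (b 0 1 *: a - a 0 1 *: b); pose b' := w^-1 *: (a 0 0 *: b - b 0 0 *: a).
have [x [y [r [ea eb]]]] : exists x y r, a' = row 0 (upper 0 x y r) /\ b' = row 1 (upper 0 x y r).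
  exists (a' 0 3%:R), (a' 0 2%:R), (b' 0 2%:R).
  split; apply: row4P; rewrite [RHS]mxE [RHS]mxE /= ?mul0r ?addr0 //.
  - by rewrite !mxE -[RHS](mulVf w0) /w /wedge12; congr (_ * _); ring.
  - by rewrite !mxE [b 0 1 * _]mulrC subrr mulr0.
  - by rewrite !mxE [b 0 0 * _]mulrC subrr mulr0.
  - by rewrite !mxE -[RHS](mulVf w0) /w /wedge12; congr (_ * _); ring.
  by rewrite !mxE; congr (_ * _); apply/eqP; rewrite -subr_eq0; apply/eqP; rewrite -[RHS]ab /om; ring.
have := P_upper x y r; rewrite -ea -eb.
suff -> : P a' b' = w^-1 ^+ 2 * P a b.
  by move/eqP; rewrite mulf_eq0 expf_eq0 invr_eq0 (negPf w0) /= => /eqP.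
rewrite /P /a' /b' !SB; move: w0; rewrite /w /wedge12 => w0.
by field.
Qed.

(** A generic symplectic [U p] moves the plane of [a] and [b] into the big cell, and then [P_cell]
    applies. If no translate gets there, all Pluecker coordinates of the pair vanish and [a], [b]
    are proportional. *)
Let P_isotropic a b : om a b = 0 -> P a b = 0.
Proof.
move=> ab.
pose U (p : vec) := (upper 0 (p 0 1) (p 0 2%:R) (p 0 3%:R))^T.
have Uent v p : [/\ (v *m U p) 0 0 = v 0 0 + p 0 2%:R * v 0 2%:R + p 0 1 * v 0 3%:R,
  (v *m U p) 0 1 = v 0 1 + p 0 3%:R * v 0 2%:R + p 0 2%:R * v 0 3%:R,
  (v *m U p) 0 2%:R = v 0 2%:R & (v *m U p) 0 3%:R = v 0 3%:R].
  by rewrite !mulmx_entries !mxE /=; split; ring.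
have lU v j : linewise (fun p => (v *m U p) 0 j).
  apply: linewise_mulmx => [i' j'|i' j']; first exact: linewise_const.
  apply: (@linewise_ext _ _ (fun p : vec => _)) => [p|]; first by rewrite !mxE.
  by case: i' => -[|[|[|[|]]]] //= ?; case: j' => -[|[|[|[|]]]] //= ?; linewise.
have lS v w : linewise (fun p => S (v *m U p) (w *m U p)).
  have lMU j : linewise (fun p => (v *m U p *m M) 0 j).
    apply: (@linewise_mulmx _ _ _ _ _ (fun p => v *m U p)) => [i' j'|i' j']; last exact: linewise_const.
    by rewrite (ord1 i'); exact: lU.
  by rewrite /S /om; linewise; solve [exact: lMU | exact: lU].
have oU p : om (a *m U p) (b *m U p) = om a b.
  have [a0 a1 a2 a3] := Uent a p; have [b0 b1 b2 b3] := Uent b p.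
  by rewrite /om a0 a1 a2 a3 b0 b1 b2 b3; ring.
have [||p|h|h] := @linewise_integral _ _ (fun p => wedge12 (a *m U p) (b *m U p)) (fun p => P (a *m U p) (b *m U p)).
- by rewrite /wedge12; linewise; exact: lU.
- by rewrite /P; do ! first [exact: lS | apply: linewise_opp | apply: linewise_mul | apply: linewise_add].
- have [->|w0] := eqVneq (wedge12 (a *m U p) (b *m U p)) 0; first by rewrite mul0r.
  by rewrite P_cell ?mulr0 // oU.
- have W (p : vec) : (a 0 0 + p 0 2%:R * a 0 2%:R + p 0 1 * a 0 3%:R) * (b 0 1 + p 0 3%:R * b 0 2%:R + p 0 2%:R * b 0 3%:R)
     - (a 0 1 + p 0 3%:R * a 0 2%:R + p 0 2%:R * a 0 3%:R) * (b 0 0 + p 0 2%:R * b 0 2%:R + p 0 1 * b 0 3%:R) = 0.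
    have := h p; rewrite /wedge12.
    by have [-> -> _ _] := Uent a p; have [-> -> _ _] := Uent b p.
  (* Five parameter values, together with [om a b = 0], determine the six Pluecker coordinates. *)
  have w0 := W 0; have w1 := W (vec4 0 1 0 0); have w2 := W (vec4 0 0 0 1).
  have w3 := W (vec4 0 0 1 0); have w4 := W (vec4 0 0 (-1) 0).
  rewrite !mxE /= !(mul0r, addr0, mul1r) in w0 w1 w2 w3 w4.
  pose m i j := a 0 i * b 0 j - a 0 j * b 0 i.
  have two (c : C) : 2%:R * c = 0 -> c = 0 by move/eqP; rewrite mulf_eq0 pnatr_eq0 => /eqP.
  have m01 : m 0 1 = 0 by rewrite /m -[RHS]w0; ring.
  have m13 : m 1 3%:R = 0.
    by transitivity (m 0 1 - 0); [rewrite -[X in _ - X]w1 /m; ring | rewrite m01 subr0].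
  have m02 : m 0 2%:R = 0.
    by transitivity (0 - m 0 1); [rewrite -[X in X - _]w2 /m; ring | rewrite m01 subr0].
  have m23 : m 2%:R 3%:R = 0.
    apply: two; transitivity (0 + 0 - 2%:R * m 0 1); last by rewrite m01; ring.
    by rewrite -[X in X + _ - _]w3 -[X in _ + X - _]w4 /m; ring.
  have m03 : m 0 3%:R = 0.
    do 2!apply: (two); transitivity (0 - 0 + 2%:R * 0 : C).
      by rewrite -[X in X - _ + _]w3 -[X in _ - X + _]w4 -[X in _ + _ * X]ab /m /om; ring.
    by ring.
  have m12 : m 1 2%:R = 0.
    by transitivity (om a b - m 0 3%:R); [rewrite /m /om; ring | rewrite ab m03 subrr].
  have mm i j : a 0 i * b 0 j = a 0 j * b 0 i.
    apply/eqP; rewrite -subr_eq0; apply/eqP; rewrite -/(m i j).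
    have mC i' j' : m i' j' = - m j' i' by rewrite /m; ring.
    have all_m k : m k 0 = 0 /\ m k 1 = 0 /\ m k 2%:R = 0 /\ m k 3%:R = 0.
      have : [\/ k = 0, k = 1, k = 2%:R | k = 3%:R].
        by case: k => -[|[|[|[|//]]]] kp; [apply: Or41 | apply: Or42 | apply: Or43 | apply: Or44]; apply: val_inj.
      by case=> ->; rewrite ?[m 1 0]mC ?[m 2%:R 0]mC ?[m 3%:R 0]mC ?[m 2%:R 1]mC ?[m 3%:R 1]mC ?[m 3%:R 2%:R]mC
        ?m01 ?m02 ?m03 ?m12 ?m13 ?m23 ?oppr0 /m ?subrr.
    have [k0 [k1 [k2 k3]]] := all_m i.
    case: j => -[|[|[|[|//]]]] jp; [rewrite -[RHS]k0 | rewrite -[RHS]k1 | rewrite -[RHS]k2 | rewrite -[RHS]k3];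
      by congr (m _ _); apply: val_inj.
  have [a0|] := eqVneq a 0; first by rewrite /P a0 -(scale0r b) !SB; ring.
  case/rV0Pn => i ai; have -> : b = (b 0 i / a 0 i) *: a.
    by apply/rowP => j; rewrite mxE mulrAC [b 0 i * _]mulrC -mm mulrAC mulfV // mul1r.
  by rewrite /P !SB; ring.
by have := h 0; rewrite /U !mxE upper0 trmx1 !mulmx1.
Qed.

(** The Gram matrix of the four vectors is invertible, so they form a basis, and the form detects
    zero against a basis. *)
Let om_basis a b v w (Q : C) : Q != 0 -> om a b = - Q -> om v w = - Q ->
  om a v = 0 -> om a w = 0 -> om b v = 0 -> om b w = 0 ->
  forall x : vec, om x a = 0 -> om x b = 0 -> om x v = 0 -> om x w = 0 -> x = 0.
Proof.
move=> Q0 ab vw av aw bv bw x xa xb xv xw.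
pose B : 'M[C]_4 := \matrix_i (nth 0 [:: a; b; v; w] i).
have rB (i : 'I_4) : row i B = nth 0 [:: a; b; v; w] i by rewrite rowK.
have eJ (y z : vec) : (y *m symp_form C *m z^T) 0 0 = om y z by rewrite omE.
have gram i j : (B *m (symp_form C *m B^T)) i j = om (row i B) (row j B).
  by rewrite -eJ mulmxA -row_mul mxE [RHS]mxE; apply: eq_bigr => k _; rewrite !mxE.
pose G : 'M[C]_4 := mx_of_rows [:: [:: 0; - Q; 0; 0]; [:: Q; 0; 0; 0]; [:: 0; 0; 0; - Q]; [:: 0; 0; Q; 0]].
have BG : B *m (symp_form C *m B^T) = G.
  apply/matrixP => i j; rewrite gram !rB mxE.
  case: i => -[|[|[|[|//]]]] ip; case: j => -[|[|[|[|//]]]] jp /=; rewrite ?omxx //;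
    by rewrite omC ?ab ?vw ?av ?aw ?bv ?bw ?opprK ?oppr0.
have GG : G *m (- (Q ^- 2) *: G) = 1%:M.
  rewrite -scalemxAr /G mx4_mul -diag4_1 /diag4; apply/matrixP => i j; rewrite !mxE.
  by case: i => -[|[|[|[|//]]]] ip; case: j => -[|[|[|[|//]]]] jp /=; field.
have := mulmx1C (etrans (mulmxA _ _ _) (etrans (congr1 (mulmx^~ _) BG) GG)).
rewrite -!mulmxA => E; rewrite -[x]mulmx1 -E !mulmxA.
suff -> : x *m symp_form C *m B^T = 0 by rewrite !mul0mx.
apply/rowP => j; rewrite !mxE; transitivity (om x (row j B)).
  by rewrite -eJ !mxE; apply: eq_bigr => k _; rewrite !mxE.
by rewrite rB; case: j => -[|[|[|[|//]]]].
Qed.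

(** If the form vanished on the orthogonal complement of [a] and [b], the complement would be zero
    and the identity would have rank at most 2. *)
Let complement_pair a b (Q : C) : Q != 0 -> om a b = - Q -> exists w1 w2,
  [/\ om w1 a = 0, om w1 b = 0, om w2 a = 0, om w2 b = 0 & om w1 w2 = - Q].
Proof.
move=> Q0 ab; have ba : om b a = Q by rewrite omC ab opprK.
have [pr prE] : exists pr : vec -> vec, forall y, pr y = y + (Q^-1 * om y b) *: a - (Q^-1 * om y a) *: b by eexists.
have pra y : om (pr y) a = 0.
  by rewrite prE !omB omxx ba; field.
have prb y : om (pr y) b = 0.
  by rewrite prE !omB omxx ab; field.
have [|h] := pselect (exists y1 y2, om (pr y1) (pr y2) != 0).
  case=> y1 [y2 n0]; exists (- (Q / om (pr y1) (pr y2)) *: pr y1), (pr y2).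
  by rewrite !omB !pra !prb !mulr0; split=> //; rewrite mulNr mulfVK.
have h0 y1 y2 : om (pr y1) (pr y2) = 0.
  by apply/eqP/negPn/negP => n0; apply: h; exists y1, y2.
have pr0 y : pr y = 0.
  apply: om_nondeg => z; have := h0 y z; rewrite (prE z) !omB pra prb !mulr0 oppr0 !addr0.
  by [].
have E : 1%:M = row_mx (\col_i - (Q^-1 * om (delta_mx 0 i) b)) (\col_i (Q^-1 * om (delta_mx 0 i) a)) *m col_mx a b :> 'M[C]_4.
  rewrite mul_row_col; apply/row_matrixP => i; rewrite row1.
  have := pr0 (delta_mx 0 i); rewrite prE => h1.
  have -> : delta_mx 0 i = - ((Q^-1 * om (delta_mx 0 i) b) *: a) + (Q^-1 * om (delta_mx 0 i) a) *: b.
    by apply/eqP; rewrite -subr_eq0 opprD opprK addrA h1.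
  apply/rowP => j; rewrite !mxE !big_ord_recl !big_ord0 !mxE !addr0; ring.
have := mxrankM_maxl (row_mx (\col_i - (Q^-1 * om (delta_mx 0 i) b)) (\col_i (Q^-1 * om (delta_mx 0 i) a))) (col_mx a b).
by rewrite -E mxrank1 => /leq_trans/(_ (rank_leq_col _)).
Qed.

(** [v] and [v' = v M] span a nondegenerate plane. For a suitable pair in its orthogonal complement,
    [v + c w1] and [v' - c^-1 w2] span isotropic planes for every [c], so [P] gives a Laurent
    polynomial identity in [c]. Its coefficients force [M] to be a scalar [k] with [k ^+ 2 = 1] on
    the complement and to send [v'] to [2 k v' - v]; hence the image of [M - k] is spanned by
    [v' - k v]. *)
Lemma rank_one_form v : S v v != 0 ->
  exists (e : C) (u : vec), e ^+ 2 = 1 /\ M = e%:M + symp_form C *m u^T *m u.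
Proof.
set Q := S v v => Q0; pose v' := v *m M.
have vv' : om v v' = - Q by rewrite /Q /S omC.
have Svv' : S v v' = 0 by exact: omxx.
have Sv'v' : S v' v' = Q by rewrite /S /v' om_mulmx.
pose inW w := om w v = 0 /\ om w v' = 0.
have SvW w : inW w -> S v w = 0 by case=> _ h; rewrite /S omC -/v' h oppr0.
have SWv' w : inW w -> S w v' = 0 by case=> h _; rewrite /S om_mulmx.
have key w1 w2 : inW w1 -> inW w2 -> om w1 w2 = - Q ->
  [/\ S w1 w1 = 0, Q * S w1 v + S w1 w2 * S v' w1 = 0, Q * S v' w2 + S w1 w2 * S w2 v = 0
    & Q ^+ 2 - S w1 v * S v' w2 + S w1 w2 * (S v' v - S w2 w1) = 0].
  move=> W1 W2 w12; have [h11 h12] := W1; have [h21 h22] := W2.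
  have [c|e4 e3 e2 e1 e0] := @quartic_eq0 C (- (S w1 w1 * Q))
    (- (S w1 w2 * S v' w1) - S w1 v * Q + S w1 w1 * S v' w2)
    (- (S w1 w2 * (S v' v - S w2 w1)) - (Q ^+ 2 - S w1 v * S v' w2 + S w1 w1 * S w2 w2))
    (S w1 w2 * S w2 v + Q * S v' w2 - S w1 v * S w2 w2) (- (Q * S w2 w2)).
    move=> c0; have iso : om (v + c *: w1) (v' - c^-1 *: w2) = 0.
      rewrite !omB vv' w12 [om v w2]omC h21 h12; by field.
    have := P_isotropic iso; rewrite /P !SB (SvW w1 W1) (SvW w2 W2) (SWv' w1 W1) (SWv' w2 W2) Svv' Sv'v' -/Q => E.
    transitivity (c ^+ 2 * 0); last by rewrite mulr0.
    by rewrite -[X in _ = _ * X]E; field.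
  have s11 : S w1 w1 = 0.
    by move/eqP: e4; rewrite oppr_eq0 mulf_eq0 (negPf Q0) orbF => /eqP.
  have s22 : S w2 w2 = 0.
    by move/eqP: e0; rewrite oppr_eq0 mulf_eq0 (negPf Q0) => /eqP.
  split=> //; apply/eqP; rewrite -oppr_eq0; apply/eqP.
  - by rewrite -[RHS]e3 s11; ring.
  - by rewrite -oppr0 -[X in _ = - X]e1 s22; ring.
  by rewrite -[RHS]e2 s11; ring.
have [w1 [w2 [a1 b1 a2 b2 w12]]] := complement_pair Q0 vv'.
have W1 : inW w1 by []. have W2 : inW w2 by [].
have W2n : inW (- w1) by rewrite /inW !omB a1 b1 oppr0.
have W3 : inW (w2 + w1) by rewrite /inW !omB a1 b1 a2 b2 addr0.
have w13 : om w1 (w2 + w1) = - Q by rewrite !omB omxx w12 addr0.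
have w21 : om w2 (- w1) = - Q by rewrite !omB omC w12 opprK.
have [s11 k1 k2 k3] := key _ _ W1 W2 w12.
have [s22 m1 m2 m3] := key _ _ W2 W2n w21.
have [_ _ _ n3] := key _ _ W1 W3 w13.
have S21 : S w2 w1 = - S w1 w2.
  have w31 : om (w2 + w1) (- w1) = - Q by rewrite !omB omxx [om w2 w1]omC w12; ring.
  have [+ _ _ _] := key _ _ W3 W2n w31; rewrite !SB s11 s22 => h.
  by apply/eqP; rewrite -addr_eq0 -[X in _ == X]h; apply/eqP; ring.
pose k := - (S w1 w2 / Q); have S12 : S w1 w2 = - (k * Q) by rewrite /k mulNr opprK mulfVK.
move: k1 k2 k3 m1 m2 m3 n3; rewrite !SB S21 S12 s11 => k1 k2 k3 m1 m2 m3 n3.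
have cancelQ (x : C) : Q * x = 0 -> x = 0 by move/eqP; rewrite mulf_eq0 (negPf Q0) => /eqP.
have ks1 : S w1 v = k * S v' w1.
  by apply/eqP; rewrite -subr_eq0; apply/eqP/cancelQ; rewrite -[RHS]k1; ring.
have kt2 : S v' w2 = k * S w2 v.
  by apply/eqP; rewrite -subr_eq0; apply/eqP/cancelQ; rewrite -[RHS]k2; ring.
have ks2 : S w2 v = k * S v' w2.
  by apply/eqP; rewrite -subr_eq0; apply/eqP/cancelQ; rewrite -[RHS]m1; ring.
have kt1 : S v' w1 = k * S w1 v.
  by apply/eqP; rewrite -subr_eq0; apply/eqP/cancelQ; rewrite -oppr0 -[X in _ = - X]m2; ring.
have basis : forall x : vec, om x v = 0 -> om x v' = 0 -> om x w1 = 0 -> om x w2 = 0 -> x = 0.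
  by apply: (om_basis Q0 vv' w12); rewrite omC ?a1 ?b1 ?a2 ?b2 oppr0.
have fixed w : S w v = 0 -> S w v' = 0 -> S w w1 = k * om w w1 -> S w w2 = k * om w w2 ->
   inW w -> w *m M = k *: w.
  move=> h1 h2 h3 h4 [h5 h6]; apply/eqP; rewrite -subr_eq0; apply/eqP/basis.
  - by rewrite !omB -/(S w v) h1 h5 mulr0 subrr.
  - by rewrite !omB -/(S w v') h2 h6 mulr0 subrr.
  - by rewrite !omB -/(S w w1) h3 subrr.
  by rewrite !omB -/(S w w2) h4 subrr.
have st0 : S w1 v = 0 /\ S w2 v = 0 -> w1 *m M = k *: w1 /\ w2 *m M = k *: w2.
  case=> e1 e2; split; apply: fixed => //; rewrite ?SWv' ?s11 ?s22 ?omxx ?mulr0 ?S12 ?S21 ?S12 ?w12 ?mulrN //.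
  by rewrite omC w12 !opprK.
have fin : S w1 v = 0 /\ S w2 v = 0 -> k ^+ 2 = 1.
  move=> /st0[e1 e2]; have := om_mulmx w1 w2 sM; rewrite e1 e2 !omB w12 => /eqP.
  rewrite !mulrN eqr_opp mulrA -expr2 -subr_eq0 -{2}[Q]mul1r -mulrBl mulf_eq0 (negPf Q0) orbF subr_eq0.
  by move/eqP.
have k21 : k ^+ 2 = 1.
  have [//|kn] := eqVneq (k ^+ 2) 1; apply: fin; split; apply/eqP.
    have : (k ^+ 2 - 1) * S w1 v == 0 by rewrite mulrBl mul1r {2}ks1 kt1 mulrA -expr2 subrr.
    by rewrite mulf_eq0 subr_eq0 (negPf kn).
  have : (k ^+ 2 - 1) * S w2 v == 0 by rewrite mulrBl mul1r {2}ks2 kt2 mulrA -expr2 subrr.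
  by rewrite mulf_eq0 subr_eq0 (negPf kn).
have k0 : k != 0 by apply: contraTneq isT => k0; move: k21; rewrite k0 expr0n => /eqP; rewrite eq_sym oner_eq0.
have t1 : S v' w1 = 0.
  apply/eqP; rewrite -sqrf_eq0; apply/eqP/(mulfI k0); rewrite mulr0.
  by rewrite -[RHS](subrr 0) -{1}k3 -n3 ks1; ring.
have t2 : S v' w2 = 0.
  apply/eqP; rewrite -sqrf_eq0; apply/eqP/(mulfI k0); rewrite mulr0.
  have W4 : inW (- w1 + w2) by rewrite /inW !omB a1 b1 a2 b2 oppr0 addr0.
  have w24 : om w2 (- w1 + w2) = - Q by rewrite omDr omxx w21 addr0.
  have [_ _ _] := key _ _ W2 W4 w24; rewrite !SB S21 S12 s22 => n4.
  by rewrite -[RHS](subrr 0) -{1}m3 -n4 ks2; ring.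
have s1 : S w1 v = 0 by rewrite ks1 t1 mulr0.
have s2 : S w2 v = 0 by rewrite ks2 t2 mulr0.
have [M1 M2] := st0 (conj s1 s2).
have Q2 : S v' v = 2%:R * k * Q.
  apply/eqP; rewrite -subr_eq0; apply/eqP/(mulfI k0)/(mulfI Q0); rewrite !mulr0.
  move: k3; rewrite s1 => k3.
  apply: (addrI 0); rewrite -{1}k3.
  by transitivity (Q ^+ 2 * (1 - k ^+ 2)); [ring | rewrite k21 subrr mulr0 addr0].
have Mv' : v' *m M = - v + (2%:R * k) *: v'.
  have omv w : inW w -> om v w = 0 /\ om v' w = 0 by case=> h1 h2; rewrite omC h1 [om v' w]omC h2 oppr0.
  have [u1 u2] := omv _ W1; have [u3 u4] := omv _ W2.
  apply/eqP; rewrite -subr_eq0; apply/eqP/basis.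
  - by rewrite !omB -/(S v' v) Q2 omxx [om v' v]omC vv'; ring.
  - by rewrite !omB -/(S v' v') Sv'v' omxx vv'; ring.
  - by rewrite !omB -/(S v' w1) t1 u1 u2; ring.
  by rewrite !omB -/(S v' w2) t2 u3 u4; ring.
pose u := v' - k *: v.
have omv w : inW w -> om v w = 0 /\ om v' w = 0 by case=> h1 h2; rewrite omC h1 [om v' w]omC h2 oppr0.
have [u1 u2] := omv _ W1; have [u3 u4] := omv _ W2.
have w12' : om w2 w1 = Q by rewrite omC w12 opprK.
have v'v : om v' v = Q by rewrite omC vv' opprK.
have decomp (x : vec) : x = (Q^-1 * om x v) *: v' - (Q^-1 * om x v') *: v
    + (Q^-1 * om x w1) *: w2 - (Q^-1 * om x w2) *: w1.
  apply/eqP; rewrite -subr_eq0; apply/eqP/basis; rewrite !omB ?omxx ?vv' ?v'v ?a1 ?a2 ?b1 ?b2 ?u1 ?u2 ?u3 ?u4 ?w12 ?w12';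
    by field.
have E (x : vec) : x *m M = k *: x + (- (Q^-1) * om x u) *: u.
  have e1 : x *m M = (Q^-1 * om x v) *: (- v + (2%:R * k) *: v') - (Q^-1 * om x v') *: v'
    + (Q^-1 * om x w1) *: (k *: w2) - (Q^-1 * om x w2) *: (k *: w1).
    by rewrite {1}[x]decomp !mulmxDl !mulNmx -!scalemxAl M1 M2 Mv'.
  have e2 : k *: x = k *: ((Q^-1 * om x v) *: v' - (Q^-1 * om x v') *: v
    + (Q^-1 * om x w1) *: w2 - (Q^-1 * om x w2) *: w1) by rewrite -decomp.
  rewrite e1 e2 /u omDr omNr omZr.
  move: (om x v) (om x v') (om x w1) (om x w2) (v') => c1 c2 c3 c4 z.
  apply/rowP => j; rewrite !mxE; move: (z 0 j) (v 0 j) (w1 0 j) (w2 0 j) => x1 x2 x3 x4.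
  have kk : k * k = 1 by rewrite -expr2.
  apply/eqP; rewrite -subr_eq0; apply/eqP; transitivity ((k * k - 1) * (Q^-1 * c1 * x2)); last by rewrite kk subrr mul0r.
  by ring.
(* The square root absorbs the scalar, since the correction term is quadratic in its vector. *)
exists k, ((sqrtC (- Q^-1)) *: u); split=> //.
apply/row_matrixP => i; rewrite !rowE E; set x := delta_mx 0 i; rewrite mulmxDr mul_mx_scalar; congr (_ + _).
have -> : (sqrtC (- Q^-1) *: u)^T = sqrtC (- Q^-1) *: u^T by rewrite linearZ.
rewrite -!(scalemxAr, scalemxAl) !scalerA -expr2 sqrtCK !mulmxA.
rewrite [x *m _ *m _](_ : _ = (om x u)%:M); first by rewrite mul_scalar_mx scalerA.
by apply/matrixP => i' j'; rewrite !ord1 omE [RHS]mxE mulr1n.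
Qed.
End RankOne.

(** A few parameter values in the two identities determine all entries except [M 0 2]; symplecticity
    disposes of that one and gives [a ^+ 2 = 1]. *)
Lemma central_form : (forall p, param p 0 1 = 0) -> (forall p, param p 0 3%:R = 0) ->
  exists2 e : C, e ^+ 2 = 1 & M = e%:M.
Proof.
move=> h1 h3; pose a := M 0 0.
have eqA z s t : M 0 1 + z * M 1 1 + s * M 2%:R 1 + t * M 3%:R 1 -
    z * (M 0 0 + z * M 1 0 + s * M 2%:R 0 + t * M 3%:R 0) = 0.
  have := h1 (vec4 z (t - z * s) s 0); rewrite param_vec4 => <-.
  by rewrite /twist /upper /upper_inv [M]mx4_eta !mx4_mul !mxE /=; ring.
have two (c : C) : 2%:R * c = 0 -> c = 0 by move/eqP; rewrite mulf_eq0 pnatr_eq0 => /eqP.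
have m01 : M 0 1 = 0 by apply: (lin_comb1 (a := 1) (eqA 0 0 0)); ring.
have m10 : M 1 0 = 0.
  by apply: two; apply: (lin_comb2 (a := -1) (b := -1) (eqA 1 0 0) (eqA (-1) 0 0)); rewrite m01; ring.
have m11 : M 1 1 = a.
  by apply/eqP; rewrite -subr_eq0; apply/eqP/(lin_comb1 (a := 1) (eqA 1 0 0)); rewrite m01 m10 /a; ring.
have m21 : M 2%:R 1 = 0 by apply: (lin_comb1 (a := 1) (eqA 0 1 0)); rewrite m01; ring.
have m31 : M 3%:R 1 = 0 by apply: (lin_comb1 (a := 1) (eqA 0 0 1)); rewrite m01; ring.
have m20 : M 2%:R 0 = 0 by apply: (lin_comb1 (a := -1) (eqA 1 1 0)); rewrite m01 m10 m11 m21 /a; ring.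
have m30 : M 3%:R 0 = 0 by apply: (lin_comb1 (a := -1) (eqA 1 0 1)); rewrite m01 m10 m11 m31 /a; ring.
have eqB z s t : (M 0 3%:R + z * M 1 3%:R + s * M 2%:R 3%:R + t * M 3%:R 3%:R) - a * t - a * z * s
   + z * (M 0 2%:R + z * M 1 2%:R + s * M 2%:R 2%:R + t * M 3%:R 2%:R) = 0.
  have := h3 (vec4 z (t - z * s) s 0); rewrite param_vec4 => <-; move: m01 m10 m11 m21 m31 m20 m30.
  rewrite /a /twist /upper /upper_inv [M]mx4_eta !mx4_mul !mxE /= => -> -> -> -> -> -> ->; ring.
have m03 : M 0 3%:R = 0 by apply: (lin_comb1 (a := 1) (eqB 0 0 0)); ring.
have m33 : M 3%:R 3%:R = a.
  by apply/eqP; rewrite -subr_eq0; apply/eqP/(lin_comb1 (a := 1) (eqB 0 0 1)); rewrite m03; ring.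
have m23 : M 2%:R 3%:R = 0 by apply: (lin_comb1 (a := 1) (eqB 0 1 0)); rewrite m03; ring.
have m12 : M 1 2%:R = 0.
  by apply: two; apply: (lin_comb2 (a := 1) (b := 1) (eqB 1 0 0) (eqB (-1) 0 0)); rewrite m03; ring.
have m13 : M 1 3%:R = - M 0 2%:R.
  by apply/eqP; rewrite -addr_eq0; apply/eqP/(lin_comb1 (a := 1) (eqB 1 0 0)); rewrite m03 m12; ring.
have m22 : M 2%:R 2%:R = a.
  by apply/eqP; rewrite -subr_eq0; apply/eqP/(lin_comb1 (a := 1) (eqB 1 1 0)); rewrite m03 m12 m13 m23; ring.
have m32 : M 3%:R 2%:R = 0 by apply: (lin_comb1 (a := 1) (eqB 1 0 1)); rewrite m03 m12 m13 m33; ring.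
have o01 := om_mulmx (vec4 1 0 0 0) (vec4 0 1 0 0) sM.
have o03 := om_mulmx (vec4 1 0 0 0) (vec4 0 0 0 1) sM.
rewrite /om !mulmx_entries !mxE /= m01 m03 m10 m11 m12 m13 m20 m21 m22 m23 m30 m31 m32 m33 -/a in o01 o03.
have a2 : a ^+ 2 = 1 by rewrite -[RHS](_ : 1 * 1 + 0 * 0 - 0 * 0 - 0 * 0 = 1); [rewrite -o03; ring | ring].
have a0 : a != 0 by apply: contraTneq isT => a0; move: a2; rewrite a0 expr0n => /eqP; rewrite eq_sym oner_eq0.
have m02 : M 0 2%:R = 0.
  rewrite [RHS](_ : _ = 0) in o01; last by ring.
  by apply: (mulfI a0); rewrite mulr0; apply: (two); apply: (lin_comb1 (a := -1) o01); ring.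
exists a => //; rewrite [LHS]mx4_eta m01 ?m02 m03 m10 m11 m12 m13 m02 m20 m21 m22 m23 m30 m31 m32 m33 oppr0 -/a.
apply/matrixP => i j; rewrite !mxE.
by case: i => -[|[|[|[|//]]]] ip; case: j => -[|[|[|[|//]]]] jp.
Qed.

Theorem not_dvd2 : ~~ (l ^ 2 %| n.+1)%N -> exists2 e : C, e ^+ 2 = 1 & M = e%:M.
Proof.
move=> nd; have key i p : (i == 1) || (i == 3%:R) -> param p 0 i = 0.
  move=> ii; apply: (linewise_generic (F := fun p => param p 0 i)) => [|{}p gp]; first exact: linewise_param.
  have RP := Realized_param gp; apply/eqP/negPn/negP => h; case/negP: nd.
  apply: (Realized_dvd2 l_odd l_gt1 q_prim RP).
  by move: h; case/orP: ii => /eqP ->; [left | right].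
by apply: central_form => p; apply: key; rewrite eqxx ?orbT.
Qed.

(** The product of the three functions tested by [Realized_dvd3] vanishes at all good parameters,
    hence everywhere, hence one factor vanishes identically; each possibility has been analysed
    above. *)
Theorem not_dvd3 : ~~ (l ^ 3 %| n.+1)%N -> M *m M = 1%:M \/
  exists (e : C) (u : vec), e ^+ 2 = 1 /\ M = e%:M + symp_form C *m u^T *m u.
Proof.
move=> nd; have lp i j : linewise (fun p => param p i j) := @linewise_param i j.
pose F1 p := param p 0 3%:R * param p 0 0 + param p 0 1 * param p 0 2%:R.
pose F2 p := param p 0 2%:R * param p 1 3%:R - param p 0 3%:R * param p 1 2%:R.
have l1 : linewise F1 by rewrite /F1; apply: linewise_add; apply: linewise_mul; apply: lp.
have l2 : linewise F2.
  by rewrite /F2; apply: linewise_add; [|apply: linewise_opp]; apply: linewise_mul; apply: lp.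
have [|h|h] := linewise_integral (lp 0 3%:R) (linewise_mul l1 l2).
- apply: (linewise_generic (F := fun p => param p 0 3%:R * (F1 p * F2 p))) => [|p gp]; first by apply: linewise_mul; [exact: lp | exact: linewise_mul].
  have RP := Realized_param gp; apply/eqP/negPn; rewrite !mulf_eq0 !negb_or.
  apply/negP => /and3P[k1 k2 k3]; case/negP: nd.
  by have := Realized_dvd3 l_odd l_gt1 q_prim RP k1 k2 k3.
- by left; apply: isotropic_quadratic_involution.
have [h1|h2] := linewise_integral l1 l2 h.
  by left; apply/isotropic_quadratic_involution/heisenberg_degenerate.
have [|/existsNP[v /eqP Sv]] := pselect (forall v, S v v = 0).
  move=> S0; left; apply: isotropic_quadratic_involution => p.
  rewrite /param; have [_ -> _ _] := twist_entries (p 0 0) (p 0 1) (p 0 2%:R) (p 0 3%:R).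
  by rewrite S0 oppr0.
right; apply: rank_one_form Sv => x y r.
have := h2 (vec4 0 x y r); rewrite /F2 param_vec4.
have [-> -> -> ->] := twist_entries 0 x y r.
by rewrite !mulrNN.
Qed.
End Geometry.

(** * Dimension bounds *)

Section Counting.
Variables (C : numClosedFieldType) (N : nat).
Implicit Types (t : 'rV[C]_N) (f g : 'rV[C]_N -> C).

Definition upd t i (c : C) : 'rV[C]_N := \row_j (if j == i then c else t 0 j).
(** A bound on the degree in each variable separately, which is what detection of zero on a grid
    requires. *)
Definition sepdeg K f := forall t i, exists2 p : {poly C}, (size p <= K.+1)%N &
  forall c, f (upd t i c) = p.[c].

Lemma sepdegW K L f : (K <= L)%N -> sepdeg K f -> sepdeg L f.
Proof. by move=> KL h t i; have [p sp e] := h t i; exists p => //; apply: leq_trans sp _. Qed.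
Lemma sepdeg_const K c : sepdeg K (fun=> c).
Proof. by move=> t i; exists c%:P => [|x]; rewrite ?hornerC // (leq_trans (size_polyC_leq1 _)). Qed.
Lemma sepdeg_coord j : sepdeg 1 (fun t => t 0 j).
Proof.
move=> t i; have [ji|ji] := eqVneq j i.
  by exists 'X => [|c]; rewrite ?size_polyX // mxE ji eqxx hornerX.
exists (t 0 j)%:P => [|c]; first by rewrite (leq_trans (size_polyC_leq1 _)).
by rewrite mxE (negPf ji) hornerC.
Qed.
Lemma sepdeg_add K f g : sepdeg K f -> sepdeg K g -> sepdeg K (fun t => f t + g t).
Proof.
move=> hf hg t i; have [p sp ep] := hf t i; have [r sr er] := hg t i.
by exists (p + r) => [|c]; rewrite ?hornerD ?ep ?er // (leq_trans (size_polyD _ _)) // geq_max sp.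
Qed.
Lemma sepdeg_mul K L f g : sepdeg K f -> sepdeg L g -> sepdeg (K + L) (fun t => f t * g t).
Proof.
move=> hf hg t i; have [p sp ep] := hf t i; have [r sr er] := hg t i.
exists (p * r) => [|c]; last by rewrite hornerM ep er.
by rewrite (leq_trans (size_polyMleq _ _)) //; lia.
Qed.
Lemma sepdeg_exp K f n : sepdeg K f -> sepdeg (n * K) (fun t => f t ^+ n).
Proof.
move=> hf; elim: n => [|n IH]; first exact: sepdeg_const.
by move=> t i; have [p sp e] := sepdeg_mul hf IH t i; exists p => // c; rewrite exprS e.
Qed.
Lemma sepdeg_prod (I : finType) (F : I -> 'rV[C]_N -> C) (K : I -> nat) :
  (forall i, sepdeg (K i) (F i)) -> sepdeg (\sum_i K i) (fun t => \prod_i F i t).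
Proof.
move=> h; elim: (index_enum I) => [|i s IH].
  by move=> t j; exists 1 => [|c]; rewrite ?big_nil ?hornerC // size_poly1.
by rewrite big_cons => t j; have [p sp e] := sepdeg_mul (h i) IH t j; exists p => // c; rewrite big_cons e.
Qed.
Lemma sepdeg_sum (I : finType) (F : I -> 'rV[C]_N -> C) K :
  (forall i, sepdeg K (F i)) -> sepdeg K (fun t => \sum_i F i t).
Proof.
move=> h; elim: (index_enum I) => [|i s IH].
  by move=> t j; exists 0 => [|c]; rewrite ?big_nil ?hornerC // size_poly0.
by move=> t j; have [p sp e] := sepdeg_add (h i) IH t j; exists p => // c; rewrite big_cons e.
Qed.

Lemma sepdeg_grid K f : sepdeg K f ->
  (forall e : {ffun 'I_N -> 'I_K.+1}, f (\row_i (e i : nat)%:R) = 0) -> forall t, f t = 0.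
Proof.
move=> sf fg.
suff H j : (j <= N)%N -> forall t, (forall i : 'I_N, (j <= i)%N -> exists m : 'I_K.+1, t 0 i = (m : nat)%:R) -> f t = 0.
  by move=> t; apply: (H N) => // i; rewrite leqNgt ltn_ord.
elim: j => [|j IH] jN t ht.
  have [e he] := fin_all_exists (fun i => ht i (leq0n i)).
  have -> : t = \row_i ([ffun i => e i] i : nat)%:R by apply/rowP => i; rewrite !mxE ffunE he.
  exact: fg.
pose i0 := Ordinal jN; have [p sp e] := sf t i0.
have -> : t = upd t i0 (t 0 i0) by apply/rowP => i; rewrite mxE; case: eqP => [->|].
rewrite e; suff -> : p = 0 by rewrite horner0.
apply/eqP/negPn/negP => p0.
have : all (root p) (map (fun m : 'I_K.+1 => (m : nat)%:R) (enum 'I_K.+1)).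
  apply/allP => _ /mapP[m _ ->]; rewrite rootE -e; apply/eqP/IH; first exact: ltnW.
  move=> i ji; rewrite mxE; case: eqP => [_|/eqP ne]; first by exists m.
  by apply: ht; rewrite ltn_neqAle ji andbT; apply: contraNneq ne => ji'; apply/eqP/val_inj.
move/(max_poly_roots p0); rewrite size_map size_enum_ord map_inj_uniq ?enum_uniq.
  by move=> /(_ isT)/leq_trans/(_ sp); rewrite ltnn.
by move=> a b /eqP; rewrite eqr_nat => /eqP/val_inj.
Qed.

(** A count of dimensions: there are [d ^ m] monomials with exponents below [d], made into
    polynomials by powers of [G], against [(D K + 1) ^ N] grid points that detect these polynomials.
    For large [d] some combination of monomials vanishes on the grid. *)
Lemma algebraic_dependence m K (G : 'rV[C]_N -> C) (F : 'I_m -> 'rV[C]_N -> C) : (N < m)%N ->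
  sepdeg K G -> (forall j, sepdeg K (F j)) ->
  exists2 p : {mpoly C[m]}, p != 0 &
    forall t v, G t != 0 -> (forall j, G t * v j = F j t) -> p.@[v] = 0.
Proof.
(* [D K + 1 <= d (m K + 1)] and [(m K + 1) ^ N < d], so [(D K + 1) ^ N < d ^ (N + 1) <= d ^ m]. *)
move=> Nm sG sF; pose d := ((m * K).+1 ^ N).+1; pose D := (m * d)%N.
pose term (e : {ffun 'I_m -> 'I_d}) t := (\prod_j F j t ^+ e j) * G t ^+ (D - \sum_j e j).
have sumD (e : {ffun 'I_m -> 'I_d}) : (\sum_j e j <= D)%N.
  rewrite /D -[m in (m * d)%N]card_ord -sum_nat_const; apply: leq_sum => j _; exact: ltnW.
have sterm e : sepdeg (D * K) (term e).
  have := sepdeg_mul (sepdeg_prod (fun j => sepdeg_exp (e j) (sF j))) (sepdeg_exp (D - \sum_j e j) sG).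
  by apply: sepdegW; rewrite -big_distrl -mulnDl subnKC.
pose A := \matrix_(i < #|{ffun 'I_m -> 'I_d}|, j < #|{ffun 'I_N -> 'I_(D * K).+1}|)
   term (enum_val i) (\row_k ((enum_val j : {ffun 'I_N -> 'I_(D * K).+1}) k : nat)%:R).
have card : (#|{ffun 'I_N -> 'I_(D * K).+1}| < #|{ffun 'I_m -> 'I_d}|)%N.
  rewrite !card_ffun !card_ord.
  have h1 : ((D * K).+1 <= d * (m * K).+1)%N by rewrite /D; nia.
  have ex r : ((D * K).+1 ^ r <= (d * (m * K).+1) ^ r)%N by case: r => // r; rewrite leq_exp2r.
  apply: leq_ltn_trans (ex N) _.
  rewrite expnMn; apply: leq_trans (_ : d ^ N * d <= _)%N; first by rewrite ltn_pmul2l ?expn_gt0.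
  by rewrite -expnSr leq_exp2l // /d ltnS expn_gt0.
have : kermx A != 0.
  rewrite -mxrank_eq0 mxrank_ker -lt0n subn_gt0.
  exact: leq_ltn_trans (rank_leq_col _) card.
case/rowV0Pn => c /sub_kermxP cA c0.
pose mn (e : {ffun 'I_m -> 'I_d}) : 'X_{1..m} := [multinom (e i : nat) | i < m].
have mn_inj : injective mn.
  by move=> e1 e2 /mnmP h; apply/ffunP => i; apply: val_inj; have := h i; rewrite !mnmE.
pose p : {mpoly C[m]} := \sum_i c 0 i *: 'X_[mn (enum_val i)].
exists p.
  have [i ci] : exists i, c 0 i != 0 by exact/rV0Pn.
  apply: contraNneq ci => p0; have : p@_(mn (enum_val i)) = 0 by rewrite p0 mcoeff0.
  rewrite /p raddf_sum (bigD1 i) //= mcoeffZ mcoeffX eqxx mulr1 big1 ?addr0 => [->//|k ki].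
  rewrite mcoeffZ mcoeffX (inj_eq mn_inj) (inj_eq enum_val_inj) (negPf ki) mulr0 //.
move=> t v Gt vF; have grid0 : \sum_i c 0 i * term (enum_val i) t = 0.
  apply: (sepdeg_grid (K := (D * K)%N) (f := fun t => \sum_i c 0 i * term (enum_val i) t)).
    apply: sepdeg_sum => i; have := sepdeg_mul (sepdeg_const 0 (c 0 i)) (sterm (enum_val i)).
    by rewrite add0n.
  move=> e; have /rowP/(_ (enum_rank e)) := cA; rewrite !mxE => E; rewrite -[RHS]E.
  by apply: eq_bigr => i _; rewrite !mxE enum_rankK.
have : G t ^+ D * p.@[v] = 0.
  rewrite -[RHS]grid0 /p raddf_sum mulr_sumr; apply: eq_bigr => i _ /=.
  rewrite mevalZ mevalX mulrCA; congr (_ * _); rewrite /term.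
  set e : {ffun 'I_m -> 'I_d} := enum_val i.
  have -> : \prod_(j < m) v j ^+ mn e j = \prod_j v j ^+ e j.
    by apply: eq_bigr => j _; rewrite /mn mnmE.
  have -> : \prod_j F j t ^+ e j = G t ^+ (\sum_j e j) * \prod_j v j ^+ e j.
    by rewrite -prodrXr -big_split; apply: eq_bigr => j _; rewrite -vF exprMn.
  by rewrite [RHS]mulrAC -exprD subnKC.
by move/eqP; rewrite mulf_eq0 expf_eq0 (negPf Gt) andbF => /eqP.
Qed.

Definition ratfun (D : 'rV[C]_N -> Prop) f := exists K F G,
  [/\ sepdeg K F, sepdeg K G & forall t, D t -> G t != 0 /\ G t * f t = F t].

Section RationalFunctions.
Variable D : 'rV[C]_N -> Prop.
Lemma ratfun_poly K f : sepdeg K f -> ratfun D f.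
Proof.
by exists K, f, (fun=> 1); split=> //; [exact: sepdeg_const | move=> t _; rewrite oner_neq0 mul1r].
Qed.
Lemma ratfun_const c : ratfun D (fun=> c).
Proof. exact: ratfun_poly (sepdeg_const 0 c). Qed.
Lemma ratfun_coord j : ratfun D (fun t => t 0 j).
Proof. exact: ratfun_poly (sepdeg_coord j). Qed.
Lemma ratfun_mul f g : ratfun D f -> ratfun D g -> ratfun D (fun t => f t * g t).
Proof.
move=> [K [F [G [sF sG h]]]] [K' [F' [G' [sF' sG' h']]]].
exists (K + K')%N, (fun t => F t * F' t), (fun t => G t * G' t); split; try exact: sepdeg_mul.
move=> t Dt; have [G0 e] := h t Dt; have [G0' e'] := h' t Dt.
by split; [exact: mulf_neq0 | rewrite mulrACA e e'].
Qed.
Lemma ratfun_add f g : ratfun D f -> ratfun D g -> ratfun D (fun t => f t + g t).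
Proof.
move=> [K [F [G [sF sG h]]]] [K' [F' [G' [sF' sG' h']]]].
exists (K + K')%N, (fun t => F t * G' t + F' t * G t), (fun t => G t * G' t).
split; [|exact: sepdeg_mul|].
  by apply: sepdeg_add; [exact: sepdeg_mul | rewrite addnC; exact: sepdeg_mul].
move=> t Dt; have [G0 e] := h t Dt; have [G0' e'] := h' t Dt.
by split; [exact: mulf_neq0 | rewrite -e -e'; ring].
Qed.
Lemma ratfun_opp f : ratfun D f -> ratfun D (fun t => - f t).
Proof.
move=> h; have := ratfun_mul (ratfun_const (-1)) h.
by case=> [K [F [G [sF sG k]]]]; exists K, F, G; split=> // t Dt; have [G0 <-] := k t Dt; rewrite mulN1r.
Qed.
Lemma ratfun_inv f : ratfun D f -> (forall t, D t -> f t != 0) -> ratfun D (fun t => (f t)^-1).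
Proof.
move=> [K [F [G [sF sG h]]]] f0; exists K, G, F; split=> // t Dt; have [G0 e] := h t Dt.
by rewrite -e mulf_neq0 ?f0 // mulfK ?f0.
Qed.
Lemma ratfun_sum (I : finType) (F : I -> 'rV[C]_N -> C) : (forall i, ratfun D (F i)) ->
  ratfun D (fun t => \sum_i F i t).
Proof.
move=> h; suff E (s : seq I) : ratfun D (fun t => \sum_(i <- s) F i t) by exact: E.
elim: s => [|i s [K [P [G [sP sG k]]]]].
  by have [K [P [G [sP sG k]]]] := ratfun_const 0; exists K, P, G; split=> // t /k; rewrite big_nil.
have [K' [P' [G' [sP' sG' k']]]] := ratfun_add (h i) (ex_intro _ K (ex_intro _ P (ex_intro _ G (And3 sP sG k)))).
by exists K', P', G'; split=> // t /k'; rewrite big_cons.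
Qed.
Lemma ratfun_mulmx m n r (A : 'rV[C]_N -> 'M[C]_(m, n)) (B : 'rV[C]_N -> 'M[C]_(n, r)) :
  (forall i j, ratfun D (fun x => A x i j)) -> (forall i j, ratfun D (fun x => B x i j)) ->
  forall i j, ratfun D (fun x => (A x *m B x) i j).
Proof.
move=> rA rB i j.
have [K [P [G [sP sG k]]]] := ratfun_sum (fun l => ratfun_mul (rA i l) (rB l j)).
by exists K, P, G; split=> // t /k; rewrite mxE.
Qed.
End RationalFunctions.

Lemma chart_dependence m D (f : 'I_m -> 'rV[C]_N -> C) : (N < m)%N -> (forall j, ratfun D (f j)) ->
  exists2 p : {mpoly C[m]}, p != 0 & forall t, D t -> p.@[fun j => f j t] = 0.
Proof.
move=> Nm h.
have [K hK] := fin_all_exists h; have [F hF] := fin_all_exists hK; have [G hG] := fin_all_exists hF.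
pose K0 := (\sum_j K j)%N; pose GG t := \prod_j G j t.
have sGG : sepdeg K0 GG by apply: sepdeg_prod => j; have [] := hG j.
pose FF j t := F j t * \prod_(i | i != j) G i t.
have sFF j : sepdeg K0 (FF j).
  have : sepdeg (\sum_i K i) (fun t => \prod_i (if i == j then F i else G i) t).
    by apply: sepdeg_prod => i; have [sF sG _] := hG i; case: eqP.
  move=> s t i; have [p sp e] := s t i; exists p => // c; rewrite -e (bigD1 j) //= eqxx.
  by congr (_ * _); apply: eq_bigr => i' /negPf ->.
have [p p0 hp] := algebraic_dependence Nm sGG sFF.
exists p => // t Dt; apply: (hp t).
  by apply/prodf_neq0 => j _; have [_ _ /(_ t Dt)[]] := hG j.
move=> j; rewrite /GG /FF (bigD1 j) //=; have [_ _ /(_ t Dt)[_ <-]] := hG j.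
by rewrite mulrAC.
Qed.
End Counting.

Section DimensionBound.
Variables (C : numClosedFieldType) (N : nat).

Definition covered (S : 'M[C]_4 -> Prop) := exists (I : finType) (D : I -> 'rV[C]_N -> Prop)
  (X : I -> 'rV[C]_N -> 'M[C]_4), (forall i a b, ratfun (D i) (fun t => X i t a b)) /\
  forall x, S x -> exists i t, D i t /\ x = X i t.

(** On each chart more than [N] entries satisfy a polynomial relation, and the product of these
    relations over the finitely many charts vanishes on all of [S]. *)
Lemma dim_of_covered S : covered S -> (dim_of S <= N)%N.
Proof.
move=> [I [D [X [rX SX]]]]; apply/bigmax_leqP => E /asboolP indep.
rewrite leqNgt; apply/negP => NE.
have dep i := chart_dependence NE (fun j => rX i (@enum_val _ (mem E) j).1 (@enum_val _ (mem E) j).2).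
have dep' i : exists p : {mpoly C[#|E|]}, p != 0 /\ forall t, D i t ->
    p.@[fun j => X i t (@enum_val _ (mem E) j).1 (@enum_val _ (mem E) j).2] = 0.
  by have [p p0 h] := dep i; exists p.
have [p hp] := fin_all_exists dep'.
have /eqP : \prod_i p i = 0.
  apply: indep => x /SX[i [t [Dt ->]]]; rewrite rmorph_prod (bigD1 i) //= (hp i).2 // mul0r //.
by apply/negP/prodf_neq0 => i _; case: (hp i).
Qed.
End DimensionBound.

(** * Classes of central elements, transvections and involutions *)

Section Charts.
Variable C : numClosedFieldType.
Notation mx4 a11 a12 a13 a14 a21 a22 a23 a24 a31 a32 a33 a34 a41 a42 a43 a44 :=
  (mx_of_rows [:: [:: a11; a12; a13; a14]; [:: a21; a22; a23; a24];
                  [:: a31; a32; a33; a34]; [:: a41; a42; a43; a44]]).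
Local Notation J := (symp_form C).
Implicit Types (M x h : 'M[C]_4).

Lemma Sp4_symplectic h : Sp4 h -> [/\ symplectic h, h \in unitmx & invmx h *m J = J *m h^T].
Proof.
have JJ : J *m J = - 1%:M.
  rewrite /symp_form mx4_mul -diag4_1 /diag4; apply/matrixP => i j; rewrite !mxE.
  by case: i => -[|[|[|[|//]]]] ip; case: j => -[|[|[|[|//]]]] jp /=; ring.
move=> hJ; have E : (- (J *m h^T *m J)) *m h = 1%:M.
  by rewrite mulNmx -!mulmxA (mulmxA h^T) [h^T *m J *m h]hJ JJ opprK.
have uh : h \in unitmx by case/mulmx1_unit: E.
have hi : invmx h = - (J *m h^T *m J).
  by rewrite -[RHS]mulmx1 -(mulmxV uh) mulmxA E mul1mx.
have E2 : invmx h *m J = J *m h^T by rewrite hi mulNmx -!mulmxA JJ !mulmxN mulmx1 opprK.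
by split=> //; rewrite /symplectic -mulmxA -E2 mulmxA mulmxV // mul1mx.
Qed.

Lemma conj_class_symplectic M x : symplectic M -> conj_class M x -> symplectic x.
Proof.
move=> sM [h /Sp4_symplectic[sh uh hJ] ->]; apply: symplecticM; first exact: symplecticM.
by rewrite /symplectic hJ -mulmxA -trmx_mul mulVmx // trmx1 mulmx1.
Qed.

Lemma conj_class_rank M x a : conj_class M x -> \rank (x - a%:M) = \rank (M - a%:M).
Proof.
move=> [h /Sp4_symplectic[_ uh _] ->].
have -> : h *m M *m invmx h - a%:M = h *m (M - a%:M) *m invmx h.
  by rewrite mulmxBr mulmxBl mul_mx_scalar -scalemxAl mulmxV // scalemx1.
by rewrite mxrankMfree ?row_free_unit ?unitmx_inv // -mxrank_tr trmx_mul mxrankMfree ?mxrank_tr //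
  row_free_unit unitmx_tr.
Qed.

Lemma dim_central e : (dim_of (conj_class (e%:M : 'M[C]_4)) <= 0)%N.
Proof.
apply: dim_of_covered; exists unit, (fun _ _ => True), (fun _ _ => e%:M); split.
  by move=> _ a b; exact: ratfun_const.
move=> x [h /Sp4_symplectic[_ uh _] ->]; exists tt, 0; split=> //.
by rewrite mul_mx_scalar -scalemxAl mulmxV // scalemx1.
Qed.

(** Conjugation by a symplectic [h] replaces [u] by [u h^-1], so the four coordinates of a vector
    parametrize the class. *)
Lemma dim_rank_one e (u : 'rV[C]_4) : (dim_of (conj_class (e%:M + J *m u^T *m u)) <= 5)%N.
Proof.
apply: leq_trans (_ : 4 <= 5)%N => //.
apply: dim_of_covered; exists unit, (fun _ _ => True), (fun _ t => e%:M + J *m t^T *m t); split.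
  move=> _ a b.
  have E : forall i j, ratfun (fun _ : 'rV[C]_4 => True) (fun t => (J *m t^T *m t) i j).
    apply: ratfun_mulmx => [|i j]; last by rewrite (ord1 i); exact: ratfun_coord.
    apply: ratfun_mulmx => i j; first exact: ratfun_const.
    rewrite (ord1 j); have [K [F [G [sF sG k]]]] := @ratfun_coord C 4 (fun _ => True) i.
    by exists K, F, G; split=> // t /k; rewrite mxE.
  have [K [F [G [sF sG k]]]] := ratfun_add (ratfun_const (fun _ : 'rV[C]_4 => True) ((e%:M : 'M[C]_4) a b)) (E a b).
  by exists K, F, G; split=> // t /k; rewrite [in X in _ -> X]mxE.
move=> x [h /Sp4_symplectic[sh uh hJ] ->]; exists tt, (u *m invmx h); split=> //.
rewrite mulmxDr mulmxDl mul_mx_scalar -scalemxAl mulmxV // scalemx1; congr (_ + _).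
rewrite trmx_mul !mulmxA; congr (_ *m _ *m _ *m _).
have : h *m J *m h^T = J := sh.
move=> E; rewrite -{2}E -!mulmxA -trmx_mul mulVmx // trmx1 mulmx1 //.
Qed.

(** For a symplectic involution [x] the matrix [x J] is skew, which leaves six entries; unless [x]
    is a scalar, [x ^ 2 = 1] also forces the linear relation [a11 + a22 = 0]. *)
Lemma dim_involution M : symplectic M -> M *m M = 1%:M -> (dim_of (conj_class M) <= 5)%N.
Proof.
move=> sM MM.
have [[e ->]|nsc] := pselect (exists e, M = e%:M).
  exact: leq_trans (dim_central e) _.
apply: dim_of_covered; exists unit, (fun _ _ => True),
  (fun _ t => mx4 (t 0 2%:R) (t 0 1) (- t 0 0) 0 (t 0 3%:R) (- t 0 2%:R) 0 (t 0 0)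
     (t 0 4%:R) 0 (- t 0 2%:R) (t 0 1) 0 (- t 0 4%:R) (t 0 3%:R) (t 0 2%:R)); split.
  move=> _ a b; have [K [F [G [sF sG k]]]] : ratfun (fun _ : 'rV[C]_5 => True) (fun t =>
    nth 0 (nth [::] [:: [:: t 0 2%:R; t 0 1; - t 0 0; 0]; [:: t 0 3%:R; - t 0 2%:R; 0; t 0 0];
     [:: t 0 4%:R; 0; - t 0 2%:R; t 0 1]; [:: 0; - t 0 4%:R; t 0 3%:R; t 0 2%:R]] a) b).
    case: a => -[|[|[|[|//]]]] ip; case: b => -[|[|[|[|//]]]] jp /=;
      do ! first [exact: ratfun_coord | exact: ratfun_const | apply: ratfun_opp].
  by exists K, F, G; split=> // t /k; rewrite mxE.
move=> x cx; have sx := conj_class_symplectic sM cx.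
have [h hS xE] := cx; have [_ uh _] := Sp4_symplectic hS.
have xx : x *m x = 1%:M.
  by rewrite xE !mulmxA mulmxKV // -(mulmxA h) MM mulmx1 mulmxV.
have nsx e : x != e%:M.
  apply/eqP => xe; apply: nsc; exists e.
  have : invmx h *m x *m h = e%:M by rewrite xe mul_mx_scalar -scalemxAl mulVmx // scalemx1.
  by rewrite xE !mulmxA mulVmx // mul1mx mulmxKV.
have skew : J *m x^T = x *m J by rewrite -[LHS]mul1mx -xx -mulmxA (mulmxA x J) sx.
have ske i j : (J *m x^T) i j = (x *m J) i j by rewrite skew.
have tr (a11 a12 a13 a14 a21 a22 a23 a24 a31 a32 a33 a34 a41 a42 a43 a44 : C) :
  (mx4 a11 a12 a13 a14 a21 a22 a23 a24 a31 a32 a33 a34 a41 a42 a43 a44)^T =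
  mx4 a11 a21 a31 a41 a12 a22 a32 a42 a13 a23 a33 a43 a14 a24 a34 a44.
  by apply/matrixP=> i j; rewrite !mxE; case: i => -[|[|[|[|]]]] //= ?; case: j => -[|[|[|[|]]]] //= ?.
have two (c : C) : 2%:R * c = 0 -> c = 0 by move/eqP; rewrite mulf_eq0 pnatr_eq0 => /eqP.
move: (ske) nsx; have xxe i j : (x *m x) i j = (1%:M : 'M[C]_4) i j by rewrite xx.
move: xxe; rewrite [x]mx4_eta.
move: (x 0 0) (x 0 1) (x 0 2%:R) (x 0 3%:R) (x 1 0) (x 1 1) (x 1 2%:R) (x 1 3%:R)
  (x 2%:R 0) (x 2%:R 1) (x 2%:R 2%:R) (x 2%:R 3%:R) (x 3%:R 0) (x 3%:R 1) (x 3%:R 2%:R) (x 3%:R 3%:R)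
  => a11 a12 a13 a14 a21 a22 a23 a24 a31 a32 a33 a34 a41 a42 a43 a44.
rewrite tr /symp_form !mx4_mul -diag4_1 /diag4 => xxe s nsx.
have s00 := s 0 0; have s01 := s 0 1; have s02 := s 0 2%:R; have s03 := s 0 3%:R.
have s11 := s 1 1; have s12 := s 1 2%:R; have s13 := s 1 3%:R; have s22 := s 2%:R 2%:R.
have s23 := s 2%:R 3%:R; have s33 := s 3%:R 3%:R.
rewrite !mxE /= !(mulr0, mul0r, mulr1, mul1r, addr0, add0r, mulrN1, mulN1r) in s00 s01 s02 s03 s11 s12 s13 s22 s23 s33.
have p01 := xxe 0 1; have p02 := xxe 0 2%:R; have p10 := xxe 1 0; have p20 := xxe 2%:R 0.
have p00 := xxe 0 0; have p11 := xxe 1 1; clear xxe s.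
rewrite !mxE /= in p01 p02 p10 p20 p00 p11.
have dbl (c : C) : c = - c -> c = 0.
  by move=> e; apply: two; rewrite mulr_natl mulr2n {1}e addNr.
have z14 := dbl _ s00; have z23 := dbl _ s11.
have z32 : a32 = 0 by apply: dbl.
have z41 : a41 = 0 by apply: dbl.
subst a14 a23 a32 a41 a24 a34 a44 a33 a43; have e42 : a42 = - a31 by rewrite -s23 opprK.
subst a42; rewrite !(mulr0, mul0r, addr0, add0r) in p01 p02 p10 p20 p00 p11.
have t0 : a11 + a22 = 0.
  apply/eqP/negPn/negP => nz.
  have z (c d : C) : d = c * (a11 + a22) -> d = 0 -> c = 0.
    by move=> -> /eqP; rewrite mulf_eq0 (negPf nz) orbF => /eqP.
  have a12z : a12 = 0 by apply: z p01; ring.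
  have a13z : a13 = 0 by apply: z p02; ring.
  have a21z : a21 = 0 by apply: z p10; ring.
  have a31z : a31 = 0 by apply: z p20; ring.
  subst a12 a13 a21 a31.
  have e : a11 - a22 = 0.
    by apply: (z _ (0 : C)) => //; transitivity (a11 * a11 + 0 * 0 + 0 * 0 - (0 * 0 + a22 * a22 + - 0 * - 0)); [|ring];
      move: p00 p11; rewrite !(mulr0, mul0r, addr0, add0r, oppr0) => -> ->; rewrite subrr.
  have e' : a22 = a11 by apply/eqP; rewrite eq_sym -subr_eq0 e.
  case/eqP: (nsx a11); rewrite e' oppr0; apply/matrixP => i j; rewrite !mxE.
  by case: i => -[|[|[|[|//]]]] ip; case: j => -[|[|[|[|//]]]] jp.
have e22 : a22 = - a11 by apply/eqP; rewrite -addr_eq0 addrC t0.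
exists tt, (\row_j nth 0 [:: - a13; a12; a11; a21; a31] j); split=> //.
by rewrite !mxE /= opprK e22.
Qed.
End Charts.

(** * Charts adapted to an eigenvector *)

Section ParabolicCharts.
Variable C : numClosedFieldType.
Notation mx4 a11 a12 a13 a14 a21 a22 a23 a24 a31 a32 a33 a34 a41 a42 a43 a44 :=
  (mx_of_rows [:: [:: a11; a12; a13; a14]; [:: a21; a22; a23; a24];
                  [:: a31; a32; a33; a34]; [:: a41; a42; a43; a44]]).
Local Notation J := (symp_form C).
Implicit Types (M h : 'M[C]_4).

(** A symplectic matrix with first row [(a, 0, 0, 0)], the middle block having determinant 1;
    symplecticity forces the other entries, as [par_form] shows. *)
Definition par (a A11 A12 A21 A22 p1 p2 c : C) : 'M[C]_4 :=
  mx4 a 0 0 0  p1 A11 A12 0  p2 A21 A22 0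
      c (a^-1 * (A11 * p2 - A21 * p1)) (a^-1 * (A12 * p2 - A22 * p1)) a^-1.

Lemma par_form (x : 'M[C]_4) : symplectic x -> x 0 1 = 0 -> x 0 2%:R = 0 -> x 0 3%:R = 0 ->
  [/\ x 0 0 != 0, x 1 1 * x 2%:R 2%:R - x 1 2%:R * x 2%:R 1 = 1 &
   x = par (x 0 0) (x 1 1) (x 1 2%:R) (x 2%:R 1) (x 2%:R 2%:R) (x 1 0) (x 2%:R 0) (x 3%:R 0)].
Proof.
move=> sx x01 x02 x03.
have o i j : om (row i x) (row j x) = om (delta_mx 0 i) (delta_mx 0 j).
  by rewrite !rowE om_mulmx.
have o01 := o 0 1; have o02 := o 0 2%:R; have o03 := o 0 3%:R; have o12 := o 1 2%:R.
have o13 := o 1 3%:R; have o23 := o 2%:R 3%:R; clear o.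
rewrite /om !mxE /= x01 x02 x03 !(mulr0, mul0r, mulr1, addr0, subr0, add0r) in o01 o02 o03 o12 o13 o23.
have a0 : x 0 0 != 0 by apply: contraTneq isT => e; move: o03; rewrite e mul0r => /eqP; rewrite eq_sym oner_eq0.
have m1 : x 1 3%:R = 0.
  by apply: (mulfI a0); rewrite mulr0; apply: etrans (etrans _ o01) _; ring.
have m2 : x 2%:R 3%:R = 0.
  by apply: (mulfI a0); rewrite mulr0; apply: etrans (etrans _ o02) _; ring.
have d : x 3%:R 3%:R = (x 0 0)^-1.
  by apply: (mulfI a0); rewrite mulfV //; apply: etrans (etrans _ o03) _; ring.
rewrite m1 m2 d in o12 o13 o23.
have det1 : x 1 1 * x 2%:R 2%:R - x 1 2%:R * x 2%:R 1 = 1.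
  by apply: etrans (etrans _ o12) _; ring.
have e13 : x 1 0 * (x 0 0)^-1 + x 1 1 * x 3%:R 2%:R - x 1 2%:R * x 3%:R 1 = 0.
  by apply: etrans (etrans _ o13) _; ring.
have e23 : x 2%:R 0 * (x 0 0)^-1 + x 2%:R 1 * x 3%:R 2%:R - x 2%:R 2%:R * x 3%:R 1 = 0.
  by apply: etrans (etrans _ o23) _; ring.
split=> //; rewrite {1}[x]mx4_eta x01 x02 x03 m1 m2 d /par.
have q1 : x 3%:R 1 = (x 0 0)^-1 * (x 1 1 * x 2%:R 0 - x 2%:R 1 * x 1 0).
  rewrite -[LHS]mulr1 -det1; apply/eqP; rewrite -subr_eq0; apply/eqP.
  by apply: (lin_comb2 (a := x 2%:R 1) (b := - x 1 1) e13 e23); ring.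
have q2 : x 3%:R 2%:R = (x 0 0)^-1 * (x 1 2%:R * x 2%:R 0 - x 2%:R 2%:R * x 1 0).
  rewrite -[LHS]mulr1 -det1; apply/eqP; rewrite -subr_eq0; apply/eqP.
  by apply: (lin_comb2 (a := x 2%:R 2%:R) (b := - x 1 2%:R) e13 e23); ring.
by rewrite -q1 -q2.
Qed.

Definition wswap : 'M[C]_4 := mx4 0 1 0 0  1 0 0 0  0 0 0 1  0 0 1 0.
Definition wlong : 'M[C]_4 := mx4 0 0 0 1  0 1 0 0  0 0 1 0  (-1) 0 0 0.
(** Signed permutation matrices that bring the coordinate [i] of a row vector to the front up to
    sign. *)
Definition weyl (i : 'I_4) : 'M[C]_4 :=
  nth 1%:M [:: 1%:M; wswap; wswap *m wlong; wlong] i.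

Let tr4 (a11 a12 a13 a14 a21 a22 a23 a24 a31 a32 a33 a34 a41 a42 a43 a44 : C) :
  (mx4 a11 a12 a13 a14 a21 a22 a23 a24 a31 a32 a33 a34 a41 a42 a43 a44)^T =
  mx4 a11 a21 a31 a41 a12 a22 a32 a42 a13 a23 a33 a43 a14 a24 a34 a44.
Proof. by apply/matrixP=> i j; rewrite !mxE; case: i => -[|[|[|[|]]]] //= ?; case: j => -[|[|[|[|]]]] //= ?. Qed.

Lemma symplectic1 : symplectic (1%:M : 'M[C]_4).
Proof. by rewrite /symplectic mul1mx trmx1 mulmx1. Qed.
Lemma weyl_symplectic i : symplectic (weyl i).
Proof.
have s1 : symplectic wswap.
  rewrite /symplectic /wswap tr4 /symp_form !mx4_mul.
  by congr (mx_of_rows [:: [:: _; _; _; _]; [:: _; _; _; _]; [:: _; _; _; _]; [:: _; _; _; _]]); ring.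
have s2 : symplectic wlong.
  rewrite /symplectic /wlong tr4 /symp_form !mx4_mul.
  by congr (mx_of_rows [:: [:: _; _; _; _]; [:: _; _; _; _]; [:: _; _; _; _]; [:: _; _; _; _]]); ring.
by case: i => -[|[|[|[|//]]]] ip; rewrite /weyl /=; [exact: symplectic1 | | exact: symplecticM | ].
Qed.
Lemma upper_symplectic z x y r : symplectic (upper z x y r : 'M[C]_4).
Proof.
rewrite /symplectic /upper tr4 /symp_form !mx4_mul.
by congr (mx_of_rows [:: [:: _; _; _; _]; [:: _; _; _; _]; [:: _; _; _; _]; [:: _; _; _; _]]); ring.
Qed.
Lemma symplectic_unit (x : 'M[C]_4) : symplectic x -> x \in unitmx.
Proof.
move=> sx; have JJ : J *m (- J) = 1%:M.
  rewrite mulmxN /symp_form mx4_mul -diag4_1 /diag4; apply/matrixP => i j; rewrite !mxE.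
  by case: i => -[|[|[|[|//]]]] ip; case: j => -[|[|[|[|//]]]] jp /=; ring.
have E : x *m (J *m x^T *m (- J)) = 1%:M by rewrite !mulmxA sx.
by case/mulmx1_unit: E.
Qed.
Lemma symplectic_inv (x : 'M[C]_4) : symplectic x -> symplectic (invmx x).
Proof.
move=> sx; have ux := symplectic_unit sx; rewrite /symplectic -{1}[J]sx.
by rewrite !mulmxA mulVmx // mul1mx -mulmxA -trmx_mul mulVmx // trmx1 mulmx1.
Qed.

Lemma weyl_entry (r : 'rV[C]_4) i : r 0 i != 0 -> (r *m weyl i) 0 0 != 0.
Proof.
have : [\/ i = 0, i = 1, i = 2%:R | i = 3%:R].
  by case: i => -[|[|[|[|//]]]] kp; [apply: Or41 | apply: Or42 | apply: Or43 | apply: Or44]; apply: val_inj.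
case=> -> r0; rewrite /weyl /= /wswap /wlong ?mx4_mul ?mulmx1 ?mulmx_entries ?mxE /=;
  by rewrite ?(mulr0, mulr1, mul0r, mul1r, add0r, addr0, mulrN1, oppr0) ?oppr_eq0.
Qed.

Definition chart i z x y (P : 'M[C]_4) :=
  weyl i *m upper_inv z x y 0 *m P *m (upper z x y 0 *m invmx (weyl i)).

(** An eigenvector with nonzero coordinate [i], moved to the front and normalized, is the first row
    of a symplectic matrix [upper]; in that basis [x] fixes the first coordinate line and has the
    form [par]. *)
Lemma chartP (x : 'M[C]_4) a (r : 'rV[C]_4) i : symplectic x -> r *m x = a *: r -> r 0 i != 0 ->
  exists r' : 'rV[C]_4, exists A11 A12 A21 A22 p1 p2 c,
  [/\ r' = ((r *m weyl i) 0 0)^-1 *: (r *m weyl i), a != 0, A11 * A22 - A12 * A21 = 1,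
   (\rank (par a A11 A12 A21 A22 p1 p2 c - a%:M)%R <= \rank (x - a%:M)%R)%N &
  x = chart i (r' 0 1) (r' 0 3%:R - r' 0 1 * r' 0 2%:R) (r' 0 2%:R) (par a A11 A12 A21 A22 p1 p2 c)].
Proof.
move=> sx rx ri; have w0 := weyl_entry ri.
pose r' := ((r *m weyl i) 0 0)^-1 *: (r *m weyl i).
have r'1 : r' 0 0 = 1 by rewrite mxE mulVf.
set z := r' 0 1; set y := r' 0 2%:R; set t := r' 0 3%:R - z * y.
have sw := weyl_symplectic i; have uw := symplectic_unit sw.
pose g : 'M[C]_4 := upper z t y 0; have sg : symplectic g := upper_symplectic _ _ _ _.
have ug := symplectic_unit sg.
have gi : upper_inv z t y 0 = invmx g by rewrite -[LHS]mul1mx -(mulVmx ug) -mulmxA upperK mulmx1.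
pose Y := g *m invmx (weyl i) *m x *m (weyl i *m invmx g).
have sY : symplectic Y.
  apply: symplecticM; first apply: symplecticM => //; first apply: symplecticM => //.
    exact: symplectic_inv.
  by apply: symplecticM => //; apply: symplectic_inv.
have rg : row 0 g = r' by exact: upper_row0.
have rY : row 0 Y = a *: delta_mx 0 0.
  rewrite !row_mul rg /r' -!scalemxAl mulmxK // rx !mulmxA -!scalemxAl scalerA mulrC -scalerA; congr (_ *: _).
  by rewrite scalemxAl -/r' -rg -row_mul mulmxV // row1.
have Y0 j : Y 0 j = a * (delta_mx 0 0 : 'rV[C]_4) 0 j.
  by have /rowP/(_ j) := rY; rewrite mxE [RHS]mxE.
have [||| Y00 det1 Ye] := par_form sY; try by rewrite Y0 !mxE /= mulr0.
exists r', (Y 1 1), (Y 1 2%:R), (Y 2%:R 1), (Y 2%:R 2%:R), (Y 1 0), (Y 2%:R 0), (Y 3%:R 0).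
have Ya : Y 0 0 = a by rewrite Y0 !mxE /= mulr1.
rewrite Ya in Y00 Ye; split=> //; rewrite -Ye.
  have -> : Y - a%:M = g *m invmx (weyl i) *m (x - a%:M) *m (weyl i *m invmx g).
    rewrite mulmxBr mulmxBl mul_mx_scalar -scalemxAl; congr (_ - _).
    by rewrite mulmxA mulmxKV // mulmxV // scalemx1.
  exact: leq_trans (mxrankM_maxl _ _) (mxrankM_maxr _ _).
rewrite /chart -/z -/y -/t gi /Y !mulmxA.
by rewrite -/g (mulmxKV ug (weyl i)) mulmxV // mul1mx (mulmxKV ug) (mulmxK uw).
Qed.

Lemma ratfun_ext N (D : 'rV[C]_N -> Prop) f g : (forall t, f t = g t) -> ratfun D f -> ratfun D g.
Proof. by move=> e [K [F [G [sF sG k]]]]; exists K, F, G; split=> // t /k; rewrite e. Qed.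
Lemma ratfun_mx_of_rows N (D : 'rV[C]_N -> Prop) (R : 'rV[C]_N -> seq (seq C)) :
  (forall i j : 'I_4, ratfun D (fun t => nth 0 (nth [::] (R t) i) j)) ->
  forall i j, ratfun D (fun t => mx_of_rows (R t) i j).
Proof. by move=> h i j; apply: ratfun_ext (h i j) => t; rewrite mxE. Qed.

Ltac rat := repeat first [exact: ratfun_coord | exact: ratfun_const | assumption
  | apply: ratfun_opp | apply: ratfun_add | apply: ratfun_mul].
Ltac rat_rows := apply: ratfun_mx_of_rows; case=> -[|[|[|[|//]]]] ?; case=> -[|[|[|[|//]]]] ? /=; rat.

Lemma ratfun_chart N (D : 'rV[C]_N -> Prop) i a (z x y A11 A12 A21 A22 p1 p2 c : 'rV[C]_N -> C) :
  ratfun D z -> ratfun D x -> ratfun D y -> ratfun D A11 -> ratfun D A12 -> ratfun D A21 ->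
  ratfun D A22 -> ratfun D p1 -> ratfun D p2 -> ratfun D c ->
  forall j k, ratfun D (fun t => chart i (z t) (x t) (y t)
    (par a (A11 t) (A12 t) (A21 t) (A22 t) (p1 t) (p2 t) (c t)) j k).
Proof.
move=> rz rx ry r11 r12 r21 r22 r1 r2 rc.
apply: ratfun_mulmx; first apply: ratfun_mulmx; first apply: ratfun_mulmx.
- by move=> j k; exact: ratfun_const.
- by rat_rows.
- by rat_rows.
apply: ratfun_mulmx; first by rat_rows.
by move=> j k; exact: ratfun_const.
Qed.

Lemma left_kernel (N : 'M[C]_4) : (\rank N < 4)%N -> exists2 r : 'rV[C]_4, r != 0 & r *m N = 0.
Proof.
move=> rN; have : kermx N != 0 by rewrite -mxrank_eq0 mxrank_ker -lt0n subn_gt0.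
by case/rowV0Pn => r /sub_kermxP rN0 r0; exists r.
Qed.
Lemma left_kernel_hyperplane (N : 'M[C]_4) (h : 'cV[C]_4) : (\rank N <= 2)%N ->
  exists r : 'rV[C]_4, [/\ r != 0, r *m N = 0 & r *m h = 0].
Proof.
move=> rN; have : kermx (row_mx N h) != 0.
  rewrite -mxrank_eq0 mxrank_ker -lt0n subn_gt0 -mxrank_tr tr_row_mx -addsmxE.
  apply: (leq_ltn_trans (mxrank_adds_leqif _ _).1); rewrite !mxrank_tr.
  exact: (leq_ltn_trans (leq_add rN (rank_leq_col h))).
case/rowV0Pn => r /sub_kermxP rN0 r0; exists r; split=> //.
  by have := congr1 lsubmx rN0; rewrite mul_mx_row row_mxKl linear0.
by have := congr1 rsubmx rN0; rewrite mul_mx_row row_mxKr linear0.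
Qed.

Lemma eigenvalue_exists (M : 'M[C]_4) : exists a, (\rank (M - a%:M)%R < 4)%N.
Proof.
have [a ra] : exists a, root (char_poly M) a.
  by apply: closed_rootP; rewrite size_char_poly.
exists a; have := ra; rewrite -eigenvalue_root_char => /eigenvalueP[v vM v0].
rewrite ltnNge; apply: contra v0 => rk.
have u : row_free (M - a%:M) by rewrite /row_free eqn_leq rank_leq_row.
by rewrite -(mulmx_free_eq0 v u) mulmxBr vM mul_mx_scalar subrr.
Qed.

(** Three parameters for the eigenvector, three for [p1, p2, c], and three for the middle block of
    determinant 1, which takes two charts. The eigenvalue is constant on the class. *)
Lemma dim_general M : symplectic M -> (dim_of (conj_class M) <= 9)%N.
Proof.
move=> sM; have [a ra] := eigenvalue_exists M.
pose k j : 'rV[C]_9 -> C := fun t => t 0 j.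
apply: dim_of_covered; exists ('I_4 * bool)%type,
 (fun ib t => t 0 6%:R != 0),
 (fun ib t => if ib.2
   then chart ib.1 (t 0 0) (t 0 1) (t 0 2%:R) (par a (t 0 6%:R) (t 0 7%:R) (t 0 8%:R)
      ((1 + t 0 7%:R * t 0 8%:R) * (t 0 6%:R)^-1) (t 0 3%:R) (t 0 4%:R) (t 0 5%:R))
   else chart ib.1 (t 0 0) (t 0 1) (t 0 2%:R) (par a 0 (t 0 6%:R) (- (t 0 6%:R)^-1)
      (t 0 7%:R) (t 0 3%:R) (t 0 4%:R) (t 0 5%:R))); split.
  have inv : ratfun (fun t : 'rV[C]_9 => t 0 6%:R != 0) (fun t => (t 0 6%:R)^-1).
    by apply: ratfun_inv => //; exact: ratfun_coord.
  by case=> i [] j l /=; apply: ratfun_chart; rat.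
move=> x cx; have sx := conj_class_symplectic sM cx.
have [r r0 rx] : exists2 r : 'rV[C]_4, r != 0 & r *m (x - a%:M) = 0.
  by apply: left_kernel; rewrite (conj_class_rank a cx).
have {}rx : r *m x = a *: r.
  by apply/eqP; rewrite -subr_eq0 -mul_mx_scalar -mulmxBr rx.
have [i ri] : exists i, r 0 i != 0 by exact/rV0Pn.
have [r' [A11 [A12 [A21 [A22 [p1 [p2 [c [_ a0 det1 _ xE]]]]]]]]] := chartP sx rx ri.
have [A0|A0] := eqVneq A11 0.
  have A12n : A12 != 0.
    by apply: contraTneq isT => e; move: det1; rewrite A0 e !mul0r subrr => /eqP; rewrite eq_sym oner_eq0.
  exists (i, false), (\row_j nth 0 [:: r' 0 1; r' 0 3%:R - r' 0 1 * r' 0 2%:R; r' 0 2%:R; p1; p2; c; A12; A22; 0] j).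
  rewrite !mxE /=; split=> //; rewrite xE A0; congr (chart _ _ _ _ (par _ _ _ _ _ _ _ _)).
  by apply: (mulfI A12n); rewrite mulrN mulfV // -det1 A0; ring.
exists (i, true), (\row_j nth 0 [:: r' 0 1; r' 0 3%:R - r' 0 1 * r' 0 2%:R; r' 0 2%:R; p1; p2; c; A11; A12; A21] j).
rewrite !mxE /=; split=> //; rewrite xE; congr (chart _ _ _ _ (par _ _ _ _ _ _ _ _)).
by apply: (mulfI A0); rewrite -det1; field.
Qed.

Let q1 (a A11 A12 A21 A22 p1 p2 : C) := a^-1 * (A11 * p2 - A21 * p1).
Let q2 (a A11 A12 A21 A22 p1 p2 : C) := a^-1 * (A12 * p2 - A22 * p1).
Let Delta (a A11 A12 A21 A22 : C) := (A11 - a) * (A22 - a) - A12 * A21.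
Let cfun (a A11 A12 A21 A22 p1 p2 : C) :=
  ((q1 a A11 A12 A21 A22 p1 p2 * (A22 - a) - q2 a A11 A12 A21 A22 p1 p2 * A21) * p1
   + (q2 a A11 A12 A21 A22 p1 p2 * (A11 - a) - q1 a A11 A12 A21 A22 p1 p2 * A12) * p2)
  * (Delta a A11 A12 A21 A22)^-1.

(** The middle block in four cases. In cases 0 and 1 it has eigenvalues [a] and [a^-1], at most two
    parameters suffice and [c] is free. In cases 2 and 3 [a] is no eigenvalue, the block takes three
    parameters, and the rank condition determines [c] as [cfun]. *)
Let gl7 a (k : nat) (t : 'rV[C]_7) : C * C * C * C :=
  match k with
  | 0%N => (a + (a^-1 - a - t 0 5%:R * t 0 6%:R), t 0 6%:R,
            t 0 5%:R * (a^-1 - a - t 0 5%:R * t 0 6%:R), a + t 0 5%:R * t 0 6%:R)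
  | 1%N => (a, 0, t 0 5%:R, a^-1)
  | 2%N => (t 0 4%:R, t 0 5%:R, t 0 6%:R, (1 + t 0 5%:R * t 0 6%:R) * (t 0 4%:R)^-1)
  | _ => (0, t 0 4%:R, - (t 0 4%:R)^-1, t 0 5%:R)
  end.
Let dom7 a (k : nat) (t : 'rV[C]_7) : Prop :=
  (1 < k)%N -> t 0 4%:R != 0 /\
   Delta a (gl7 a k t).1.1.1 (gl7 a k t).1.1.2 (gl7 a k t).1.2 (gl7 a k t).2 != 0.
Let c7 a (k : nat) (t : 'rV[C]_7) : C :=
  if (1 < k)%N then cfun a (gl7 a k t).1.1.1 (gl7 a k t).1.1.2 (gl7 a k t).1.2 (gl7 a k t).2 (t 0 2%:R) (t 0 3%:R)
  else t 0 4%:R.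
Let chart7 a (i : 'I_4) (b : bool) k (t : 'rV[C]_7) : 'M[C]_4 :=
  chart i (t 0 0) (if b then t 0 1 else - (t 0 0 * t 0 1)) (if b then 0 else t 0 1)
    (par a (gl7 a k t).1.1.1 (gl7 a k t).1.1.2 (gl7 a k t).1.2 (gl7 a k t).2 (t 0 2%:R) (t 0 3%:R) (c7 a k t)).

Let ratfun_chart7 a i b k : (k < 4)%N -> forall u v, ratfun (dom7 a k) (fun t => chart7 a i b k t u v).
Proof.
move=> k4.
have inv : (1 < k)%N -> ratfun (dom7 a k) (fun t => (t 0 4%:R)^-1).
  by move=> k1; apply: ratfun_inv => [|t /(_ k1)[]//]; exact: ratfun_coord.
have [r1 r2 r3 r4] : [/\ ratfun (dom7 a k) (fun t => (gl7 a k t).1.1.1), ratfun (dom7 a k) (fun t => (gl7 a k t).1.1.2),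
   ratfun (dom7 a k) (fun t => (gl7 a k t).1.2) & ratfun (dom7 a k) (fun t => (gl7 a k t).2)].
  case: k k4 inv => [|[|[|[|//]]]] _ inv /=; split; rat; exact: inv.
have rc : ratfun (dom7 a k) (c7 a k).
  rewrite /c7; case k1: (1 < k)%N; last exact: ratfun_coord.
  rewrite /cfun /q1 /q2; apply: ratfun_mul; first by rat.
  by apply: ratfun_inv => [|t /(_ k1)[]//]; rewrite /Delta; rat.
by rewrite /chart7 => u v; apply: ratfun_chart => //; case: b; rat.
Qed.

(** The eigenspace has dimension at least 2 and so meets the hyperplane where the last coordinate
    vanishes. This leaves two parameters for the eigenvector, two for [p1, p2], and three for the
    block and [c] together. *)
Lemma dim_rank2 M a : symplectic M -> (\rank (M - a%:M)%R <= 2)%N -> (dim_of (conj_class M) <= 7)%N.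
Proof.
move=> sM rM; apply: dim_of_covered; exists ('I_4 * bool * 'I_4)%type,
  (fun (ibk : 'I_4 * bool * 'I_4) t => dom7 a ibk.2 t), (fun (ibk : 'I_4 * bool * 'I_4) t => chart7 a ibk.1.1 ibk.1.2 ibk.2 t); split.
  by case=> [[i b] k] u v; apply: ratfun_chart7.
move=> x cx; have sx := conj_class_symplectic sM cx.
have rx : (\rank (x - a%:M)%R <= 2)%N by rewrite (conj_class_rank a cx).
have [r [r0 rN rh]] := left_kernel_hyperplane (delta_mx 3%:R 0) rx.
have {}rN : r *m x = a *: r by apply/eqP; rewrite -subr_eq0 -mul_mx_scalar -mulmxBr rN.
have r3 : r 0 3%:R = 0.
  by have /matrixP/(_ 0 0) := rh; rewrite -colE !mxE.
have [i ri] : exists i, r 0 i != 0 by exact/rV0Pn.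
have [r' [A11 [A12 [A21 [A22 [p1 [p2 [c [r'E a0 det1 rY xE]]]]]]]]] := chartP sx rN ri.
have [b [z [s [e1 e2 e3]]]] : exists b z s, [/\ r' 0 1 = z,
   r' 0 3%:R - r' 0 1 * r' 0 2%:R = (if b then s else - (z * s)) & r' 0 2%:R = if b then 0 else s :> C].
  have : [\/ i = 0, i = 1, i = 2%:R | i = 3%:R].
    by case: (i) => -[|[|[|[|//]]]] kp; [apply: Or41 | apply: Or42 | apply: Or43 | apply: Or44]; apply: val_inj.
  case=> ie; subst i; last by rewrite r3 eqxx in ri.
  - exists false, (r' 0 1), (r' 0 2%:R); split=> //.
    suff -> : r' 0 3%:R = 0 by rewrite sub0r.
    by rewrite r'E /weyl /= mulmx1 mxE r3 mulr0.
  - exists true, (r' 0 1), (r' 0 3%:R - r' 0 1 * r' 0 2%:R); split=> //.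
    suff h : (r *m weyl 1) 0 2%:R = 0 by rewrite r'E mxE h mulr0.
    by rewrite /weyl /= /wswap mulmx_entries !mxE /= r3; ring.
  exists true, (r' 0 1), (r' 0 3%:R - r' 0 1 * r' 0 2%:R); split=> //.
  suff h : (r *m weyl 2%:R) 0 2%:R = 0 by rewrite r'E mxE h mulr0.
  by rewrite /weyl /= /wswap /wlong mx4_mul mulmx_entries !mxE /= r3; ring.
have fin k t : dom7 a k t -> (k < 4)%N -> t 0 0 = z -> t 0 1 = s -> t 0 2%:R = p1 -> t 0 3%:R = p2 ->
   gl7 a k t = (A11, A12, A21, A22) -> c7 a k t = c ->
   exists (ibk : 'I_4 * bool * 'I_4) t, dom7 a ibk.2 t /\ x = chart7 a ibk.1.1 ibk.1.2 ibk.2 t.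
  move=> Dt k4 t0 t1 t2 t3 gt ct; exists (i, b, Ordinal k4), t; split=> //.
  by rewrite xE /chart7 /= gt ct t0 t1 t2 t3 e2 e3 e1.
have [D0|D0] := eqVneq (Delta a A11 A12 A21 A22) 0.
  have trA : A11 + A22 = a + a^-1.
    have e : a * (A11 + A22) = a * a + 1.
    apply/eqP; rewrite -subr_eq0; apply/eqP.
    have det1' : A11 * A22 - A12 * A21 - 1 = 0 by rewrite det1 subrr.
    by apply: (lin_comb2 (a := -1) (b := 1) D0 det1'); rewrite /Delta; ring.
  by apply: (mulfI a0); rewrite e mulrDr mulfV.
  have [h1|] := boolP ((A11 == a) && (A12 == 0)).
    have /andP[/eqP h11 /eqP h12] := h1.
    apply: (fin 1%N (\row_j nth 0 [:: z; s; p1; p2; c; A21; 0] j)); rewrite ?mxE //=.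
    by rewrite h11 h12 !mxE /= (_ : A22 = a^-1) //; apply: (addrI A11); rewrite trA h11.
    by rewrite /c7 /= mxE.
  rewrite negb_and => h1.
  have [tt [t1 t2]] : exists tt, A21 = tt * (A11 - a) /\ A22 - a = tt * A12.
    have [e|e] := eqVneq (A11 - a) 0.
      have A12n : A12 != 0 by case/orP: h1 => //; rewrite -subr_eq0 e eqxx.
      exists ((A22 - a) / A12); rewrite mulfVK // e mulr0; split=> //.
      by apply: (mulfI A12n); rewrite mulr0; apply: (lin_comb1 (a := -1) D0); rewrite /Delta e; ring.
    exists (A21 / (A11 - a)); rewrite mulfVK //; split=> //; apply: (mulfI e).
    apply/eqP; rewrite -subr_eq0; apply/eqP/(lin_comb1 (a := 1) D0); rewrite /Delta; by field.
  have w1 : A11 = a + (a^-1 - a - tt * A12).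
    by rewrite -t2; apply/eqP; rewrite -subr_eq0; apply/eqP; transitivity (A11 + A22 - (a + a^-1)); [ring | rewrite trA subrr].
  apply: (fin 0%N (\row_j nth 0 [:: z; s; p1; p2; c; tt; A12] j)); rewrite ?mxE //=.
    rewrite !mxE /= -w1; congr (_, _, _, _); last by rewrite -t2 addrC subrK.
    by rewrite t1; congr (_ * _); apply/eqP; rewrite -subr_eq0 w1; apply/eqP; ring.
  by rewrite /c7 /= mxE.
(* A second kernel vector, with first coordinate zero, expresses the last row of [par - a] through
   the two middle rows, which determines [c]. *)
have [k [k0 kY kh]] := left_kernel_hyperplane (delta_mx 0 0) (leq_trans rY rx).
have k00 : k 0 0 = 0 by have /matrixP/(_ 0 0) := kh; rewrite -colE !mxE.
have kc j : k 0 1 * (par a A11 A12 A21 A22 p1 p2 c - a%:M) 1 j + k 0 2%:R * (par a A11 A12 A21 A22 p1 p2 c - a%:M) 2%:R j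
   + k 0 3%:R * (par a A11 A12 A21 A22 p1 p2 c - a%:M) 3%:R j = 0.
  have /matrixP/(_ 0 j) := kY; rewrite mulmx_entries k00 mul0r add0r [RHS]mxE => E; exact: E.
have c0 := kc 0; have c1 := kc 1; have c2 := kc 2%:R; clear kc.
rewrite !mxE /= !(mulr0n, mulr1n, subr0) -/(q1 a A11 A12 A21 A22 p1 p2) -/(q2 a A11 A12 A21 A22 p1 p2) in c0 c1 c2.
have k3 : k 0 3%:R != 0.
  apply: contraNneq k0 => e; rewrite e !mul0r !addr0 in c0 c1 c2.
  have d1 : k 0 1 = 0.
    apply: (mulfI D0); rewrite mulr0; apply: (lin_comb2 (a := A22 - a) (b := - A21) c1 c2); rewrite /Delta; ring.
  have d2 : k 0 2%:R = 0.
    apply: (mulfI D0); rewrite mulr0; apply: (lin_comb2 (a := - A12) (b := A11 - a) c1 c2); rewrite /Delta; ring.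
  by apply/eqP/row4P; rewrite ?k00 ?d1 ?d2 ?e mxE.
have cE : c = cfun a A11 A12 A21 A22 p1 p2.
  apply: (mulfI k3); rewrite /cfun.
  set Q1 := q1 _ _ _ _ _ _ _ in c1 *; set Q2 := q2 _ _ _ _ _ _ _ in c2 *.
  have E1 : k 0 3%:R * Q1 = - (k 0 1 * (A11 - a) + k 0 2%:R * A21).
    by apply/eqP; rewrite -subr_eq0; apply/eqP/(lin_comb1 (a := 1) c1); ring.
  have E2 : k 0 3%:R * Q2 = - (k 0 1 * A12 + k 0 2%:R * (A22 - a)).
    by apply/eqP; rewrite -subr_eq0; apply/eqP/(lin_comb1 (a := 1) c2); ring.
  transitivity (((k 0 3%:R * Q1 * (A22 - a) - k 0 3%:R * Q2 * A21) * p1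
    + (k 0 3%:R * Q2 * (A11 - a) - k 0 3%:R * Q1 * A12) * p2) * (Delta a A11 A12 A21 A22)^-1); last by ring.
  rewrite E1 E2; apply/eqP; rewrite -subr_eq0; apply/eqP/(lin_comb1 (a := 1) c0).
  by move: D0; rewrite /Delta => D0; field.
have [e|e] := eqVneq A11 0.
  have A12n : A12 != 0.
    by apply: contraTneq isT => e'; move: det1; rewrite e e' !mul0r subrr => /eqP; rewrite eq_sym oner_eq0.
  have A21e : - A12^-1 = A21 by apply: (mulfI A12n); rewrite mulrN mulfV // -det1 e; ring.
  apply: (fin 3%N (\row_j nth 0 [:: z; s; p1; p2; A12; A22; 0] j)); rewrite /dom7 /c7 /= ?mxE //= ?A21e -?e //.
  by move=> _; move: D0; rewrite e => D0; split.
have A22e : (1 + A12 * A21) * A11^-1 = A22 by apply: (mulIf e); rewrite mulfVK // -det1; ring.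
by apply: (fin 2%N (\row_j nth 0 [:: z; s; p1; p2; A11; A12; A21] j)); rewrite /dom7 /c7 /= ?mxE //= ?A22e.
Qed.
End ParabolicCharts.

(** * Regular conjugacy classes *)

Section QuadraticForms.
Variable C : numClosedFieldType.
Local Notation vec := 'rV[C]_4.
Implicit Types (A B : 'M[C]_4) (x y v : vec) (c : 'cV[C]_4).

Definition bil A x y : C := (x *m A *m y^T) 0 0.
Definition qf A x : C := bil A x x.
Definition lf c x : C := (x *m c) 0 0.

Lemma bilDl A x y v : bil A (x + y) v = bil A x v + bil A y v. Proof. by rewrite /bil !mulmxDl mxE. Qed.
Lemma bilDr A x y v : bil A v (x + y) = bil A v x + bil A v y.
Proof. by rewrite /bil linearD /= mulmxDr mxE. Qed.
Lemma bilZl A a x v : bil A (a *: x) v = a * bil A x v. Proof. by rewrite /bil -!scalemxAl mxE. Qed.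
Lemma bilZr A a x v : bil A v (a *: x) = a * bil A v x.
Proof. by rewrite /bil linearZ /= -scalemxAr mxE. Qed.
Lemma lfD c x y : lf c (x + y) = lf c x + lf c y. Proof. by rewrite /lf mulmxDl mxE. Qed.
Lemma lfZ c a x : lf c (a *: x) = a * lf c x. Proof. by rewrite /lf -scalemxAl mxE. Qed.
Definition formE := (bilDl, bilDr, bilZl, bilZr, lfD, lfZ).

Lemma bil_delta A i j : bil A (delta_mx 0 i) (delta_mx 0 j) = A i j.
Proof. by rewrite /bil -rowE trmx_delta -colE !mxE. Qed.
Lemma lf_delta c i : lf c (delta_mx 0 i) = c i 0.
Proof. by rewrite /lf -rowE mxE. Qed.

Lemma linewise_lf c : linewise (lf c).
Proof. by apply: linewise_linear => x t y; rewrite !formE. Qed.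
Lemma linewise_qf A : linewise (qf A).
Proof.
move=> x d; apply: (@polyfun_ext _ (fun t => qf A x + t * (bil A x d + bil A d x) + t * t * qf A d)).
  by move=> t; rewrite /qf !formE; ring.
by polyfun.
Qed.

Lemma qf_eq0 A : (forall x, qf A x = 0) -> forall i j, A i j = - A j i.
Proof.
move=> h i j; have := h (delta_mx 0 i + delta_mx 0 j).
rewrite /qf !formE !bil_delta; have := h (delta_mx 0 i); have := h (delta_mx 0 j).
rewrite /qf !bil_delta => -> ->; rewrite add0r addr0 => /eqP.
by rewrite addr_eq0 => /eqP ->.
Qed.

(** The quadric contains no hyperplane; by [reducible_quadric] the form is otherwise a product of
    two linear forms. *)
Definition irreducible_quadric A := forall c, c != 0 -> exists2 x, lf c x = 0 & qf A x != 0.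

Lemma lf_neq0 c : c != 0 -> exists x, lf c x != 0.
Proof.
move=> c0; have [i ci] : exists i, c i 0 != 0.
  apply/existsP; apply: contraNT c0; rewrite negb_exists => /forallP h.
  by apply/eqP/matrixP => i j; rewrite (ord1 j) mxE; apply/eqP/negPn/h.
by exists (delta_mx 0 i); rewrite lf_delta.
Qed.

(** Projection from a point [o] of the quadric: up to a scalar, [psi v] is the second intersection
    with the line through [o] and [v]. This gives access to linewise arguments on the quadric. The
    last two properties say that the image lies in no hyperplane and on no other quadric. *)
Lemma quadric_parametrization A : irreducible_quadric A -> exists psi : vec -> vec,
  [/\ forall x, qf A (psi x) = 0, forall j, linewise (fun x => psi x 0 j),
     forall c, c != 0 -> exists x, lf c (psi x) != 0 &
     forall B, (forall x, qf B (psi x) = 0) -> exists k, forall x, qf B x = k * qf A x].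
Proof.
move=> irr.
have [x Ax] : exists x, qf A x != 0.
  have [|x _ Ax] := irr (delta_mx 0 0); last by exists x.
  by apply/eqP => /matrixP/(_ 0 0); rewrite !mxE => /eqP; rewrite oner_eq0.
have polar (o : vec) : exists c, forall v, lf c v = bil A o v + bil A v o.
  exists (A^T *m o^T + A *m o^T) => v; rewrite /lf mulmxDr mxE !mulmxA; congr (_ + _).
  have -> : v *m A^T *m o^T = (o *m A *m v^T)^T by rewrite !trmx_mul trmxK mulmxA.
  by rewrite mxE.
have [cx cxE] := polar x.
have cx0 : cx != 0.
  apply: contraNneq Ax => e; have := cxE x; rewrite e /lf mulmx0 mxE /qf -mulr2n => /eqP.
  by rewrite eq_sym mulrn_eq0.
have [y cy Ay] := irr cx cx0; rewrite cxE in cy.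
(* As [x] and [y] are orthogonal for the polar form, [x + t0 y] is isotropic for this value of
   [t0]. *)
pose t0 := sqrtC (- (qf A x / qf A y)).
have t02 : t0 * t0 = - (qf A x / qf A y) by rewrite -expr2 sqrtCK.
pose o := x + t0 *: y.
have Qo : qf A o = 0.
  rewrite /o /qf !formE; transitivity (qf A x + t0 * (bil A x y + bil A y x) + t0 * t0 * qf A y); first by rewrite /qf; ring.
  by rewrite cy t02; field.
have [c cE] := polar o.
have cx' : lf c x != 0.
  rewrite cE /o !formE; have -> : bil A x x + t0 * bil A y x + (bil A x x + t0 * bil A x y) = 2%:R * qf A x + t0 * (bil A x y + bil A y x).
    by rewrite /qf; ring.
  by rewrite cy mulr0 addr0 mulf_neq0 ?pnatr_eq0.
have c0 : c != 0 by apply: contraNneq cx' => ->; rewrite /lf mulmx0 mxE.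
have [z cz Az] := irr c c0.
pose psi v := qf A v *: o - lf c v *: v.
have psiB B v : qf B (psi v) = qf A v * qf A v * qf B o - qf A v * lf c v * (bil B o v + bil B v o) + lf c v * lf c v * qf B v.
  by rewrite /psi -scaleNr /qf !formE; ring.
have psic d v : lf d (psi v) = qf A v * lf d o - lf c v * lf d v.
  by rewrite /psi -scaleNr !formE; ring.
exists psi; split.
- by move=> v; rewrite psiB Qo -cE; ring.
- move=> j; apply: (@linewise_ext _ _ (fun v => qf A v * o 0 j + - (lf c v * v 0 j))).
    by move=> v; rewrite !mxE.
  apply: linewise_add; first by apply: linewise_mul; [exact: linewise_qf | exact: linewise_const].
  by apply: linewise_opp; apply: linewise_mul; [exact: linewise_lf | exact: linewise_coord].
- move=> d d0; have [h|/existsNP[v /eqP h]] := pselect (forall v, lf d (psi v) = 0); last by exists v.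
  have do0 : lf d o = 0.
    have := h z; rewrite psic cz mul0r subr0 => /eqP; rewrite mulf_eq0 (negPf Az) => /eqP //.
  have [v|e|e] := linewise_integral (@linewise_lf c) (@linewise_lf d).
  + by have := h v; rewrite psic do0 mulr0 sub0r => /eqP; rewrite oppr_eq0 => /eqP.
  + by rewrite e eqxx in cx'.
  by have [v] := lf_neq0 d0; rewrite e eqxx.
move=> B h.
have Bo : qf B o = 0.
  have := h z; rewrite psiB cz !(mulr0, mul0r) subr0 addr0 => /eqP.
  by rewrite !mulf_eq0 (negPf Az) => /eqP.
have T v : lf c v * qf B v = qf A v * (bil B o v + bil B v o).
  have lT : linewise (fun v => bil B o v + bil B v o) by apply: linewise_linear => u t w; rewrite !formE; ring.
  have [u|e|e] := linewise_integral (@linewise_lf c)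
    (linewise_add (linewise_mul (@linewise_lf c) (@linewise_qf B))
      (linewise_opp (linewise_mul (@linewise_qf A) lT))).
  + by have := h u; rewrite psiB Bo => e; rewrite -[RHS]e; ring.
  + by rewrite e eqxx in cx'.
  by apply/eqP; rewrite -subr_eq0 e.
pose T1 v := bil B o v + bil B v o.
have T1l u t w : T1 (u + t *: w) = T1 u + t * T1 w by rewrite /T1 !formE; ring.
have T10 v : lf c v = 0 -> T1 v = 0.
  move=> cv; apply/eqP/negPn/negP => Tv.
  have [|t Ht] := @polyfun_nonzero _ [:: (fun t => qf A (z + t *: v)); (fun t => T1 z + t * T1 v)].
    case=> [|[|//]] _ /=; split.
    - exact: linewise_qf.
    - by exists 0; rewrite scale0r addr0.
    - by polyfun.
    - exists ((1 - T1 z) / T1 v); rewrite mulfVK // addrC subrK oner_neq0 //.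
  have := T (z + t *: v); rewrite !lfD lfZ cz cv mulr0 addr0 mul0r -/(T1 _) T1l => /esym/eqP.
  by rewrite mulf_eq0 (negPf (Ht 0%N isT)) (negPf (Ht 1%N isT)).
pose k := T1 x / lf c x.
have T1k v : T1 v = k * lf c v.
  have := T10 (v + (- (lf c v / lf c x)) *: x); rewrite !formE mulNr mulfVK // subrr T1l => /(_ erefl)/eqP.
  by rewrite mulNr subr_eq0 => /eqP ->; rewrite /k; field.
exists k => v.
have [u|e|e] := linewise_integral (@linewise_lf c)
  (linewise_add (@linewise_qf B) (linewise_opp (linewise_mul (@linewise_const _ _ k) (@linewise_qf A)))).
- by have := T u; rewrite -/(T1 u) T1k => e; rewrite mulrDr mulrN e; ring.
- by rewrite e eqxx in cx'.
by apply/eqP; rewrite -subr_eq0 e.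
Qed.
End QuadraticForms.

Section Skew.
Variable C : numClosedFieldType.
Local Notation J := (symp_form C).
Implicit Types (N : 'M[C]_4).

Lemma ord4P (i : 'I_4) : [\/ i = 0, i = 1, i = 2%:R | i = 3%:R].
Proof.
by case: i => -[|[|[|[|//]]]] kp; [apply: Or41 | apply: Or42 | apply: Or43 | apply: Or44]; apply: val_inj.
Qed.
Lemma sum4 (F : 'I_4 -> C) : \sum_i F i = F 0 + F 1 + F 2%:R + F 3%:R.
Proof.
rewrite !big_ord_recl big_ord0 addr0 !addrA.
by congr (_ + F _ + F _ + F _); apply: val_inj.
Qed.

Definition skew N := forall i j, N i j = - N j i.
Lemma skew_trmx N : N^T = - N -> skew N.
Proof. by move=> s i j; have /matrixP/(_ j i) := s; rewrite !mxE. Qed.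
Lemma trmx_skew N : skew N -> N^T = - N.
Proof. by move=> s; apply/matrixP => i j; rewrite !mxE s. Qed.
Lemma skew_diag N i : skew N -> N i i = 0.
Proof. by move=> s; have /eqP := s i i; rewrite -addr_eq0 -mulr2n mulrn_eq0 => /eqP. Qed.

(** For a column times a row, [N i j * N j i = N i i * N j j], and the diagonal of a skew matrix is
    zero. *)
Lemma skew_rank1 N : skew N -> (\rank N <= 1)%N -> N = 0.
Proof.
move=> s rk.
have [c [r Ncr]] : exists (c : 'cV[C]_4) (r : 'rV[C]_4), N = c *m r.
  move: rk (col_base N) (row_base N) (mulmx_base N); case: (\rank N) => [|[|//]] _ c r E.
    by exists 0, 0; rewrite mul0mx -E [c]thinmx0 mul0mx.
  by exists c, r.
have E i j : N i j = c i 0 * r 0 j by rewrite Ncr mxE big_ord1.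
apply/matrixP => i j; rewrite [RHS]mxE; apply/eqP; rewrite -sqrf_eq0.
have -> : N i j ^+ 2 = - (N i i * N j j).
  transitivity (N i j * - N j i); first by rewrite -(s i j) expr2.
  by rewrite !E; ring.
by rewrite !(skew_diag _ s) mulr0 oppr0.
Qed.

Definition pf N := N 0 1 * N 2%:R 3%:R - N 0 2%:R * N 1 3%:R + N 0 3%:R * N 1 2%:R.
Definition dual N : 'M[C]_4 := mx_of_rows
  [:: [:: 0; N 2%:R 3%:R; - N 1 3%:R; N 1 2%:R]; [:: - N 2%:R 3%:R; 0; N 0 3%:R; - N 0 2%:R];
      [:: N 1 3%:R; - N 0 3%:R; 0; N 0 1]; [:: - N 1 2%:R; N 0 2%:R; - N 0 1; 0]].
Lemma skew_eta N : skew N -> N = mx_of_rows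
  [:: [:: 0; N 0 1; N 0 2%:R; N 0 3%:R]; [:: - N 0 1; 0; N 1 2%:R; N 1 3%:R];
      [:: - N 0 2%:R; - N 1 2%:R; 0; N 2%:R 3%:R]; [:: - N 0 3%:R; - N 1 3%:R; - N 2%:R 3%:R; 0]].
Proof.
move=> s; rewrite [LHS]mx4_eta !(skew_diag _ s) (s 1 0) (s 2%:R 0) (s 3%:R 0) (s 2%:R 1) (s 3%:R 1).
by rewrite (s 3%:R 2%:R).
Qed.
Lemma mul_dual N : skew N -> N *m dual N = (- pf N)%:M.
Proof.
move=> s; rewrite {1}(skew_eta s) /dual mx4_mul /pf; apply/matrixP => i j; rewrite !mxE.
by case: i => -[|[|[|[|//]]]] ip; case: j => -[|[|[|[|//]]]] jp /=; ring.
Qed.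
Lemma skew_unit N : skew N -> pf N != 0 -> N \in unitmx.
Proof.
move=> s p0; have : N *m ((- pf N)^-1 *: dual N) = 1%:M.
  by rewrite -scalemxAr mul_dual // scale_scalar_mx mulVf // oppr_eq0.
by case/mulmx1_unit.
Qed.
(** The Pfaffian vanishes, so [N *m dual N = 0]. If [N] had rank 3, the skew matrix [dual N] would
    have rank at most 1 and be zero, but its entries are those of [N] up to sign. *)
Lemma skew_singular N : skew N -> (\rank N < 4)%N -> (\rank N <= 2)%N.
Proof.
move=> s r4; rewrite leqNgt; apply/negP => r3.
have p0 : pf N = 0.
  by apply/eqP/negPn/negP => /(skew_unit s)/mxrank_unit rN; rewrite rN in r4.
have := mul_dual s; rewrite p0 oppr0 raddf0 => /mulmx0_rank_max rd.
have d0 : dual N = 0.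
  apply: skew_rank1; last by lia.
  by move=> i j; case: (ord4P i) => ->; case: (ord4P j) => ->; rewrite !mxE /= ?opprK ?oppr0.
have e i j : dual N i j = 0 by rewrite d0 mxE.
have := e 0 1; have := e 2%:R 0; have := e 0 3%:R; have := e 1 2%:R; have := e 3%:R 1; have := e 2%:R 3%:R.
rewrite !mxE /= => e1 e2 e3 e4 e5 e6.
move: r3; rewrite [N](skew_eta s) e1 e2 e3 e4 e5 e6 oppr0 (_ : mx_of_rows _ = 0) ?mxrank0 //.
by apply/matrixP => i j; case: (ord4P i) => ->; case: (ord4P j) => ->; rewrite !mxE.
Qed.

Lemma JT : J^T = - J.
Proof. by apply/matrixP => i j; case: (ord4P i) => ->; case: (ord4P j) => ->; rewrite !mxE /= ?opprK ?oppr0. Qed.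
Lemma JJ : J *m J = - 1%:M.
Proof.
rewrite /symp_form mx4_mul; apply/matrixP => i j; rewrite !mxE.
by case: i => -[|[|[|[|//]]]] ip; case: j => -[|[|[|[|//]]]] jp /=; ring.
Qed.
Lemma unitJ : J \in unitmx.
Proof. by have : J *m (- J) = 1%:M by [rewrite mulmxN JJ opprK]; case/mulmx1_unit. Qed.
Lemma symplectic_tr (M : 'M[C]_4) : symplectic M -> J *m M^T = invmx M *m J.
Proof.
move=> sM; rewrite -[X in _ = _ *m X]sM !mulmxA mulVmx ?mul1mx //; exact: symplectic_unit.
Qed.
End Skew.

Section Splitting.
Variable C : numClosedFieldType.
Local Notation vec := 'rV[C]_4.
Implicit Types (A B : 'M[C]_4) (x y v : vec) (c d p : 'cV[C]_4).

Lemma lf_mul c M v : lf c (v *m M) = lf (M *m c) v. Proof. by rewrite /lf mulmxA. Qed.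
Lemma lfDc c d v : lf (c + d) v = lf c v + lf d v. Proof. by rewrite /lf mulmxDr mxE. Qed.
Lemma lfNc c v : lf (- c) v = - lf c v. Proof. by rewrite /lf mulmxN mxE. Qed.
Lemma lfZc a c v : lf (a *: c) v = a * lf c v. Proof. by rewrite /lf -scalemxAr mxE. Qed.
Lemma lf0 v : lf 0 v = 0 :> C. Proof. by rewrite /lf mulmx0 mxE. Qed.
Lemma lf_eq0 c : (forall v, lf c v = 0) -> c = 0.
Proof. by move=> h; apply/eqP/negPn/negP => /lf_neq0[v]; rewrite h eqxx. Qed.
Lemma lf_normal c : c != 0 -> exists z, lf c z = 1.
Proof. by move=> /lf_neq0[z cz]; exists ((lf c z)^-1 *: z); rewrite lfZ mulVf. Qed.

Lemma polar_form A o : exists c, forall v, lf c v = bil A o v + bil A v o.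
Proof.
exists (A^T *m o^T + A *m o^T) => v; rewrite /lf mulmxDr mxE !mulmxA; congr (_ + _).
have -> : v *m A^T *m o^T = (o *m A *m v^T)^T by rewrite !trmx_mul trmxK mulmxA.
by rewrite mxE.
Qed.
Lemma reducible_quadric A c : c != 0 -> (forall x, lf c x = 0 -> qf A x = 0) ->
  exists d, forall x, qf A x = lf c x * lf d x.
Proof.
move=> /lf_normal[z cz] h; have [e eE] := polar_form A z; exists (e - qf A z *: c) => x.
have : qf A (x + (- lf c x) *: z) = 0 by apply: h; rewrite !formE cz; ring.
rewrite lfDc lfNc lfZc eE /qf !formE => h0; apply/eqP; rewrite -subr_eq0 -h0; apply/eqP.
ring.
Qed.
Lemma lf_cases c p d : c != 0 -> (forall v, lf c v = 0 -> lf p v * lf d v = 0) ->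
  (exists s, p = s *: c) \/ (exists s, d = s *: c).
Proof.
move=> /lf_normal[z cz] h.
have pr v (r : 'cV[C]_4) : lf (r - lf r z *: c) v = lf r (v + (- lf c v) *: z).
  by rewrite !formE lfDc lfNc lfZc; ring.
have [v|e|e] := linewise_integral (@linewise_lf _ (p - lf p z *: c)) (@linewise_lf _ (d - lf d z *: c)).
- by rewrite !pr; apply: h; rewrite !formE cz; ring.
- by left; exists (lf p z); apply/eqP; rewrite -subr_eq0; apply/eqP/lf_eq0.
by right; exists (lf d z); apply/eqP; rewrite -subr_eq0; apply/eqP/lf_eq0.
Qed.

Lemma bil_mx k A (W : 'M[C]_(k, 4)) i j : (W *m A *m W^T) i j = bil A (row i W) (row j W).
Proof.
rewrite /bil !mxE; apply: eq_bigr => s _; rewrite !mxE; congr (_ * _).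
by apply: eq_bigr => t _; rewrite mxE.
Qed.

(** Two orthogonal anisotropic vectors are split off; an anisotropic third one orthogonal to both
    would give the polar form rank 3. What remains is a combination of two squares, which factors
    over an algebraically closed field. *)
Lemma quadric_rank2 A : (\rank (A + A^T)%R <= 2)%N ->
  exists c d, forall v, qf A v = lf c v * lf d v.
Proof.
move=> rT.
have bT x y : bil (A + A^T) x y = bil A x y + bil A y x.
  rewrite /bil mulmxDr mulmxDl mxE; congr (_ + _).
  have -> : x *m A^T *m y^T = (y *m A *m x^T)^T by rewrite !trmx_mul trmxK mulmxA.
  by rewrite mxE.
have [h|/existsNP[x /eqP Qx]] := pselect (forall v, qf A v = 0).
  by exists 0, 0 => v; rewrite lf0 mul0r.
have [c1 c1E] := polar_form A x.
have c1x : lf c1 x = 2%:R * qf A x by rewrite c1E /qf; ring.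
have c10 : c1 != 0.
  by apply: contraNneq Qx => e; have := c1x; rewrite e lf0 => /esym/eqP; rewrite mulf_eq0 pnatr_eq0.
have [h|/existsNP[y /not_implyP[c1y /eqP Qy]]] := pselect (forall v, lf c1 v = 0 -> qf A v = 0).
  by have [d dE] := reducible_quadric c10 h; exists c1, d.
have [c2 c2E] := polar_form A y.
have two0 : (2%:R : C) != 0 by rewrite pnatr_eq0.
pose al v := lf c1 v / (2%:R * qf A x); pose be v := lf c2 v / (2%:R * qf A y).
have rest v : qf A (v + (- al v) *: x + (- be v) *: y) = 0.
  set r := v + _ + _.
  have rx : bil A x r + bil A r x = 0.
    have c2x : bil A y x + bil A x y = 0 by rewrite addrC -c1E.
    rewrite -c1E /r !formE c1x c1y /al; field; rewrite ?Qx ?two0 //.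
  have ry : bil A y r + bil A r y = 0.
    have c2y : lf c2 y = 2%:R * qf A y by rewrite c2E /qf; ring.
    have c2x : lf c2 x = 0 by rewrite c2E addrC -c1E.
    by rewrite -c2E /r !formE c2x c2y /be; field; rewrite ?Qy ?two0.
  apply/eqP/negPn/negP => Qr.
  have xy : bil A x y + bil A y x = 0 by rewrite -c1E.
  have yx : bil A y x + bil A x y = 0 by rewrite addrC.
  have xr : bil A r x + bil A x r = 0 by rewrite addrC.
  have yr : bil A r y + bil A y r = 0 by rewrite addrC.
  pose W : 'M[C]_(3, 4) := \matrix_(i < 3) nth 0 [:: x; y; r] i.
  pose D : 'rV[C]_3 := \row_i (2%:R * nth 0 [:: qf A x; qf A y; qf A r] i).
  have WT : W *m (A + A^T) *m W^T = diag_mx D.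
    apply/matrixP => i j; rewrite bil_mx bT !rowK !mxE.
    have [->|] := eqVneq i j.
      by rewrite mulr1n; case: j => -[|[|[|//]]] jp /=; rewrite /qf; ring.
    rewrite mulr0n; case: i => -[|[|[|//]]] ip; case: j => -[|[|[|//]]] jp //= _.
  have : (\rank (diag_mx D) <= 2)%N.
    by rewrite -WT (leq_trans (mxrankM_maxl _ _)) // (leq_trans (mxrankM_maxr _ _)).
  rewrite mxrank_unit // unitmxE det_diag unitfE; apply/prodf_neq0 => i _; rewrite mxE mulf_neq0 //.
  by case: i => -[|[|[|//]]] ip.
have Qv v : qf A v = al v * al v * qf A x + be v * be v * qf A y.
  have := rest v; rewrite /qf !formE => h0.
  have c12 : bil A x y + bil A y x = 0 by rewrite -c1E.
  have e1 : bil A x v + bil A v x = 2%:R * al v * qf A x by rewrite -c1E /al; field.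
  have e2 : bil A y v + bil A v y = 2%:R * be v * qf A y by rewrite -c2E /be; field.
  rewrite /qf in e1 e2.
  transitivity (0 + al v * (bil A x v + bil A v x) + be v * (bil A y v + bil A v y)
     - al v * be v * (bil A x y + bil A y x) - al v * al v * bil A x x - be v * be v * bil A y y).
    by rewrite -h0; ring.
  by rewrite c12 e1 e2; ring.
pose t := sqrtC (- (qf A y / qf A x)).
have t2 : t * t = - (qf A y / qf A x) by rewrite -expr2 sqrtCK.
exists (qf A x *: ((2%:R * qf A x)^-1 *: c1 - t *: ((2%:R * qf A y)^-1 *: c2))),
  ((2%:R * qf A x)^-1 *: c1 + t *: ((2%:R * qf A y)^-1 *: c2)) => v.
rewrite Qv !(lfZc, lfDc, lfNc) [_^-1 * lf c1 v]mulrC [_^-1 * lf c2 v]mulrC -/(al v) -/(be v).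
transitivity (qf A x * (al v * al v - t * t * (be v * be v))); last by ring.
by rewrite t2; field.
Qed.
End Splitting.

Section General.
Variables (C : numClosedFieldType) (q : C) (l n : nat).
Hypotheses (l_odd : odd l) (l_gt1 : (1 < l)%N) (q_prim : l.-primitive_root q).
Variable M : 'M[C]_4.
Hypothesis RM : Realized q l n M.
Local Notation J := (symp_form C).
Local Notation vec := 'rV[C]_4.
Implicit Types (v w x y : vec).
Let sM := Realized_symplectic RM.
Let uM := symplectic_unit sM.

(** [v] and [v M] span an isotropic plane, and a normalized basis of it provides the first two rows
    of some [upper]. Conjugation by it produces the zeros required by [Realized_dvd4]; the
    conditions on the first coordinate of [v M] and on [v M, v M M] keep the conjugate in the big
    cell. *)
Lemma dvd4_vector v : om (v *m M) v = 0 -> v 0 0 != 0 -> (v *m M) 0 0 != 0 ->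
  wedge12 v (v *m M) != 0 -> wedge12 (v *m M) (v *m M *m M) != 0 ->
  om (v *m M *m M) v != 0 -> (l ^ 4 %| n.+1)%N.
Proof.
have wZ (a : C) x y : wedge12 (a *: x) (a *: y) = a * a * wedge12 x y by rewrite /wedge12 !mxE; ring.
have Z0 (a : C) (x : vec) : (a *: x) 0 0 = a * x 0 0 by rewrite mxE.
move=> Sv v0; wlog v1 : v Sv v0 / v 0 0 = 1 => [hw h1 h2 h3 h4|].
  have i0 : (v 0 0)^-1 != 0 by rewrite invr_eq0.
  apply: (hw ((v 0 0)^-1 *: v)); rewrite -?scalemxAl ?wZ ?omZl ?omZr ?Z0 ?mulf_neq0 ?mulVf ?oner_neq0 //.
  by rewrite Sv !mulr0.
clear v0; have [vM vME] : exists vM, vM = v *m M by exists (v *m M).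
rewrite -!vME in Sv *; set W := wedge12 v vM; set c := vM 0 0 => c0 W0 W1 o0.
pose w : vec := W^-1 *: (vM - c *: v).
have w0 : w 0 0 = 0 by rewrite !mxE v1 mulr1 /c subrr mulr0.
have w1 : w 0 1 = 1.
  rewrite mxE; have -> : (vM - c *: v) 0 1 = W by rewrite !mxE /W /wedge12 v1 /c; ring.
  by rewrite mulVf.
have ow : om vM w = 0 by rewrite /w !omB omxx Sv; ring.
have ovw : om v w = 0 by rewrite /w !omB omxx omC Sv; ring.
pose z := v 0 1; pose y := w 0 3%:R; pose r := w 0 2%:R; pose x := v 0 3%:R - z * y.
have e0 : row 0 (upper z x y r) = v.
  apply: row4P; rewrite [LHS]mxE [LHS]mxE /= //; last by rewrite /x; ring.
  apply/eqP; rewrite -subr_eq0; apply/eqP; rewrite -[RHS]ovw /om v1 w0 w1 /z /y /r; ring.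
have e1 : row 1 (upper z x y r) = w by apply: row4P; rewrite [LHS]mxE [LHS]mxE.
have wM : w *m M = W^-1 *: (vM *m M - c *: vM) by rewrite /w -scalemxAl mulmxBl -scalemxAl -vME.
have [m1 m2] := Realized_lead RM.
have t0 : twist M z x y r 0 0 = c /\ twist M z x y r 0 1 = vM 0 1 - z * c.
  by rewrite !twist_entry e0 -vME; have [-> -> _ _] := upper_inv_entries vM z x y r.
have t1 : minor2 (twist M z x y r) 0 1 = W^-1 * wedge12 vM (vM *m M).
  by rewrite twist_minor2 e0 e1 wM -vME; move: (vM *m M) => u; rewrite /wedge12 !mxE; ring.
have RT : Realized q l n (twist M z x y r).
  apply: (Realized_twist l_odd l_gt1 q_prim RM m1 m2); first by rewrite t0.1.
  by rewrite t1 mulf_neq0 ?invr_eq0.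
have [T02 T03 T12 _] := twist_entries M z x y r; rewrite e0 e1 -vME in T02 T03 T12.
apply: (Realized_dvd4 l_odd l_gt1 q_prim RT).
- by rewrite T02 ow oppr0.
- by rewrite T03 Sv oppr0.
- rewrite t0.2; have -> : vM 0 1 - z * c = W by rewrite /W /wedge12 v1 /z /c; ring.
  by [].
have o1 : om (vM *m M) vM = 0 by rewrite {1 2}vME (om_mulmx (v *m M) v sM) -vME.
have o2 : om (w *m M) w = - (W^-1 * W^-1 * c * om (vM *m M) v).
  by rewrite wM /w !omB o1 omxx Sv; ring.
by rewrite T12 o2 opprK !mulf_neq0 ?invr_eq0.
Qed.

Definition E2 : 'M[C]_4 := mx_of_rows [:: [:: 0; 1; 0; 0]; [:: -1; 0; 0; 0]; [:: 0; 0; 0; 0]; [:: 0; 0; 0; 0]].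
Lemma bilE (A : 'M[C]_4) x y : bil A x y = \sum_i (x *m A) 0 i * y 0 i.
Proof. by rewrite /bil mxE; apply: eq_bigr => i _; rewrite [y^T _ _]mxE. Qed.
Lemma wedge12E x y : wedge12 x y = bil E2 x y.
Proof. by rewrite bilE sum4 !mulmx_entries !mxE /= /wedge12; ring. Qed.
Lemma bil_mulr (A B : 'M[C]_4) x y : bil A x (y *m B) = bil (A *m B^T) x y.
Proof. by rewrite /bil trmx_mul !mulmxA. Qed.
Lemma bil_mull (A B : 'M[C]_4) x y : bil A (x *m B) y = bil (B *m A) x y.
Proof. by rewrite /bil !mulmxA. Qed.
Lemma om_bil x y : om x y = bil J x y. Proof. by rewrite omE. Qed.
Lemma qfB (A B : 'M[C]_4) k v : qf (A - k *: B) v = qf A v - k * qf B v.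
Proof. by rewrite /qf /bil mulmxBr mulmxBl -scalemxAr -scalemxAl !mxE. Qed.
Lemma SE v : om (v *m M) v = qf (M *m J) v. Proof. by rewrite om_bil bil_mull. Qed.

(** The hypothesis makes [M] self-adjoint for the skew form [E2 + k J]. If [k] is nonzero this form
    is nondegenerate and [(M - a) (E2 + k J)] is skew and singular. If [k = 0], comparison of
    entries shows that the first two columns of [M - M 0 0] vanish. *)
Lemma selfadjoint_rank2 k : (forall v, qf (E2 *m M^T) v = k * qf (M *m J) v) ->
  (exists a, (\rank (M - a%:M)%R < 4)%N) -> exists a, (\rank (M - a%:M)%R <= 2)%N.
Proof.
move=> h [a ra].
have sN : skew (E2 *m M^T - k *: (M *m J)) by apply: qf_eq0 => v; rewrite qfB h subrr.
have E2T : E2^T = - E2 by apply/matrixP => i j; case: (ord4P i) => ->; case: (ord4P j) => ->; rewrite !mxE /= ?opprK ?oppr0.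
have := trmx_skew sN; rewrite linearB linearZ /= !trmx_mul trmxK E2T JT.
pose be := E2 + k *: J; rewrite mulmxN mulNmx => eq.
have bM : be *m M^T = M *m be.
  rewrite /be mulmxDl mulmxDr -scalemxAl -scalemxAr; move: eq.
  move: (E2 *m M^T) (J *m M^T) (M *m E2) (M *m J) => X1 X2 X3 X4 /matrixP eq.
  apply/matrixP => i j; have := eq i j; rewrite !mxE => h'.
  apply/eqP; rewrite -subr_eq0; apply/eqP.
  transitivity ((- X3 i j - k * - X2 i j) - (- (X1 i j - k * X4 i j))); [ring | by rewrite h' subrr].
have beT : be^T = - be by rewrite /be linearD linearZ /= E2T JT scalerN opprD.
have [k0|k0] := eqVneq k 0.
  have ent i j : E2 i 0 * M j 0 + E2 i 1 * M j 1 + E2 i 2%:R * M j 2%:R + E2 i 3%:R * M j 3%:R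
    = M i 0 * E2 0 j + M i 1 * E2 1 j + M i 2%:R * E2 2%:R j + M i 3%:R * E2 3%:R j.
    have /matrixP/(_ i j) := bM; rewrite /be k0 scale0r addr0 [LHS]mxE [RHS]mxE !sum4 => <-.
    by rewrite ![M^T _ _]mxE.
  have two (x : C) : x = - x -> x = 0.
    by move=> /eqP; rewrite -addr_eq0 -mulr2n mulrn_eq0 => /eqP.
  have := ent 0 0; have := ent 0 1; have := ent 0 2%:R; have := ent 0 3%:R.
  have := ent 1 1; have := ent 1 2%:R; have := ent 1 3%:R.
  rewrite !mxE /= !(subr0, sub0r, mul0r, mulr0, addr0, add0r, mul1r, mulr1, mulN1r, mulrN1).
  move=> h13 h12 h11 h03 h02 h01 h00.
  exists (M 0 0); have /mulmx0_rank_max : (M - (M 0 0)%:M) *m (pid_mx 2 : 'M[C]_(4, 2)) = 0.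
    have c0 i : (M - (M 0 0)%:M) i 0 = 0.
      case: (ord4P i) => ->; rewrite !mxE /= ?mulr1n ?mulr0n ?subrr ?subr0 //.
      - exact: two (esym h11).
      - by apply/eqP; rewrite -oppr_eq0 h12.
      - by apply/eqP; rewrite -oppr_eq0 h13.
    have c1 i : (M - (M 0 0)%:M) i 1 = 0.
      case: (ord4P i) => ->; rewrite !mxE /= ?mulr1n ?mulr0n ?subrr ?subr0 //.
      - exact: two.
      - by rewrite h01 subrr.
    apply/matrixP => i j; rewrite mxE sum4 c0 c1 [in RHS]mxE !mul0r !mxE /=.
    by case: j => -[|[|//]] jp /=; rewrite ?mulr0 ?addr0.
  by rewrite rank_pid_mx // -[X in (_ <= X)%N]/(2 + 2)%N leq_add2r.
exists a.
have ube : be \in unitmx.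
  apply: skew_unit; first exact: skew_trmx.
  have -> : pf be = k * k by rewrite /pf /be !mxE /=; ring.
  by rewrite mulf_neq0.
have sN2 : skew ((M - a%:M) *m be).
  apply: skew_trmx; rewrite trmx_mul beT linearB /= tr_scalar_mx mulNmx mulmxBr mulmxBl bM.
  by rewrite mul_mx_scalar mul_scalar_mx.
have := skew_singular sN2; rewrite mxrankMfree ?row_free_unit // => hs.
exact: hs ra.
Qed.

Lemma trMJ : (M *m J)^T = - (invmx M *m J).
Proof. by rewrite trmx_mul JT mulNmx symplectic_tr. Qed.
Lemma trMiJ : (invmx M *m J)^T = - (M *m J).
Proof. by rewrite -symplectic_tr // trmx_mul trmxK JT mulmxN. Qed.

(** The adjoint of [M] for [J] is its inverse, so [M + M^-1] is self-adjoint. *)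
Lemma skew_trace k : skew ((M + invmx M - k%:M) *m J).
Proof.
apply: skew_trmx; rewrite mulmxBl mulmxDl mul_scalar_mx linearB linearD linearZ /= trMJ trMiJ JT scalerN.
move: (M *m J) (invmx M *m J) (k *: J) => X Y Z; apply/matrixP => i j; rewrite !mxE; ring.
Qed.
(** [M] is annihilated by [(M - a) (M - (k - a))] with [a] a root of [T^2 - k T + 1], and one of the
    two factors has rank at most 2. *)
Lemma quadratic_equation k : M + invmx M = k%:M -> exists a, (\rank (M - a%:M)%R <= 2)%N.
Proof.
move=> e; pose s := sqrtC (k ^+ 2 - 4%:R); have s2 : s ^+ 2 = k ^+ 2 - 4%:R by rewrite sqrtCK.
pose a := (k + s) / 2%:R.
have ab : a * (k - a) = 1.
  have -> : a * (k - a) = (k ^+ 2 - s ^+ 2) / 4%:R by rewrite /a; field.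
  by rewrite s2 opprB addrC subrK divff // pnatr_eq0.
have /mulmx0_rank_max : (M - a%:M) *m (M - (k - a)%:M) = 0.
  have M2 : M *m M + 1%:M = k *: M by rewrite -(mulmxV uM) -mulmxDr e mul_mx_scalar.
  rewrite mulmxBr !mulmxBl !mul_mx_scalar mul_scalar_mx -[a%:M]scalemx1 scalerA [_ * a]mulrC ab scale1r.
  apply/eqP; rewrite scalerBl -M2; move: (M *m M) (1%:M) => X Y; apply/eqP/matrixP => i j; rewrite !mxE; ring.
move=> rr; case: (leqP (\rank (M - a%:M)) 2) => [h|h]; first by exists a.
exists (k - a); rewrite leqNgt; apply/negP => h'; by have := leq_trans (leq_add h h') rr.
Qed.

(** The hypothesis yields [(M - M^-1) (M + M^-1 - k) = 0]. If the first factor has rank at least 3,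
    the second has rank at most 1; being skew after multiplication by [J], it is zero. *)
Lemma trace_rank2 k : (forall v, qf (M *m M *m J) v = k * qf (M *m J) v) ->
  (exists a, (\rank (M - a%:M)%R <= 2)%N) \/ (\rank (M - invmx M)%R <= 2)%N.
Proof.
move=> h; have sN : skew (M *m M *m J - k *: (M *m J)) by apply: qf_eq0 => v; rewrite qfB h subrr.
case: (leqP (\rank (M - invmx M)) 2) => [|r3]; first by right.
left; apply: (@quadratic_equation k).
have eq : M *m M - k *: M = invmx M *m invmx M - k *: invmx M.
  have := trmx_skew sN; rewrite linearB linearZ /= trMJ -mulmxA trmx_mul trMJ mulNmx -mulmxA symplectic_tr //.
  rewrite scalerN opprK => eq; have {}eq : (M *m M - k *: M) *m J = (invmx M *m invmx M - k *: invmx M) *m J.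
    rewrite !mulmxBl -!scalemxAl -!mulmxA; move: eq; rewrite -?mulmxA opprB.
    move: (invmx M *m J) (M *m J) (invmx M *m (invmx M *m J)) (M *m (M *m J)) => X2 X4 X1 X3 /matrixP eq.
    apply/matrixP => i j; have := eq i j; rewrite !mxE => h'.
    apply/eqP; rewrite -subr_eq0; apply/eqP; transitivity ((- X1 i j + k * X2 i j) - (k * X4 i j - X3 i j)); [ring|].
    by rewrite h' subrr.
  by have := congr1 (fun X => X *m invmx J) eq; rewrite !mulmxK ?unitJ.
have /mulmx0_rank_max rY : (M - invmx M) *m (M + invmx M - k%:M) = 0.
  rewrite mulmxBr mulmxDr !mulmxBl mulmxV // mulVmx // !mul_mx_scalar.
  move: eq; move: (1%:M) (invmx M) (invmx M *m invmx M) (M *m M) => X4 X3 X2 X1 /matrixP eq.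
  apply/matrixP => i j; have := eq i j; rewrite !mxE => h'.
  apply/eqP; rewrite -subr_eq0; apply/eqP; transitivity ((X1 i j - k * M i j) - (X2 i j - k * X3 i j)); [ring|].
  by rewrite h' subrr.
have := skew_rank1 (skew_trace k); rewrite mxrankMfree ?row_free_unit ?unitJ // => Y0.
have {}Y0 : (M + invmx M - k%:M) *m J = 0 by apply: Y0; rewrite leqNgt; apply/negP => h'; have := leq_trans (leq_add r3 h') rY.
apply/eqP; rewrite -subr_eq0 -[_ - _](mulmxK (unitJ C)) Y0 mul0mx //.
Qed.

(** [(M - M^-1) J] is the symmetrization of [M J], that is, the polar form of the quadric. *)
Lemma polar_product c d : (forall v, qf (M *m J) v = lf c v * lf d v) ->
  (M - invmx M) *m J = row_mx c d *m col_mx d^T c^T.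
Proof.
move=> dE; have sN : skew (M *m J - 1 *: (c *m d^T)).
  apply: qf_eq0 => v; rewrite qfB mul1r dE.
  have -> : qf (c *m d^T) v = lf c v * lf d v; last by rewrite subrr.
  rewrite /qf /bil mulmxA -mulmxA mxE big_ord1 /lf; congr (_ * _).
  by rewrite -trmx_mul mxE.
have := trmx_skew sN; rewrite scale1r linearB /= trMJ trmx_mul trmxK => eq.
rewrite mul_row_col mulmxBl; move: eq; move: (M *m J) (invmx M *m J) (c *m d^T) (d *m c^T) => X1 X2 X3 X4 /matrixP eq.
apply/matrixP => i j; have := eq i j; rewrite !mxE => h'.
apply/eqP; rewrite -subr_eq0; apply/eqP; transitivity ((- X2 i j - X4 i j) - (- (X1 i j - X3 i j))); [ring|].
by rewrite h' subrr.
Qed.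

(** On an irreducible quadric [om (v M) v = 0] the open conditions of [dvd4_vector] are tested along
    the parametrization. If one fails identically, its quadratic form is proportional to that of the
    quadric and a preceding lemma applies. A reducible quadric has a polar form of rank at most
    2. *)
Theorem not_dvd4_general : (exists a, (\rank (M - a%:M)%R < 4)%N) -> ~~ (l ^ 4 %| n.+1)%N ->
  (exists a, (\rank (M - a%:M)%R <= 2)%N) \/ (\rank (M - invmx M)%R <= 2)%N.
Proof.
move=> ra nd; have [irr|nirr] := pselect (irreducible_quadric (M *m J)); last first.
  right; move: nirr; rewrite /irreducible_quadric => /existsNP[c /not_implyP[c0 hc]].
  have [|d dE] := @reducible_quadric _ (M *m J) c c0.
    by move=> x cx; apply/eqP/negPn/negP => Qx; apply: hc; exists x.
  have eq := polar_product dE.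
  rewrite -(@mxrankMfree _ _ _ _ (M - invmx M) J) ?row_free_unit ?unitJ // eq.
  by rewrite (leq_trans (mxrankM_maxl _ _)) // rank_leq_col.
have [psi [psi0 psil psic psiq]] := quadric_parametrization irr.
have lc c : linewise (fun x => lf c (psi x)).
  apply: linewise_ext (linewise_mulmx (A := psi) (B := fun=> c) _ _ 0 0) => // [i j|i j]; last exact: linewise_const.
  by rewrite (ord1 i).
have lq A : linewise (fun x => qf A (psi x)).
  apply: linewise_ext (linewise_mulmx (A := fun x => psi x *m A) (B := fun x => (psi x)^T) _ _ 0 0) => // i j.
    by apply: linewise_mulmx => [i' j'|i' j']; [rewrite (ord1 i') | exact: linewise_const].
  by apply: linewise_ext (psil i) => x; rewrite [in RHS]mxE (ord1 j).
pose f0 x := lf (delta_mx 0 0) (psi x); pose f1 x := lf (M *m delta_mx 0 0) (psi x).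
pose f2 x := qf (E2 *m M^T) (psi x); pose f3 x := qf (M *m E2 *m M^T *m M^T) (psi x).
pose f4 x := qf (M *m M *m J) (psi x).
have l34 := linewise_mul (lq (M *m E2 *m M^T *m M^T)) (lq (M *m M *m J)).
have l24 := linewise_mul (lq (E2 *m M^T)) l34.
have l14 := linewise_mul (lc (M *m delta_mx 0 0)) l24.
have lfe (v : vec) : lf (delta_mx 0 0) v = v 0 0 by rewrite /lf -colE mxE.
have [x|h|h] := linewise_integral (lc (delta_mx 0 0)) l14.
- apply/eqP/negPn; rewrite !mulf_eq0 !negb_or; apply/negP => /and5P[k0 k1 k2 k3 k4]; case/negP: nd.
  apply: (@dvd4_vector (psi x)).
  + by rewrite SE.
  + by rewrite -lfe.
  + by rewrite -lfe lf_mul.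
  + by rewrite wedge12E bil_mulr.
  + by rewrite wedge12E bil_mulr bil_mull bil_mulr !mulmxA.
  + by rewrite om_bil !bil_mull mulmxA.
- have [|x] := psic (delta_mx 0 0); last by rewrite h eqxx.
  by apply/eqP => /matrixP/(_ 0 0)/eqP; rewrite !mxE oner_eq0.
have [h1|{}h] := linewise_integral (lc (M *m delta_mx 0 0)) l24 h.
  have [|x] := psic (M *m delta_mx 0 0); last by rewrite h1 eqxx.
  apply/eqP => /matrixP/(_ 0 0)/eqP; rewrite -colE !mxE; apply/negP.
  by have [] := Realized_lead RM.
have [/psiq[k h2]|{}h] := linewise_integral (lq (E2 *m M^T)) l34 h.
  by left; apply: (selfadjoint_rank2 h2 ra).
have [/psiq[k h3]|{}h] := linewise_integral (lq (M *m E2 *m M^T *m M^T)) (lq (M *m M *m J)) h.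
  left; apply: (@selfadjoint_rank2 k) => // v.
  (* Replacing [v] by [v M^-1] turns the condition on [v M, v M M] into the one on [v, v M]. *)
  have := h3 (v *m invmx M); rewrite -!SE mulmxKV // => h3'.
  transitivity (k * om v (v *m invmx M)); last first.
    by rewrite -(om_mulmx v (v *m invmx M) sM) mulmxKV.
  rewrite -h3' /qf -!bil_mulr -[M *m E2]/(M *m E2).
  by rewrite -bil_mull !mulmxKV // bil_mulr.
have [k h4] := psiq _ h.
exact: trace_rank2 h4.
Qed.
End General.

(** * Exchange of positive and negative generators, and the exceptional classes *)

Section Swap.
Variables (C : numClosedFieldType) (q : C) (l n : nat).
Hypotheses (l_odd : odd l) (l_gt1 : (1 < l)%N) (q_prim : l.-primitive_root q).
Local Notation io := (scm C n).

Definition swap_data (d : zdata C) : zdata C :=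
  ZData (zF d) (zG d) (zYf d) (zHf d) (zA d) (zB d) (zYe d) (zHe d) (zc0 d)^-1 (zc1 d)^-1.

Lemma UQ_swap a b yE hE f g yF hF w0 w1 v0 v1 : UQ io q a b yE hE f g yF hF w0 w1 v0 v1 ->
  UQ io q f g yF hF a b yE hE v0 v1 w0 w1.
Proof.
have ioC c x : io c * x = x * io c := scmC c x.
move=> U; split.
- exact: uq_F U.
- exact: uq_E U.
- exact: uq_v0w0 U.
- exact: uq_w0v0 U.
- exact: uq_v1w1 U.
- exact: uq_w1v1 U.
- exact: uq_v1v0 U.
- by have := uq_v0f ioC q_prim U.
- exact: uq_v0g U.
- exact: uq_v1f U.
- by have := uq_v1g ioC q_prim U.
- by have := uq_v0a ioC q_prim U.
- exact: uq_v0b U.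
- exact: uq_v1a U.
- by have := uq_v1b ioC q_prim U.
- by rewrite (uq_af U) -addrA -mulrDr addrA subrK subrr mulr0 addr0.
- by rewrite (uq_bg U) -addrA -mulrDr addrA subrK subrr mulr0 addr0.
- by rewrite (uq_bf U).
by rewrite (uq_ag U).
Qed.

Lemma realizes_swap d : realizes q l n d -> realizes q l n (swap_data d).
Proof.
move=> [a [b [yE [hE [f [g [yF [hF [w0 [w1 [v0 [v1 D]]]]]]]]]]]].
have [U al bl yEl hEl fl gl yFl hFl w0l w1l c00 c10] := D.
have inv (w v : 'M[C]_n.+1) c : w * v = 1 -> v * w = 1 -> c != 0 -> w ^+ l = io c -> v ^+ l = io c^-1.
  move=> wv vw c0 wl; rewrite -[LHS]mul1r -(rmorph1 io) -(mulVf c0) rmorphM -mulrA -wl.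
  by rewrite -exprMn_comm ?wv ?expr1n ?mulr1 // /GRing.comm wv vw.
exists f, g, yF, hF, a, b, yE, hE, v0, v1, w0, w1; split=> //=; first exact: UQ_swap.
- exact: inv (uq_w0v0 U) (uq_v0w0 U) c00 w0l.
- exact: inv (uq_w1v1 U) (uq_v1w1 U) c10 w1l.
- by rewrite invr_eq0.
by rewrite invr_eq0.
Qed.
End Swap.

Section SwapPhi.
Variable C : numClosedFieldType.
Notation mx4 a11 a12 a13 a14 a21 a22 a23 a24 a31 a32 a33 a34 a41 a42 a43 a44 :=
  (mx_of_rows [:: [:: a11; a12; a13; a14]; [:: a21; a22; a23; a24];
                  [:: a31; a32; a33; a34]; [:: a41; a42; a43; a44]]).
Lemma mx4_tr (a11 a12 a13 a14 a21 a22 a23 a24 a31 a32 a33 a34 a41 a42 a43 a44 : C) :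
  (mx4 a11 a12 a13 a14 a21 a22 a23 a24 a31 a32 a33 a34 a41 a42 a43 a44)^T =
  mx4 a11 a21 a31 a41 a12 a22 a32 a42 a13 a23 a33 a43 a14 a24 a34 a44.
Proof.
by apply/matrixP => i j; rewrite !mxE; case: i => -[|[|[|[|]]]] //= ?; case: j => -[|[|[|[|]]]].
Qed.

Definition swap_diag (c0 c1 : C) : 'M[C]_4 :=
  let al := - (c0 ^+ 2 / c1) in let be := - (c1 ^+ 2 / c0 ^+ 2) in
  diag4 (al ^+ 2 * be) (al * be) al 1.
Definition swap_mx (d : zdata C) : 'M[C]_4 :=
  swap_diag (zc0 d) (zc1 d) *m (unip_minus (zF d) (zYf d) (zHf d) (zG d))^T.

(** On matrices the exchange is thus the inverse transpose, up to conjugation by [swap_mx d]. That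
    matrix preserves the line of the first basis column, so conditions on this column can be carried
    over. *)
Lemma phi_swap d : zc0 d != 0 -> zc1 d != 0 ->
  phi (swap_data d) *m swap_mx d *m (phi d)^T = swap_mx d.
Proof.
case: d => A B Ye He F G Yf Hf c0 c1 /= h0 h1.
rewrite /swap_mx /phi /= !trmx_mul.
set L := unip_minus F Yf Hf G; set T := swap_diag c0 c1.
set L' := unip_minus A Ye He B.
set D' := diag4 _ _ _ _; set D := diag4 _ _ _ _.
set U' := unip_plus _ _ _ _; set U := unip_plus _ _ _ _.
have e1 : U' *m T *m L^T = T.
  rewrite /U' /T /L /swap_diag /unip_minus /unip_plus /diag4 mx4_tr.
  do ?[rewrite mx4_mul !(mul0r, mulr0, add0r, addr0, mul1r, mulr1)].
  congr (mx4 _ _ _ _ _ _ _ _ _ _ _ _ _ _ _ _); field; rewrite ?h0 ?h1 //.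
have e2 : L' *m D' *m T *m U^T *m D^T = T.
  rewrite /L' /D' /T /U /D /swap_diag /unip_minus /unip_plus /diag4 !mx4_tr.
  do ?[rewrite mx4_mul !(mul0r, mulr0, add0r, addr0, mul1r, mulr1)].
  congr (mx4 _ _ _ _ _ _ _ _ _ _ _ _ _ _ _ _); field; rewrite ?h0 ?h1 //.
transitivity (L' *m D' *m (U' *m T *m L^T) *m U^T *m D^T *m L^T); first by rewrite !mulmxA.
by rewrite e1 e2.
Qed.

Lemma swap_mx_unit d : zc0 d != 0 -> zc1 d != 0 -> swap_mx d \in unitmx /\
  exists2 t : C, t != 0 & swap_mx d *m delta_mx 0 0 = t *: (delta_mx 0 0 : 'cV[C]_4).
Proof.
move=> h0 h1; set al := - (zc0 d ^+ 2 / zc1 d); set be := - (zc1 d ^+ 2 / zc0 d ^+ 2).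
have a0 : al != 0 by rewrite oppr_eq0 mulf_neq0 ?invr_eq0 ?expf_neq0.
have b0 : be != 0 by rewrite oppr_eq0 mulf_neq0 ?invr_eq0 ?expf_neq0.
split; last first.
  exists (al ^+ 2 * be); first by rewrite !mulf_neq0 ?expf_neq0.
  rewrite /swap_mx /swap_diag /unip_minus /diag4 mx4_tr mx4_mul -colE.
  by apply/matrixP => i j; rewrite (ord1 j) !mxE; case: (ord4P i) => -> /=; rewrite -/al -/be; ring.
have uT : swap_diag (zc0 d) (zc1 d) \in unitmx.
  have : swap_diag (zc0 d) (zc1 d) *m diag4 (al ^+ 2 * be)^-1 (al * be)^-1 al^-1 1 = 1%:M.
    rewrite /swap_diag diag4_mul -/al -/be !mulfV ?mulf_neq0 ?expf_neq0 // mulr1.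
    by apply/matrixP => i j; case: (ord4P i) => ->; case: (ord4P j) => ->; rewrite !mxE.
  by case/mulmx1_unit.
rewrite /swap_mx unitmx_mul uT unitmx_tr unitmxE det_trig; last first.
  apply/is_trig_mxP => i j; case: (ord4P i) => ->; case: (ord4P j) => -> //= _; by rewrite !mxE.
by rewrite (eq_bigr (fun=> 1)) ?big1 ?unitr1 // => i _; case: (ord4P i) => ->; rewrite !mxE.
Qed.
End SwapPhi.

(** The row spaces of [A ^ 2] and [B ^ 2] have dimension at most 2 and span everything, so they meet
    in zero; the rows of [Y ^ 2] lie in both. *)
Lemma square_eq0 (F : fieldType) (A B Y W : 'M[F]_4) : A *m B = Y -> B *m A = Y ->
  A *m Y = Y *m A -> B *m Y = Y *m B -> (\rank (A *m A) <= 2)%N -> (\rank (B *m B) <= 2)%N ->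
  W *m (B *m B - A *m A) = 1%:M -> Y *m Y = 0.
Proof.
move=> AB BA AY BY rA rB W1.
have Y1 : Y *m Y = (B *m B) *m (A *m A) by rewrite -mulmxA [B *m (A *m A)]mulmxA BA mulmxA BY -mulmxA BA.
have Y2 : Y *m Y = (A *m A) *m (B *m B) by rewrite -mulmxA [A *m (B *m B)]mulmxA AB mulmxA AY -mulmxA AB.
have full : (4 <= \rank (A *m A + B *m B)%MS)%N.
  rewrite -[X in (X <= _)%N](mxrank1 F 4); apply: mxrankS.
  have -> : 1%:M = - W *m (A *m A) + W *m (B *m B) by rewrite -W1 mulmxBr mulNmx addrC.
  by apply: addmx_sub_adds; apply: submxMl.
have := mxrank_sum_cap (A *m A) (B *m B) => sc.
have c0 : \rank (A *m A :&: B *m B)%MS = 0%N.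
  apply/eqP; rewrite -leqn0 -(leq_add2l (\rank (A *m A + B *m B)%MS)) sc addn0.
  exact: leq_trans (leq_add rA rB) full.
apply/eqP; rewrite -submx0.
have /eqP <- : (A *m A :&: B *m B)%MS == 0 by rewrite -mxrank_eq0 c0.
by rewrite sub_capmx {1}Y1 submxMl Y2 submxMl.
Qed.

Section Cyclic.
Variables (C : numClosedFieldType) (q : C) (l n : nat).
Hypotheses (l_odd : odd l) (l_gt1 : (1 < l)%N) (q_prim : l.-primitive_root q).
Variable M : 'M[C]_4.
Hypothesis RM : Realized q l n M.
Local Notation J := (symp_form C).
Local Notation vec := 'rV[C]_4.
Implicit Types (v w x y : vec) (c d p g : 'cV[C]_4).
Let sM := Realized_symplectic RM.
Let uM := symplectic_unit sM.
Local Notation Z := (M *m M - 1%:M).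
Hypothesis big_rank : forall a, (2 < \rank (M - a%:M)%R)%N.
Hypothesis rank_Z : (\rank Z <= 2)%N.

Let addsc e : M + e%:M = M - (- e)%:M. Proof. by rewrite raddfN opprK. Qed.
Let factor e : e * e = 1 -> (M - e%:M) *m (M + e%:M) = Z.
Proof.
move=> ee; rewrite mulmxBl mulmxDr mul_mx_scalar mul_scalar_mx scalerDr scale_scalar_mx ee.
by rewrite opprD addrA addrK.
Qed.
Let factor' e : e * e = 1 -> (M + e%:M) *m (M - e%:M) = Z.
Proof. by move=> ee; rewrite -(@factor (- e)) ?mulrNN // raddfN opprK. Qed.
Let commZ : M *m Z = Z *m M. Proof. by rewrite mulmxBr mulmxBl mulmxA mulmx1 mul1mx. Qed.
Let commZe e : (M - e%:M) *m Z = Z *m (M - e%:M).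
Proof. by rewrite [LHS]mulmxBl [RHS]mulmxBr commZ mul_mx_scalar mul_scalar_mx. Qed.
Let one1 : 1 * 1 = 1 :> C. Proof. exact: mulr1. Qed.

Lemma rank_Z_ge2 : (2 <= \rank Z)%N.
Proof.
rewrite -(factor one1); have := mxrank_mul_min (M - 1%:M) (M + 1%:M).
apply: leq_trans; rewrite addsc.
exact: (leq_sub2r 4 (leq_add (big_rank 1) (big_rank (-1)))).
Qed.
Lemma Z_factor_neq0 e : Z *m (M - e%:M) != 0.
Proof.
apply/eqP => /mulmx0_rank_max h.
by have := leq_trans (leq_add rank_Z_ge2 (big_rank e)) h.
Qed.
(** [(M - e) ^ 2 = M (M + M^-1 - 2 e)], and the second factor becomes skew after multiplication by
    [J]; a singular skew matrix has rank at most 2. *)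
Lemma rank_square e : e * e = 1 -> (\rank ((M - e%:M) *m (M - e%:M)) <= 2)%N.
Proof.
move=> ee; have r4 : (\rank (M - e%:M)%R < 4)%N.
  rewrite ltnNge; apply/negP => h4; have u : M - e%:M \in unitmx.
    by rewrite -row_full_unit /row_full eqn_leq rank_leq_col h4.
  have := rank_Z; rewrite -(factor' ee) mxrankMfree ?row_free_unit // addsc leqNgt.
  by rewrite big_rank.
have sq : (M - e%:M) *m (M - e%:M) = M *m (M + invmx M - (2%:R * e)%:M).
  rewrite [LHS]mulmxBr !mulmxBl [RHS]mulmxBr mulmxDr mulmxV // !mul_mx_scalar mul_scalar_mx.
  rewrite scale_scalar_mx ee; move: (1%:M) (M *m M) => I P; apply/matrixP => i j; rewrite !mxE; ring.
have := skew_singular (skew_trace RM (2%:R * e)); rewrite mxrankMfree ?row_free_unit ?unitJ // => hs.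
rewrite sq (leq_trans (mxrankM_maxr _ _)) //; apply: hs.
have -> : M + invmx M - (2%:R * e)%:M = invmx M *m ((M - e%:M) *m (M - e%:M)) by rewrite sq mulKmx.
by rewrite mulmxA; apply: leq_ltn_trans (mxrankM_maxr _ _) r4.
Qed.

(** The squares of [M - 1] and [M + 1] differ by the invertible [4 M], so [square_eq0] applies to
    their product [Z]. *)
Lemma Z_square : Z *m Z = 0.
Proof.
apply: (@square_eq0 _ (M - 1%:M) (M - (-1)%:M) Z (4%:R^-1 *: invmx M)); rewrite ?commZe //.
- by rewrite -addsc factor.
- by rewrite -addsc factor'.
- exact: rank_square.
- by apply: rank_square; rewrite mulrNN.
have -> : (M - (-1)%:M) *m (M - (-1)%:M) - (M - 1%:M) *m (M - 1%:M) = 4%:R *: M.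
  rewrite -addsc !(mulmxDl, mulmxDr, mulNmx, mulmxN, mul1mx, mulmx1).
  by move: (1%:M) (M *m M) => I P; apply/matrixP => i j; rewrite !mxE; ring.
by rewrite -scalemxAl -scalemxAr mulVmx // scalerA mulVf ?scale1r // pnatr_eq0.
Qed.

Lemma lf_cancel c p d : c != 0 -> (forall v, lf c v * lf p v = lf c v * lf d v) -> p = d.
Proof.
move=> c0 h; apply/eqP; rewrite -subr_eq0; apply/eqP.
have [v|e|e] := linewise_integral (@linewise_lf _ c) (@linewise_lf _ (p - d)).
- by rewrite lfDc lfNc mulrBr h subrr.
- by have [v] := lf_neq0 c0; rewrite e eqxx.
exact: lf_eq0.
Qed.
Lemma ker_point c p : c != 0 -> (forall r, p <> r *: c) -> exists2 v, lf c v = 0 & lf p v != 0.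
Proof.
move=> c0 nr; have [h|/existsNP[v /not_implyP[cv /eqP pv]]] := pselect (forall v, lf c v = 0 -> lf p v = 0); last by exists v.
have [|[r e]|[r e]] := @lf_cases _ c p p c0; first by move=> v /h ->; rewrite mul0r.
  by case: (nr r).
by case: (nr r).
Qed.

(** The quadric splits into two hyperplanes, which [M] permutes because it preserves the form. If
    [M] fixed both, [Z ^ 2 = 0] would make their equations eigenvectors for one and the same
    eigenvalue 1 or -1, against [big_rank]; so [M] interchanges them. *)
Lemma special_quadric : exists c s, [/\ s != 0,
  (forall v, qf (M *m J) v = s * (lf c v * lf (M *m c) v)), M *m (M *m c) = c, c != 0 &
  forall r, M *m c <> r *: c].
Proof.
have TZ : invmx M *m Z = M - invmx M by rewrite mulmxBr mulmxA mulVmx // mul1mx mulmx1.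
have rA : (\rank (M *m J + (M *m J)^T)%R <= 2)%N.
  rewrite (trMJ RM) -mulmxBl mxrankMfree ?row_free_unit ?unitJ // -TZ.
  exact: leq_trans (mxrankM_maxr _ _) rank_Z.
have [c [d dE]] := quadric_rank2 rA.
have rcd : (2 <= \rank (row_mx c d))%N.
  have := rank_Z_ge2; have -> : Z = M *m (M - invmx M) by rewrite mulmxBr mulmxV.
  move=> h; have {}h := leq_trans h (mxrankM_maxr _ _).
  rewrite -(@mxrankMfree _ _ _ _ (M - invmx M) J) ?row_free_unit ?unitJ // (polar_product RM dE) in h.
  exact: leq_trans h (mxrankM_maxl _ _).
have ncd r : d <> r *: c.
  move=> e; have E : row_mx c d = c *m row_mx 1%:M r%:M by rewrite mul_mx_row mulmx1 mul_mx_scalar e.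
  have := leq_trans rcd; rewrite E => /(_ _ (mxrankM_maxl _ _)) h.
  by have := leq_trans h (rank_leq_col _).
have ndc r : c <> r *: d.
  move=> e; have E : row_mx c d = d *m row_mx r%:M 1%:M by rewrite mul_mx_row mulmx1 mul_mx_scalar -e.
  have := leq_trans rcd; rewrite E => /(_ _ (mxrankM_maxl _ _)) h.
  by have := leq_trans h (rank_leq_col _).
have c0 : c != 0 by apply/eqP => e; apply: (ndc 0); rewrite scale0r.
have d0 : d != 0 by apply/eqP => e; apply: (ncd 0); rewrite scale0r.
have inv v : lf (M *m c) v * lf (M *m d) v = lf c v * lf d v.
  by rewrite -!lf_mul -!dE -!SE; apply: om_mulmx.
have M0 p : M *m p = 0 -> p = 0 by move=> e; rewrite -[p](mulKmx uM) e mulmx0.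
have [|[r e]|[r e]] := @lf_cases _ c (M *m c) (M *m d) c0.
- by move=> v cv; rewrite inv cv mul0r.
- have rd : r *: (M *m d) = d.
    by apply: (lf_cancel c0) => v; rewrite lfZc -inv e lfZc; ring.
  have Zc : Z *m c = (r * r - 1) *: c.
    by rewrite mulmxBl mul1mx -mulmxA e -scalemxAr e scalerA scalerBl scale1r.
  have : (Z *m Z) *m c = 0 by rewrite Z_square mul0mx.
  rewrite -mulmxA Zc -scalemxAr Zc scalerA => /eqP.
  rewrite scaler_eq0 (negPf c0) orbF mulf_eq0 orbb subr_eq0 => /eqP rr.
  have Md : M *m d = r *: d by rewrite -{2}rd scalerA rr scale1r.
  have /mulmx0_rank_max h : (M - r%:M) *m row_mx c d = 0.
    by rewrite mul_mx_row !mulmxBl !mul_scalar_mx e Md !subrr row_mx0.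
  by have := leq_trans (leq_add (big_rank r) rcd) h.
have dM : d = r *: (M *m c).
  by apply: (lf_cancel c0) => v; rewrite lfZc -inv e lfZc; ring.
have r0 : r != 0 by apply: contraNneq d0 => r0; rewrite dM r0 scale0r.
exists c, r; split=> //.
- by move=> v; rewrite dE dM lfZc; ring.
- by apply: (scalerI r0); rewrite -e dM -scalemxAr.
by move=> t ct; apply: (ncd (r * t)); rewrite dM ct scalerA.
Qed.

Local Notation e0 := (delta_mx 0 0 : 'cV[C]_4).
Local Notation e1 := (delta_mx 1 0 : 'cV[C]_4).
(** Upper unipotent matrices fix the first basis column, so conjugation by them cannot bring this
    about; [special_dvd4] obtains it from the exchange of positive and negative generators. *)
Hypothesis cyc : forall e, e * e = 1 -> Z *m (M - e%:M) *m e0 != 0.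

Let Ze0 : Z *m e0 != 0.
Proof. by apply/eqP => e; have := cyc one1; rewrite -commZe -mulmxA e mulmx0 eqxx. Qed.
Lemma lf_delta_mx (i : 'I_4) v : lf (delta_mx i 0) v = v 0 i.
Proof. by rewrite /lf -colE mxE. Qed.
Lemma wedge_forms v : wedge12 v (v *m M) = lf e0 v * lf (M *m e1) v - lf e1 v * lf (M *m e0) v.
Proof. by rewrite -!lf_mul !lf_delta_mx. Qed.

(** If the minor vanished on the hyperplane of [g], its linear factors would be proportional modulo
    [g]. This makes the first two basis columns proportional, or [M g] a multiple of [g], or
    [Z (M - s)] kill the first column for some [s] with [s ^ 2 = 1]; each is excluded. *)
Lemma wedge_point g : g != 0 -> M *m (M *m g) = g -> (forall r, M *m g <> r *: g) ->
  exists2 v, lf g v = 0 & wedge12 v (v *m M) != 0.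
Proof.
move=> g0 gg ng.
have [h|/existsNP[v /not_implyP[gv /eqP wv]]] := pselect (forall v, lf g v = 0 -> wedge12 v (v *m M) = 0); last by exists v.
have [z gz] := lf_normal g0.
pose pr p := p - lf p z *: g.
have prE p v : lf (pr p) v = lf p (v + (- lf g v) *: z).
  by rewrite /pr lfDc lfNc lfZc !formE; ring.
have H v : lf (pr e0) v * lf (pr (M *m e1)) v = lf (pr e1) v * lf (pr (M *m e0)) v.
  apply/eqP; rewrite -subr_eq0 !prE -wedge_forms; apply/eqP/h.
  by rewrite !formE gz; ring.
have comb p d s : pr p = s *: pr d -> p - s *: d = (lf p z - s * lf d z) *: g.
  rewrite /pr scalerBr scalerA => e; have {}e := congr1 (fun x : 'cV[C]_4 => x + lf p z *: g) e.
  rewrite /= subrK in e; rewrite {1}e scalerBl.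
  by apply/matrixP => i j; rewrite !mxE; ring.
have Zg : Z *m g = 0 by rewrite mulmxBl mul1mx -mulmxA gg subrr.
have pe : pr e0 != 0.
  by apply/eqP => /eqP; rewrite subr_eq0 => /eqP e; case/eqP: Ze0; rewrite e -scalemxAr Zg scaler0.
have [|[s es]|[s es]] := @lf_cases _ (pr e0) (pr e1) (pr (M *m e0)) pe.
- by move=> v ev; rewrite -H ev mul0r.
- have eM : pr (M *m e1) = s *: pr (M *m e0).
    by apply: (lf_cancel pe) => v; rewrite H es !lfZc; ring.
  have := comb _ _ _ eM; have := comb _ _ _ es; set m := (lf e1 z - _); set m' := (lf (M *m e1) z - _) => h1 h2.
  have mm : m *: (M *m g) = m' *: g by rewrite scalemxAr -h1 -h2 mulmxBr -scalemxAr.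
  have [m0|m0] := eqVneq m 0; last first.
    by case: (ng (m^-1 * m')); rewrite -scalerA -mm scalerA mulVf // scale1r.
  move: h1; rewrite m0 scale0r => /matrixP/(_ 1 0)/eqP.
  by rewrite !mxE /= mulr0 subr0 oner_eq0.
have := comb _ _ _ es; set m := (lf (M *m e0) z - _) => h1.
have [w wE] : exists w : 'cV[C]_4, w = Z *m e0 by exists (Z *m e0).
have w1 : M *m w = s *: w.
  rewrite wE mulmxA commZ -mulmxA -[M *m e0](subrK (s *: e0)) h1 mulmxDr -!scalemxAr Zg scaler0 add0r //.
have Zw : Z *m w = 0 by rewrite wE mulmxA Z_square mul0mx.
have w0 : w != 0 by rewrite wE.
move: Zw; rewrite mulmxBl mul1mx -mulmxA w1 -scalemxAr w1 scalerA -{2}[w]scale1r -scalerBl => /eqP.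
rewrite scaler_eq0 (negPf w0) orbF subr_eq0 => /eqP ss.
by have := cyc ss; rewrite -commZe -mulmxA -wE mulmxBl w1 mul_scalar_mx subrr eqxx.
Qed.

(** The quadric is reducible, so a vector for [dvd4_vector] is sought on one of its hyperplanes,
    parametrized by the projection [P]. Each open condition holds at some point there, hence all of
    them hold at a common point. *)
Theorem cyclic_dvd4 : (l ^ 4 %| n.+1)%N.
Proof.
have [c [s [s0 Q cc c0 nc]]] := special_quadric.
have [z cz] := lf_normal c0; pose P v : vec := v + (- lf c v) *: z.
have Pker v : lf c (P v) = 0 by rewrite /P !formE cz; ring.
have Pid v : lf c v = 0 -> P v = v by rewrite /P => ->; rewrite oppr0 scale0r addr0.
have LP (F : vec -> C) : linewise F -> linewise (fun v => F (P v)).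
  move=> lF x d; apply: polyfun_ext (lF (P x) (P d)) => t; congr F.
  by rewrite /P !formE; apply/matrixP => i j; rewrite !mxE; ring.
have NZ (F : vec -> C) : (exists2 v, lf c v = 0 & F v != 0) -> exists v, F (P v) != 0.
  by case=> v cv Fv; exists v; rewrite Pid.
have ll p : linewise (lf p) := @linewise_lf _ p.
have l2 : linewise (fun v => wedge12 v (v *m M)).
  apply: (@linewise_ext _ _ (fun v => lf e0 v * lf (M *m e1) v + - (lf e1 v * lf (M *m e0) v))).
    by move=> v; rewrite wedge_forms.
  by apply: linewise_add; [|apply: linewise_opp]; apply: linewise_mul.
have l3 : linewise (fun v => wedge12 (v *m M) (v *m M *m M)).
  apply: (@linewise_ext _ _ (fun v => lf (M *m e0) v * lf (M *m (M *m e1)) v + - (lf (M *m e1) v * lf (M *m (M *m e0)) v))).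
    by move=> v; rewrite wedge_forms !lf_mul.
  by apply: linewise_add; [|apply: linewise_opp]; apply: linewise_mul.
have pol x y : om (x *m M) y + om (y *m M) x = s * (lf c x * lf (M *m c) y + lf c y * lf (M *m c) x).
  have h := Q (x + y); have hx := Q x; have hy := Q y.
  rewrite -!SE in h hx hy; rewrite mulmxDl !omB !formE hx hy in h.
  move/eqP: h; rewrite -subr_eq0 => /eqP h; apply/eqP; rewrite -subr_eq0; apply/eqP/(lin_comb1 (a := 1) h).
  by ring.
have F4E v : om (v *m M *m M) v = s * (lf (M *m c) v * lf (M *m c) v + lf c v * lf c v).
  by have := pol (v *m M) v; rewrite omxx addr0 !lf_mul cc.
have l4 : linewise (fun v => om (v *m M *m M) v).
  apply: (@linewise_ext _ _ (fun v => s * (lf (M *m c) v * lf (M *m c) v + lf c v * lf c v))).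
    by move=> v; rewrite F4E.
  by apply: linewise_mul; [exact: linewise_const | apply: linewise_add; apply: linewise_mul].
have Zc : Z *m c = 0 by rewrite mulmxBl mul1mx -mulmxA cc subrr.
have n0 : exists v, lf e0 (P v) != 0.
  apply: NZ; apply: ker_point => // r e; case/eqP: Ze0.
  by rewrite e -scalemxAr Zc scaler0.
have n1 : exists v, lf (M *m e0) (P v) != 0.
  apply: NZ; apply: ker_point => // r e; case/eqP: Ze0.
  by rewrite -[LHS](mulKmx uM) [M *m (Z *m _)]mulmxA commZ -[Z *m M *m _]mulmxA e -scalemxAr Zc scaler0 mulmx0.
have n2 : exists v, wedge12 (P v) (P v *m M) != 0.
  by apply: (NZ (fun v => wedge12 v (v *m M))); apply: wedge_point.
have n3 : exists v, wedge12 (P v *m M) (P v *m M *m M) != 0.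
  apply: (NZ (fun v => wedge12 (v *m M) (v *m M *m M))).
  have [| |r|u u0 uw] := @wedge_point (M *m c).
  - by apply: contraNneq c0 => e; rewrite -cc e mulmx0.
  - by rewrite cc.
  - rewrite cc => e; have r0 : r != 0 by apply: contraNneq c0 => r0; rewrite e r0 scale0r.
    by apply: (nc r^-1); rewrite {2}e scalerA mulVf // scale1r.
  exists (u *m invmx M); last by rewrite mulmxKV.
  by rewrite -cc -lf_mul mulmxKV.
have n4 : exists v, om (P v *m M *m M) (P v) != 0.
  apply: (NZ (fun v => om (v *m M *m M) v)).
  have [v cv Mv] := ker_point c0 nc; exists v => //.
  by rewrite F4E cv mulr0 addr0 !mulf_neq0.
have [a a3 a4] := linewise_mul_nonzero (LP _ l3) (LP _ l4) n3 n4.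
have [b b2 b3] := linewise_mul_nonzero (LP _ l2) (linewise_mul (LP _ l3) (LP _ l4)) n2 (ex_intro _ a (mulf_neq0 a3 a4)).
have [d d1 d2] := linewise_mul_nonzero (LP _ (ll (M *m e0))) (linewise_mul (LP _ l2) (linewise_mul (LP _ l3) (LP _ l4)))
  n1 (ex_intro _ b (mulf_neq0 b2 b3)).
have [v v0] := linewise_mul_nonzero (LP _ (ll e0)) (linewise_mul (LP _ (ll (M *m e0))) (linewise_mul (LP _ l2) (linewise_mul (LP _ l3) (LP _ l4))))
  n0 (ex_intro _ d (mulf_neq0 d1 d2)).
rewrite !mulf_eq0 !negb_or => /and4P[v1 v2 v3 v4].
apply: (dvd4_vector l_odd l_gt1 q_prim RM (v := P v)) => //.
- by rewrite SE Q Pker mul0r mulr0.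
- by rewrite -lf_delta_mx.
by rewrite -lf_delta_mx lf_mul.
Qed.
End Cyclic.

Section NotDvd4.
Variables (C : numClosedFieldType) (q : C) (l n : nat).
Hypotheses (l_odd : odd l) (l_gt1 : (1 < l)%N) (q_prim : l.-primitive_root q).
Local Notation vec := 'rV[C]_4.
Local Notation U p := (upper (p 0 0) (p 0 1) (p 0 2%:R) (p 0 3%:R)).

Lemma upper_row_point (N : 'M[C]_4) : N != 0 -> exists (p : vec) j, (row 0 (U p) *m N) 0 j != 0.
Proof.
move=> N0; have [i [j Nij]] : exists i j, N i j != 0.
  have [h|/existsNP[i /existsNP[j /eqP h]]] := pselect (forall i j, N i j = 0); last by exists i, j.
  by case/eqP: N0; apply/matrixP => i j; rewrite h mxE.
have [v v1 vN] : exists2 v : vec, v 0 0 = 1 & (v *m N) 0 j != 0.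
  have [N0j|N0j] := eqVneq (N 0 j) 0; last first.
    by exists (delta_mx 0 0); [rewrite mxE | rewrite -rowE mxE].
  exists (delta_mx 0 0 + delta_mx 0 i); last by rewrite mulmxDl -!rowE !mxE N0j add0r.
  have i0 : i != 0 by apply: contraNneq Nij => ->; rewrite N0j.
  by rewrite !mxE /= eq_sym (negPf i0) addr0.
exists (vec4 (v 0 1) (v 0 3%:R - v 0 1 * v 0 2%:R) (v 0 2%:R) 0), j.
by rewrite ![vec4 _ _ _ _ _ _]mxE /= upper_row0.
Qed.

Lemma conj_rank (P Q N : 'M[C]_4) : P *m Q = 1%:M -> \rank (P *m N *m Q) = \rank N.
Proof.
move=> PQ; have [uP uQ] := mulmx1_unit PQ.
by rewrite mxrankMfree ?row_free_unit // (eqmxMfull _ (_ : row_full P)) // row_full_unit.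
Qed.

(** A generic conjugation makes the first row of [Z (M - e)] nonzero for both signs [e]. The
    exchange of positive and negative generators then turns rows into columns and yields the
    condition on the first column in [cyclic_dvd4]. *)
Theorem special_dvd4 (M : 'M[C]_4) : Realized q l n M ->
  (forall a, (2 < \rank (M - a%:M)%R)%N) -> (\rank (M *m M - 1%:M)%R <= 2)%N -> (l ^ 4 %| n.+1)%N.
Proof.
move=> RM hr hZ; have Ne e := Z_factor_neq0 hr e.
have lr (N : 'M[C]_4) j : linewise (fun p : vec => (row 0 (U p) *m N) 0 j).
  apply: (@linewise_mulmx _ _ _ _ _ (fun p : vec => row 0 (U p)) (fun=> N)) => [i' j'|i' j'].
    by apply: linewise_ext (@linewise_upper _ 0 j') => p; rewrite [RHS]mxE.
  exact: linewise_const.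
have [p1 [j1 h1]] := upper_row_point (Ne 1); have [p2 [j2 h2]] := upper_row_point (Ne (-1)).
have lg : linewise (fun p => param M p 0 0 * minor2 (param M p) 0 1).
  rewrite /minor2; apply: linewise_mul; [|apply: linewise_add; [|apply: linewise_opp]; apply: linewise_mul];
    exact: linewise_param.
have ng : exists p, param M p 0 0 * minor2 (param M p) 0 1 != 0.
  by exists 0; have /andP[g1 g2] := good0 RM; rewrite mulf_neq0.
have [a a1 a2] := linewise_mul_nonzero (lr _ j1) (lr _ j2) (ex_intro _ p1 h1) (ex_intro _ p2 h2).
have [p gp] := linewise_mul_nonzero lg (linewise_mul (lr _ j1) (lr _ j2)) ng (ex_intro _ a (mulf_neq0 a1 a2)).
rewrite !mulf_eq0 !negb_or in gp *; case/andP => r1 r2.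
have RM1 := Realized_param l_odd l_gt1 q_prim RM gp.
have [M1 M1E] : exists M1, M1 = param M p by exists (param M p).
rewrite -M1E in RM1.
set P := U p in r1 r2; set Q := upper_inv (p 0 0) (p 0 1) (p 0 2%:R) (p 0 3%:R).
have PQ : P *m Q = 1%:M := upperK _ _ _ _; have QP := mulmx1C PQ.
have {}M1E : M1 = P *m M *m Q by rewrite M1E.
have cM (X Y : 'M[C]_4) : (P *m X *m Q) *m (P *m Y *m Q) = P *m (X *m Y) *m Q.
  by rewrite -!mulmxA [Q *m (P *m _)]mulmxA QP mul1mx.
have Z1E : M1 *m M1 - 1%:M = P *m (M *m M - 1%:M) *m Q by rewrite mulmxBr mulmxBl mulmx1 PQ M1E cM.
have M1e e : M1 - e%:M = P *m (M - e%:M) *m Q.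
  by rewrite mulmxBr mulmxBl mul_mx_scalar -scalemxAl PQ scalemx1 M1E.
have row1 e : e * e = 1 -> (delta_mx 0 0 : vec) *m ((M1 *m M1 - 1%:M) *m (M1 - e%:M)) != 0.
  have key (N : 'M[C]_4) : row 0 P *m N != 0 -> (delta_mx 0 0 : vec) *m (P *m N *m Q) != 0.
    apply: contraNneq => h0; have h : row 0 P *m N *m Q = 0 by rewrite rowE -h0 !mulmxA.
    by rewrite -[row 0 P *m N]mulmx1 -QP mulmxA h mul0mx.
  move=> ee; rewrite Z1E M1e cM; apply: key; apply/eqP => h0.
  have /orP[/eqP e1|/eqP e1] : (e == 1) || (e == -1) by rewrite -sqrf_eq1 expr2 ee.
    by rewrite e1 in h0; move: r1; rewrite h0 mxE eqxx.
  by rewrite e1 in h0; move: r2; rewrite h0 mxE eqxx.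
have [d rd dE] := RM1.
have [c00 c10] : zc0 d != 0 /\ zc1 d != 0.
  by have [? [? [? [? [? [? [? [? [? [? [? [? D]]]]]]]]]]]] := rd; rewrite (ud_c0 D) (ud_c1 D).
pose M2 := phi (swap_data d); have RM2 : Realized q l n M2 by exists (swap_data d) => //; apply: realizes_swap.
have [uX [t t0 Xe]] := swap_mx_unit c00 c10; have eqX := phi_swap c00 c10.
rewrite -dE -/M2 in eqX; move: (swap_mx d) uX Xe eqX => X uX Xe eqX; clearbody M2.
pose L := M1^T; rewrite -/L in eqX.
have uL : L \in unitmx by rewrite unitmx_tr; apply: symplectic_unit (Realized_symplectic RM1).
have Lsub b : \rank (L - b%:M) = \rank (M - b%:M).
  have -> : L - b%:M = (M1 - b%:M)^T by rewrite linearB /= tr_scalar_mx.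
  by rewrite mxrank_tr M1e conj_rank.
have rfX : row_full X by rewrite row_full_unit.
have big2 b : (2 < \rank (M2 - b%:M)%R)%N.
  have [->|b0] := eqVneq b 0.
    by rewrite raddf0 subr0 mxrank_unit // (symplectic_unit (Realized_symplectic RM2)).
  have E : (M2 - b%:M) *m (X *m L) = (- b) *: (X *m (L - b^-1%:M)).
    rewrite mulmxBl mulmxA eqX mul_scalar_mx mulmxBr mul_mx_scalar scalerBr scalerA mulNr mulfV //.
    by rewrite scaleN1r opprK scaleNr addrC.
  have <- : \rank ((M2 - b%:M) *m (X *m L)) = \rank (M2 - b%:M).
    by rewrite mxrankMfree // row_free_unit unitmx_mul uX.
  by rewrite E mxrank_scale_nz ?oppr_eq0 // (eqmxMfull _ rfX) Lsub.
have XLL : M2 *m M2 *m X *m L *m L = X by rewrite -[M2 *m M2 *m X]mulmxA -[M2 *m _ *m L]mulmxA eqX eqX.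
have ZX : (M2 *m M2 - 1%:M) *m (X *m (L *m L)) = - (X *m (L *m L - 1%:M)).
  by rewrite mulmxBl mul1mx mulmxBr mulmx1 opprB !mulmxA XLL.
have LLT : L *m L - 1%:M = (M1 *m M1 - 1%:M)^T by rewrite linearB /= trmx_mul trmx1.
have rank2 : (\rank (M2 *m M2 - 1%:M)%R <= 2)%N.
  have <- : \rank ((M2 *m M2 - 1%:M) *m (X *m (L *m L))) = \rank (M2 *m M2 - 1%:M).
    by rewrite mxrankMfree // row_free_unit !unitmx_mul uX uL.
  by rewrite ZX mxrank_opp (eqmxMfull _ rfX) LLT mxrank_tr Z1E conj_rank.
apply: (cyclic_dvd4 l_odd l_gt1 q_prim RM2 big2 rank2) => e ee; apply/eqP => h0.
have cL : comm_mx L (L *m L - 1%:M).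
  by apply: comm_mxB; [apply: comm_mxM; exact: comm_mx_refl | exact: comm_mx1].
have cLe : comm_mx L (L - e%:M) by apply: comm_mxB; [exact: comm_mx_refl | exact: comm_mx_scalar].
have cLLe : comm_mx (L *m L) (L - e%:M) by apply: comm_mx_sym; apply: comm_mxM; apply: comm_mx_sym.
pose K := (L *m L - 1%:M) *m (L - e%:M).
have cK : comm_mx (L *m (L *m L)) K.
  by apply: comm_mx_sym; do 2?[apply: comm_mxM]; apply: comm_mx_sym; apply: comm_mxM.
have key : (M2 *m M2 - 1%:M) *m (M2 - e%:M) *m X *m (L *m (L *m L)) = e *: (X *m K).
  have E1 : (M2 - e%:M) *m X *m L = - (e *: (X *m (L - e%:M))).
    rewrite mulmxBl mulmxBl eqX mul_scalar_mx mulmxBr mul_mx_scalar scalerBr scalerA ee scale1r opprB.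
    by rewrite -scalemxAl.
  transitivity ((M2 *m M2 - 1%:M) *m ((M2 - e%:M) *m X *m L) *m (L *m L)); first by rewrite !mulmxA.
  rewrite E1 mulmxN mulNmx -scalemxAr -scalemxAl.
  have -> : (M2 *m M2 - 1%:M) *m (X *m (L - e%:M)) *m (L *m L) = (M2 *m M2 - 1%:M) *m (X *m (L *m L)) *m (L - e%:M).
    by rewrite -!mulmxA; congr (_ *m (_ *m _)); rewrite [RHS]mulmxA cLLe.
  by rewrite ZX mulNmx scalerN opprK /K mulmxA.
pose y : 'cV[C]_4 := invmx (L *m (L *m L)) *m delta_mx 0 0.
have yE : L *m (L *m L) *m y = delta_mx 0 0 by rewrite /y mulKVmx // !unitmx_mul uL.
have e0 : e != 0 by apply: contraTneq isT => e0; move: ee; rewrite e0 mul0r => /eqP; rewrite eq_sym oner_eq0.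
have Ky : K *m y = 0.
  have h : (M2 *m M2 - 1%:M) *m (M2 - e%:M) *m (X *m (L *m (L *m L) *m y)) = 0.
    by rewrite yE Xe -scalemxAr h0 scaler0.
  have : (e *: (X *m K)) *m y = 0 by rewrite -key -h -!mulmxA.
  rewrite -scalemxAl -mulmxA => /eqP; rewrite scaler_eq0 (negPf e0) /= => /eqP h'.
  by rewrite -[LHS](mulKmx uX) h' mulmx0.
have K0 : K *m delta_mx 0 0 = 0 :> 'cV[C]_4 by rewrite -yE mulmxA -cK -mulmxA Ky mulmx0.
have := row1 e ee; rewrite -[_ *m _]trmxK trmx_eq0 !trmx_mul trmx_delta -LLT.
have -> : (M1 - e%:M)^T = L - e%:M by rewrite linearB /= tr_scalar_mx.
have -> : (L - e%:M) *m (L *m L - 1%:M) = K.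
  by rewrite /K; apply: comm_mxB; [apply: comm_mx_sym | exact: comm_mx1].
by rewrite K0 eqxx.
Qed.

Theorem not_dvd4 (M : 'M[C]_4) : Realized q l n M -> ~~ (l ^ 4 %| n.+1)%N ->
  exists a, (\rank (M - a%:M)%R <= 2)%N.
Proof.
move=> RM nd; have [//|hn] := pselect (exists a, (\rank (M - a%:M)%R <= 2)%N).
have hr a : (2 < \rank (M - a%:M)%R)%N by rewrite ltnNge; apply/negP => h; apply: hn; exists a.
have uM := symplectic_unit (Realized_symplectic RM).
have [//|rT] := not_dvd4_general l_odd l_gt1 q_prim RM (eigenvalue_exists M) nd.
case/negP: nd; apply: (special_dvd4 RM hr).
have -> : M *m M - 1%:M = M *m (M - invmx M) by rewrite mulmxBr mulmxV.
exact: leq_trans (mxrankM_maxr _ _) rT.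
Qed.
End NotDvd4.

(** * From the presented algebra to matrices *)

Section FromSerre.
Variables (C : fieldType) (B : nzRingType) (io : {rmorphism C -> B}).
Hypothesis ioC : forall c x, io c * x = x * io c.
Variables (q : C) (l : nat).
Hypotheses (l_odd : odd l) (l_gt1 : (1 < l)%N) (q_prim : l.-primitive_root q).
Local Notation k := (qc io q).
Let q0 : q != 0 := prim_neq0 q_prim.
Variables (f g y h : B).
Hypotheses (hy : (k 2 - k (-2)) * y = f * g - k (-2) * g * f)
  (hh : (k 1 - k (-1)) * h = f * y - y * f)
  (S1 : f * f * f * g - (k 2 + 1 + k (-2)) * f * f * g * f + (k 2 + 1 + k (-2)) * f * g * f * f - g * f * f * f = 0)
  (S2 : g * g * f - (k 2 + k (-2)) * g * f * g + f * g * g = 0).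

(** With [y] and [h] eliminated, the relations for [f * h] and [g * y] are the two Serre relations;
    the other relations are consequences. *)
Lemma IQ_from_serre : IQ io q f g y h.
Proof.
have fg : f * g = k (-2) * g * f + (k 2 - k (-2)) * y by rewrite hy addrC subrK.
have gf : g * f = k 2 * f * g - k 2 * (k 2 - k (-2)) * y.
  transitivity (k 2 * (k (-2) * g * f)); first by nc ioC q0 [:: f; g; y] (tt).
  transitivity (k 2 * (f * g - (k 2 - k (-2)) * y)); last by nc ioC q0 [:: f; g; y] (tt).
  by rewrite hy opprB addrCA subrr addr0.
have fy : f * y = y * f + (k 1 - k (-1)) * h by rewrite hh addrC subrK.
have e : (k 2 - k (-2)) * ((k 1 - k (-1)) * h) = f * (f * g - k (-2) * g * f) - (f * g - k (-2) * g * f) * f.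
  by rewrite hh -hy; nc ioC q0 [:: f; g; y] (tt).
have fh : f * h = k 2 * h * f.
  apply: (d0_reg l_odd l_gt1 q_prim); apply: (d1_reg l_odd l_gt1 q_prim).
  transitivity (f * ((k 2 - k (-2)) * ((k 1 - k (-1)) * h))); first by nc ioC q0 [:: f; g; y; h] (tt).
  transitivity (k 2 * ((k 2 - k (-2)) * ((k 1 - k (-1)) * h)) * f); last by nc ioC q0 [:: f; g; y; h] (tt).
  rewrite e; apply/eqP; rewrite -subr_eq0; apply/eqP; rewrite -[RHS]S1.
  by nc ioC q0 [:: f; g; y; h] (tt).
have gy : g * y = k (-2) * y * g.
  apply: (d1_reg l_odd l_gt1 q_prim).
  transitivity (g * ((k 2 - k (-2)) * y)); first by nc ioC q0 [:: f; g; y; h] (tt).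
  transitivity (k (-2) * ((k 2 - k (-2)) * y) * g); last by nc ioC q0 [:: f; g; y; h] (tt).
  rewrite hy; apply/eqP; rewrite -subr_eq0; apply/eqP; transitivity (- k (-2) * 0); last by rewrite mulr0.
  by rewrite -S2; nc ioC q0 [:: f; g; y; h] (tt).
have gh : g * h = h * g + (k (-1) - k 3) * y * y.
  apply: (d0_reg l_odd l_gt1 q_prim).
  transitivity (g * ((k 1 - k (-1)) * h)); first by nc ioC q0 [:: f; g; y; h] (tt).
  transitivity (((k 1 - k (-1)) * h) * g + (k 1 - k (-1)) * (k (-1) - k 3) * y * y); last by nc ioC q0 [:: f; g; y; h] (tt).
  by rewrite hh; nc ioC q0 [:: f; g; y; h] (tt, gf, gy).
have E1 : (k 2 - k (-2)) * y * h = k 2 * h * ((k 2 - k (-2)) * y)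
   + (k (-1) - k 3) * (k 1 - k (-1)) * (h * y + y * h).
  by rewrite hy; nc ioC q0 [:: f; g; y; h] (tt, fh, gh, fy).
(* [E1] has [y * h] on both sides; collecting leaves the coefficient [q^2 (q^2 - q^-2)], which can
   be cancelled. *)
have yh : y * h = k (-2) * h * y.
  apply: (d1_reg l_odd l_gt1 q_prim).
  transitivity (k (-2) * ((k 2 - k (-2)) * y * h - (k (-1) - k 3) * (k 1 - k (-1)) * (y * h))).
    by nc ioC q0 [:: f; g; y; h] (tt).
  by rewrite E1; nc ioC q0 [:: f; g; y; h] (tt).
by split.
Qed.
End FromSerre.

Import passmx.
Section Matrices.
Variables (C : fieldType) (U : algType C) (V : vectType C) (rho : {linear U -> 'End(V)}).
Hypothesis rho_rep : is_representation rho.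

(* Transposition turns row vectors into column vectors, so that composition
   becomes multiplication. *)
Lemma matrix_representation : ({:V} != 0)%VS -> exists (n : nat) (Phi : U -> 'M[C]_n.+1),
  [/\ n.+1 = \dim {:V}, Phi 1 = 1,
   (forall x y, Phi (x + y) = Phi x + Phi y) /\ (forall x y, Phi (x * y) = Phi x * Phi y),
   (forall c x, Phi (c *: x) = c%:M * Phi x) &
   forall z c, rho z = c *: \1%VF -> Phi z = c%:M].
Proof.
rewrite -dimv_eq0 => V0; have [rho1 rhoM] := rho_rep.
have [m [F [mE F1 FD [FM FZ Fc]]]] : exists m (F : U -> 'M[C]_m), [/\ m = \dim {:V}, F 1 = 1%:M,
   (forall x y, F (x + y) = F x + F y) & [/\ (forall x y, F (x * y) = F x *m F y),
   (forall c x, F (c *: x) = c *: F x) & forall z c, rho z = c *: \1%VF -> F z = c%:M]].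
  pose e := vbasis {:V}; have eB : basis_of {:V} e := vbasisP _; have eF := basis_free eB.
  exists (\dim {:V}), (fun a => (passmx.mxof e e (rho a))^T); split=> //.
  - by rewrite rho1 passmx.mxof1 // trmx1.
  - by move=> x y; rewrite !linearD.
  split.
  - by move=> x y; rewrite rhoM (@passmx.mxof_comp _ _ _ _ e e e eB) trmx_mul.
  - by move=> c x; rewrite !linearZ.
  by move=> z c ->; rewrite !linearZ /= passmx.mxof1 // trmx1 scalemx1.
case: m F mE F1 FD FM FZ Fc => [|n] F mE F1 FD FM FZ Fc; first by rewrite -mE in V0.
exists n, F; split=> //.
by move=> c x; rewrite FZ -mul_scalar_mx.
Qed.
End Matrices.

Section Bridge.
Variables (C : numClosedFieldType) (q : C) (l n : nat).
Hypotheses (l_odd : odd l) (l_gt1 : (1 < l)%N) (q_prim : l.-primitive_root q).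
Local Notation M := 'M[C]_n.+1.
Local Notation io := (scm C n).
Local Notation k := (qc io q).
Let ioC c (x : M) : io c * x = x * io c. Proof. exact: scmC. Qed.
Let q0 : q != 0 := prim_neq0 q_prim.
Variables (U : algType C) (gg : generators U) (HR : Uq_relations q gg) (Phi : U -> M).
Hypotheses (P1 : Phi 1 = 1) (PD : forall x y, Phi (x + y) = Phi x + Phi y)
  (PM : forall x y, Phi (x * y) = Phi x * Phi y) (PZ : forall c x, Phi (c *: x) = io c * Phi x).

Let P0 : Phi 0 = 0. Proof. by rewrite -(scale0r 0) PZ rmorph0 mul0r. Qed.
Let PN x : Phi (- x) = - Phi x. Proof. by rewrite -scaleN1r PZ rmorphN1 mulN1r. Qed.
Let PX x m : Phi (x ^+ m) = Phi x ^+ m.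
Proof. by elim: m => [|m IH]; rewrite ?P1 // !exprS PM IH. Qed.

Definition wt (i j : int) : weight := \row_s (if s == 0 then i else j).
Local Notation K b := (Phi (gK gg b)).
Let KD b c : K b * K c = K (b + c). Proof. by rewrite -PM (rel_KD HR). Qed.
Let K0 : K 0 = 1. Proof. by rewrite (rel_K0 HR). Qed.
Let wtD i j i' j' : wt i j + wt i' j' = wt (i + i') (j + j').
Proof. by apply/rowP => s; rewrite !mxE; case: ifP. Qed.
Let wt0 : wt 0 0 = 0. Proof. by apply/rowP => s; rewrite !mxE; case: ifP. Qed.
Let wtN i j : - wt i j = wt (- i) (- j). Proof. by apply/rowP => s; rewrite !mxE; case: ifP. Qed.

Let e0 := Phi (gE gg 0). Let e1 := Phi (gE gg 1).
Let f0 := Phi (gF gg 0). Let f1 := Phi (gF gg 1).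
Let d0 := q ^ 1 - q ^ (-1). Let d1 := q ^ 2 - q ^ (-2).
Let d0n : d0 != 0 := d0_neq0 l_odd l_gt1 q_prim.
Let d1n : d1 != 0 := d1_neq0 l_odd l_gt1 q_prim.
Let io_d0 : io d0 = k 1 - k (-1). Proof. by rewrite /d0 rmorphB. Qed.
Let io_d1 : io d1 = k 2 - k (-2). Proof. by rewrite /d1 rmorphB. Qed.
Let a := (k 1 - k (-1)) * e0. Let b := (k 2 - k (-2)) * e1.
Let f := (k 1 - k (-1)) * f0. Let g := (k 2 - k (-2)) * f1.
Let w0 := K (wt 1 0). Let v0 := K (wt (-1) 0).
Let w1 := K (wt 0 1). Let v1 := K (wt 0 (-1)).
Let yE := io d1^-1 * (a * b - k (-2) * b * a).
Let hE := io d0^-1 * (a * yE - yE * a).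
Let yF := io d1^-1 * (f * g - k (-2) * g * f).
Let hF := io d0^-1 * (f * yF - yF * f).

Let dK0 (x : M) : (k 1 - k (-1)) * (io d0^-1 * x) = x.
Proof. by rewrite -io_d0 mulrA -rmorphM mulfV // rmorph1 mul1r. Qed.
Let dK1 (x : M) : (k 2 - k (-2)) * (io d1^-1 * x) = x.
Proof. by rewrite -io_d1 mulrA -rmorphM mulfV // rmorph1 mul1r. Qed.

Let KE c i x : form_root c i = x -> K c * Phi (gE gg i) = k x * Phi (gE gg i) * K c.
Proof.
move=> <-; have := congr1 Phi (rel_KE HR c i); rewrite !PM PZ -[io _]/(k _) => <-.
by rewrite -!mulrA KD addNr K0 mulr1.
Qed.
Let KF c i x : - form_root c i = x -> K c * Phi (gF gg i) = k x * Phi (gF gg i) * K c.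
Proof.
move=> <-; have := congr1 Phi (rel_KF HR c i); rewrite !PM PZ -[io _]/(k _) => <-.
by rewrite -!mulrA KD addNr K0 mulr1.
Qed.
Let fr i j s : form_root (wt i j) s = (symd s)%:Z * (if s == 0 then i else j).
Proof. by rewrite /form_root mxE. Qed.

Let root0 : simple_root 0 = wt 1 0 + wt 1 0 + wt 0 (-1).
Proof. by rewrite !wtD; apply/rowP => s; rewrite !mxE /cartan; case: s => -[|[|//]] sp. Qed.
Let root1 : simple_root 1 = wt (-1) 0 + wt (-1) 0 + wt 0 1 + wt 0 1.
Proof. by rewrite !wtD; apply/rowP => s; rewrite !mxE /cartan; case: s => -[|[|//]] sp. Qed.
Let root0N : - simple_root 0 = wt (-1) 0 + wt (-1) 0 + wt 0 1.
Proof. by rewrite root0 !wtD wtN. Qed.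
Let root1N : - simple_root 1 = wt 1 0 + wt 1 0 + wt 0 (-1) + wt 0 (-1).
Proof. by rewrite root1 !wtD wtN. Qed.

Let central_diff (i j : int) : exists X : M, (forall z, X * z = z * X) /\ k i - k j = X.
Proof. by exists (io (q ^ i - q ^ j)); split; [exact: ioC | rewrite rmorphB]. Qed.
Let scal_comm (x y : M) (c i j : int) : y * x = k c * x * y ->
  y * ((k i - k j) * x) = k c * ((k i - k j) * x) * y.
Proof. by move=> e; have [X [XC ->]] := central_diff i j; rewrite [LHS]mulrA -[y * X]XC -[LHS]mulrA e !mulrA XC. Qed.
Let scal_comm0 (x y : M) (i j : int) : y * x = k 0 * x * y ->
  y * ((k i - k j) * x) = ((k i - k j) * x) * y.
Proof.
by rewrite (qc0 io) mul1r => e; have [X [XC ->]] := central_diff i j; rewrite [LHS]mulrA -[y * X]XC -[LHS]mulrA e !mulrA.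
Qed.

Let qbinom31 (p : C) : p != 0 -> qbinom p 3 1 = p ^+ 2 + 1 + p ^- 2 /\ qbinom p 3 2 = p ^+ 2 + 1 + p ^- 2 /\ qbinom p 3 3 = 1.
Proof.
move=> p0; have E r s : p ^ (r%:Z - s%:Z) = p ^+ r / p ^+ s by rewrite expfzDr // -exprnP -exprnN.
rewrite /qbinom !E.
by split; [|split]; field.
Qed.
Let qbinom21 (p : C) : p != 0 -> qbinom p 2 1 = p + p^-1 /\ qbinom p 2 2 = 1.
Proof.
move=> p0; have E r s : p ^ (r%:Z - s%:Z) = p ^+ r / p ^+ s by rewrite expfzDr // -exprnP -exprnN.
rewrite /qbinom !E.
by split; field.
Qed.
Let serre01 (x : 'I_2 -> U) : serre q x 0 1 = x 0 * x 0 * x 0 * x 1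
  - (q ^+ 2 + 1 + q ^- 2) *: (x 0 * x 0 * x 1 * x 0) + (q ^+ 2 + 1 + q ^- 2) *: (x 0 * x 1 * x 0 * x 0) - x 1 * x 0 * x 0 * x 0.
Proof.
have [b1 [b2 b3]] := qbinom31 q0.
rewrite /serre (_ : `|(1 - cartan 0 1)%R|%N = 3%N) //.
rewrite (eq_bigr (fun s : 'I_4 => ((-1) ^+ s * nth 0 [:: 1; q ^+ 2 + 1 + q ^- 2; q ^+ 2 + 1 + q ^- 2; 1] s) *:
  (x 0 ^+ (3 - s) * x 1 * x 0 ^+ s))).
  by rewrite !big_ord_recl big_ord0 /= /bump /= !exprS !expr0 !mulr1 !mul1r !mulN1r opprK !mul1r !scaleNr !scale1r addr0 !mulrA !addrA.
move=> s _; congr ((_ * _) *: _); rewrite /qi /symd eqxx expr1.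
by case: s => -[|[|[|[|//]]]] sp.
Qed.
Let serre10 (x : 'I_2 -> U) : serre q x 1 0 = x 1 * x 1 * x 0
  - (q ^+ 2 + q ^- 2) *: (x 1 * x 0 * x 1) + x 0 * x 1 * x 1.
Proof.
have [|b1 b2] := @qbinom21 (q ^+ 2); first by rewrite expf_neq0.
rewrite /serre (_ : `|(1 - cartan 1 0)%R|%N = 2%N) //.
rewrite (eq_bigr (fun s : 'I_3 => ((-1) ^+ s * nth 0 [:: 1; q ^+ 2 + q ^- 2; 1] s) *:
  (x 1 ^+ (2 - s) * x 0 * x 1 ^+ s))).
  by rewrite !big_ord_recl big_ord0 /= /bump /= !exprS !expr0 !mulr1 !mul1r !mulN1r opprK ?mul1r !scaleNr !scale1r addr0 !mulrA !addrA.
move=> s _; congr ((_ * _) *: _); rewrite /qi /symd.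
by case: s => -[|[|[|//]]] sp.
Qed.

Let serre_words (X Y : M) (x : 'I_2 -> U) : (X = Phi (x 0)) -> (Y = Phi (x 1)) ->
  (forall i j, i != j -> serre q x i j = 0) ->
  X * X * X * Y - (k 2 + 1 + k (-2)) * X * X * Y * X + (k 2 + 1 + k (-2)) * X * Y * X * X - Y * X * X * X = 0 /\
  Y * Y * X - (k 2 + k (-2)) * Y * X * Y + X * Y * Y = 0.
Proof.
move=> -> -> S; have := congr1 Phi (S 0 1 isT); have := congr1 Phi (S 1 0 isT).
have c3 : io (q ^+ 2 + 1 + q ^- 2) = k 2 + 1 + k (-2) by rewrite !rmorphD rmorph1.
have c2 : io (q ^+ 2 + q ^- 2) = k 2 + k (-2) by rewrite rmorphD.
rewrite serre01 serre10 !(PD, PN, PZ, PM) P0 c2 c3 => S2 S1.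
split; [rewrite -[RHS]S1 | rewrite -[RHS]S2]; nc ioC q0 [:: Phi (x 0); Phi (x 1)] (tt).
Qed.

Theorem UQ_of_representation : UQ io q a b yE hE f g yF hF w0 w1 v0 v1.
Proof.
have [s1 s2] := serre_words (erefl e0) (erefl e1) (rel_SE HR).
have [s3 s4] := serre_words (erefl f0) (erefl f1) (rel_SF HR).
have IE : IQ io q a b yE hE.
  apply: (IQ_from_serre ioC l_odd l_gt1 q_prim); rewrite ?dK0 ?dK1 //.
    transitivity ((k 1 - k (-1)) * (k 1 - k (-1)) * (k 1 - k (-1)) * (k 2 - k (-2)) * 0 : M); last by rewrite mulr0.
    by rewrite -s1 /a /b; nc ioC q0 [:: e0; e1] (tt).
  transitivity ((k 2 - k (-2)) * (k 2 - k (-2)) * (k 1 - k (-1)) * 0 : M); last by rewrite mulr0.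
  by rewrite -s2 /a /b; nc ioC q0 [:: e0; e1] (tt).
have IF : IQ io q f g yF hF.
  apply: (IQ_from_serre ioC l_odd l_gt1 q_prim); rewrite ?dK0 ?dK1 //.
    transitivity ((k 1 - k (-1)) * (k 1 - k (-1)) * (k 1 - k (-1)) * (k 2 - k (-2)) * 0 : M); last by rewrite mulr0.
    by rewrite -s3 /f /g; nc ioC q0 [:: f0; f1] (tt).
  transitivity ((k 2 - k (-2)) * (k 2 - k (-2)) * (k 1 - k (-1)) * 0 : M); last by rewrite mulr0.
  by rewrite -s4 /f /g; nc ioC q0 [:: f0; f1] (tt).
have EF i j : Phi (gE gg i) * Phi (gF gg j) = Phi (gF gg j) * Phi (gE gg i) +
   Phi (if i == j then (qi q i - (qi q i)^-1)^-1 *: (gK gg (simple_root i) - gK gg (- simple_root i)) else 0).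
  by rewrite -(rel_EF HR i j) PD PN !PM addrC subrK.
have q0i : qi q 0 - (qi q 0)^-1 = d0 by rewrite /qi /d0 /symd eqxx.
have q1i : qi q 1 - (qi q 1)^-1 = d1 by [].
split=> //; try by rewrite ?KD ?wtD ?wt0 ?K0 // addrC.
- by apply: scal_comm; apply: KE; rewrite fr.
- by apply: scal_comm0; apply: KE; rewrite fr.
- by apply: scal_comm0; apply: KE; rewrite fr.
- by apply: scal_comm; apply: KE; rewrite fr.
- by apply: scal_comm; apply: KF; rewrite fr.
- by apply: scal_comm0; apply: KF; rewrite fr.
- by apply: scal_comm0; apply: KF; rewrite fr.
- by apply: scal_comm; apply: KF; rewrite fr.
- have := EF 0 0; rewrite eqxx PZ q0i PD PN root0N root0 -!KD -/e0 -/f0 -/w0 -/v0 -/w1 -/v1 => E.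
  transitivity (f * a + (k 1 - k (-1)) * ((k 1 - k (-1)) * (io d0^-1 * (w0 * w0 * v1 - v0 * v0 * w1)))); last by rewrite dK0.
  rewrite /a /f; set D := io d0^-1; rewrite -/D in E; clearbody D.
  by nc ioC q0 [:: e0; f0; w0; w1; v0; v1; D] (tt, E).
- have := EF 1 1; rewrite eqxx PZ q1i PD PN root1N root1 -!KD -/e1 -/f1 -/w0 -/v0 -/w1 -/v1 => E.
  transitivity (g * b + (k 2 - k (-2)) * ((k 2 - k (-2)) * (io d1^-1 * (v0 * v0 * w1 * w1 - w0 * w0 * v1 * v1)))); last by rewrite dK1.
  rewrite /b /g; set D := io d1^-1; rewrite -/D in E; clearbody D.
  by nc ioC q0 [:: e1; f1; w0; w1; v0; v1; D] (tt, E).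
- have := EF 0 1; rewrite /= P0 addr0 -/e0 -/f1 => E.
  by rewrite /a /g; nc ioC q0 [:: e0; f1] (tt, E).
have := EF 1 0; rewrite /= P0 addr0 -/e1 -/f0 => E.
by rewrite /b /f; nc ioC q0 [:: e1; f0] (tt, E).
Qed.
End Bridge.

(** * Root vectors of the braid group action and their matrices in [sp_4] *)

Section BraidFormulas.
Variables (C : fieldType) (q : C) (A : algType C) (g : generators A).
Hypothesis q0 : q != 0.

Lemma qfact_small (p : C) : p != 0 -> [/\ qfact p 0 = 1, qfact p 1 = 1 & qfact p 2 = p + p^-1].
Proof.
move=> p0; have q1 : qint p 1 = 1 by rewrite /qint big_ord_recl big_ord0 addr0.
have q2 : qint p 2 = p + p^-1.
  transitivity (p ^ 1 + p ^ (-1)); last by rewrite expr1z exprN1.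
  by rewrite /qint big_ord_recr big_ord1; congr (_ + _).
rewrite /qfact; split; first by rewrite big_geq.
  by rewrite big_nat1.
by rewrite big_nat_recr //= big_nat1 q1 q2 mul1r.
Qed.

Definition serre_form (c : C) (x0 x1 : A) : A :=
  c^-1 *: (x0 * x0 * x1) - q^-1 *: (x0 * x1 * x0) + (q ^- 2 * c^-1) *: (x1 * x0 * x0).

Lemma braid0_E1 : gE (braid q 0 g) 1 = serre_form (q + q^-1) (gE g 0) (gE g 1).
Proof.
have [f0 f1 f2] := qfact_small q0; rewrite /serre_form.
rewrite /braid /= ?(_ : absz (cartan 0 1) = 2%N) // !big_ord_recl big_ord0 /= /bump /= addr0.
rewrite /divpow /qi /symd /= ?subn0 ?subSS ?subn0 f0 f1 f2 invr1 !scale1r !expr0 !expr1 !mulr1 !mul1r.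
rewrite -!(scalerAl, scalerAr) !scalerA !addnS !addn0 !exprS !expr0 !mulr1 !mulN1r !opprK ?mul1r !mulrA.
by rewrite mulN1r scaleNr addrA.
Qed.
Lemma braid0_F1 : gF (braid q 0 g) 1 = q ^+ 2 *: serre_form (q + q^-1) (gF g 0) (gF g 1).
Proof.
have [f0 f1 f2] := qfact_small q0; rewrite /serre_form.
rewrite /braid /= ?(_ : absz (cartan 0 1) = 2%N) // !big_ord_recl big_ord0 /= /bump /= addr0.
rewrite /divpow /qi /symd /= ?subn0 ?subSS ?subn0 f0 f1 f2 invr1 !scale1r !expr0 !expr1 !mulr1 !mul1r.
rewrite -!(scalerAl, scalerAr) !scalerA !addnS !addn0 !exprS !expr0 !mulr1 !mulN1r !opprK ?mul1r !mulrA.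
have s2 : q * q * ((q * q)^-1 / (q + q^-1)) = (q + q^-1)^-1 by rewrite mulrA mulfV ?mul1r // mulf_neq0.
rewrite scalerDr scalerBr !scalerA s2 mulfK // mulN1r scaleNr.
by rewrite [RHS]addrC; congr (_ + _); rewrite addrC.
Qed.
Lemma braid1_E0 : gE (braid q 1 g) 0 = - (gE g 1 * gE g 0) + q ^- 2 *: (gE g 0 * gE g 1).
Proof.
have [f0 f1 _] := @qfact_small (q ^+ 2) (expf_neq0 _ q0).
rewrite /braid /= ?(_ : absz (cartan 1 0) = 1%N) // !big_ord_recl big_ord0 /= /bump /= addr0.
rewrite /divpow /qi /symd /= ?subn0 ?subnn f0 f1 invr1 !scale1r !expr0 !expr1 !mulr1 !mul1r.
by rewrite ?addn1 ?invr1 ?mulr1 ?sqrrN ?expr1n ?mul1r scaleN1r.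
Qed.
Lemma braid1_F0 : gF (braid q 1 g) 0 = - (gF g 0 * gF g 1) + q ^+ 2 *: (gF g 1 * gF g 0).
Proof.
have [f0 f1 _] := @qfact_small (q ^+ 2) (expf_neq0 _ q0).
rewrite /braid /= ?(_ : absz (cartan 1 0) = 1%N) // !big_ord_recl big_ord0 /= /bump /= addr0.
rewrite /divpow /qi /symd /= ?subn0 ?subnn f0 f1 invr1 !scale1r !expr0 !expr1 !mulr1 !mul1r.
by rewrite ?addn1 ?invr1 ?mulr1 ?sqrrN ?expr1n ?mul1r scaleN1r.
Qed.
End BraidFormulas.

Section RootVectors.
Variables (C : fieldType) (B : nzRingType) (io : {rmorphism C -> B}).
Hypothesis ioC : forall c x, io c * x = x * io c.
Variables (q : C) (l : nat).
Hypotheses (l_odd : odd l) (l_gt1 : (1 < l)%N) (q_prim : l.-primitive_root q).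
Local Notation k := (qc io q).
Local Notation d0 := (k 1 - k (-1)).
Local Notation d1 := (k 2 - k (-2)).
Let q0 : q != 0 := prim_neq0 q_prim.

Definition serre_word (x0 x1 : B) := x0 * x0 * x1 - (1 + k (-2)) * x0 * x1 * x0 + k (-2) * x1 * x0 * x0.

Lemma serre_word_IQ (x0 x1 a b y h : B) : IQ io q a b y h -> d0 * x0 = a -> d1 * x1 = b ->
  d0 * serre_word x0 x1 = h.
Proof.
move=> I ax bx; apply: (d0_reg l_odd l_gt1 q_prim); apply: (d1_reg l_odd l_gt1 q_prim).
transitivity (a * a * b - (1 + k (-2)) * a * b * a + k (-2) * b * a * a).
  by rewrite -ax -bx /serre_word; nc ioC q0 [:: x0; x1] (tt).
by nc ioC q0 [:: a; b; y; h] (tt, iq_fg I, iq_fy I, iq_fh I, iq_gy I, iq_yh I, iq_gh I).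
Qed.

Variables (a b yE hE f g yF hF w0 w1 v0 v1 : B).
Hypothesis U : UQ io q a b yE hE f g yF hF w0 w1 v0 v1.
Let E := uq_E U.
Let F := uq_F U.

Ltac uqw ex := nc ioC q0 [:: a; b; yE; hE; f; g; yF; hF; w0; w1; v0; v1]
  (ex, uq_af U, uq_bg U, uq_ag U, uq_bf U, uq_w0a U, uq_w0b U, uq_w1a U, uq_w1b U,
   uq_w0f U, uq_w0g U, uq_w1f U, uq_w1g U, uq_w0v0 U, uq_v0w0 U, uq_w1v1 U, uq_v1w1 U,
   uq_w1w0 U).
Let t1 := uq_v0a ioC q_prim U. Let t2 := uq_v0b U. Let t3 := uq_v1a U. Let t4 := uq_v1b ioC q_prim U.
Let t5 := uq_v0f ioC q_prim U. Let t6 := uq_v0g U. Let t7 := uq_v1f U. Let t8 := uq_v1g ioC q_prim U.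
Let t9 := esym (uq_v0w1 U). Let t10 := uq_v1w0 U. Let t11 := uq_v1v0 U.
Let s1 := uq_w0yE ioC l_odd l_gt1 q_prim U. Let s2 := uq_w0hE ioC l_odd l_gt1 q_prim U.
Let s3 := uq_v0yE ioC l_odd l_gt1 q_prim U. Let s4 := uq_v0hE ioC l_odd l_gt1 q_prim U.
Let s5 := uq_w0yF ioC l_odd l_gt1 q_prim U. Let s6 := uq_w0hF ioC l_odd l_gt1 q_prim U.
Let s7 := uq_v0yF ioC l_odd l_gt1 q_prim U. Let s8 := uq_v0hF ioC l_odd l_gt1 q_prim U.
Let u1 := uq_w1yE ioC l_odd l_gt1 q_prim U. Let u2 := uq_w1hE ioC l_odd l_gt1 q_prim U.
Let u3 := uq_v1yE ioC l_odd l_gt1 q_prim U. Let u4 := uq_v1hE ioC l_odd l_gt1 q_prim U.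
Let u5 := uq_w1yF ioC l_odd l_gt1 q_prim U. Let u6 := uq_w1hF ioC l_odd l_gt1 q_prim U.
Let u7 := uq_v1yF ioC l_odd l_gt1 q_prim U. Let u8 := uq_v1hF ioC l_odd l_gt1 q_prim U.
Let c1 := uq_yEf ioC l_odd l_gt1 q_prim U. Let c2 := uq_yEg ioC l_odd l_gt1 q_prim U.
Let c3 := uq_ayF ioC l_odd l_gt1 q_prim U. Let c4 := uq_byF ioC l_odd l_gt1 q_prim U.
Let c5 := uq_hEf ioC l_odd l_gt1 q_prim U. Let c6 := uq_hEg ioC l_odd l_gt1 q_prim U.
Let c7 := uq_ahF ioC l_odd l_gt1 q_prim U. Let c8 := uq_bhF ioC l_odd l_gt1 q_prim U.
Ltac uqv ex := uqw (ex, t1, t2, t3, t4, t5, t6, t7, t8, t9, t10, t11, s1, s2, s3, s4, s5, s6, s7, s8,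
  u1, u2, u3, u4, u5, u6, u7, u8, c1, c2, c3, c4, c5, c6, c7, c8).

Lemma uq_yEhF : yE * hF = hF * yE + (1 - k (-4)) * f * v1.
Proof.
apply: (d1_reg l_odd l_gt1 q_prim).
transitivity ((a * b - k (-2) * b * a) * hF); first by uqw (tt, iq_fg E).
transitivity (hF * (a * b - k (-2) * b * a) + d1 * ((1 - k (-4)) * f * v1)); last by uqw (tt, iq_fg E).
by uqv (tt).
Qed.
Lemma uq_hEyF : hE * yF = yF * hE - (1 - k (-4)) * a * w1.
Proof.
apply: (d1_reg l_odd l_gt1 q_prim).
transitivity (hE * (f * g - k (-2) * g * f)); first by uqw (tt, iq_fg F).
transitivity ((f * g - k (-2) * g * f) * hE - d1 * ((1 - k (-4)) * a * w1)); last by uqw (tt, iq_fg F).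
by uqv (tt).
Qed.

(** This and the next three lemmas identify the later root vectors with rescaled [yE], [yF], [b] and
    [g]. The powers of [q ^ 2] disappear in l-th powers, but the sign in front of [yE] survives
    since [l] is odd. *)
Lemma root2_E (x f0 : B) : d1 * x = hE -> d0 * f0 = f ->
  d0 * (- (x * - (f0 * (w0 * w0 * v1))) + k (-2) * (- (f0 * (w0 * w0 * v1)) * x)) = - yE.
Proof.
move=> hx hf; apply: (d1_reg l_odd l_gt1 q_prim).
transitivity ((d1 * x) * (d0 * f0) * w0 * w0 * v1 - k (-2) * (d0 * f0) * w0 * w0 * v1 * (d1 * x)).
  by nc ioC q0 [:: x; f0; w0; v1] (tt).
by rewrite hx hf; uqv (tt).
Qed.
Lemma root2_F (x e0 : B) : d1 * x = k 2 * hF -> d0 * e0 = a ->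
  d0 * (- (- (v0 * v0 * w1 * e0) * x) + k 2 * (x * - (v0 * v0 * w1 * e0))) = k 2 * yF.
Proof.
move=> hx he; apply: (d1_reg l_odd l_gt1 q_prim).
transitivity (v0 * v0 * w1 * (d0 * e0) * (d1 * x) - k 2 * (d1 * x) * v0 * v0 * w1 * (d0 * e0)).
  by nc ioC q0 [:: x; e0; v0; w1] (tt).
by rewrite hx he; uqv (tt).
Qed.
Lemma root3_E (x0 x1 : B) : d0 * x0 = - yE -> d1 * x1 = k 2 * hF ->
  d0 * serre_word x0 (- (x1 * (w0 * w0))) = b.
Proof.
move=> h0 h1; apply: (d0_reg l_odd l_gt1 q_prim); apply: (d1_reg l_odd l_gt1 q_prim).
transitivity (serre_word (d0 * x0) (- ((d1 * x1) * (w0 * w0)))).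
  by rewrite /serre_word; nc ioC q0 [:: x0; x1; w0] (tt).
by rewrite h0 h1 /serre_word; uqv (tt, uq_yEhF).
Qed.
Lemma root3_F (x0 x1 : B) : d0 * x0 = k 2 * yF -> d1 * x1 = hE ->
  d0 * (k 2 * serre_word x0 (- (v0 * v0 * x1))) = g.
Proof.
move=> h0 h1; apply: (d0_reg l_odd l_gt1 q_prim); apply: (d1_reg l_odd l_gt1 q_prim).
transitivity (k 2 * serre_word (d0 * x0) (- (v0 * v0 * (d1 * x1)))).
  by rewrite /serre_word; nc ioC q0 [:: x0; x1; v0] (tt).
by rewrite h0 h1 /serre_word; uqv (tt, uq_hEyF).
Qed.
End RootVectors.

Section RootElements.
Variable C : numClosedFieldType.
Notation mx4 a11 a12 a13 a14 a21 a22 a23 a24 a31 a32 a33 a34 a41 a42 a43 a44 :=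
  (mx_of_rows [:: [:: a11; a12; a13; a14]; [:: a21; a22; a23; a24];
                  [:: a31; a32; a33; a34]; [:: a41; a42; a43; a44]]).
Local Notation sp4 := (sp4_generators C).

Lemma scale4 (c a11 a12 a13 a14 a21 a22 a23 a24 a31 a32 a33 a34 a41 a42 a43 a44 : C) :
  c *: mx4 a11 a12 a13 a14 a21 a22 a23 a24 a31 a32 a33 a34 a41 a42 a43 a44 =
  mx4 (c * a11) (c * a12) (c * a13) (c * a14) (c * a21) (c * a22) (c * a23) (c * a24)
      (c * a31) (c * a32) (c * a33) (c * a34) (c * a41) (c * a42) (c * a43) (c * a44).
Proof.
by apply/matrixP => i j; rewrite !mxE; case: i => -[|[|[|[|]]]] //= ?; case: j => -[|[|[|[|]]]].
Qed.
Lemma add4 (a11 a12 a13 a14 a21 a22 a23 a24 a31 a32 a33 a34 a41 a42 a43 a44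
  b11 b12 b13 b14 b21 b22 b23 b24 b31 b32 b33 b34 b41 b42 b43 b44 : C) :
  mx4 a11 a12 a13 a14 a21 a22 a23 a24 a31 a32 a33 a34 a41 a42 a43 a44 +
  mx4 b11 b12 b13 b14 b21 b22 b23 b24 b31 b32 b33 b34 b41 b42 b43 b44 =
  mx4 (a11 + b11) (a12 + b12) (a13 + b13) (a14 + b14) (a21 + b21) (a22 + b22) (a23 + b23) (a24 + b24)
      (a31 + b31) (a32 + b32) (a33 + b33) (a34 + b34) (a41 + b41) (a42 + b42) (a43 + b43) (a44 + b44).
Proof.
by apply/matrixP => i j; rewrite !mxE; case: i => -[|[|[|[|]]]] //= ?; case: j => -[|[|[|[|]]]].
Qed.
Lemma opp4 (a11 a12 a13 a14 a21 a22 a23 a24 a31 a32 a33 a34 a41 a42 a43 a44 : C) :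
  - mx4 a11 a12 a13 a14 a21 a22 a23 a24 a31 a32 a33 a34 a41 a42 a43 a44 =
  mx4 (- a11) (- a12) (- a13) (- a14) (- a21) (- a22) (- a23) (- a24)
      (- a31) (- a32) (- a33) (- a34) (- a41) (- a42) (- a43) (- a44).
Proof.
by apply/matrixP => i j; rewrite !mxE; case: i => -[|[|[|[|]]]] //= ?; case: j => -[|[|[|[|]]]].
Qed.
Lemma one4 : 1 = mx4 1 0 0 0 0 1 0 0 0 0 1 0 0 0 0 1 :> 'M[C]_4.
Proof.
by apply/matrixP => i j; rewrite !mxE; case: i => -[|[|[|[|]]]] //= ?; case: j => -[|[|[|[|]]]].
Qed.
Lemma mul4 (X Y : 'M[C]_4) : X * Y = X *m Y. Proof. by []. Qed.

Definition e4 := mx4 0 1 0 0 0 0 0 0 0 0 0 (-1) 0 0 0 0 : 'M[C]_4.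
Definition f4 := mx4 0 0 0 0 1 0 0 0 0 0 0 0 0 0 (-1) 0 : 'M[C]_4.
Definition mE1 := mx4 0 0 0 1 0 0 0 0 0 0 0 0 0 0 0 0 : 'M[C]_4.
Definition mF1 := mx4 0 0 0 0 0 0 0 0 0 0 0 0 1 0 0 0 : 'M[C]_4.
Definition mE2 := mx4 0 0 (-1) 0 0 0 0 (-1) 0 0 0 0 0 0 0 0 : 'M[C]_4.
Definition mF2 := mx4 0 0 0 0 0 0 0 0 (-1) 0 0 0 0 (-1) 0 0 : 'M[C]_4.
Definition mE3 := mx4 0 0 0 0 0 0 1 0 0 0 0 0 0 0 0 0 : 'M[C]_4.
Definition mF3 := mx4 0 0 0 0 0 0 0 0 0 1 0 0 0 0 0 0 : 'M[C]_4.

Lemma mx4_congr (a11 a12 a13 a14 a21 a22 a23 a24 a31 a32 a33 a34 a41 a42 a43 a44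
  b11 b12 b13 b14 b21 b22 b23 b24 b31 b32 b33 b34 b41 b42 b43 b44 : C) :
  [/\ a11 = b11, a12 = b12, a13 = b13 & a14 = b14] -> [/\ a21 = b21, a22 = b22, a23 = b23 & a24 = b24] ->
  [/\ a31 = b31, a32 = b32, a33 = b33 & a34 = b34] -> [/\ a41 = b41, a42 = b42, a43 = b43 & a44 = b44] ->
  mx4 a11 a12 a13 a14 a21 a22 a23 a24 a31 a32 a33 a34 a41 a42 a43 a44 =
  mx4 b11 b12 b13 b14 b21 b22 b23 b24 b31 b32 b33 b34 b41 b42 b43 b44.
Proof. by do 4![case=> -> -> -> ->]. Qed.

Lemma root_vectors_sp4 :
  [/\ root_e C 0 = e4, root_e C 1 = mE1, root_e C 2 = mE2 & root_e C 3 = mE3] /\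
  [/\ root_f C 0 = f4, root_f C 1 = mF1, root_f C 2 = mF2 & root_f C 3 = mF3].
Proof.
have one : (1 : C) != 0 := oner_neq0 _.
pose g1 := braid 1 0 sp4; pose g2 := braid 1 1 g1.
have two : (1 + 1 : C) != 0 by rewrite -mulr2n pnatr_eq0.
have g0E : gE sp4 0 = e4 by []. have g0F : gF sp4 0 = f4 by [].
have g0E1 : gE sp4 1 = mE3 by []. have g0F1 : gF sp4 1 = mF3 by [].
have E1 : gE g1 1 = mE1.
  rewrite /g1 braid0_E1 // /serre_form invr1 expr1n invr1 g0E g0E1 /e4 /mE3 /mE1 !mul4 !mx4_mul !scale4 !(opp4, add4).
  by apply: mx4_congr; split; ring.
have F1 : gF g1 1 = mF1.
  rewrite /g1 braid0_F1 // /serre_form invr1 expr1n invr1 g0F g0F1 /f4 /mF3 /mF1 !mul4 !mx4_mul !scale4 !(opp4, add4) !scale4.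
  by apply: mx4_congr; split; ring.
have E0 : gE g1 0 = - f4 by rewrite -[gE g1 0]/(- (gF sp4 0 * 1)) g0F mulr1.
have F0 : gF g1 0 = - e4 by rewrite -[gF g1 0]/(- (1 * gE sp4 0)) g0E mul1r.
have E2 : gE g2 0 = mE2.
  rewrite /g2 braid1_E0 // E0 E1 /f4 /mE1 /mE2 ?opp4 !mul4 !mx4_mul !scale4 !(opp4, add4).
  by apply: mx4_congr; split; field.
have F2 : gF g2 0 = mF2.
  rewrite /g2 braid1_F0 // F0 F1 /e4 /mF1 /mF2 ?opp4 !mul4 !mx4_mul !scale4 !(opp4, add4).
  by apply: mx4_congr; split; ring.
have E21 : gE g2 1 = - mF1 by rewrite -[gE g2 1]/(- (gF g1 1 * 1)) F1 mulr1.
have F21 : gF g2 1 = - mE1 by rewrite -[gF g2 1]/(- (1 * gE g1 1)) E1 mul1r.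
split; split=> //.
- rewrite -[root_e C 3]/(gE (braid 1 0 g2) 1) braid0_E1 // /serre_form E2 E21 /mE2 /mF1 /mE3 ?opp4 !mul4 !mx4_mul !scale4 !(opp4, add4).
  by apply: mx4_congr; split; field; rewrite ?two ?one.
rewrite -[root_f C 3]/(gF (braid 1 0 g2) 1) braid0_F1 // /serre_form F2 F21 /mF2 /mE1 /mF3 ?opp4 !mul4 !mx4_mul !scale4 !(opp4, add4) !scale4.
by apply: mx4_congr; split; field; rewrite ?two ?one.
Qed.

Lemma nilexp_square0 (X : 'M[C]_4) : X * X = 0 -> nilexp X = 1 + X.
Proof.
move=> X2; rewrite /nilexp !big_ord_recl big_ord0 /= /bump /= expr0 expr1 !exprS expr0 mulr1 X2 mulr0 !scaler0 !addr0.
by rewrite !fact0 factS fact0 muln1 invr1 !scale1r.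
Qed.

(** The sign of [Ye] compensates that of [root2_E]. *)
Lemma exp_plus (c0 c1 A Ye He B : C) : c0 != 0 -> c1 != 0 ->
  nilexp ((B * c0 ^+ 2 / c1 ^+ 2) *: mE3) * (nilexp ((- Ye / c1) *: mE2) *
   (nilexp ((He / c0 ^+ 2) *: mE1) * (nilexp ((A * c1 / c0 ^+ 2) *: e4) * 1)))
  = unip_plus (A / c0 ^+ 2 * c1) (Ye / c1) (He / c0 ^+ 2) (B * c0 ^+ 2 / c1 ^+ 2).
Proof.
move=> h0 h1.
have z4 : 0 = mx4 0 0 0 0 0 0 0 0 0 0 0 0 0 0 0 0 :> 'M[C]_4.
  by apply/matrixP => i j; rewrite !mxE; case: i => -[|[|[|[|]]]] //= ?; case: j => -[|[|[|[|]]]].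
have sq (x : C) : [/\ (x *: mE3) * (x *: mE3) = 0, (x *: mE2) * (x *: mE2) = 0, (x *: mE1) * (x *: mE1) = 0 & (x *: e4) * (x *: e4) = 0].
  by split; rewrite /mE3 /mE2 /mE1 /e4 z4 mul4 !scale4 mx4_mul; apply: mx4_congr; split; ring.
have := sq (A * c1 / c0 ^+ 2); have := sq (He / c0 ^+ 2); have := sq (- Ye / c1); have := sq (B * c0 ^+ 2 / c1 ^+ 2).
case=> h3 _ _ _ [_ h2 _ _] [_ _ h1' _] [_ _ _ h0'].
rewrite !nilexp_square0 // /mE3 /mE2 /mE1 /e4 /unip_plus !scale4 one4 !add4 !mul4.
do ?[rewrite mx4_mul !(mul0r, mulr0, add0r, addr0, mul1r, mulr1)].
by apply: mx4_congr; split; field; rewrite ?h0 ?h1.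
Qed.

Lemma exp_minus (F G Yf Hf : C) :
  (nilexp (- F *: f4) * (nilexp (- Hf *: mF1) * (nilexp (- Yf *: mF2) * (nilexp (- G *: mF3) * 1))))
   *m unip_minus F Yf Hf G = 1%:M.
Proof.
have z4 : 0 = mx4 0 0 0 0 0 0 0 0 0 0 0 0 0 0 0 0 :> 'M[C]_4.
  by apply/matrixP => i j; rewrite !mxE; case: i => -[|[|[|[|]]]] //= ?; case: j => -[|[|[|[|]]]].
have sq (x : C) : [/\ (x *: mF3) * (x *: mF3) = 0, (x *: mF2) * (x *: mF2) = 0, (x *: mF1) * (x *: mF1) = 0 & (x *: f4) * (x *: f4) = 0].
  by split; rewrite /mF3 /mF2 /mF1 /f4 z4 mul4 !scale4 mx4_mul; apply: mx4_congr; split; ring.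
have := sq (- F); have := sq (- Hf); have := sq (- Yf); have := sq (- G).
case=> h3 _ _ _ [_ h2 _ _] [_ _ h1' _] [_ _ _ h0'].
rewrite -[RHS]/(1 : 'M[C]_4) !nilexp_square0 // /mF3 /mF2 /mF1 /f4 /unip_minus !scale4 one4 !add4 !mul4.
do ?[rewrite mx4_mul !(mul0r, mulr0, add0r, addr0, mul1r, mulr1)].
by apply: mx4_congr; split; ring.
Qed.
End RootElements.

Section RootUnfolding.
Variables (C : fieldType) (q : C) (A : algType C) (g : generators A).
Let g1 := braid q 0 g.
Let g2 := braid q 1 g1.
Lemma root_EE : [/\ root_E q g 0 = gE g 0, root_E q g 1 = gE g1 1, root_E q g 2 = gE g2 0 &
  root_E q g 3 = gE (braid q 0 g2) 1].
Proof. by []. Qed.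
Lemma root_FE : [/\ root_F q g 0 = gF g 0, root_F q g 1 = gF g1 1, root_F q g 2 = gF g2 0 &
  root_F q g 3 = gF (braid q 0 g2) 1].
Proof. by []. Qed.
Lemma wtP (b : weight) (i j : int) : b 0 0 = i -> b 0 1 = j -> b = wt i j.
Proof.
move=> h0 h1; apply/rowP => s; rewrite mxE; case: s => -[|[|//]] sp /=.
  by rewrite -h0; congr (b _ _); apply: val_inj.
by rewrite -h1; congr (b _ _); apply: val_inj.
Qed.
Lemma pos_rootE : [/\ pos_root 0 = wt 2 (-1), pos_root 1 = wt 2 0, pos_root 2 = wt 0 1 & pos_root 3 = wt (-2) 2].
Proof. by split; apply: wtP; rewrite /pos_root /= /refl !mxE. Qed.
Lemma vec_weightE : [/\ vec_weight 0 = wt 1 0, vec_weight 1 = wt (-1) 1, vec_weight 2%:R = wt 1 (-1) &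
  vec_weight 3%:R = wt (-1) 0].
Proof. by split; apply: wtP; rewrite !mxE. Qed.
Lemma gK_braid : gK g1 (simple_root 1) = gK g (wt 2 0) /\ gK g1 (- simple_root 1) = gK g (wt (-2) 0).
Proof. by split; congr (gK g _); apply: wtP; rewrite /refl !mxE. Qed.
End RootUnfolding.
Local Opaque root_E root_F pos_root.

Section Character.
Variables (C : numClosedFieldType) (q : C) (l n : nat).
Hypotheses (l_odd : odd l) (l_gt1 : (1 < l)%N) (q_prim : l.-primitive_root q).
Local Notation M := 'M[C]_n.+1.
Local Notation io := (scm C n).
Local Notation k := (qc io q).
Let ioC c (x : M) : io c * x = x * io c. Proof. exact: scmC. Qed.
Let q0 : q != 0 := prim_neq0 q_prim.
Variables (U : algType C) (gg : generators U) (HR : Uq_relations q gg) (Phi : U -> M).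
Hypotheses (P1 : Phi 1 = 1) (PD : forall x y, Phi (x + y) = Phi x + Phi y)
  (PM : forall x y, Phi (x * y) = Phi x * Phi y) (PZ : forall c x, Phi (c *: x) = io c * Phi x).
Variable chi : U -> C.
Hypothesis Pchi : forall z, Z0 q l gg z -> Phi z = io (chi z).

Let PN x : Phi (- x) = - Phi x. Proof. by rewrite -scaleN1r PZ rmorphN1 mulN1r. Qed.
Let PX x m : Phi (x ^+ m) = Phi x ^+ m.
Proof. by elim: m => [|m IH]; rewrite ?P1 // !exprS PM IH. Qed.
Let io_inj c d : io c = io d -> c = d.
Proof. by move=> /matrixP/(_ 0 0); rewrite !mxE eqxx !mulr1n. Qed.
Let chiM x y : Z0 q l gg x -> Z0 q l gg y -> chi (x * y) = chi x * chi y.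
Proof. by move=> zx zy; apply: io_inj; rewrite rmorphM -!Pchi ?PM //; apply: Z0_mul. Qed.

Let X b := chi (gK gg b ^+ l).
Let XE b : Phi (gK gg b) ^+ l = io (X b). Proof. by rewrite -PX Pchi //; apply: Z0_K. Qed.
Let KD b c : Phi (gK gg b) * Phi (gK gg c) = Phi (gK gg (b + c)). Proof. by rewrite -PM (rel_KD HR). Qed.
Let XD b c : X (b + c) = X b * X c.
Proof.
apply: io_inj; rewrite rmorphM -!XE -exprMn_comm ?KD //.
by rewrite /GRing.comm !KD addrC.
Qed.
Let X0 : X 0 = 1.
Proof. by apply: io_inj; rewrite -XE (rel_K0 HR) P1 expr1n rmorph1. Qed.
Let Xn0 b : X b != 0.
Proof. by apply: contraTneq (oner_neq0 C) => e; rewrite -X0 -(subrr b) XD e mul0r eqxx. Qed.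
Let XN b : X (- b) = (X b)^-1.
Proof. by apply: (mulfI (Xn0 b)); rewrite mulfV // -XD subrr X0. Qed.
Let c0 := X (wt 1 0). Let c1 := X (wt 0 1).
Let Xwt (i j : nat) : X (wt i%:Z j%:Z) = c0 ^+ i * c1 ^+ j.
Proof.
have XM b m : X (b *+ m) = X b ^+ m by elim: m => [|m IH]; rewrite ?mulr0n // mulrS exprS XD IH.
rewrite -!XM -XD; congr X; apply/rowP => s.
by rewrite !(mxE, mulmxnE); case: (s == 0); rewrite ?mul0rn ?addr0 ?add0r ?natz // -?natz.
Qed.
Let X_wt (i j i' j' : nat) (b : weight) : b = wt (i%:Z - i'%:Z) (j%:Z - j'%:Z) ->
  X b = c0 ^+ i * c1 ^+ j / (c0 ^+ i' * c1 ^+ j').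
Proof.
move=> ->; rewrite -!Xwt -XN -XD; congr X; apply/rowP => s; rewrite !mxE.
by case: (s == 0).
Qed.

Let x_E r := chi (root_E q gg r ^+ l). Let x_F r := chi (root_F q gg r ^+ l).
(** The reduced word lists the roots as short, twice short plus long, short plus long, long, so
    index 1 gives [zHe] and index 2 gives [zYe]. The minus sign is that of [root2_E]. *)
Definition character_data : zdata C :=
  ZData (root_scale q l 0 * x_E 0) (root_scale q l 3 * x_E 3) (- (root_scale q l 2 * x_E 2))
    (root_scale q l 1 * x_E 1) (root_scale q l 0 * x_F 0) (root_scale q l 3 * x_F 3)
    (root_scale q l 2 * x_F 2) (root_scale q l 1 * x_F 1) c0 c1.

Lemma Spec_to_G_phi : Spec_to_G q l gg chi = phi character_data.
Proof.
have c0n : c0 != 0 by exact: Xn0. have c1n : c1 != 0 by exact: Xn0.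
have [[re0 re1 re2 re3] [rf0 rf1 rf2 rf3]] := root_vectors_sp4 C.
have [w0 w1 w2 w3] := pos_rootE; have [u0 u1 u2 u3] := vec_weightE.
have ZE r b w : pos_root r = b -> X b = w -> (r < 4)%N ->
    root_scale q l r * chi (gK gg (- pos_root r) ^+ l * root_E q gg r ^+ l) = root_scale q l r * x_E r / w.
  move=> wr <- r4; rewrite chiM; [|exact: Z0_K|exact: Z0_E].
  by rewrite -[chi (gK _ _ ^+ l)]/(X _) XN wr [RHS]mulrAC -mulrA.
pose cd := character_data.
have up : coord_u q l gg chi = unip_plus (zA cd / c0 ^+ 2 * c1) (zYe cd / c1)
    (zHe cd / c0 ^+ 2) (zB cd * c0 ^+ 2 / c1 ^+ 2).
  rewrite -(exp_plus (zA cd) (zYe cd) (zHe cd) (zB cd) c0n c1n).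
  pose G s3 s2 s1 s0 := nilexp (s3 *: mE3 C) * (nilexp (s2 *: mE2 C) * (nilexp (s1 *: mE1 C) * (nilexp (s0 *: e4 C) * 1))).
  have -> : coord_u q l gg chi = G (root_scale q l 3 * chi (gK gg (- pos_root 3) ^+ l * root_E q gg 3 ^+ l))
     (root_scale q l 2 * chi (gK gg (- pos_root 2) ^+ l * root_E q gg 2 ^+ l))
     (root_scale q l 1 * chi (gK gg (- pos_root 1) ^+ l * root_E q gg 1 ^+ l))
     (root_scale q l 0 * chi (gK gg (- pos_root 0) ^+ l * root_E q gg 0 ^+ l)).
    by rewrite /coord_u !big_cons big_nil re0 re1 re2 re3.
  have t0 := ZE 0%N _ _ w0 (X_wt (i := 2) (j := 0) (i' := 0) (j' := 1) erefl) isT.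
  have t1 := ZE 1%N _ _ w1 (X_wt (i := 2) (j := 0) (i' := 0) (j' := 0) erefl) isT.
  have t2 := ZE 2%N _ _ w2 (X_wt (i := 0) (j := 1) (i' := 0) (j' := 0) erefl) isT.
  have t3 := ZE 3%N _ _ w3 (X_wt (i := 0) (j := 2) (i' := 2) (j' := 0) erefl) isT.
  etransitivity; first exact: (f_equal4 G t3 t2 t1 t0).
  rewrite -[zB cd]/(root_scale q l 3 * x_E 3) -[zYe cd]/(- (root_scale q l 2 * x_E 2)).
  rewrite -[zHe cd]/(root_scale q l 1 * x_E 1) -[zA cd]/(root_scale q l 0 * x_E 0).
  move: (root_scale q l 3 * x_E 3) (root_scale q l 2 * x_E 2) (root_scale q l 1 * x_E 1) (root_scale q l 0 * x_E 0) => y3 y2 y1 y0.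
  by apply: (f_equal4 G); field; rewrite ?c0n ?c1n.
have um : coord_u_minus q l gg chi *m unip_minus (zF cd) (zYf cd) (zHf cd) (zG cd) = 1%:M.
  rewrite -[RHS](exp_minus (zF cd) (zG cd) (zYf cd) (zHf cd)); congr (_ *m _).
  by rewrite /coord_u_minus !big_cons big_nil rf0 rf1 rf2 rf3.
have tE : coord_t l gg chi = diag4 c0 (c1 / c0) (c0 / c1) c0^-1.
  have v0 := X_wt (i := 1) (j := 0) (i' := 0) (j' := 0) u0.
  have v1 := X_wt (i := 0) (j := 1) (i' := 1) (j' := 0) u1.
  have v2 := X_wt (i := 1) (j := 0) (i' := 0) (j' := 1) u2.
  have v3 := X_wt (i := 0) (j := 0) (i' := 1) (j' := 0) u3.
  rewrite !(expr0, expr1, mulr1, mul1r, divr1) in v0 v1 v2 v3.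
  rewrite /coord_t [LHS]mx4_eta !mxE /= !mulr1n -![chi (gK gg (vec_weight _) ^+ l)]/(X _).
  by rewrite v0 v1 v2 v3.
have [uu _] := mulmx1_unit um.
have ui : invmx (coord_u_minus q l gg chi) = unip_minus (zF character_data) (zYf character_data)
    (zHf character_data) (zG character_data).
  by rewrite -/cd -[LHS]mulmx1 -um mulmxA mulVmx // mul1mx.
rewrite /Spec_to_G /phi ui up tE expr2 mul4 diag4_mul; congr (_ *m diag4 _ _ _ _ *m _) => /=.
all: by field.
Qed.

Let e0 := Phi (gE gg 0). Let e1 := Phi (gE gg 1).
Let f0 := Phi (gF gg 0). Let f1 := Phi (gF gg 1).
Local Notation d0 := (k 1 - k (-1)).
Local Notation d1 := (k 2 - k (-2)).

Lemma Phi_serre_form x0 x1 :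
  d1 * Phi (serre_form q (q + q^-1) x0 x1) = d0 * serre_word io q (Phi x0) (Phi x1).
Proof.
have qq0 : q + q^-1 != 0.
  have := d1_neq0 l_odd l_gt1 q_prim; apply: contraNneq => e.
  have -> : q ^ 2 - q ^ (-2) = (q + q^-1) * (q - q^-1).
    by rewrite -exprnP -exprnN; field.
  by rewrite e mul0r.
have D1 : d1 * io (q + q^-1)^-1 = d0.
  have eD : (q ^ 2 - q ^ (-2)) * (q + q^-1)^-1 = q ^ 1 - q ^ (-1).
    rewrite -[q ^ 2]/(q ^+ 2) -[q ^ (-2)]/((q ^+ 2)^-1) -[q ^ 1]/q -[q ^ (-1)]/(q^-1).
    by apply: (mulIf qq0); rewrite mulfVK //; field.
  transitivity (io ((q ^ 2 - q ^ (-2)) * (q + q^-1)^-1)); first by rewrite rmorphM rmorphB.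
  by rewrite eD rmorphB.
rewrite /serre_form !(PD, PN, PZ, PM) /serre_word.
have s2 : io (q ^- 2 * (q + q^-1)^-1) = k (-2) * io (q + q^-1)^-1 by rewrite rmorphM.
have s1 : io q^-1 = (1 + k (-2)) * io (q + q^-1)^-1.
  have e2 : q^-1 = (1 + q ^ (-2)) * (q + q^-1)^-1.
    rewrite -[q ^ (-2)]/((q ^+ 2)^-1).
    by apply: (mulIf qq0); rewrite mulfVK //; field.
  by rewrite {1}e2 rmorphM rmorphD rmorph1.
rewrite s1 s2; move: (io (q + q^-1)^-1) D1 (ioC (q + q^-1)^-1) => D D1 DC; rewrite -D1.
by nc ioC q0 [:: Phi x0; Phi x1; D] (tt, DC (Phi x0), DC (Phi x1)).
Qed.

Theorem realizes_character : realizes q l n character_data.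
Proof.
have [yE [hE [yF [hF UU]]]] : exists yE hE yF hF, UQ io q (d0 * e0) (d1 * e1) yE hE (d0 * f0) (d1 * f1) yF hF
    (Phi (gK gg (wt 1 0))) (Phi (gK gg (wt 0 1))) (Phi (gK gg (wt (-1) 0))) (Phi (gK gg (wt 0 (-1)))).
  by do 4!eexists; exact: (UQ_of_representation l_odd l_gt1 q_prim HR P1 PD PM PZ).
have [E0 E1 E2 E3] := root_EE q gg; have [F0 F1 F2 F3] := root_FE q gg.
have [K1 K1'] := gK_braid q gg.
have kK (i j i' j' : int) : wt i j + wt i' j' = wt (i + i') (j + j').
  by apply/rowP => s; rewrite !mxE; case: ifP.
have W0 : Phi (gK gg (simple_root 0)) = Phi (gK gg (wt 1 0)) * Phi (gK gg (wt 1 0)) * Phi (gK gg (wt 0 (-1))).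
  by rewrite !KD !kK; congr (Phi (gK gg _)); apply: wtP; rewrite !mxE.
have W0' : Phi (gK gg (- simple_root 0)) = Phi (gK gg (wt (-1) 0)) * Phi (gK gg (wt (-1) 0)) * Phi (gK gg (wt 0 1)).
  by rewrite !KD !kK; congr (Phi (gK gg _)); apply: wtP; rewrite !mxE.
have W1 : Phi (gK gg (wt 2 0)) = Phi (gK gg (wt 1 0)) * Phi (gK gg (wt 1 0)) by rewrite KD kK.
have W1' : Phi (gK gg (wt (-2) 0)) = Phi (gK gg (wt (-1) 0)) * Phi (gK gg (wt (-1) 0)) by rewrite KD kK.
have r1 : d1 * Phi (root_E q gg 1) = hE.
  by rewrite E1 braid0_E1 // Phi_serre_form; apply: (serre_word_IQ ioC l_odd l_gt1 q_prim (uq_E UU)).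
have pull (z : M) (c : C) (i j : int) : (k i - k j) * (io c * z) = io c * ((k i - k j) * z).
  by rewrite -rmorphB !mulrA ioC.
have r1F : d1 * Phi (root_F q gg 1) = k 2 * hF.
  rewrite F1 braid0_F1 // PZ pull Phi_serre_form.
  by congr (_ * _); apply: (serre_word_IQ ioC l_odd l_gt1 q_prim (uq_F UU)).
have r2 : d0 * Phi (root_E q gg 2) = - yE.
  rewrite E2 braid1_E0 // -E1 -[gE (braid q 0 gg) 0]/(- (gF gg 0 * gK gg (simple_root 0))).
  rewrite !(PD, PN, PZ, PM, W0).
  by apply: (root2_E ioC l_odd l_gt1 q_prim UU r1).
have r2F : d0 * Phi (root_F q gg 2) = k 2 * yF.
  rewrite F2 braid1_F0 // -F1 -[gF (braid q 0 gg) 0]/(- (gK gg (- simple_root 0) * gE gg 0)).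
  rewrite !(PD, PN, PZ, PM, W0').
  by apply: (root2_F ioC l_odd l_gt1 q_prim UU r1F).
have r3 : d1 * Phi (root_E q gg 3) = d1 * e1.
  rewrite E3 braid0_E1 // Phi_serre_form -E2.
  rewrite -[gE (braid q 1 _) 1]/(- (gF (braid q 0 gg) 1 * gK (braid q 0 gg) (simple_root 1))) K1 -F1 PN PM W1.
  by apply: (root3_E ioC l_odd l_gt1 q_prim UU r2 r1F).
have r3F : d1 * Phi (root_F q gg 3) = d1 * f1.
  rewrite F3 braid0_F1 // PZ pull Phi_serre_form -F2.
  rewrite -[gF (braid q 1 _) 1]/(- (gK (braid q 0 gg) (- simple_root 1) * gE (braid q 0 gg) 1)) K1' -E1 PN PM W1'.
  rewrite -pull; by apply: (root3_F ioC l_odd l_gt1 q_prim UU r2F r1).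
have s0 : root_scale q l 0 = (q ^ 1 - q ^ (-1)) ^+ l by rewrite /root_scale /qi /symd eqxx.
have s1 : root_scale q l 1 = (q ^ 2 - q ^ (-2)) ^+ l by [].
have s2 : root_scale q l 2 = (q ^ 1 - q ^ (-1)) ^+ l by rewrite /root_scale /qi /symd eqxx.
have s3 : root_scale q l 3 = (q ^ 2 - q ^ (-2)) ^+ l by [].
have pE c (i j : int) r : (q ^ i - q ^ j) ^+ l = c -> (r < 4)%N ->
    ((k i - k j) * Phi (root_E q gg r)) ^+ l = io (c * x_E r).
  move=> <- r4; rewrite -rmorphB exprMn_comm; last exact: ioC.
  by rewrite -PX Pchi; [rewrite -rmorphXn -rmorphM | exact: Z0_E].
have pF c (i j : int) r : (q ^ i - q ^ j) ^+ l = c -> (r < 4)%N ->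
    ((k i - k j) * Phi (root_F q gg r)) ^+ l = io (c * x_F r).
  move=> <- r4; rewrite -rmorphB exprMn_comm; last exact: ioC.
  by rewrite -PX Pchi; [rewrite -rmorphXn -rmorphM | exact: Z0_F].
(* The factors [q ^ 2] of the negative root vectors have l-th power 1. *)
have k2l (x : M) : (k 2 * x) ^+ l = x ^+ l.
  rewrite exprMn_comm; last exact: (ioC (q ^ 2)).
  have -> : k 2 ^+ l = 1; last by rewrite mul1r.
  by rewrite -[k 2]/(io (q ^+ 2)) -rmorphXn -exprM mulnC exprM (prim_expr_order q_prim) expr1n rmorph1.
do 12!eexists; split; first exact: UU.
- by rewrite /e0 -E0 (pE _ _ _ _ (esym s0)).
- by rewrite -r3 (pE _ _ _ _ (esym s3)).
- have -> : yE = - (d0 * Phi (root_E q gg 2)) by rewrite r2 opprK.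
  by rewrite exprNn -signr_odd l_odd expr1 mulN1r (pE _ _ _ _ (esym s2)) // -rmorphN.
- by rewrite -r1 (pE _ _ _ _ (esym s1)).
- by rewrite /f0 -F0 (pF _ _ _ _ (esym s0)).
- by rewrite -r3F (pF _ _ _ _ (esym s3)).
- by rewrite -k2l -r2F (pF _ _ _ _ (esym s2)).
- by rewrite -k2l -r1F (pF _ _ _ _ (esym s1)).
- exact: XE.
- exact: XE.
- exact: Xn0.
exact: Xn0.
Qed.
End Character.

Lemma Realized_dim_dvd (C : numClosedFieldType) (q : C) (l n : nat) (M : 'M[C]_4) :
  odd l -> (1 < l)%N -> l.-primitive_root q -> Realized q l n M ->
  (l ^ (dim_of (conj_class M))./2 %| n.+1)%N.
Proof.
move=> l_odd l_gt1 q_prim RM; have sM := Realized_symplectic RM.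
(* Only the integer part of half the dimension occurs, so the bounds 5, 7 and 9 serve as well as 4,
   6 and 8. *)
have weaken k m : (m./2 <= k)%N -> (dim_of (conj_class M) <= m)%N -> (l ^ k %| n.+1)%N ->
    (l ^ (dim_of (conj_class M))./2 %| n.+1)%N.
  by move=> mk dm; apply: dvdn_trans; apply: dvdn_exp2l; apply: leq_trans mk; apply: half_leq.
have [d4|/(not_dvd4 l_odd l_gt1 q_prim RM)[a ra]] := boolP (l ^ 4 %| n.+1)%N.
  exact: (weaken 4%N 9%N) (dim_general sM) d4.
have [d3|nd3] := boolP (l ^ 3 %| n.+1)%N; first exact: (weaken 3%N 7%N) (dim_rank2 sM ra) d3.
have [d2|nd2] := boolP (l ^ 2 %| n.+1)%N.
  apply: (weaken 2%N 5%N) d2 => //.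
  have [M2|[e [u [_ ->]]]] := not_dvd3 l_odd l_gt1 q_prim RM nd3; first exact: dim_involution.
  exact: dim_rank_one.
have [e _ eM] := not_dvd2 l_odd l_gt1 q_prim RM nd2.
by apply: (weaken 0%N 0%N) => //; rewrite eM; apply: dim_central.
Qed.

Theorem corollary3p8 (R : realType) (l : nat) (eps : R[i])
    (l_odd : odd l) (l_gt1 : (1 < l)%N) (eps_prim : l.-primitive_root eps)
    (U : algType R[i]) (g : generators U) (HU : is_Uq eps g)
    (V : vectType R[i]) (rho : {linear U -> 'End(V)})
    (rho_rep : is_representation rho) (rho_irr : irreducible rho)
    (chi : U -> R[i]) (rho_chi : acts_by rho (Z0 eps l g) chi) :
  (l ^ (dim_of (conj_class (Spec_to_G eps l g chi)))./2 %| \dim {:V})%N.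
Proof.
have [V0 _] := rho_irr; have [HR _ _] := HU.
have [n [Phi [<- P1 [PD PM] PZ Pc]]] := matrix_representation rho_rep V0.
have Pchi z : Z0 eps l g z -> Phi z = scm _ n (chi z) by move=> zz; apply/Pc/rho_chi.
apply: (Realized_dim_dvd l_odd l_gt1 eps_prim).
exists (character_data eps l g chi).
  by have := realizes_character l_odd l_gt1 eps_prim HR P1 PD PM PZ Pchi.
by have := Spec_to_G_phi HR P1 PM Pchi.
Qed.
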